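(* The orbit-cycle map extends to an injective morphism $$\iota_d:\mathrm{rat}_d=\mathrm{Rat}_d/G\longrightarrow Y_d,\qquad[F]\longmapsto\overline{G\cdot[F]}=\bigl(\#\mathrm{Aut}(F)\bigr)\overline{G\cdot[F]}_{\mathrm{red}}.$$ For every $F\in\mathrm{Rat}_d$, the orbit cycle has total degree $\deg\overline{G\cdot[F]}=d^3-d$, whereas its reduced support has degree $(d^3-d)/\#\mathrm{Aut}(F)$.
   Context: $k$ is an algebraically closed field of characteristic $0$, $d\ge2$, $G=\mathrm{PGL}_2$ over $k$. $\overline{\mathrm{Rat}}_d:=\mathbb{P}(H^0(\mathbb{P}^1\times\mathbb{P}^1,\mathcal{O}(d,1)))\simeq\mathbb{P}^{2d+1}$; a point $[F]$ is the class of a nonzero form $F=y_1f_0(x)-y_0f_1(x)$ with $f_0,f_1$ binary forms of degree $d$; the open set $\mathrm{Rat}_d$ where $f_0,f_1$ are coprime is the space of degree-$d$ rational maps $x\mapsto[f_0(x):f_1(x)]$. $G$ acts by (the extension of) conjugation; $\mathrm{Rat}_d/G$ is the geometric quotient (which exists, by Silverman); $\mathrm{Aut}(F)=\mathrm{stab}_G([F])$. Degrees are with respect to $\mathcal{O}(1)$ on $\mathbb{P}^{2d+1}$. Chow quotient: let $X$ be a projective variety with a generically free action of $G$. For $x\in X$ with finite stabilizer the orbit cycle is $\overline{G\cdot x}:=(\#\mathrm{stab}_G(x))\overline{G\cdot x}_{\mathrm{red}}$, with $\overline{G\cdot x}_{\mathrm{red}}$ the reduced orbit closure. Let $U\subset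 X$ be a $G$-invariant dense open subset on which the action is free and the orbit closures form an algebraic family; $X/\!/_{Ch}G$ is the closure in $\mathrm{Chow}(X)$ of the image of the orbit-cycle map $U\to\mathrm{Chow}(X)$, $x\mapsto\overline{G\cdot x}$. Put $Y_d:=\overline{\mathrm{Rat}}_d/\!/_{Ch}G$. The orbit-cycle map being extended is the one defined on the locus of maps with trivial automorphism group. *)

(* Defs.v *)
From HB Require Import structures.
From mathcomp Require Import all_boot all_order all_algebra.
From mathcomp Require Import boolp classical_sets functions fsbigop cardinality.
From mathcomp Require Import finmap.
From mathcomp Require Import mpoly.

Set Implicit Arguments.
Unset Strict Implicit.
Unset Printing Implicit Defensive.

Import GRing.Theory.

Local Open Scope classical_set_scope.
Local Open Scope ring_scope.

Section Projective.
Variable k : fieldType.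

(* The lines of k^n, i.e. the projective space of dimension n - 1. *)
Definition proj (n : nat) := {L : {vspace 'rV[k]_n} | \dim L == 1%N}.

(* Vectors of homogeneous coordinates; they are nonzero since \dim = 1. *)
Definition coords n (p : proj n) : set 'rV[k]_n := [set v | val p = <[v]>%VS].

Definition mev n (f : {mpoly k[n]}) (v : 'rV[k]_n) : k := f.@[fun i => v 0 i].

Definition zariski_closed n (Z : set (proj n)) : Prop :=
  exists S : set {mpoly k[n]},
    (forall f, S f -> exists e : nat, f \is e.-homog) /\
    Z = [set p | forall f v, S f -> coords p v -> mev f v = 0].

Definition zariski_closure n (A : set (proj n)) : set (proj n) :=
  smallest (@zariski_closed n) A.

Definition irreducible_closed n (Z : set (proj n)) : Prop :=
  [/\ zariski_closed Z, Z !=set0 &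
      forall Z1 Z2, zariski_closed Z1 -> zariski_closed Z2 ->
        Z `<=` Z1 `|` Z2 -> Z `<=` Z1 \/ Z `<=` Z2].

(* The section of Z by the r hyperplanes whose coefficients are the rows of u
   (a zero row imposes no condition). *)
Definition linear_section n r (Z : set (proj n)) (u : 'M[k]_(r, n)) :
    set (proj n) :=
  [set p | Z p /\ forall v, coords p v -> u *m v^T = 0].

(* Dimension of a closed subset of projective space over an algebraically
   closed field: the least r such that some r + 1 hyperplanes have no common
   point on Z. *)
Definition has_dim n (Z : set (proj n)) (r : nat) : Prop :=
  (forall u : 'M[k]_(r, n), linear_section Z u !=set0) /\
  (exists u : 'M[k]_(r.+1, n), linear_section Z u = set0).

(* Degree with respect to O(1): the number of points of Z on a generic linear
   subspace of codimension dim Z. *)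
Definition has_degree n (Z : set (proj n)) (e : nat) : Prop :=
  exists r : nat, has_dim Z r /\
  exists Q : {mpoly k[r * n]}, Q != 0 /\
    forall u : 'M[k]_(r, n), mev Q (mxvec u) != 0 ->
      (linear_section Z u #= `I_e)%card.

Definition degree n (Z : set (proj n)) : nat := xget 0%N (has_degree Z).

End Projective.

(* Spaces with k-valued functions. A variety is recorded by its closed points,
   its Zariski topology and its sheaf of regular functions; [regular O f] means
   that the restriction of f to the open set O is regular (the values of f
   outside O are irrelevant). *)
Record kspace (k : fieldType) := KSpace {
  kpts :> Type;
  is_open : set kpts -> Prop;
  regular : set kpts -> (kpts -> k) -> Prop }.

Section Spaces.
Variable k : fieldType.

Definition morphism (X Y : kspace k) (phi : X -> Y) : Prop :=
  forall O : set Y, is_open O ->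
    is_open (phi @^-1` O) /\
    forall f : Y -> k, regular O f -> regular (phi @^-1` O) (f \o phi).

Definition space_closure (X : kspace k) (A : set X) : set X :=
  smallest (fun C => is_open (~` C)) A.

(* T is the disjoint union of pieces T_i, each identified with a subset of a
   projective space; [at_ i x p] says that x lies in T_i and corresponds to p.
   The pieces are open and closed in T and carry the structure induced from
   projective space: regular functions are locally quotients of homogeneous
   polynomials of the same degree. *)
Definition embedded (T I : Type) (n : I -> nat)
    (at_ : forall i, T -> proj k (n i) -> Prop) : kspace k :=
  KSpace
    (fun O : set T => forall i, exists Z, zariski_closed Z /\
       forall x p, at_ i x p -> (O x <-> ~ Z p))
    (fun (O : set T) (f : T -> k) => forall i x p, O x -> at_ i x p ->
       exists (e : nat) (g h : {mpoly k[n i]}),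
         [/\ g \is e.-homog, h \is e.-homog,
             (forall v, coords p v -> mev h v != 0) &
             forall y q v, O y -> at_ i y q -> coords q v -> mev h v != 0 ->
               f y = mev g v / mev h v]).

(* The subset V of projective space (used for V locally closed). *)
Definition subvariety n (V : set (proj k n)) : kspace k :=
  @embedded {p | V p} unit (fun=> n) (fun _ x p => sval x = p).

(* The geometric quotient as a space with functions: points are the orbits
   (here, the classes of E), the topology is the quotient topology and the
   regular functions are the regular functions upstairs constant on orbits. *)
Definition quot_pts (X : kspace k) (E : X -> X -> Prop) :=
  {C : set X | exists x, C = E x}.

Definition quot_map (X : kspace k) (E : X -> X -> Prop) (x : X) :
    quot_pts E := exist _ (E x : set X) (ex_intro _ x erefl).

Definition geometric_quotient (X : kspace k) (E : X -> X -> Prop) : kspace k :=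
  KSpace
    (fun O : set (quot_pts E) => is_open (@quot_map X E @^-1` O))
    (fun O (f : quot_pts E -> k) =>
       regular (@quot_map X E @^-1` O) (f \o @quot_map X E)).

End Spaces.

Section Chow.
Variables (k : fieldType) (n : nat).

(* Formal sums of subsets of projective space; the effective r-cycles are
   singled out by [effective]. *)
Definition cycle := set (proj k n) -> nat.

Definition components (c : cycle) : set (set (proj k n)) :=
  [set Z | c Z != 0%N].

Definition effective (r : nat) (c : cycle) : Prop :=
  [/\ finite_set (components c), components c !=set0 &
      forall Z, components c Z -> irreducible_closed Z /\ has_dim Z r].

Definition cycle_degree (c : cycle) : nat :=
  \big[addn/0%N]_(Z \in components c) (c Z * degree Z)%N.

Definition irreducible_mpoly m (R : {mpoly k[m]}) : Prop :=
  [/\ R != 0, R \isn't a GRing.unit &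
      forall a b, R = a * b -> a \is a GRing.unit \/ b \is a GRing.unit].

(* The Chow form (Cayley form) of an irreducible Z of dimension r: the equation,
   unique up to a scalar, of the irreducible hypersurface formed by the
   (r + 1)-tuples of hyperplanes having a common point on Z. *)
Definition chow_form_var r (Z : set (proj k n)) (R : {mpoly k[r.+1 * n]}) :
    Prop :=
  irreducible_mpoly R /\
  forall u : 'M[k]_(r.+1, n), mev R (mxvec u) = 0 <-> linear_section Z u !=set0.

Definition chow_form r (c : cycle) (R : {mpoly k[r.+1 * n]}) : Prop :=
  exists rho : set (proj k n) -> {mpoly k[r.+1 * n]},
    (forall Z, components c Z -> chow_form_var Z (rho Z)) /\
    R = \big[*%R/1]_(Z \in components c) rho Z ^+ c Z.

Definition coef_dim (N D : nat) : nat := #|{: 'X_{1..N < D.+1}}|.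

Definition coef_vec N D (R : {mpoly k[N]}) : 'rV[k]_(coef_dim N D) :=
  \row_i R@_(enum_val i : 'X_{1..N < D.+1}).

(* p is the Chow point of the r-cycle c, whose Chow form has total degree D;
   D is (r + 1) times the degree of c. *)
Definition chow_point (r D : nat) (c : cycle)
    (p : proj k (coef_dim (r.+1 * n) D)) : Prop :=
  effective r c /\
  exists R, [/\ chow_form c R, R \is D.-homog & coords p (coef_vec D R)].

Definition chow_pts := {c : cycle | exists r, effective r c}.

(* The Chow variety of projective space: the disjoint union, over dimensions
   and degrees, of the sets of Chow points. *)
Definition Chow : kspace k :=
  @embedded k chow_pts (nat * nat) (fun rD => coef_dim (rD.1.+1 * n) rD.2)
    (fun rD c p => chow_point (sval c) p).

(* A (closed) subset of the Chow variety, with its reduced structure. *)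
Definition chow_sub (A : set Chow) : kspace k :=
  @embedded k {c : Chow | A c} (nat * nat)
    (fun rD => coef_dim (rD.1.+1 * n) rD.2)
    (fun rD c p => chow_point (sval (sval c)) p).

End Chow.

Section Rat.
Variables (k : fieldType) (d : nat).

(* A 2 x (d + 1) matrix A stands for y_1 f_0(x) - y_0 f_1(x), where row i of A
   holds the coefficients of f_i = \sum_j A i j x_0^j x_1^(d - j). *)
Definition bform (A : 'M[k]_(2, d.+1)) (i : 'I_2) : {mpoly k[2]} :=
  \sum_(j < d.+1) A i j *: ('X_ord0 ^+ j * 'X_ord_max ^+ (d - j)).

Definition Ratbar := proj k (2 * d.+1).

Definition coprime_forms (f g : {mpoly k[2]}) : Prop :=
  forall h q r, f = h * q -> g = h * r -> h \is a GRing.unit.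

Definition is_rat (p : Ratbar) : Prop :=
  forall A, coords p (mxvec A) ->
    coprime_forms (bform A ord0) (bform A ord_max).

(* The components of a o f o a^-1, for f = (f_0, f_1). *)
Definition conj_form (a : 'M[k]_2) (A : 'M[k]_(2, d.+1)) (i : 'I_2) :
    {mpoly k[2]} :=
  \sum_(l < 2) a i l *:
    (bform A l \mPo [tuple \sum_(m < 2) invmx a t m *: 'X_m | t < 2]).

Definition conj_mx (a : 'M[k]_2) (A : 'M[k]_(2, d.+1)) : 'M[k]_(2, d.+1) :=
  \matrix_(i, j) (conj_form a A i)@_(U_(ord0) *+ j + U_(ord_max) *+ (d - j))%MM.

(* PGL_2 is the open subset of P(M_2) of classes of invertible matrices;
   [acts g p q] says that g lies in it and that g . p = q. *)
Definition acts (g : proj k (2 * 2)) (p q : Ratbar) : Prop :=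
  exists a A, [/\ a \in unitmx, coords g (mxvec a),
                  coords p (mxvec A) & coords q (mxvec (conj_mx a A))].

Definition orbit (p : Ratbar) : set Ratbar := [set q | exists g, acts g p q].

Definition Aut (p : Ratbar) : set (proj k (2 * 2)) := [set g | acts g p p].

(* Only meaningful when Aut p is finite (the value is 0 otherwise). *)
Definition card_Aut (p : Ratbar) : nat := #|` fset_set (Aut p)|.

Definition orbit_closure (p : Ratbar) : set Ratbar := zariski_closure (orbit p).

Definition orbit_cycle (p : Ratbar) : cycle k (2 * d.+1) :=
  fun Z => if `[< Z = orbit_closure p >] then card_Aut p else 0%N.

Definition Ratd : kspace k := subvariety is_rat.

Definition same_orbit (F G : Ratd) : Prop := orbit (sval F) (sval G).

Definition ratd : kspace k := geometric_quotient same_orbit.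

Definition rat_class (F : Ratd) : ratd := quot_map same_orbit F.

(* The closure in the Chow variety of the image of U under the orbit-cycle
   map. It is the Chow quotient for every U that is open, dense, invariant and
   on which the action is free and the orbit closures form an algebraic family;
   it does not depend on the choice of such a U. *)
Definition chow_quotient (U : set Ratbar) : kspace k :=
  chow_sub (space_closure
    [set c : Chow k (2 * d.+1) | exists2 p, U p & sval c = orbit_cycle p]).

Definition trivial_Aut : set Ratbar :=
  [set p | is_rat p /\ Aut p = [set g | coords g (mxvec 1%:M)]].

Definition Yd : kspace k := chow_quotient trivial_Aut.

End Rat.

Definition cycle_of (k : fieldType) (n : nat) (A : set (Chow k n))
  (y : chow_sub A) : cycle k n := sval (sval y).

(* Main.v *)
(* Write A^h for the conjugate of a map A by h in PGL_2. When h degenerates to a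
   matrix of rank one, the limits of A^h are explicit (an affine map with a hole
   of order d - 1, or a constant map), and they satisfy closed conditions; so
   elimination shows that the pairs (A, U), U a 4-tuple of hyperplanes through
   some A^h or some limit, are cut out by one equation G(A, U), homogeneous in A.

   For a generic triple u of hyperplanes, v |-> G(A, (u, v)) is a constant times
   the product of the linear forms v(A^h) over the h such that A^h lies on u.
   These h are simple solutions, so their number does not depend on the generic
   (A, u). It can be counted for the power map x^d and the triple of conditions
   0 -> oo -> 1 -> 0: such h are the three-cycles z -> z^d -> z^(d^2) of distinct
   points, and there are d^3 - d of them.

   For a rational map A every point of the orbit is reached by #Aut(A) of the h.
   Comparing multiplicities, G(A, .) is the #Aut(A)-th power of the irreducible
   Chow form of the orbit closure, that is, the Chow form of the orbit cycle. It
   is homogeneous of degree 4 (d^3 - d) in U, and its coefficients are forms in A,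
   which gives the morphism. The maps with trivial automorphism group are dense:
   this is an open condition, and x + x^d / (x + 1) satisfies it. Finally, the
   limits of A^h are never rational maps of degree d, so that the orbit can be
   recovered from its closure. *)

(* Automorphisms are the obstacle. If several h give the same A^h, the equation in the coordinates
   of A^h has multiple roots, and no simplicity argument applies to it. The incidence equation is
   therefore built twice, also for hyperplanes in the Segre coordinates of the pair (h, A^h), where
   different h are always different points. There every generic triple gives one simple factor for
   each h. Restricted to hyperplanes that see only h_00 times A^h, this second equation is a
   multiple of the first one. At a map with trivial automorphism group both have the same degree, so
   the quotient depends on (A, u) alone, and the factorization carries over to the first equation
   for all A. In both equations the coefficient T of one coordinate of the last hyperplane is kept
   as a polynomial variable over the factorial ring of polynomials in the other data. Codimension
   one then becomes one-variable divisibility: the ideal of the incidence variety is prime and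
   contains nothing nonzero that is free of T, hence it is principal. *)
From HB Require Import structures.
From mathcomp Require Import all_boot all_order all_algebra all_field.
From mathcomp Require Import mpoly.
From mathcomp Require Import boolp.
From mathcomp Require Import zify ring.

Set Implicit Arguments.
Unset Strict Implicit.
Unset Printing Implicit Defensive.
Import GRing.Theory.
Local Open Scope ring_scope.

(** * Unique factorization of polynomials *)

Section Factoriality.
Variable A : idomainType.

Definition rdvd (a b : A) : Prop := exists c, b = c * a.

Definition rprime (a : A) : Prop :=
  [/\ a != 0, a \isn't a GRing.unit &
      forall x y, rdvd a (x * y) -> rdvd a x \/ rdvd a y].

Definition rirr (a : A) : Prop :=
  [/\ a != 0, a \isn't a GRing.unit &
      forall x y, a = x * y -> x \is a GRing.unit \/ y \is a GRing.unit].

(** Asking for prime rather than irreducible factors builds uniqueness into the existence statement,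
    and primality is what the later divisibility arguments use. *)
Definition ufd : Prop := forall a : A, a != 0 ->
  exists u (s : seq A), [/\ u \is a GRing.unit, (forall p, p \in s -> rprime p) &
    a = u * \prod_(p <- s) p].

Lemma rdvd_mull (a b c : A) : rdvd a b -> rdvd a (c * b).
Proof. by case=> e ->; exists (c * e); rewrite mulrA. Qed.

Lemma rdvd_mulr (a b c : A) : rdvd a b -> rdvd a (b * c).
Proof. by rewrite mulrC; exact: rdvd_mull. Qed.

Lemma rdvd_add (a b c : A) : rdvd a b -> rdvd a c -> rdvd a (b + c).
Proof. by move=> [x ->] [y ->]; exists (x + y); rewrite mulrDl. Qed.

Lemma rdvd_refl (a : A) : rdvd a a. Proof. by exists 1; rewrite mul1r. Qed.

Lemma rprime_prod (a : A) (s : seq A) : rprime a ->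
  rdvd a (\prod_(p <- s) p) -> exists2 p, p \in s & rdvd a p.
Proof.
move=> pa; elim: s => [|b s IHs]; last first.
  rewrite big_cons; case: (pa) => _ _ /[apply]; case=> [ab|/IHs [p ps ap]].
    by exists b; rewrite ?mem_head.
  by exists p; rewrite ?inE ?ps ?orbT.
rewrite big_nil => -[c /esym c1]; case: pa => _ /negP[].
by apply/unitrP; exists c; rewrite c1 mulrC.
Qed.

Lemma rprime_irr (a : A) : rprime a -> rirr a.
Proof.
move=> [a0 aU ap]; split=> // x y axy.
have [|[c xE]|[c yE]] := ap x y; first by rewrite -axy; exact: rdvd_refl.
- right; apply/unitrPr; exists c; apply: (mulfI a0).
  by rewrite mulr1 {2}axy xE; ring.
- left; apply/unitrPr; exists c; apply: (mulfI a0).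
  by rewrite mulr1 {2}axy yE; ring.
Qed.

End Factoriality.

(** * Gauss's lemma: polynomials over a factorial ring *)

Section Gauss.
Variable A : idomainType.
Hypothesis ufdA : ufd A.
Implicit Types (p q : {poly A}) (a : A).

(** A leading term of x or y that is divisible by a can be removed without affecting the claim. Once
    neither leading coefficient is divisible by a, their product contradicts primality in A. The
    induction is on the sum of the two sizes. *)
Lemma rprime_polyC a : rprime a -> rprime (a%:P : {poly A}).
Proof.
move=> [a0 aU ap]; split; first by rewrite polyC_eq0.
  by rewrite poly_unitE coefC eqxx (negPf aU) andbF.
have red (z : {poly A}) : z != 0 -> rdvd a (lead_coef z) -> exists z' w,
    z = z' + w * a%:P /\ (size z' < size z)%N.
  move=> z0 [c cE]; exists (z - (lead_coef z) *: 'X^((size z).-1)).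
  exists (c *: 'X^((size z).-1)).
  rewrite cE -scalerAl [_ * a%:P]mulrC mul_polyC scalerA subrK; split=> //.
  rewrite -cE -[X in (_ < X)%N]prednK ?size_poly_gt0 // ltnS; apply/leq_sizeP => j.
  rewrite leq_eqVlt => /predU1P[<-|lt]; rewrite coefB coefZ coefXn.
    by rewrite eqxx mulr1 lead_coefE subrr.
  rewrite gtn_eqF // mulr0 subr0 nth_default //.
  by move: lt; case: (size z).
have adv w : rdvd a%:P (w * a%:P) by exists w.
move=> x y; have [n] := ubnP (size x + size y)%N.
elim: n x y => // n IHn x y sn axy.
have [->|x0] := eqVneq x 0; first by left; exists 0; rewrite mul0r.
have [->|y0] := eqVneq y 0; first by right; exists 0; rewrite mul0r.
have [ax|nax] := pselect (rdvd a (lead_coef x)).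
  have [x' [w [xE sx]]] := red x x0 ax.
  have axy' : rdvd a%:P (x' * y).
    have -> : x' * y = x * y + (- w * y) * a%:P.
      by rewrite xE mulrDl mulrAC !mulNr addrK.
    exact: rdvd_add.
  have s' : (size x' + size y < n)%N by rewrite -ltnS; apply: leq_trans sn; rewrite ltnS ltn_add2r.
  case: (IHn _ _ s' axy') => [ax'|]; [|by right].
  by left; rewrite xE; apply: rdvd_add.
have [ay|nay] := pselect (rdvd a (lead_coef y)).
  have [y' [w [yE sy]]] := red y y0 ay.
  have axy' : rdvd a%:P (x * y').
    have -> : x * y' = x * y + (- x * w) * a%:P.
      by rewrite yE mulrDr mulrA !mulNr addrK.
    exact: rdvd_add.
  have s' : (size x + size y' < n)%N by rewrite -ltnS; apply: leq_trans sn; rewrite ltnS ltn_add2l.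
  case: (IHn _ _ s' axy') => [|ay']; [by left|].
  by right; rewrite yE; apply: rdvd_add.
case: axy => c /(congr1 lead_coef); rewrite !lead_coefM lead_coefC => lE.
by case: (ap (lead_coef x) (lead_coef y)) => //; exists (lead_coef c).
Qed.

Lemma rprime_polyC_inv a : rprime (a%:P : {poly A}) -> rprime a.
Proof.
move=> [a0 aU aM]; split; first by rewrite -polyC_eq0.
  by apply: contra aU => aU; rewrite rmorph_unit.
move=> x y [c cE]; case: (aM x%:P y%:P).
- by exists c%:P; rewrite -polyCM cE polyCM.
- by case=> e /(congr1 (fun p : {poly _} => p`_0)); rewrite coefC coefMC /= => eE; left; exists e`_0.
- by case=> e /(congr1 (fun p : {poly _} => p`_0)); rewrite coefC coefMC /= => eE; right; exists e`_0.
Qed.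

Lemma rdvd_polyC a p : (forall i, rdvd a p`_i) -> rdvd a%:P p.
Proof.
move=> /choice[f fE]; exists (\poly_(i < size p) f i); apply/polyP => i.
rewrite coefMC coef_poly; case: ltnP => [_|/(nth_default 0)->]; first exact: fE.
by rewrite mul0r.
Qed.

Definition prim p := forall a, rprime a -> ~ rdvd a%:P p.

(** A prime constant dividing p divides its leading coefficient, so the number of prime factors of
    that coefficient bounds how often a constant can be split off. *)
Lemma content_split p : p != 0 -> exists (s : seq A) q,
  [/\ forall a, a \in s -> rprime a, p = (\prod_(a <- s) a)%:P * q & prim q].
Proof.
move=> p0; have [u [s [uU sp pE]]] : exists u (s : seq A),
    [/\ u \is a GRing.unit, (forall a, a \in s -> rprime a) &
      lead_coef p = u * \prod_(a <- s) a] by apply: ufdA; rewrite lead_coef_eq0.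
have [n] := ubnP (size s); elim: n p p0 u s uU sp pE => // n IHn p p0 u s uU sp pE sn.
have [[a [pa [q pq]]]|np] := pselect (exists a, rprime a /\ rdvd a%:P p); last first.
  exists [::], p; rewrite big_nil mul1r; split=> // a pa ap; apply: np.
  by exists a.
have a0 : a != 0 by case: pa.
have q0 : q != 0 by apply: contra_neq p0 => q0; rewrite pq q0 mul0r.
have lE : u * \prod_(b <- s) b = lead_coef q * a.
  by rewrite -pE pq lead_coefM lead_coefC.
have [b bs [c bE]] : exists2 b, b \in s & rdvd a b.
  apply: rprime_prod => //; exists (u^-1 * lead_coef q).
  by rewrite -mulrA -lE mulKr.
have cU : c \is a GRing.unit.
  have [_ _ /(_ _ _ bE)[]//] := rprime_irr (sp _ bs).
  by move=> aU; case: pa => _; rewrite aU.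
have lqE : lead_coef q = (u * c) * \prod_(e <- rem b s) e.
  apply: (mulIf a0); rewrite -lE (perm_big _ (perm_to_rem bs)) big_cons {1}bE /=.
  by ring.
have srem : {subset rem b s <= s} by exact: mem_rem.
have ucU : u * c \is a GRing.unit by rewrite unitrM uU.
have remP : forall e, e \in rem b s -> rprime e by move=> e /srem; exact: sp.
have srn : (size (rem b s) < n)%N.
  by rewrite size_rem //; case: (s) bs sn.
have [s' [q' [s'p qE q'p]]] := IHn q q0 _ _ ucU remP lqE srn.
exists (a :: s'), q'; split=> //.
  by move=> e; rewrite inE => /predU1P[->//|/s'p].
by rewrite big_cons pq qE polyCM; ring.
Qed.

(** The prime factors of c are cancelled one at a time: each of them divides the cofactor, because
    it cannot divide the primitive p. *)
Lemma prim_cancel c p q : prim p -> c != 0 -> rdvd p (c%:P * q) -> rdvd p q.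
Proof.
move=> pp c0; have [u [s [uU sp ->]]] := ufdA c0.
elim: s sp q => [|a s IHs] sp q.
  rewrite big_nil mulr1 => -[r rE]; exists ((u^-1)%:P * r).
  by rewrite -mulrA -rE mulrA -polyCM mulVr // mul1r.
rewrite big_cons mulrCA polyCM -mulrA => -[r rE].
have pa : rprime a by apply: sp; rewrite mem_head.
have [_ _ /(_ r p)] := rprime_polyC pa.
case; first by rewrite -rE mulrC; exists ((u * \prod_(j <- s) j)%:P * q).
  move=> [r' r'E]; apply: IHs => [e es|]; first by apply: sp; rewrite inE es orbT.
  exists r'; apply: (@mulfI _ a%:P); first by rewrite polyC_eq0; case: pa.
  by rewrite rE r'E mulrA (mulrC _ r').
by move/(pp a pa).
Qed.

Lemma rdvd_size p q : q != 0 -> rdvd p q -> (size p <= size q)%N.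
Proof.
move=> q0 [c qE]; move: q0; rewrite qE mulf_eq0 negb_or => /andP[c0 p0].
rewrite size_mul // -subn1 -addnBAC ?size_poly_gt0 //.
by rewrite leq_addl.
Qed.

Lemma prim_dvdp p q : prim p -> p %| q -> rdvd p q.
Proof.
move=> pp /Pdiv.Idomain.dvdpP[[c r] /= c0 cE]; apply: (prim_cancel pp c0).
by exists r; rewrite mul_polyC.
Qed.

Lemma rdvd_dvdp p q : rdvd p q -> p %| q.
Proof. by move=> [r ->]; rewrite dvdp_mull. Qed.

Lemma prime_prim p : rprime p -> (1 < size p)%N -> prim p.
Proof.
move=> [p0 pU pp] sp a pa [c pE]; case: (pp c a%:P).
- by rewrite -pE; exact: rdvd_refl.
- move=> [e cE]; case: pa => _ /negP[]; apply/unitrPr; exists (e`_0).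
  have : p * (a%:P * e) = p * 1 by rewrite mulr1 [RHS]pE cE; ring.
  by move/(mulfI p0)/(congr1 (fun q : {poly A} => q`_0)); rewrite coefCM coef1.
- move/rdvd_size; rewrite polyC_eq0 => h; have : (size p <= 1)%N.
    by rewrite (leq_trans (h _)) ?size_polyC ?leq_b1 //; case: pa.
  by rewrite leqNgt sp.
Qed.

(** [gcdp] works up to constants, that is over the fraction field; primitivity of p turns the
    divisibilities found there into genuine ones. *)
Lemma irreducible_prim_prime p : prim p -> (1 < size p)%N ->
  (forall q, q %| p -> (size q <= 1)%N \/ (size p <= size q)%N) -> rprime p.
Proof.
move=> pp sp irr; have p0 : p != 0 by rewrite -size_poly_gt0 ltnW.
split=> //.
  by rewrite poly_unitE; case: (size p) sp => [|[]].
move=> x y /rdvd_dvdp pxy.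
have [s1|s2] := irr (gcdp p x) (dvdp_gcdl _ _).
  right; apply: prim_dvdp => //; rewrite -(@Gauss_dvdpr _ _ x) //.
  rewrite coprimep_def eqn_leq s1 lt0n size_poly_eq0 gcdp_eq0 negb_and p0 //.
left; apply: prim_dvdp => //; apply: dvdp_trans (dvdp_gcdr p x).
have : gcdp p x %= p.
  by rewrite -dvdp_size_eqp ?dvdp_gcdl // eqn_leq s2 dvdp_leq ?dvdp_gcdl.
by rewrite /eqp => /andP[].
Qed.

Lemma ufd_prim p : prim p -> (1 < size p)%N ->
  exists s : seq {poly A}, (forall q, q \in s -> rprime q) /\
    exists2 u, u \is a GRing.unit & p = u * \prod_(q <- s) q.
Proof.
have [n] := ubnP (size p); elim: n p => // n IHn p sn pp sp.
have p0 : p != 0 by rewrite -size_poly_gt0 ltnW.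
have [irr|nirr] := pselect (forall q, q %| p -> (size q <= 1)%N \/ (size p <= size q)%N).
  exists [:: p]; split; first by move=> q; rewrite inE => /eqP->; apply: irreducible_prim_prime.
  by exists 1; rewrite ?unitr1 // mul1r big_seq1.
have [q [qp s1 s2]] : exists q, [/\ q %| p, (1 < size q)%N & (size q < size p)%N].
  apply: contrapT => H; apply: nirr => q qp; apply: contrapT => /not_orP[/negP a /negP b].
  by apply: H; exists q; rewrite !ltnNge.
have q0 : q != 0 by rewrite -size_poly_gt0 ltnW.
have [t [q1 [tp qE q1p]]] := content_split q0.
have t0 : \prod_(a <- t) a != 0.
  by apply: contra_neq q0 => t0; rewrite qE t0 mul0r.
have q10 : q1 != 0 by apply: contra_neq q0 => q10; rewrite qE q10 mulr0.
have sq1 : size q1 = size q by rewrite qE mul_polyC size_scale.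
have [r pE] : rdvd q1 p.
  apply: prim_dvdp => //; apply: dvdp_trans qp; apply: rdvd_dvdp.
  by exists (\prod_(a <- t) a)%:P.
have r0 : r != 0 by apply: contra_neq p0 => r0; rewrite pE r0 mul0r.
have rp : prim r.
  by move=> a pa ar; apply: (pp a) => //; rewrite pE; exact: rdvd_mulr.
have := size_mul r0 q10; rewrite -pE sq1 => sr.
have sr1 : (1 < size r)%N /\ (size r < size p)%N.
  by move: s1 s2 sr; lia.
case: sr1 => sr1 sr2.
have [|s [sps [u uU rE]]] := IHn r _ rp sr1; first by lia.
have [||s' [sps' [u' uU' q1E]]] := IHn q1 _ q1p; rewrite ?sq1 //; first by lia.
exists (s ++ s'); split.
  by move=> e; rewrite mem_cat => /orP[/sps|/sps'].
by exists (u * u'); rewrite ?unitrM ?uU // big_cat /= mulrACA -rE -q1E.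
Qed.

Theorem ufd_poly : ufd {poly A}.
Proof.
move=> p p0; have [s [q [sp pE qp]]] := content_split p0.
have s0 : \prod_(a <- s) a != 0.
  by apply: contra_neq p0 => t0; rewrite pE t0 mul0r.
have q0 : q != 0 by apply: contra_neq p0 => q10; rewrite pE q10 mulr0.
have sP : forall b, b \in [seq a%:P | a <- s] -> rprime (b : {poly A}).
  by move=> b /mapP[a /sp + ->]; exact: rprime_polyC.
have [sq|sq] := leqP (size q) 1; last first.
  have [s' [s'p [u uU qE]]] := ufd_prim qp sq.
  exists u, ([seq a%:P | a <- s] ++ s'); split=> //.
    by move=> b; rewrite mem_cat => /orP[/sP|/s'p].
  by rewrite big_cat big_map /= -rmorph_prod /= pE {1}qE mulrCA.
exists q, [seq a%:P | a <- s]; split=> //; last first.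
  by rewrite big_map -rmorph_prod /= pE mulrC.
rewrite (size1_polyC sq) poly_unitE coefC eqxx.
have q00 : q`_0 != 0 by rewrite -polyC_eq0 -size1_polyC.
have [u [t [uU tp qE]]] := ufdA q00.
rewrite size_polyC q00 qE /=.
case: t tp qE => [|a t] tp qE; first by rewrite big_nil mulr1.
case: (qp a); first by apply: tp; rewrite mem_head.
exists (u * \prod_(j <- t) j)%:P; rewrite (size1_polyC sq) qE big_cons -polyCM.
by rewrite mulrCA mulrC.
Qed.

(* A resultant: the prime p and q generate a nonzero constant. *)
Lemma prime_elim p q : rprime p -> (1 < size p)%N -> ~ rdvd p q ->
  exists (r : A) (a b : {poly A}), r != 0 /\ r%:P = a * p + b * q.
Proof.
move=> pp sp npq; have p0 : p != 0 by case: pp.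
have pr := prime_prim pp sp.
have cop : coprimep p q.
  have g0 : gcdp p q != 0 by rewrite gcdp_eq0 negb_and p0.
  rewrite coprimep_def eqn_leq size_poly_gt0 g0 andbT leqNgt; apply/negP => sg.
  have /Pdiv.Idomain.dvdpP[[c r] /= c0 cE] := dvdp_gcdl p q.
  have r0 : r != 0.
    apply: contra_neq p0 => r0; move: cE; rewrite r0 mul0r => /eqP.
    by rewrite -mul_polyC mulf_eq0 polyC_eq0 (negPf c0) => /eqP.
  case: pp => _ _ /(_ r (gcdp p q)); case.
  - by rewrite -cE; exists c%:P; rewrite mul_polyC.
  - move/(rdvd_size r0); rewrite leqNgt => /negP; apply.
    have := size_mul r0 g0; rewrite -cE size_scale // => ->.
    by move: sg; lia.
  - move=> /rdvd_dvdp pg; apply: npq; apply: prim_dvdp => //.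
    by apply: dvdp_trans pg (dvdp_gcdr _ _).
have /Bezout_coprimepP[[a b] /= ] := cop.
rewrite -size_poly_eq1 => /size_poly1P[r r0 rE].
by exists r, a, b; rewrite rE.
Qed.

(** The form in which elimination of one variable is used. Since r is a combination of p and q, it
    vanishes under every specialization that creates a common root, even one that kills leading
    coefficients. *)
Lemma prime_elim_root p q : rprime p -> (1 < size p)%N -> ~ rdvd p q ->
  exists2 r : A, r != 0 & forall (K : comNzRingType) (f : {rmorphism A -> K}) t,
    (map_poly f p).[t] = 0 -> (map_poly f q).[t] = 0 -> f r = 0.
Proof.
move=> pp sp npq; have [r [a [b [r0 rE]]]] := prime_elim pp sp npq.
exists r => // K f t pt qt; have := congr1 (fun p => (map_poly f p).[t]) rE.
by rewrite /= map_polyC hornerC rmorphD !rmorphM hornerD !hornerM pt qt !mulr0 addr0.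
Qed.

End Gauss.

(** * Polynomials in n + 1 variables as polynomials over those in n variables *)

Section MpolyUFD.
Variable k : fieldType.

Lemma mmap_rmorph (S S' : comNzRingType) n (f : {rmorphism k -> S})
    (g : {rmorphism S -> S'}) (h : 'I_n -> S) (p : {mpoly k[n]}) :
  g (mmap f h p) = mmap (g \o f) (g \o h) p.
Proof.
rewrite /mmap rmorph_sum; apply: eq_bigr => m _.
by rewrite rmorphM /mmap1 rmorph_prod; congr (_ * _); apply: eq_bigr => i _; rewrite rmorphXn.
Qed.

Lemma mmap_ext (S : comNzRingType) n (f f' : k -> S) (h h' : 'I_n -> S) (p : {mpoly k[n]}) :
  f =1 f' -> h =1 h' -> mmap f h p = mmap f' h' p.
Proof.
move=> ef eh; rewrite /mmap; apply: eq_bigr => m _; rewrite ef; congr (_ * _).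
by rewrite /mmap1; apply: eq_bigr => i _; rewrite eh.
Qed.

Lemma mmap_id n (p : {mpoly k[n]}) : mmap (@mpolyC n k) (fun i => 'X_i) p = p.
Proof.
rewrite -[RHS]comp_mpoly_id; apply: mmap_ext => // i.
by rewrite tnth_map tnth_ord_tuple.
Qed.

Definition mmultm n (P : {poly {mpoly k[n]}}) : {mpoly k[n.+1]} :=
  (map_poly (@mwiden n k) P).['X_ord_max].

Lemma mmultm_is_monoid n : monoid_morphism (@mmultm n).
Proof.
split; first by rewrite /mmultm rmorph1 hornerC.
by move=> p q; rewrite /mmultm rmorphM hornerM.
Qed.

Lemma mmultm_is_zmod n : zmod_morphism (@mmultm n).
Proof. by move=> p q; rewrite /mmultm rmorphB hornerD hornerN. Qed.

HB.instance Definition _ n := GRing.isZmodMorphism.Build _ _ (@mmultm n) (@mmultm_is_zmod n).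
HB.instance Definition _ n := GRing.isMonoidMorphism.Build _ _ (@mmultm n) (@mmultm_is_monoid n).

Lemma muniXw n (i : 'I_n) : muni ('X_(widen_ord (leqnSn n) i) : {mpoly k[n.+1]}) = ('X_i)%:P.
Proof.
rewrite muniE msuppX big_seq1 mcoeffX eqxx scale1r mnmE -val_eqE /= ltn_eqF // expr0.
rewrite -mul_polyC mulr1; congr (_%:P); congr ('X_[_]); apply/mnmP => j.
by rewrite !mnmE; congr nat_of_bool; apply/eqP/eqP => [/(congr1 val)/= ij|->//]; apply: val_inj.
Qed.

Lemma muniXm n : muni ('X_ord_max : {mpoly k[n.+1]}) = 'X.
Proof.
rewrite muniE msuppX big_seq1 mcoeffX eqxx scale1r mnmE eqxx expr1 -mul_polyC.
rewrite (_ : [multinom _ | i < n] = 0%MM) ?mpolyX0 ?mul1r //.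
apply/mnmP => j; rewrite !mnmE -val_eqE /= gtn_eqF //.
Qed.

Lemma ord_maxP n (i : 'I_n.+1) : i = ord_max \/ exists j : 'I_n, i = widen_ord (leqnSn n) j.
Proof.
have := ltn_ord i; rewrite ltnS leq_eqVlt => /predU1P[iE|lt].
  by left; apply: val_inj.
by right; exists (Ordinal lt); apply: val_inj.
Qed.

Lemma muni_mwiden n (c : {mpoly k[n]}) : muni (mwiden c) = c%:P.
Proof.
rewrite /mwiden (mmap_rmorph _ (@muni n k)) -[RHS](congr1 polyC (mmap_id c)).
rewrite (mmap_rmorph _ (@polyC _)); apply: mmap_ext => [x|i] /=; first exact: muniC.
exact: muniXw.
Qed.

Lemma mmultmK n : cancel (@mmultm n) (@muni n k).
Proof.
move=> P; rewrite -{2}[P]coefK poly_def /mmultm horner_coef size_map_inj_poly ?mwiden0 //; last first.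
  exact: inj_mwiden.
rewrite rmorph_sum; apply: eq_bigr => i _.
by rewrite coef_map /= muniM muni_mwiden rmorphXn /= muniXm mul_polyC.
Qed.

Lemma muniK n : cancel (@muni n k) (@mmultm n).
Proof.
move=> p; have -> : mmultm (muni p) = mmultm (muni (mmap (@mpolyC _ k) (fun i => 'X_i) p)).
  by rewrite mmap_id.
pose g := [the {rmorphism {mpoly k[n.+1]} -> {mpoly k[n.+1]}} of @mmultm n \o @muni n k].
transitivity (mmap (g \o @mpolyC _ k) (g \o (fun i => 'X_i)) p).
  exact: (mmap_rmorph _ g).
rewrite -[RHS]mmap_id; apply: mmap_ext => [c|i] /=.
  by rewrite muniC /mmultm map_polyC hornerC /= mwidenC.
have [->|[j ->]] := ord_maxP i; first by rewrite muniXm /mmultm map_polyX hornerX.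
by rewrite muniXw /mmultm map_polyC hornerC /= mwidenX mnmwiden1.
Qed.

Lemma iso_rprime (A B : idomainType) (f : {rmorphism A -> B}) (g : {rmorphism B -> A}) x :
  cancel f g -> cancel g f -> rprime x -> rprime (f x).
Proof.
move=> fK gK [x0 xU xp]; split.
- by apply: contra_neq x0 => fx0; rewrite -[x]fK fx0 rmorph0.
- by apply: contra xU => /(rmorph_unit g); rewrite fK.
- move=> y z [c cE]; case: (xp (g y) (g z)) => [|[e eE]|[e eE]].
  + by exists (g c); rewrite -rmorphM cE rmorphM fK.
  + by left; exists (f e); rewrite -rmorphM -eE gK.
  + by right; exists (f e); rewrite -rmorphM -eE gK.
Qed.

Lemma iso_rdvd (A B : idomainType) (f : {rmorphism A -> B}) (g : {rmorphism B -> A}) x y :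
  cancel f g -> rdvd (f x) (f y) -> rdvd x y.
Proof. by move=> fK [c cE]; exists (g c); rewrite -[y]fK cE rmorphM fK. Qed.

Lemma ufd_iso (A B : idomainType) (f : {rmorphism A -> B}) (g : {rmorphism B -> A}) :
  cancel f g -> cancel g f -> ufd A -> ufd B.
Proof.
move=> fK gK U b b0; have gb0 : g b != 0.
  by apply: contra_neq b0 => gb0; rewrite -[b]gK gb0 rmorph0.
have [u [s [uU sp gE]]] := U _ gb0.
exists (f u), [seq f x | x <- s]; split; first exact: rmorph_unit.
  by move=> p /mapP[x /sp xp ->]; exact: (iso_rprime fK gK).
by rewrite big_map -rmorph_prod -rmorphM -gE gK.
Qed.

Lemma mpoly_unitE n (p : {mpoly k[n]}) :
  p \is a GRing.unit <-> exists2 c, c != 0 & p = c%:MP.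
Proof.
split=> [/andP[/eqP pE p0]|[c c0 ->]]; first by exists p@_0; rewrite -?unitfE.
by apply/andP; rewrite mcoeffC eqxx mulr1 unitfE.
Qed.

Lemma mpoly0_unit (p : {mpoly k[0]}) : p != 0 -> p \is a GRing.unit.
Proof.
move=> p0; apply/mpoly_unitE; exists p@_0; last by rewrite mpolyKC.
by apply: contra_neq p0 => p0; rewrite -[p]mpolyKC p0 mpolyC0.
Qed.

Theorem ufd_mpoly n : ufd {mpoly k[n]}.
Proof.
elim: n => [|n IHn].
  move=> p p0; exists p, [::]; split=> //; first exact: mpoly0_unit.
  by rewrite big_nil mulr1.
exact: (ufd_iso (@mmultmK n) (@muniK n)  (ufd_poly IHn)).
Qed.

(** The new value goes to the last variable, the one that [muni] singles out. *)
Definition extv n (v : 'I_n -> k) (t : k) (i : 'I_n.+1) : k :=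
  if unlift ord_max i is Some j then v j else t.

Definition evp n (v : 'I_n -> k) (P : {poly {mpoly k[n]}}) : {poly k} :=
  map_poly (meval v) P.

Lemma evpM n (v : 'I_n -> k) p q : evp v (p * q) = evp v p * evp v q.
Proof. exact: rmorphM. Qed.
Lemma evpD n (v : 'I_n -> k) p q : evp v (p + q) = evp v p + evp v q.
Proof. exact: rmorphD. Qed.
Lemma evpC n (v : 'I_n -> k) c : evp v c%:P = (c.@[v])%:P.
Proof. exact: map_polyC. Qed.

Lemma evpE n (v : 'I_n -> k) (t : k) (p : {mpoly k[n.+1]}) :
  p.@[extv v t] = (evp v (muni p)).[t].
Proof.
pose g := [the {rmorphism {mpoly k[n.+1]} -> k} of
  horner_eval t \o map_poly (meval v) \o (@muni n k)].
transitivity (g (mmap (@mpolyC _ k) (fun i => 'X_i) p)); last by rewrite mmap_id.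
rewrite (mmap_rmorph _ g); apply: mmap_ext => [c|i] /=.
  by rewrite muniC map_polyC horner_evalE hornerC /= mevalC.
rewrite /extv; have [->|[j ->]] := ord_maxP i.
  by rewrite unlift_none muniXm map_polyX horner_evalE hornerX.
have wE : widen_ord (leqnSn n) j = lift ord_max j.
  by apply: val_inj; rewrite /= /bump leqNgt ltn_ord.
rewrite {1}wE liftK.
by rewrite muniXw map_polyC horner_evalE hornerC /= mevalXU.
Qed.

End MpolyUFD.

(** * Nonvanishing points and a Nullstellensatz for prime hypersurfaces *)

Section ClosedField.
Variable k : closedFieldType.

Lemma poly_nz (p : {poly k}) : p != 0 -> exists x, p.[x] != 0.
Proof.
(* A root of p + 1 is a point where p takes the value -1; if there is none, p + 1 is a nonzero
   constant, so p is constant. *)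
move=> p0; have [s1|s1] := eqVneq (size (p + 1)) 1%N.
  have [c c0 pE] : exists2 c, c != 0 & p = c%:P.
    move/eqP: s1 => /size_poly1P[c c0 cE]; exists (c - 1); last first.
      by rewrite polyCB -cE addrK.
    by apply: contra_neq p0 => c1; rewrite -[p](addrK 1) cE -polyCB c1.
  by exists 0; rewrite pE hornerC.
have [x] := closed_rootP _ s1; rewrite /root hornerD hornerC => /eqP px.
by exists x; apply/eqP => px0; move: px; rewrite px0 add0r => /eqP; rewrite oner_eq0.
Qed.

Lemma mpoly_nz n (p : {mpoly k[n]}) : p != 0 -> exists v, p.@[v] != 0.
Proof.
elim: n p => [|n IHn] p p0.
  have /mpoly_unitE[c c0 ->] := mpoly0_unit p0.
  by exists (fun=> 0); rewrite mevalC.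
have P0 : muni p != 0 by apply: contra_neq p0 => P0; rewrite -[p]muniK P0 rmorph0.
have [|v lv] := IHn (lead_coef (muni p)); first by rewrite lead_coef_eq0.
have [|t tv] := @poly_nz (evp v (muni p)); last by exists (extv v t); rewrite evpE.
by rewrite map_poly_eq0_id0.
Qed.

(** If pi involves the last variable, take v off the zeros of its leading coefficient and of the
    eliminant r of pi and q; then every root of pi over v avoids q. Otherwise pi is a prime in fewer
    variables, and some coefficient of q is not divisible by it. *)
Lemma nullstellensatz_prime n (pi q : {mpoly k[n]}) : rprime pi -> ~ rdvd pi q ->
  exists v, pi.@[v] = 0 /\ q.@[v] != 0.
Proof.
elim: n pi q => [|n IHn] pi q pp nq.
  by case: pp => p0 /negP[]; exact: mpoly0_unit.
pose P := muni pi; pose Q := muni q.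
have PP : rprime P by exact: (iso_rprime (@muniK k n) (@mmultmK k n)).
have nQ : ~ rdvd P Q by move=> PQ; apply: nq; exact: (iso_rdvd (@muniK k n)).
have [sP|sP] := leqP (size P) 1; last first.
  have [r r0 rE] := prime_elim_root (@ufd_mpoly k n) PP sP nQ.
  have [|v] := @mpoly_nz _ (lead_coef P * r).
    by rewrite mulf_neq0 // lead_coef_eq0; case: PP.
  rewrite mevalM mulf_eq0 negb_or => /andP[lv rv].
  have sv : size (evp v P) = size P by apply: size_map_poly_id0.
  have [t /rootP Pt] : exists t, root (evp v P) t.
    by apply/closed_rootP; rewrite sv gtn_eqF.
  exists (extv v t); rewrite !evpE; split=> //; apply: contra_neq rv => Qt.
  exact: (rE _ (meval v) t Pt Qt).
have PE : P = (P`_0)%:P by exact: size1_polyC.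
have cp : rprime P`_0 by apply: rprime_polyC_inv; rewrite -PE.
have [i ni] : exists i, ~ rdvd P`_0 Q`_i.
  by apply/existsNP => H; apply: nQ; rewrite PE; exact: rdvd_polyC.
have [v [pv qv]] := IHn _ _ cp ni.
have [|t Qt] := @poly_nz (evp v Q).
  by apply: contra_neq qv => Q0; rewrite -(coef_map (meval v)) -/(evp v Q) Q0 coef0.
by exists (extv v t); rewrite !evpE -/P PE /evp map_polyC hornerC.
Qed.

End ClosedField.

(** * Polynomial functions on products of matrix spaces *)

(* Finite products of matrix spaces, so that polynomial functions of several
   matrix arguments can be handled without flattening the arguments. *)
Class aff (k : closedFieldType) (T : Type) := Aff {
  adim : nat;
  aco : T -> 'rV[k]_adim;
  amk : 'rV[k]_adim -> T;
  acoK : cancel aco amk;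
  amkK : cancel amk aco }.

Section Affine.
Variable k : closedFieldType.

#[export] Instance aff_mx m n : aff k 'M[k]_(m, n) :=
  @Aff k _ (m * n) (@mxvec k m n) (@vec_mx k m n) (@mxvecK k m n) (@vec_mxK k m n).

Lemma aff_kK : cancel (fun x : k => x%:M : 'rV[k]_1) (fun v => v 0 0).
Proof. by move=> x; rewrite mxE eqxx. Qed.
Lemma aff_kV : cancel (fun v : 'rV[k]_1 => v 0 0) (fun x => x%:M).
Proof. by move=> v; rewrite -mx11_scalar. Qed.
#[export] Instance aff_k : aff k k := Aff aff_kK aff_kV.

Section Prod.
Context (A B : Type) {hA : aff k A} {hB : aff k B}.
Let co (t : A * B) := row_mx (@aco k A hA t.1) (@aco k B hB t.2).
Let mk (v : 'rV[k]_(@adim k A hA + @adim k B hB)) := (amk (lsubmx v) : A, amk (rsubmx v) : B).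
Lemma aff_pK : cancel co mk.
Proof. by move=> [a b]; rewrite /mk /co row_mxKl row_mxKr !acoK. Qed.
Lemma aff_pV : cancel mk co.
Proof. by move=> v; rewrite /mk /co /= !amkK hsubmxK. Qed.
#[export] Instance aff_prod : aff k (A * B) := Aff aff_pK aff_pV.
End Prod.

Definition cof T {hT : aff k T} (t : T) (i : 'I_adim) : k := aco t 0 i.
Definition pf T {hT : aff k T} (f : T -> k) := exists p : {mpoly k[adim]}, forall t, f t = p.@[cof t].
Definition pmap T T' {hT : aff k T} {hT' : aff k T'} (f : T -> T') :=
  forall i, pf (fun t => cof (f t) i).

Section Closure.
Context (T : Type) {hT : aff k T}.
Implicit Types f g : T -> k.

Lemma pf_ext f g : f =1 g -> pf f -> pf g.
Proof. by move=> e [p pE]; exists p => t; rewrite -e. Qed.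
Lemma pf_const c : pf (fun _ : T => c).
Proof. by exists c%:MP => t; rewrite mevalC. Qed.
Lemma pf_cof i : pf (fun t : T => cof t i).
Proof. by exists 'X_i => t; rewrite mevalXU. Qed.
Lemma pf_add f g : pf f -> pf g -> pf (fun t => f t + g t).
Proof. by move=> [p pE] [q qE]; exists (p + q) => t; rewrite mevalD pE qE. Qed.
Lemma pf_mul f g : pf f -> pf g -> pf (fun t => f t * g t).
Proof. by move=> [p pE] [q qE]; exists (p * q) => t; rewrite mevalM pE qE. Qed.
Lemma pf_opp f : pf f -> pf (fun t => - f t).
Proof. by move=> [p pE]; exists (- p) => t; rewrite mevalN pE. Qed.
Lemma pf_exp f n : pf f -> pf (fun t => f t ^+ n).
Proof. by move=> [p pE]; exists (p ^+ n) => t; rewrite rmorphXn /= pE. Qed.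
Lemma pf_mulrn f n : pf f -> pf (fun t => f t *+ n).
Proof. by move=> [p pE]; exists (p *+ n) => t; rewrite mevalMn pE. Qed.
Lemma pf_sum I (r : seq I) (P : pred I) (F : I -> T -> k) : (forall i, pf (F i)) ->
  pf (fun t => \sum_(i <- r | P i) F i t).
Proof.
move=> /choice[p pE]; exists (\sum_(i <- r | P i) p i) => t.
by rewrite raddf_sum; apply: eq_bigr => i _; rewrite pE.
Qed.
Lemma pf_prod I (r : seq I) (P : pred I) (F : I -> T -> k) : (forall i, pf (F i)) ->
  pf (fun t => \prod_(i <- r | P i) F i t).
Proof.
move=> /choice[p pE]; exists (\prod_(i <- r | P i) p i) => t.
by rewrite rmorph_prod; apply: eq_bigr => i _; rewrite /= pE.
Qed.
Lemma pf_if (b : bool) f g : pf f -> pf g -> pf (fun t => if b then f t else g t).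
Proof. by case: b. Qed.

Lemma pf_entry m n (f : T -> 'M[k]_(m, n)) i j : pmap f -> pf (fun t => f t i j).
Proof.
move=> /(_ (mxvec_index i j)); apply: pf_ext => t.
by rewrite /cof /= mxvecE.
Qed.
Lemma pmap_mx m n (f : T -> 'M[k]_(m, n)) : (forall i j, pf (fun t => f t i j)) -> pmap f.
Proof.
move=> H i; case/mxvec_indexP: i => a b; apply: pf_ext (H a b) => t.
by rewrite /cof /= mxvecE.
Qed.
Lemma pmap_k (f : T -> k) : pf f -> pmap f.
Proof. by move=> H i; apply: pf_ext H => t; rewrite /cof /= mxE [i]ord1 eqxx. Qed.
Lemma pf_pmap (f : T -> k) : pmap f -> pf f.
Proof. by move=> /(_ 0); apply: pf_ext => t; rewrite /cof /= mxE eqxx. Qed.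
Lemma pmap_pair A B {hA : aff k A} {hB : aff k B} (f : T -> A) (g : T -> B) :
  pmap f -> pmap g -> pmap (fun t => (f t, g t)).
Proof.
move=> hf hg i; rewrite -(splitK i); case: (split i) => j.
  by apply: pf_ext (hf j) => t; rewrite /cof /= row_mxEl.
by apply: pf_ext (hg j) => t; rewrite /cof /= row_mxEr.
Qed.
Lemma pmap_fst A B {hA : aff k A} {hB : aff k B} (f : T -> A * B) :
  pmap f -> pmap (fun t => (f t).1).
Proof.
by move=> hf i; apply: pf_ext (hf (lshift _ i)) => t; rewrite /cof /= row_mxEl.
Qed.
Lemma pmap_snd A B {hA : aff k A} {hB : aff k B} (f : T -> A * B) :
  pmap f -> pmap (fun t => (f t).2).
Proof.
by move=> hf i; apply: pf_ext (hf (rshift _ i)) => t; rewrite /cof /= row_mxEr.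
Qed.
Lemma pmap_id : pmap (fun t : T => t).
Proof. exact: pf_cof. Qed.
Lemma pmap_const T' {hT' : aff k T'} (c : T') : pmap (fun _ : T => c).
Proof. by move=> i; exact: pf_const. Qed.

Lemma pmap_mul m n p (f : T -> 'M[k]_(m, n)) (g : T -> 'M[k]_(n, p)) :
  pmap f -> pmap g -> pmap (fun t => f t *m g t).
Proof.
move=> hf hg; apply: pmap_mx => i j.
have: pf (fun t => \sum_l f t i l * g t l j).
  by apply: pf_sum => l; apply: pf_mul; apply: pf_entry.
by apply: pf_ext => t; rewrite mxE.
Qed.
Lemma pmap_addmx m n (f g : T -> 'M[k]_(m, n)) :
  pmap f -> pmap g -> pmap (fun t => f t + g t).
Proof.
move=> hf hg; apply: pmap_mx => i j.
by apply: pf_ext (pf_add (pf_entry i j hf) (pf_entry i j hg)) => t; rewrite mxE.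
Qed.
Lemma pmap_oppmx m n (f : T -> 'M[k]_(m, n)) : pmap f -> pmap (fun t => - f t).
Proof.
move=> hf; apply: pmap_mx => i j.
by apply: pf_ext (pf_opp (pf_entry i j hf)) => t; rewrite mxE.
Qed.
Lemma pmap_scale m n (c : T -> k) (f : T -> 'M[k]_(m, n)) :
  pf c -> pmap f -> pmap (fun t => c t *: f t).
Proof.
move=> hc hf; apply: pmap_mx => i j.
by apply: pf_ext (pf_mul hc (pf_entry i j hf)) => t; rewrite mxE.
Qed.
Lemma pmap_tr m n (f : T -> 'M[k]_(m, n)) : pmap f -> pmap (fun t => (f t)^T).
Proof.
move=> hf; apply: pmap_mx => i j.
by apply: pf_ext (pf_entry j i hf) => t; rewrite mxE.
Qed.
Lemma pmap_row_mx m n1 n2 (f : T -> 'M[k]_(m, n1)) (g : T -> 'M[k]_(m, n2)) :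
  pmap f -> pmap g -> pmap (fun t => row_mx (f t) (g t)).
Proof.
move=> hf hg; apply: pmap_mx => i j; rewrite -(splitK j); case: (split j) => l.
  by apply: pf_ext (pf_entry i l hf) => t; rewrite row_mxEl.
by apply: pf_ext (pf_entry i l hg) => t; rewrite row_mxEr.
Qed.
Lemma pmap_col_mx m1 m2 n (f : T -> 'M[k]_(m1, n)) (g : T -> 'M[k]_(m2, n)) :
  pmap f -> pmap g -> pmap (fun t => col_mx (f t) (g t)).
Proof.
move=> hf hg; apply: pmap_mx => i j; rewrite -(splitK i); case: (split i) => l.
  by apply: pf_ext (pf_entry l j hf) => t; rewrite col_mxEu.
by apply: pf_ext (pf_entry l j hg) => t; rewrite col_mxEd.
Qed.
Lemma pmap_lsubmx m n1 n2 (f : T -> 'M[k]_(m, n1 + n2)) : pmap f -> pmap (fun t => lsubmx (f t)).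
Proof.
move=> hf; apply: pmap_mx => i j.
by apply: pf_ext (pf_entry i (lshift _ j) hf) => t; rewrite mxE.
Qed.
Lemma pmap_rsubmx m n1 n2 (f : T -> 'M[k]_(m, n1 + n2)) : pmap f -> pmap (fun t => rsubmx (f t)).
Proof.
move=> hf; apply: pmap_mx => i j.
by apply: pf_ext (pf_entry i (rshift _ j) hf) => t; rewrite mxE.
Qed.
Lemma pmap_usubmx m1 m2 n (f : T -> 'M[k]_(m1 + m2, n)) : pmap f -> pmap (fun t => usubmx (f t)).
Proof.
move=> hf; apply: pmap_mx => i j.
by apply: pf_ext (pf_entry (lshift _ i) j hf) => t; rewrite mxE.
Qed.
Lemma pmap_dsubmx m1 m2 n (f : T -> 'M[k]_(m1 + m2, n)) : pmap f -> pmap (fun t => dsubmx (f t)).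
Proof.
move=> hf; apply: pmap_mx => i j.
by apply: pf_ext (pf_entry (rshift _ i) j hf) => t; rewrite mxE.
Qed.
Lemma pmap_vec_mx m n (f : T -> 'rV[k]_(m * n)) : pmap f -> pmap (fun t => vec_mx (f t)).
Proof.
move=> hf; apply: pmap_mx => i j.
by apply: pf_ext (pf_entry 0 (mxvec_index i j) hf) => t; rewrite mxE.
Qed.
Lemma pmap_mxvec m n (f : T -> 'M[k]_(m, n)) : pmap f -> pmap (fun t => mxvec (f t)).
Proof.
move=> hf; apply: pmap_mx => i j; rewrite [i]ord1; case/mxvec_indexP: j => a b.
by apply: pf_ext (pf_entry a b hf) => t; rewrite mxvecE.
Qed.
Lemma pf_det n (f : T -> 'M[k]_n) : pmap f -> pf (fun t => \det (f t)).
Proof.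
move=> hf; rewrite /determinant; apply: pf_sum => s; apply: pf_mul; first exact: pf_const.
by apply: pf_prod => i; apply: pf_entry.
Qed.
Lemma pmap_adj n (f : T -> 'M[k]_n) : pmap f -> pmap (fun t => \adj (f t)).
Proof.
move=> hf; apply: pmap_mx => i j.
have: pf (fun t => cofactor (f t) j i).
  rewrite /cofactor; apply: pf_mul; first exact: pf_const.
  apply: pf_det; apply: pmap_mx => a b.
  by apply: pf_ext (pf_entry (lift j a) (lift i b) hf) => t; rewrite !mxE.
by apply: pf_ext => t; rewrite mxE.
Qed.
Lemma pmap_scalar n (f : T -> k) : pf f -> pmap (fun t => (f t)%:M : 'M[k]_n).
Proof.
move=> hf; apply: pmap_mx => i j.
by apply: pf_ext (pf_mulrn (i == j) hf) => t; rewrite mxE.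
Qed.
Lemma pmap_matrix m n (F : T -> 'I_m -> 'I_n -> k) :
  (forall i j, pf (fun t => F t i j)) -> pmap (fun t => \matrix_(i, j) F t i j).
Proof. by move=> hf; apply: pmap_mx => i j; apply: pf_ext (hf i j) => t; rewrite mxE. Qed.
End Closure.

Lemma pf_comp T T' {hT : aff k T} {hT' : aff k T'} (g : T' -> k) (f : T -> T') :
  pf g -> pmap f -> pf (fun t => g (f t)).
Proof.
move=> [p pE] /choice[q qE]; exists (p \mPo [tuple q i | i < adim]) => t.
rewrite pE comp_mpoly_meval; apply: meval_eq => i.
by rewrite tnth_map tnth_ord_tuple -qE.
Qed.
Lemma pmap_comp T T' T'' {hT : aff k T} {hT' : aff k T'} {hT'' : aff k T''}
  (g : T' -> T'') (f : T -> T') : pmap g -> pmap f -> pmap (fun t => g (f t)).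
Proof. by move=> hg hf i; exact: (pf_comp (hg i) hf). Qed.

Lemma pmap_fst0 A B {hA : aff k A} {hB : aff k B} : pmap (@fst A B).
Proof. by apply: (pmap_fst (f := fun t => t)); exact: pmap_id. Qed.
Lemma pmap_snd0 A B {hA : aff k A} {hB : aff k B} : pmap (@snd A B).
Proof. by apply: (pmap_snd (f := fun t => t)); exact: pmap_id. Qed.

Lemma cof_amk T {hT : aff k T} (v : 'I_adim -> k) :
  cof (amk (\row_i v i) : T) =1 v.
Proof. by move=> i; rewrite /cof amkK mxE. Qed.

Lemma ev_nz T {hT : aff k T} (p : {mpoly k[adim]}) : p != 0 -> exists t : T, p.@[cof t] != 0.
Proof.
move=> /mpoly_nz[v pv]; exists (amk (\row_i v i)).
by rewrite (meval_eq p (cof_amk v)).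
Qed.

Lemma ev_inj T {hT : aff k T} (p q : {mpoly k[adim]}) :
  (forall t : T, p.@[cof t] = q.@[cof t]) -> p = q.
Proof.
move=> H; apply: contrapT => /eqP; rewrite -subr_eq0 => /ev_nz[t].
by rewrite mevalB H subrr eqxx.
Qed.

(** Irreducibility of affine space. It serves for density arguments: an identity known outside some
    exceptional loci is multiplied by their equations and then freed of them. *)
Lemma pf_mul_eq0 T {hT : aff k T} (f g : T -> k) : pf f -> pf g ->
  (forall t, f t * g t = 0) -> (forall t, f t = 0) \/ (forall t, g t = 0).
Proof.
move=> [p pE] [q qE] H; have /eqP : p * q = 0.
  by apply: ev_inj => t; rewrite mevalM -pE -qE H meval0.
by rewrite mulf_eq0 => /orP[/eqP p0|/eqP q0]; [left|right] => t; rewrite ?pE ?qE ?p0 ?q0 meval0.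
Qed.

Lemma pf_common_nz T {hT : aff k T} (f g : T -> k) : pf f -> pf g ->
  (exists t, f t != 0) -> (exists t, g t != 0) -> exists t, f t != 0 /\ g t != 0.
Proof.
move=> hf hg [a fa] [b gb]; apply: contrapT => /forallNP H.
case: (pf_mul_eq0 hf hg) => [t|f0|g0].
- apply/eqP; rewrite mulf_eq0; apply: contrapT => /negP; rewrite negb_or => /andP[x y].
  by apply: (H t).
- by rewrite f0 eqxx in fa.
- by rewrite g0 eqxx in gb.
Qed.

Lemma poly_eq_nz (p q : {poly k}) : (forall s, s != 0 -> p.[s] = q.[s]) -> p = q.
Proof.
move=> H; apply: contrapT => /eqP; rewrite -subr_eq0 => pq.
have /poly_nz[s] : 'X * (p - q) != 0 by rewrite mulf_neq0 // polyX_eq0.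
rewrite hornerM hornerX mulf_eq0 negb_or => /andP[s0].
by rewrite hornerD hornerN H // subrr eqxx.
Qed.

Lemma pf_poly P {hP : aff k P} (f : P * k -> k) : pf f ->
  exists Q : {poly {mpoly k[@adim k P hP]}}, forall p t, f (p, t) = (evp (cof p) Q).[t].
Proof.
move=> [q qE]; pose h (i : 'I_(@adim k P hP + 1)) : {poly {mpoly k[@adim k P hP]}} :=
  match split i with inl j => ('X_j)%:P | inr _ => 'X end.
exists (mmap (polyC \o @mpolyC _ _) h q) => p t; rewrite qE.
pose g := [the {rmorphism {poly {mpoly k[@adim k P hP]}} -> k} of
  horner_eval t \o map_poly (meval (cof p))].
rewrite -[RHS]/(g _) mmap_rmorph; apply: mmap_ext => [c|i] /=.
  by rewrite map_polyC horner_evalE hornerC /= mevalC.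
rewrite /cof /h /= mxE; case: split => j.
  by rewrite map_polyC horner_evalE hornerC /= mevalXU.
by rewrite map_polyX horner_evalE hornerX mxE [j]ord1 eqxx.
Qed.

Lemma pf_evp P {hP : aff k P} (Q : {poly {mpoly k[@adim k P hP]}}) :
  pf (fun pt : P * k => (evp (cof pt.1) Q).[pt.2]).
Proof.
have : pf (fun pt : P * k => \sum_(i < size Q) (Q`_i).@[cof pt.1] * pt.2 ^+ i).
  apply: pf_sum => i; apply: pf_mul.
    apply: (pf_comp (g := fun p : P => (Q`_i).@[cof p])); first by exists Q`_i.
    by apply: pmap_fst; apply: pmap_id.
  by apply: pf_exp; apply: pf_pmap; apply: pmap_snd; apply: pmap_id.
apply: pf_ext => -[p t] /=.
by rewrite (@horner_coef_wide _ (size Q)) ?size_poly //; apply: eq_bigr => i _; rewrite coef_map.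
Qed.

(** Closed sets are described by separation, one function for each outside point; arbitrary
    intersections are then closed at once, and elimination has to produce only one equation at a
    time. *)
Definition zcl T {hT : aff k T} (C : T -> Prop) := forall t, ~ C t ->
  exists f : T -> k, [/\ pf f, (forall s, C s -> f s = 0) & f t != 0].

End Affine.

Ltac pfstep := first
  [ assumption
  | apply: pf_const | apply: pmap_const | apply: pmap_fst0 | apply: pmap_snd0
  | match goal with
    | |- pf (fun _ => _ + _) => apply: pf_add
    | |- pf (fun _ => - _) => apply: pf_opp
    | |- pf (fun _ => _ * _) => apply: pf_mul
    | |- pf (fun _ => _ ^+ _) => apply: pf_exp
    | |- pf (fun _ => _ *+ _) => apply: pf_mulrn
    | |- pf (fun _ => bigop _ _ (fun _ => BigBody _ +%R _ _)) => apply: pf_sum => ?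
    | |- pf (fun _ => bigop _ _ (fun _ => BigBody _ *%R _ _)) => apply: pf_prod => ?
    | |- pf (fun _ => \det _) => apply: pf_det
    | |- pf (fun _ => fun_of_matrix _ _ _) => apply: pf_entry
    | |- pf (fun _ => if _ then _ else _) => apply: pf_if
    | |- pmap (fun x => x) => apply: pmap_id
    | |- pmap (fun _ => (_, _)) => apply: pmap_pair
    | |- pmap (fun _ => fst _) => apply: pmap_fst
    | |- pmap (fun _ => snd _) => apply: pmap_snd
    | |- pmap (fun _ => mulmx _ _) => apply: pmap_mul
    | |- pmap (fun _ => (_ + _ : matrix _ _ _)) => apply: pmap_addmx
    | |- pmap (fun _ => (- _ : matrix _ _ _)) => apply: pmap_oppmx
    | |- pmap (fun _ => _ *: _) => apply: pmap_scale
    | |- pmap (fun _ => trmx _) => apply: pmap_tr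
    | |- pmap (fun _ => row_mx _ _) => apply: pmap_row_mx
    | |- pmap (fun _ => col_mx _ _) => apply: pmap_col_mx
    | |- pmap (fun _ => lsubmx _) => apply: pmap_lsubmx
    | |- pmap (fun _ => rsubmx _) => apply: pmap_rsubmx
    | |- pmap (fun _ => usubmx _) => apply: pmap_usubmx
    | |- pmap (fun _ => dsubmx _) => apply: pmap_dsubmx
    | |- pmap (fun _ => vec_mx _) => apply: pmap_vec_mx
    | |- pmap (fun _ => mxvec _) => apply: pmap_mxvec
    | |- pmap (fun _ => \adj _) => apply: pmap_adj
    | |- pmap (fun _ => _%:M) => apply: pmap_scalar
    | |- pmap (fun _ => matrix_of_fun _ _) => apply: pmap_matrix => ? ?
    | |- @pmap _ _ _ _ (aff_k _) _ => apply: pmap_k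
    | |- pf (fun _ => fst _) => apply: pf_pmap
    | |- pf (fun _ => snd _) => apply: pf_pmap
    | |- pf (fun x => x) => apply: pf_pmap
    | |- pf fst => apply: pf_pmap
    | |- pf snd => apply: pf_pmap
    end ].
Ltac pfs := repeat pfstep.

(** * Elimination *)

Section Elimination.
Variable k : closedFieldType.

Lemma poly_avoid (ps : seq {poly k}) : (forall p, p \in ps -> p != 0) ->
  exists c, forall p, p \in ps -> p.[c] != 0.
Proof.
move=> H; have /poly_nz[c] : \prod_(p <- ps) p != 0.
  by rewrite prodf_seq_neq0; apply/allP => p /H ->.
rewrite horner_prod prodf_seq_neq0 => /allP H'.
by exists c => p /H'.
Qed.

(** Two functions vanishing on C are combined to f + c g, where each of the finitely many points
    excludes only finitely many c. *)
Lemma zcl_avoid T {hT : aff k T} (C : T -> Prop) (I : eqType) (pts : I -> T) (s : seq I) :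
  zcl C -> (forall i, i \in s -> ~ C (pts i)) ->
  exists f : T -> k, [/\ pf f, (forall t, C t -> f t = 0) & forall i, i \in s -> f (pts i) != 0].
Proof.
move=> zC; elim: s => [|i s IHs] H.
  by exists (fun=> 0); split=> //; exact: pf_const.
have [|f [pf_f fC fs]] := IHs; first by move=> j js; apply: H; rewrite inE js orbT.
have [|g [pf_g gC gi]] := zC (pts i); first by apply: H; rewrite mem_head.
pose P j : {poly k} := (f (pts j))%:P + (g (pts j)) *: 'X.
have P0 j : j \in i :: s -> P j != 0.
  rewrite inE => /predU1P[->|js].
    apply: contra_neq gi => /(congr1 (fun p : {poly k} => p`_1)).
    by rewrite coefD coefC coefZ coefX mulr1 add0r coef0.
  apply: contra_neq (fs _ js) => /(congr1 (fun p : {poly k} => p`_0)).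
  by rewrite coefD coefC coefZ coefX mulr0 addr0 coef0.
have [c cP] : exists c, forall p, p \in [seq P j | j <- i :: s] -> p.[c] != 0.
  by apply: poly_avoid => p /mapP[j /P0 + ->].
exists (fun t => f t + g t * c); split.
- by apply: pf_add => //; apply: pf_mul => //; exact: pf_const.
- by move=> t Ct; rewrite fC // gC // mul0r addr0.
- move=> j js; have := cP _ (map_f P js).
  by rewrite hornerD hornerC hornerZ hornerX.
Qed.

Lemma common_root_gcd (p q : {poly k}) : p != 0 ->
  (size (gcdp p q) > 1)%N <-> exists x, root p x /\ root q x.
Proof.
move=> p0; have g0 : gcdp p q != 0 by rewrite gcdp_eq0 negb_and p0.
split=> [s1|[x [px qx]]].
  have [x] : exists x, root (gcdp p q) x by apply/closed_rootP; rewrite gtn_eqF.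
  by rewrite root_gcd => /andP[px qx]; exists x.
have : 'X - x%:P %| gcdp p q by rewrite dvdp_gcd !dvdp_XsubCl px qx.
by move/(dvdp_leq g0); rewrite size_XsubC.
Qed.

(** Adding a high multiple of q to p prescribes the leading coefficient without changing the values
    at the roots of q; this makes the resultant with q compatible with specialization. *)
Lemma lead_coef_shift (A : idomainType) (p q : {poly A}) : q != 0 ->
  lead_coef (p + 'X^(size p) * q) = lead_coef q.
Proof.
move=> q0; rewrite lead_coefDr ?lead_coefM ?lead_coefXn ?mul1r //.
rewrite -[_ * q]mulrC size_mulXn //.
by move: q0; rewrite -size_poly_gt0; lia.
Qed.

Lemma resultant_rmorph (A B : comNzRingType) (f : {rmorphism A -> B}) (p q : {poly A}) :
  f (lead_coef p) != 0 -> f (lead_coef q) != 0 ->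
  f (resultant p q) = resultant (map_poly f p) (map_poly f q).
Proof.
move=> fp fq; rewrite /resultant -det_map_mx /Sylvester_mx !size_map_poly_id0 //.
by rewrite map_col_mx; congr (\det (col_mx _ _)); apply: map_lin1_mx => v;
  rewrite map_poly_rV rmorphM /= map_rVpoly.
Qed.

Section HomogeneousPart.
Context (P : Type) {hP : aff k P} (n : nat).
Variable C : P -> 'rV[k]_n -> Prop.
Hypothesis conic : forall p y s, s != 0 -> C p y -> C p (s *: y).

(** For (p, y) in the conic set C the polynomial s |-> f (p, s y) is zero, so each of its
    coefficients vanishes on C; one that is nonzero at (p0, y0) is kept. *)
Lemma homogeneous_part (f : P * 'rV[k]_n -> k) p0 y0 : pf f ->
  (forall p y, C p y -> f (p, y) = 0) -> f (p0, y0) != 0 ->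
  exists (D : nat) (g : P * 'rV[k]_n -> k), [/\ pf g, (forall p y, C p y -> g (p, y) = 0),
    (forall p y s, g (p, s *: y) = s ^+ D * g (p, y)) & g (p0, y0) != 0].
Proof.
move=> pf_f fC f0.
have : pf (fun q : (P * 'rV[k]_n) * k => f (q.1.1, q.2 *: q.1.2)).
  by apply: (pf_comp pf_f); pfs.
move=> /pf_poly[Q QE].
have QE' p y s : f (p, s *: y) = (evp (cof (p, y)) Q).[s] by rewrite -(QE (p, y)).
have cE q i : (evp (cof q) Q)`_i = (Q`_i).@[cof q] by rewrite coef_map.
have [D Dn] : exists D, (evp (cof (p0, y0)) Q)`_D != 0.
  apply: contrapT => /forallNP H; move/eqP: f0; apply; rewrite -[y0]scale1r QE'.
  rewrite (_ : evp _ Q = 0) ?horner0 //; apply/polyP => i; rewrite coef0.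
  by apply: contrapT => /eqP; exact: H.
exists D, (fun q => (Q`_D).@[cof q]); split.
- by exists Q`_D.
- move=> p y Cpy; rewrite -cE (_ : evp _ Q = 0) ?coef0 //.
  by apply: poly_eq_nz => s s0; rewrite -QE' horner0 fC //; exact: conic.
- move=> p y s; rewrite -!cE.
  have -> : evp (cof (p, s *: y)) Q = evp (cof (p, y)) Q \Po (s *: 'X).
    apply: poly_eq_nz => r _; rewrite horner_comp hornerZ hornerX -!QE' scalerA.
    by rewrite mulrC.
  rewrite -{1}[evp (cof (p, y)) Q]coefK poly_def rmorph_sum coef_sum.
  under eq_bigr => i _ do rewrite /= linearZ /= rmorphXn /= comp_polyX exprZn scalerA coefZ coefXn.
  have [Ds|Ds] := ltnP D (size (evp (cof (p, y)) Q)); last first.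
    rewrite nth_default // mulr0 big1 // => i _.
    by rewrite gtn_eqF ?mulr0 // (leq_trans _ Ds).
  rewrite (bigD1 (Ordinal Ds)) //= eqxx mulr1 big1 ?addr0 1?mulrC // => i iD.
  rewrite (_ : (D == i) = false) ?mulr0 //; apply: contraNF iD => /eqP Di.
  by apply/eqP/val_inj.
- by rewrite -cE.
Qed.

End HomogeneousPart.

(* Dehomogenizing at the first coordinate: the coefficients of
   g (t, y) in t, with leading coefficient g (1, 0). *)
Lemma homogeneous_coefs n (g : 'rV[k]_(1 + n) -> k) D (y : 'rV[k]_n) (p q : {poly k}) :
  (forall v s, g (s *: v) = s ^+ D * g v) ->
  (forall t, p.[t] = g (row_mx t%:M y)) -> (forall s, q.[s] = g (row_mx 1%:M (s *: y))) ->
  p`_D = g (row_mx 1%:M 0) /\ forall j, (D < j)%N -> p`_j = 0.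
Proof.
move=> hom pE qE; set m := size q.
have E : 'X^m * p = \sum_(i < m) q`_i *: 'X^(D + (m - i)).
  apply: poly_eq_nz => s s0; rewrite hornerM hornerXn pE.
  have -> : row_mx s%:M y = s *: row_mx 1%:M (s^-1 *: y) :> 'rV[k]_(1 + n).
    by rewrite scale_row_mx scalerA divff // scale1r scalemx1.
  rewrite hom -qE horner_coef -/m horner_sum mulrCA mulr_sumr mulr_sumr.
  apply: eq_bigr => i _; rewrite hornerZ hornerXn exprD expfB // exprVn.
  by field; rewrite expf_neq0.
have coefE j : p`_j = if (j <= D)%N then q`_(D - j) else 0.
  have -> : p`_j = ('X^m * p)`_(m + j) by rewrite coefXnM ltnNge leq_addr /= addKn.
  rewrite E coef_sum.
  under eq_bigr => i _ do rewrite coefZ coefXn.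
  case: (leqP j D) => jD; last first.
    by rewrite big1 // => i _; rewrite gtn_eqF ?mulr0 //; lia.
  have [Ds|Ds] := ltnP (D - j) m; last first.
    rewrite nth_default // big1 // => i _.
    by rewrite (_ : (_ == _) = false) ?mulr0 //; have := ltn_ord i; lia.
  rewrite (bigD1 (Ordinal Ds)) //= big1 ?addr0.
    by rewrite (_ : (_ == _) = true) ?mulr1 //; lia.
  move=> i iD; rewrite (_ : (_ == _) = false) ?mulr0 //.
  apply: contraNF iD => /eqP Di; apply/eqP/val_inj => /=.
  by have := ltn_ord i; move: Di; lia.
split=> [|j Dj]; last by rewrite coefE leqNgt Dj.
by rewrite coefE leqnn subnn -horner_coef0 qE scale0r.
Qed.

(** Projection from the point e = (1 : 0 : ... : 0). A form g vanishing on C but not at (p0, e) is a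
    polynomial of degree D in the first coordinate t, with leading coefficient a p = g (p, e). Away
    from a = 0 only finitely many t are possible, and resultants show that the image is closed;
    joining the locus a = 0 keeps it closed and leaves p0 outside. *)
Lemma elimination_step P {hP : aff k P} n :
  (forall C : P -> 'rV[k]_n -> Prop, zcl (fun q : P * 'rV[k]_n => C q.1 q.2) ->
     (forall p y s, s != 0 -> C p y -> C p (s *: y)) ->
     zcl (fun p => exists y, y != 0 /\ C p y)) ->
  forall C : P -> 'rV[k]_(1 + n) -> Prop,
    zcl (fun q : P * 'rV[k]_(1 + n) => C q.1 q.2) ->
    (forall p y s, s != 0 -> C p y -> C p (s *: y)) ->
    zcl (fun p => exists y, y != 0 /\ C p y).
Proof.
move=> IHn C zC conic p0 np0.
pose e : 'rV[k]_(1 + n) := row_mx 1%:M 0.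
have e0 : e != 0.
  apply/eqP => /rowP/(_ (lshift n 0)); rewrite row_mxEl !mxE eqxx => /eqP.
  by rewrite oner_eq0.
have [|f [pf_f fC f0]] := zC (p0, e); first by move=> Ce; apply: np0; exists e.
have [|D [g [pf_g gC hom g0]]] := homogeneous_part conic pf_f _ f0.
  by move=> p y; exact: (fC (p, y)).
pose a p := g (p, e).
have pf_a : pf a by apply: (pf_comp pf_g); pfs.
pose Z (q : P * 'rV[k]_n) := a q.1 = 0 \/ exists t : k, C q.1 (row_mx t%:M q.2).
have [|Pm PE] := @pf_poly k (P * 'rV[k]_n)%type _
    (fun q => g (q.1.1, row_mx q.2%:M q.1.2 : 'rV[k]_(1 + n))).
  by apply: (pf_comp pf_g); pfs.
have [|Qm QE] := @pf_poly k (P * 'rV[k]_n)%type _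
    (fun q => g (q.1.1, row_mx 1%:M (q.2 *: q.1.2) : 'rV[k]_(1 + n))).
  by apply: (pf_comp pf_g); pfs.
have coefP q : (evp (cof q) Pm)`_D = a q.1 /\ forall j, (D < j)%N -> (evp (cof q) Pm)`_j = 0.
  apply: (@homogeneous_coefs n (fun v => g (q.1, v)) D q.2 _ (evp (cof q) Qm)) => //=.
    by move=> t; rewrite -PE.
  by move=> t; rewrite -QE.
have coefPm j : (D < j)%N -> Pm`_j = 0.
  by move=> Dj; apply: ev_inj => q; rewrite meval0 -coef_map; apply: (coefP q).2.
have PmD : Pm`_D != 0.
  apply: contra_neq g0 => PmD; have [/=] := coefP (p0, 0).
  by rewrite /evp coef_map /= PmD meval0.
have sPm : size Pm = D.+1.
  apply/eqP; rewrite eqn_leq; apply/andP; split; last first.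
    by rewrite ltnNge; apply: contra PmD => /leq_sizeP/(_ D (leqnn D))->.
  by apply/leq_sizeP => j; exact: coefPm.
have lPm q : (lead_coef Pm).@[cof q] = a q.1.
  by rewrite lead_coefE sPm /= -coef_map; exact: (coefP q).1.
have Pm0 : Pm != 0 by rewrite -size_poly_gt0 sPm.
have zZ : zcl Z.
  move=> [p y] /not_orP[/= /eqP ap /forallNP nt].
  have P0 : evp (cof (p, y)) Pm != 0.
    by apply: contra_neq ap => P0; have [/= <-] := coefP (p, y); rewrite P0 coef0.
  have [rs rsE] := closed_field_poly_normal (evp (cof (p, y)) Pm).
  have [|F [pf_F FC Frs]] := @zcl_avoid _ _ _ k (fun t => (p, row_mx t%:M y : 'rV[k]_(1 + n))) rs zC.
    by move=> t _; exact: nt.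
  have [|Fm FE] := @pf_poly k (P * 'rV[k]_n)%type _
      (fun q => F (q.1.1, row_mx q.2%:M q.1.2 : 'rV[k]_(1 + n))).
    by apply: (pf_comp pf_F); pfs.
  (* At the roots of Pm the polynomial G takes the values of Fm, while its leading coefficient is
     that of Pm, which survives wherever a is nonzero. *)
  pose G := Fm + 'X^(size Fm) * Pm.
  have lG : lead_coef G = lead_coef Pm by exact: lead_coef_shift.
  have GE q t : root (evp (cof q) Pm) t ->
      root (evp (cof q) G) t = (F (q.1, row_mx t%:M q.2) == 0).
    move=> /rootP Pt; rewrite /G evpD evpM /root hornerD hornerM Pt mulr0 addr0.
    by case: (q) => p' y' /=; rewrite -FE.
  have resE q : a q.1 != 0 -> (resultant Pm G).@[cof q] = resultant (evp (cof q) Pm) (evp (cof q) G).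
    by move=> aq; apply: (resultant_rmorph (f := meval (cof q))); rewrite /= ?lG lPm.
  exists (fun q => a q.1 * (resultant Pm G).@[cof q]); split.
  - apply: pf_mul; first by apply: (pf_comp pf_a); pfs.
    by exists (resultant Pm G).
  - move=> q [->|[t Ct]]; first by rewrite mul0r.
    have [->|aq] := eqVneq (a q.1) 0; first by rewrite mul0r.
    have P0' : evp (cof q) Pm != 0.
      by apply: contra_neq aq => P0'; have [/= <-] := coefP q; rewrite P0' coef0.
    rewrite resE //; apply/eqP; rewrite mulf_eq0 resultant_eq0; apply/orP; right.
    apply/(common_root_gcd _ P0'); exists t.
    have Pt : root (evp (cof q) Pm) t.
      by case: (q) Ct => p' y' Ct; rewrite /root -PE /= gC.
    by split=> //; rewrite GE // FC.
  - rewrite mulf_neq0 // resE // resultant_eq0; apply/negP.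
    move=> /(common_root_gcd _ P0)[t [Pt Gt]].
    move: Gt; rewrite GE //=; apply/negP; apply: Frs.
    move: Pt; rewrite rsE rootZ ?root_prod_XsubC //.
    by rewrite lead_coef_eq0.
have conicZ p y s : s != 0 -> Z (p, y) -> Z (p, s *: y).
  move=> s0 [/= ap|[/= t Ct]]; first by left.
  right; exists (s * t); rewrite /= -scale_scalar_mx -scale_row_mx; exact: conic.
have nZ : ~ exists y, y != 0 /\ Z (p0, y).
  move=> [y [y0 [/= ap0|[t /= Ct]]]]; first by move: g0; rewrite -/(a p0) ap0 eqxx.
  apply: np0; exists (row_mx t%:M y); split=> //; apply: contra_neq y0 => ty0.
  by rewrite -(row_mxKr t%:M y) ty0 linear0.
have [E [pf_E EZ E0]] := IHn (fun p y => Z (p, y)) zZ conicZ p0 nZ.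
exists (fun p => E p * a p); split; first exact: pf_mul.
  move=> p [y [y0 Cy]]; have [->|ap] := eqVneq (a p) 0; first by rewrite mulr0.
  rewrite EZ ?mul0r //; have yE : y = row_mx (y 0 (lshift n 0))%:M (rsubmx y).
    by rewrite -[LHS]hsubmxK [lsubmx y]mx11_scalar mxE.
  exists (rsubmx y); split; last by right; exists (y 0 (lshift n 0)); rewrite -yE.
  apply: contra_neq ap => ry0; have t0 : y 0 (lshift n 0) != 0.
    by apply: contra_neq y0 => t0; rewrite yE t0 ry0 raddf0 row_mx0.
  have yE2 : y = y 0 (lshift n 0) *: e by rewrite {1}yE ry0 /e scale_row_mx scaler0 scalemx1.
  have gE : g (p, y) = y 0 (lshift n 0) ^+ D * g (p, e) by rewrite -hom -yE2.
  apply/eqP; rewrite /a -(mulrI_eq0 _ (mulfI (expf_neq0 D t0))) -gE gC //.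
exact: mulf_neq0.
Qed.

Theorem elimination P {hP : aff k P} n (C : P -> 'rV[k]_n -> Prop) :
  zcl (fun q : P * 'rV[k]_n => C q.1 q.2) ->
  (forall p y s, s != 0 -> C p y -> C p (s *: y)) ->
  zcl (fun p => exists y, y != 0 /\ C p y).
Proof.
elim: n C => [|n IHn] C; last exact: elimination_step.
move=> zC conic p0 np0; exists (fun=> 1).
by split; [exact: pf_const|move=> p [y [/eqP[]]]; rewrite thinmx0|exact: oner_neq0].
Qed.

End Elimination.

(** * Dimension counts for generic linear conditions *)

Section Counting.
Variable k : closedFieldType.

Definition pfnz T {hT : aff k T} (f : T -> k) := pf f /\ exists t, f t != 0.

Lemma pfnz_mul T {hT : aff k T} (f g : T -> k) : pfnz f -> pfnz g -> pfnz (fun t => f t * g t).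
Proof.
move=> [hf nf] [hg ng]; split; first exact: pf_mul.
have [t [ft gt]] := pf_common_nz hf hg nf ng.
by exists t; rewrite mulf_neq0.
Qed.

Lemma pfnz_prod T {hT : aff k T} I (r : seq I) (P : pred I) (F : I -> T -> k) (t0 : T) :
  (forall i, P i -> pfnz (F i)) -> pfnz (fun t => \prod_(i <- r | P i) F i t).
Proof.
move=> H; elim: r => [|i r IHr].
  by split; [apply: pf_ext (pf_const 1) => t; rewrite big_nil|exists t0; rewrite big_nil oner_neq0].
have [Pi|nPi] := boolP (P i); last first.
  case: IHr => hp [t nt]; split; last by exists t; rewrite big_cons (negPf nPi).
  by apply: pf_ext hp => s; rewrite big_cons (negPf nPi).
have [hp [t nt]] := pfnz_mul (H i Pi) IHr.
split; last by exists t; rewrite big_cons Pi.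
by apply: pf_ext hp => s; rewrite big_cons Pi.
Qed.

Section DegreeBound.
Variable s : nat.
Implicit Types p q : {mpoly k[s]}.

Lemma msize_mulS p q a b : (msize p <= a.+1)%N -> (msize q <= b.+1)%N ->
  (msize (p * q) <= (a + b).+1)%N.
Proof.
move=> pa qb; have [->|p0] := eqVneq p 0; first by rewrite mul0r msize0.
have [->|q0] := eqVneq q 0; first by rewrite mulr0 msize0.
rewrite msizeM //; case: (msize p) pa => [|x]; case: (msize q) qb => [|y] //=; lia.
Qed.

Lemma msize_expS p a n : (msize p <= a.+1)%N -> (msize (p ^+ n) <= (n * a).+1)%N.
Proof.
move=> pa; elim: n => [|n IHn]; first by rewrite expr0 msize1.
by rewrite exprS mulSn; exact: msize_mulS.
Qed.

Lemma msize_prodS n (F : 'I_n -> {mpoly k[s]}) a : (forall i, (msize (F i) <= a.+1)%N) ->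
  (msize (\prod_i F i) <= (n * a).+1)%N.
Proof.
elim: n F => [|n IHn] F H; first by rewrite big_ord0 msize1.
by rewrite big_ord_recl mulSn; apply: msize_mulS; [|apply: IHn].
Qed.
End DegreeBound.

(* Counting monomials: for large M the M ^ t products of powers of the phi i
   outnumber the monomials in s variables that they involve. *)
Lemma alg_dependent s t (phi : 'I_t -> {mpoly k[s]}) : (s < t)%N ->
  exists2 c : {mpoly k[t]}, c != 0 & forall z, c.@[fun i => (phi i).@[z]] = 0.
Proof.
move=> st; pose D := \max_i msize (phi i).
have phiD i : (msize (phi i) <= D.+1)%N by apply: leqW; apply: (leq_bigmax i).
pose M := ((t * D).+1 ^ s).+1; pose L := (t * (M * D)).+1.
pose dom := {ffun 'I_t -> 'I_M}; pose box := {ffun 'I_s -> 'I_L}.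
have card_lt : (#|{: box}| < #|{: dom}|)%N.
  rewrite !card_ffun !card_ord.
  have LM : (L <= M * (t * D).+1)%N by rewrite /L mulnS (mulnCA t) -add1n leq_add2r.
  have exp2r a b e : (a <= b)%N -> (a ^ e <= b ^ e)%N.
    by move=> ab; case: e => // e; rewrite leq_exp2r.
  apply: (@leq_ltn_trans ((M * (t * D).+1) ^ s)); first exact: exp2r.
  rewrite expnMn; apply: (@leq_trans (M ^ s.+1)); last by rewrite leq_exp2l // ltnS expn_gt0.
  by rewrite expnSr ltn_pmul2l ?expn_gt0.
pose W : 'M[k]_(#|{: dom}|, #|{: box}|) := \matrix_(a, b)
  (\prod_i phi i ^+ (enum_val a : dom) i)@_[multinom (enum_val b : box) i : nat | i < s].
have : kermx W != 0.
  rewrite kermx_eq0 /row_free; apply/negP => /eqP rW.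
  by have := rank_leq_col W; rewrite rW leqNgt card_lt.
rewrite -nz_row_eq0; set v := nz_row _ => v0.
have vW : v *m W = 0 by apply/sub_kermxP; exact: nz_row_sub.
pose mon (a : dom) : 'X_{1..t} := [multinom a i : nat | i < t].
have mon_inj : injective mon.
  move=> a b /mnmP ab; apply/ffunP => i; apply: val_inj.
  by have := ab i; rewrite !mnmE.
pose c : {mpoly k[t]} := \sum_a v 0 a *: 'X_[mon (enum_val a)].
have cE a : c@_(mon (enum_val a)) = v 0 a.
  rewrite raddf_sum (bigD1 a) //= mcoeffZ mcoeffX eqxx mulr1 big1 ?addr0 // => b ba.
  rewrite mcoeffZ mcoeffX (inj_eq mon_inj) (inj_eq enum_val_inj).
  by rewrite (negPf ba) mulr0.
exists c.
  have [a va] : exists a, v 0 a != 0.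
    apply: contrapT => /forallNP H; move/eqP: v0; apply; apply/rowP => a; rewrite [RHS]mxE.
    by apply: contrapT => /eqP; exact: H.
  by apply: contra_neq va => c0; rewrite -cE c0 mcoeff0.
pose Q := \sum_a v 0 a *: \prod_i phi i ^+ (enum_val a : dom) i.
have Q0 : Q = 0.
  apply/mpolyP => m; rewrite mcoeff0.
  have [mL|Lm] := ltnP (mdeg m) L.
    have mi i : (m i < L)%N.
      by apply: leq_ltn_trans mL; rewrite mdegE (bigD1 i) //= leq_addr.
    pose b : box := [ffun i => Ordinal (mi i)].
    have mE : m = [multinom (enum_val (enum_rank b) : box) i : nat | i < s].
      by apply/mnmP => i; rewrite mnmE enum_rankK ffunE.
    have := congr1 (fun A : 'rV[k]__ => A 0 (enum_rank b)) vW; rewrite /= [RHS]mxE => <-.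
    rewrite mxE raddf_sum; apply: eq_bigr => a _.
    by rewrite /= mcoeffZ mE mxE.
  rewrite raddf_sum big1 // => a _; rewrite /= mcoeffZ memN_msupp_eq0 ?mulr0 //.
  apply: contraTN Lm => /msize_mdeg_lt mlt; rewrite -ltnNge.
  apply: leq_trans mlt _; apply: msize_prodS => i.
  apply: leq_trans (msize_expS _ (phiD i)) _.
  by rewrite ltnS leq_mul2r ltnW ?orbT.
move=> z; have <- : Q.@[z] = c.@[fun i => (phi i).@[z]].
  rewrite !raddf_sum; apply: eq_bigr => a _; rewrite /= !mevalZ; congr (_ * _).
  rewrite mevalX rmorph_prod; apply: eq_bigr => i _.
  by rewrite /= rmorphXn mnmE.
by rewrite Q0 meval0.
Qed.

Lemma alg_dependent_aff T T' {hT : aff k T} {hT' : aff k T'} (phi : T -> T') :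
  pmap phi -> (@adim k T hT < @adim k T' hT')%N ->
  exists c : T' -> k, pfnz c /\ forall t, c (phi t) = 0.
Proof.
move=> /choice[p pE] lt; have [c c0 cz] := alg_dependent p lt.
exists (fun t => c.@[cof t]); split.
  by split; [exists c|exact: ev_nz].
by move=> t; rewrite -(cz (cof t)); apply: meval_eq => i; rewrite pE.
Qed.

(** Where the minor sg of Y(z) is invertible, the u with u Y(z) = 0 are the w K(z), with r (N - p)
    entries in w. Together with z these are s + r (N - p) < r N parameters, so all such u satisfy
    one nontrivial equation. *)
Lemma avoid_chart s r N p (Y : 'rV[k]_s -> 'M[k]_(N, p)) (sg : 'I_p -> 'I_N) :
  pmap Y -> (s < r * p)%N -> injective sg ->
  exists c : 'M[k]_(r, N) -> k, pfnz c /\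
    forall z u, rowsub sg (Y z) \in unitmx -> u *m Y z = 0 -> c u = 0.
Proof.
move=> hY sr sgI; pose S := [set j | j \notin codom sg].
have cS : (N - p)%N = #|S|.
  rewrite cardsCs card_ord; congr (_ - _)%N.
  have -> : ~: S = [set j in codom sg] by apply/setP => j; rewrite !inE negbK.
  by rewrite cardsE card_codom // card_ord.
pose g (i : 'I_(N - p)) : 'I_N := enum_val (cast_ord cS i).
have gI : injective g by move=> i j /enum_val_inj /cast_ord_inj.
have gS i : g i \notin codom sg by have := enum_valP (cast_ord cS i); rewrite inE.
have gV j : j \notin codom sg -> exists i, j = g i.
  move=> jS; have jS' : j \in S by rewrite inE.
  exists (cast_ord (esym cS) (enum_rank_in jS' j)).
  by rewrite /g cast_ordKV enum_rankK_in.
pose G : 'M[k]_(N - p, N) := rowsub g 1%:M; pose H : 'M[k]_(p, N) := rowsub sg 1%:M.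
have HE i j : H i j = (sg i == j)%:R by rewrite !mxE.
have GE i j : G i j = (g i == j)%:R by rewrite !mxE.
have HYE q' (A : 'M[k]_(N, q')) : H *m A = rowsub sg A by rewrite [RHS]rowsubE.
(* The rows of K z span the left kernel of Y z where the minor is invertible; the factor det (H Y z)
   clears the denominator and keeps K polynomial. *)
pose K z := \det (H *m Y z) *: G - (G *m Y z) *m \adj (H *m Y z) *m H.
have [||c [cnz cK]] := @alg_dependent_aff ('rV[k]_s * 'M[k]_(r, N - p))%type 'M[k]_(r, N) _ _
    (fun t => t.2 *m K t.1).
- have hY1 : pmap (fun t : 'rV[k]_s * 'M[k]_(r, N - p) => Y t.1) by apply: (pmap_comp hY); pfs.
  by rewrite /K; pfs.
- have pN : (p <= N)%N by have := leq_card _ sgI; rewrite !card_ord.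
  by rewrite /= mul1n mulnBr; have := leq_mul (leqnn r) pN; lia.
exists c; split=> // z u Yu uY; rewrite -HYE in Yu.
have d0 : \det (H *m Y z) != 0 by rewrite -unitfE.
pose w := (\det (H *m Y z))^-1 *: colsub g u.
suff -> : u = w *m K z by exact: (cK (z, w)).
have KY : K z *m Y z = 0.
  by rewrite mulmxBl -scalemxAl -!mulmxA mul_adj_mx mul_mx_scalar -scalemxAr subrr.
pose u' := u - w *m K z.
have u'Y : u' *m Y z = 0 by rewrite mulmxBl uY -mulmxA KY mulmx0 subrr.
have wK i l : (w *m K z) l (g i) = u l (g i).
  have -> : w *m K z = \det (H *m Y z) *: (w *m G) - w *m (G *m Y z) *m \adj (H *m Y z) *m H.
    by rewrite mulmxBr -scalemxAr !mulmxA.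
  rewrite mxE [X in _ + X]mxE [X in _ - X]mxE [X in _ - X]big1 ?subr0; last first.
    move=> j _; rewrite HE (_ : (_ == _) = false) ?mulr0 //.
    by apply: contraNF (gS i) => /eqP <-; exact: codom_f.
  rewrite mxE mxE (bigD1 i) //= big1 ?addr0; last first.
    by move=> j ji; rewrite GE (inj_eq gI) (negPf ji) mulr0.
  by rewrite GE eqxx mulr1 mxE mxE mulrA mulfV // mul1r.
have u'E : u' = colsub sg u' *m H.
  apply/matrixP => l j; rewrite [RHS]mxE.
  have [/codomP[i ->]|/gV[i ->]] := boolP (j \in codom sg).
    rewrite (bigD1 i) //= big1 ?addr0; last first.
      by move=> a ai; rewrite HE (inj_eq sgI) (negPf ai) mulr0.
    by rewrite HE eqxx mulr1 [RHS]mxE.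
  rewrite [LHS]mxE [X in _ + X]mxE wK subrr big1 // => a _.
  rewrite HE (_ : (_ == _) = false) ?mulr0 //.
  by apply: contraNF (gS i) => /eqP <-; exact: codom_f.
have : colsub sg u' *m (H *m Y z) = 0 by rewrite mulmxA -u'E.
move/(congr1 (fun A => A *m invmx (H *m Y z))); rewrite mulmxK // mul0mx => u'0.
by apply/eqP; rewrite -subr_eq0 -/u' u'E u'0 mul0mx.
Qed.

Lemma generic_avoid s r N p (Y : 'rV[k]_s -> 'M[k]_(N, p)) :
  pmap Y -> (s < r * p)%N ->
  exists c : 'M[k]_(r, N) -> k, pfnz c /\
    forall z u, \rank (Y z) = p -> u *m Y z = 0 -> c u = 0.
Proof.
move=> hY sr.
have /choice[c cP] : forall sg : {ffun 'I_p -> 'I_N}, exists c : 'M[k]_(r, N) -> k,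
    injective sg -> pfnz c /\
    forall z u, rowsub sg (Y z) \in unitmx -> u *m Y z = 0 -> c u = 0.
  move=> sg; have [sI|nI] := pselect (injective sg); last by exists (fun=> 0).
  by have [c cP] := avoid_chart hY sr sI; exists c.
exists (fun u => \prod_(sg : {ffun 'I_p -> 'I_N} | injectiveb sg) c sg u); split.
  by apply: (pfnz_prod _ 0) => sg /injectiveP /cP[].
move=> z u rY uY; have fY : row_full (Y z) by rewrite /row_full rY.
have sgI : injective (fullrankfun fY) by exact: fullrankfun_inj.
rewrite (bigD1 (fullrankfun fY)) /=; last exact/injectiveP.
by rewrite ((cP _ sgI).2 z) ?mul0r // fullrowsub_unit.
Qed.

(** [chart e] is the e-th affine chart of projective space, [chart0 e] the space of its tangent
    directions. *)
Definition chart n (e : 'I_n.+1) (z : 'rV[k]_n) : 'rV[k]_n.+1 :=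
  \row_j if unlift e j is Some i then z 0 i else 1.

Definition chart0 n (e : 'I_n.+1) (z : 'rV[k]_n) : 'rV[k]_n.+1 :=
  \row_j if unlift e j is Some i then z 0 i else 0.

Lemma pmap_chart T {hT : aff k T} n e (f : T -> 'rV[k]_n) : pmap f -> pmap (fun t => chart e (f t)).
Proof.
move=> hf; rewrite /chart; apply: pmap_mx => i j.
case E : (unlift e j) => [a|]; last first.
  by apply: pf_ext (pf_const 1) => t; rewrite mxE E.
by apply: pf_ext (pf_entry 0 a hf) => t; rewrite mxE E.
Qed.

Lemma pmap_chart0 T {hT : aff k T} n e (f : T -> 'rV[k]_n) : pmap f -> pmap (fun t => chart0 e (f t)).
Proof.
move=> hf; rewrite /chart0; apply: pmap_mx => i j.
case E : (unlift e j) => [a|]; last first.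
  by apply: pf_ext (pf_const 0) => t; rewrite mxE E.
by apply: pf_ext (pf_entry 0 a hf) => t; rewrite mxE E.
Qed.

Lemma chartP n (y : 'rV[k]_n.+1) e : y 0 e != 0 ->
  exists z, y = y 0 e *: chart e z.
Proof.
move=> ye; exists (\row_i ((y 0 e)^-1 * y 0 (lift e i))); apply/rowP => j.
rewrite !mxE; case: unliftP => [i ->|->]; last by rewrite mulr1.
by rewrite mxE mulrA mulfV // mul1r.
Qed.

Lemma chart0P n (y : 'rV[k]_n.+1) e : y 0 e = 0 ->
  exists z, y = chart0 e z.
Proof.
move=> ye; exists (\row_i (y 0 (lift e i))); apply/rowP => j.
by rewrite !mxE; case: unliftP => [i ->|->] //; rewrite mxE.
Qed.

Lemma row_nz n (y : 'rV[k]_n) : y != 0 -> exists e, y 0 e != 0.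
Proof.
move=> y0; apply: contrapT => /forallNP H; move/eqP: y0; apply.
by apply/rowP => j; rewrite mxE; apply: contrapT => /eqP; exact: H.
Qed.

End Counting.

Lemma I2P (i : 'I_2) : i = 0 \/ i = 1.
Proof. by case: i => -[|[|//]] lt; [left|right]; apply: val_inj. Qed.

Lemma sum_I2 (R : nmodType) (F : 'I_2 -> R) : \sum_i F i = F 0 + F 1.
Proof. by rewrite big_ord_recl big_ord1; congr (_ + F _); apply: val_inj. Qed.

(** * Conjugates of a map and their limits *)

Section Forms.
Variables (K : comNzRingType) (d : nat).

Definition mon (x : 'cV[K]_2) : 'cV[K]_d.+1 := \col_j (x 0 0 ^+ j * x 1 0 ^+ (d - j)).

Definition lin (h : 'M[K]_2) (l : 'I_2) : {poly K} := h l 0 *: 'X + (h l 1)%:P.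

(* The action of h on the vector of monomials of degree d. *)
Definition Rm (h : 'M[K]_2) : 'M[K]_d.+1 :=
  \matrix_(i, j) (lin h 0 ^+ i * lin h 1 ^+ (d - i))`_j.

(* Up to the factor \det h, the conjugate h^-1 o A o h. *)
Definition Gam (A : 'M[K]_(2, d.+1)) (h : 'M[K]_2) : 'M[K]_(2, d.+1) := \adj h *m A *m Rm h.

Definition ev (A : 'M[K]_(2, d.+1)) (x : 'cV[K]_2) : 'cV[K]_2 := A *m mon x.

(** The homogenization of p in degree m, evaluated at x: [Rm] is defined by coefficients of
    one-variable polynomials, and this leads back to binary forms. *)
Definition heval m (p : {poly K}) (x : 'cV[K]_2) : K :=
  \sum_(j < m.+1) p`_j * (x 0 0 ^+ j * x 1 0 ^+ (m - j)).

Lemma heval_lin m (h : 'M[K]_2) l (p : {poly K}) (x : 'cV[K]_2) : (size p <= m.+1)%N ->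
  heval m.+1 (lin h l * p) x = (h *m x) l 0 * heval m p x.
Proof.
move=> sp; have cE j : (lin h l * p)`_j =
    (if j is j'.+1 then h l 0 * p`_j' else 0) + h l 1 * p`_j.
  rewrite /lin mulrDl coefD mul_polyC coefZ -scalerAl coefZ coefXM.
  by case: j => //=; rewrite mulr0.
have hE : (h *m x) l 0 = h l 0 * x 0 0 + h l 1 * x 1 0 by rewrite mxE sum_I2.
rewrite /heval hE; under eq_bigr => j _ do rewrite cE mulrDl.
rewrite big_split /= mulrDl; congr (_ + _).
  rewrite big_ord_recl /= mul0r add0r mulr_sumr; apply: eq_bigr => j _.
  by rewrite /= /bump /= add1n subSS exprS; ring.
rewrite big_ord_recr /= nth_default // mulr0 mul0r addr0 mulr_sumr.
apply: eq_bigr => j _; rewrite subSn; last by rewrite -ltnS ltn_ord.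
by rewrite exprS; ring.
Qed.

Lemma size_lin h l : (size (lin h l) <= 2)%N.
Proof.
rewrite /lin (leq_trans (size_polyD _ _)) // geq_max size_polyC.
by rewrite (leq_trans (size_scale_leq _ _)) ?size_polyX //; case: eqP.
Qed.

Lemma size_lin_mul h l (p : {poly K}) m : (size p <= m.+1)%N -> (size (lin h l * p)%R <= m.+2)%N.
Proof.
move=> sp; apply: leq_trans (size_mul_leq _ _) _; have := size_lin h l.
by move: sp; case: (size p) => [|a]; case: (size (lin h l)) => [|b] //=; lia.
Qed.

Lemma size_lin_prod h i j : (size (lin h 0 ^+ i * lin h 1 ^+ j)%R <= (i + j).+1)%N.
Proof.
elim: i => [|i IHi]; last by rewrite exprS -mulrA addSn; exact: size_lin_mul.
rewrite expr0 mul1r add0n; elim: j => [|j IHj]; first by rewrite expr0 size_poly1.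
by rewrite exprS; exact: size_lin_mul.
Qed.

Lemma heval_lin_prod h i j x :
  heval (i + j) (lin h 0 ^+ i * lin h 1 ^+ j) x = (h *m x) 0 0 ^+ i * (h *m x) 1 0 ^+ j.
Proof.
elim: i => [|i IHi].
  rewrite !expr0 !mul1r add0n; elim: j => [|j IHj].
    by rewrite /heval big_ord1 expr0 coef1 !expr0 !mulr1.
  rewrite exprS heval_lin ?IHj -?exprS //.
  by have := size_lin_prod h 0 j; rewrite expr0 mul1r.
by rewrite exprS -mulrA addSn heval_lin ?IHi ?size_lin_prod // mulrA -exprS.
Qed.

Lemma Rm_mon h x : Rm h *m mon x = mon (h *m x).
Proof.
apply/colP => i; rewrite [RHS]mxE.
have := heval_lin_prod h i (d - i) x; rewrite subnKC; last by rewrite -ltnS ltn_ord.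
move=> <-.
by rewrite mxE; apply: eq_bigr => j _; rewrite !mxE.
Qed.

Lemma Gam_mon A h x : Gam A h *m mon x = \adj h *m ev A (h *m x).
Proof. by rewrite /Gam /ev -Rm_mon !mulmxA. Qed.

Lemma monZ c x : mon (c *: x) = c ^+ d *: mon x.
Proof.
apply/colP => j; rewrite !mxE !exprMn mulrACA -exprD subnKC //.
by rewrite -ltnS ltn_ord.
Qed.

Lemma evZ A c x : ev A (c *: x) = c ^+ d *: ev A x.
Proof. by rewrite /ev monZ scalemxAr. Qed.

Lemma adj2E (h : 'M[K]_2) : [/\ (\adj h) 0 0 = h 1 1, (\adj h) 0 1 = - h 0 1,
  (\adj h) 1 0 = - h 1 0 & (\adj h) 1 1 = h 0 0].
Proof.
have E (i j : 'I_2) a b : (forall x : 'I_1, lift j x = a) -> (forall x : 'I_1, lift i x = b) ->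
    (\adj h) i j = (-1) ^+ (j + i) * h a b.
  by move=> ja ib; rewrite mxE /cofactor det_mx11 !mxE ja ib.
have l0 (x : 'I_1) : lift (0 : 'I_2) x = 1 by rewrite [x]ord1; apply: val_inj.
have l1 (x : 'I_1) : lift (1 : 'I_2) x = 0 by rewrite [x]ord1; apply: val_inj.
split.
- by rewrite (E _ _ _ _ l0 l0) addn0 expr0 mul1r.
- by rewrite (E _ _ _ _ l1 l0) addn0 expr1 mulN1r.
- by rewrite (E _ _ _ _ l0 l1) add0n expr1 mulN1r.
- by rewrite (E _ _ _ _ l1 l1) addn1 sqrrN expr1n mul1r.
Qed.

Lemma mx2P m (a b : 'M[K]_(2, m)) : (forall j, a 0 j = b 0 j) -> (forall j, a 1 j = b 1 j) -> a = b.
Proof. by move=> H0 H1; apply/matrixP => i j; case: (I2P i) => ->. Qed.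

Lemma mul2E m n (a : 'M[K]_(m, 2)) (b : 'M[K]_(2, n)) i j :
  (a *m b) i j = a i 0 * b 0 j + a i 1 * b 1 j.
Proof. by rewrite mxE sum_I2. Qed.

Lemma det2E (h : 'M[K]_2) : \det h = h 0 0 * h 1 1 - h 0 1 * h 1 0.
Proof.
have := congr1 (fun A : 'M[K]_2 => A 0 0) (mul_mx_adj h).
by rewrite /= mul2E; have [-> _ -> _] := adj2E h; rewrite mxE eqxx mulr1n => <-; ring.
Qed.

Lemma adj_mul2 (h g : 'M[K]_2) : \adj (h *m g) = \adj g *m \adj h.
Proof.
have [a1 a2 a3 a4] := adj2E (h *m g); have [b1 b2 b3 b4] := adj2E h.
have [c1 c2 c3 c4] := adj2E g.
apply: mx2P => j; case: (I2P j) => ->; rewrite ?a1 ?a2 ?a3 ?a4 !mul2E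
  ?b1 ?b2 ?b3 ?b4 ?c1 ?c2 ?c3 ?c4; ring.
Qed.

Definition wedge (x y : 'cV[K]_2) : K := x 0 0 * y 1 0 - y 0 0 * x 1 0.

Lemma wedge_mul (h : 'M[K]_2) x y : wedge (h *m x) (h *m y) = \det h * wedge x y.
Proof. by rewrite /wedge !mul2E det2E; ring. Qed.

Lemma wedge_adj (h : 'M[K]_2) x y : wedge (\adj h *m x) y = wedge x (h *m y).
Proof.
by rewrite /wedge !mul2E; have [-> -> -> ->] := adj2E h; ring.
Qed.

Lemma adjD2 (h g : 'M[K]_2) : \adj (h + g) = \adj h + \adj g.
Proof.
have [a1 a2 a3 a4] := adj2E (h + g); have [b1 b2 b3 b4] := adj2E h.
have [c1 c2 c3 c4] := adj2E g.
have addE (a b : 'M[K]_2) i j : (a + b) i j = a i j + b i j by rewrite mxE.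
apply: mx2P => j; case: (I2P j) => ->; rewrite [RHS]addE ?a1 ?a2 ?a3 ?a4 addE
  ?b1 ?b2 ?b3 ?b4 ?c1 ?c2 ?c3 ?c4 ?opprD //; ring.
Qed.

Lemma adjZ2 c (h : 'M[K]_2) : \adj (c *: h) = c *: \adj h.
Proof.
have [a1 a2 a3 a4] := adj2E (c *: h); have [b1 b2 b3 b4] := adj2E h.
have scE (a : 'M[K]_2) i j : (c *: a) i j = c * a i j by rewrite mxE.
apply: mx2P => j; case: (I2P j) => ->; rewrite [RHS]scE ?a1 ?a2 ?a3 ?a4 scE
  ?b1 ?b2 ?b3 ?b4 ?mulrN //; ring.
Qed.

(* The difference quotient of the form A dehomogenized at the coordinate e. *)
Definition Gq (e : 'I_2) (A : 'M[K]_(2, d.+1)) (a b : 'cV[K]_2) : 'cV[K]_2 :=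
  \col_l (if e == 0 then
    - \sum_(i < d.+1) A l i * ((a 0 0 * b 0 0) ^+ i *
      \sum_(j < d - i) (a 1 0 * b 0 0) ^+ (d - i - j.+1) * (b 1 0 * a 0 0) ^+ j)
  else
    \sum_(i < d.+1) A l i * ((a 1 0 * b 1 0) ^+ (d - i) *
      \sum_(j < i) (a 0 0 * b 1 0) ^+ (i - j.+1) * (b 0 0 * a 1 0) ^+ j)).

(** The two terms on the left agree when a and b are proportional; the quotient by their determinant
    is the geometric sum in x ^ n - y ^ n, taken monomial by monomial. *)
Lemma Gq_eq e A (a b : 'cV[K]_2) :
  b e 0 ^+ d *: ev A a - a e 0 ^+ d *: ev A b = wedge a b *: Gq e A a b.
Proof.
have subXX (x y : K) n : x ^+ n - y ^+ n = (x - y) * \sum_(j < n) x ^+ (n - j.+1) * y ^+ j.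
  rewrite subrXX; congr (_ * _); apply: eq_bigr => j _.
  by congr (_ ^+ _ * _); have := ltn_ord j; lia.
apply/colP => l; rewrite [LHS]mxE [X in X + _]mxE [X in _ + X]mxE [X in _ - X]mxE !mxE.
rewrite !mulr_sumr -sumrB.
case: (I2P e) => ->; rewrite ?eqxx /= ?mulrN ?mulr_sumr -?sumrN; apply: eq_bigr => i _;
  rewrite !mxE; have id : (i <= d)%N by rewrite -ltnS ltn_ord.
- have -> : b 0 0 ^+ d = b 0 0 ^+ i * b 0 0 ^+ (d - i) by rewrite -exprD subnKC.
  have -> : a 0 0 ^+ d = a 0 0 ^+ i * a 0 0 ^+ (d - i) by rewrite -exprD subnKC.
  have := subXX (a 1 0 * b 0 0) (b 1 0 * a 0 0) (d - i)%N.
  set S := \sum_(j < _) _; rewrite !exprMn => E.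
  transitivity (A l i * (a 0 0 ^+ i * b 0 0 ^+ i) * (a 1 0 ^+ (d - i) * b 0 0 ^+ (d - i) -
    b 1 0 ^+ (d - i) * a 0 0 ^+ (d - i))); first by ring.
  by rewrite E /wedge; ring.
- have -> : b 1 0 ^+ d = b 1 0 ^+ i * b 1 0 ^+ (d - i) by rewrite -exprD subnKC.
  have -> : a 1 0 ^+ d = a 1 0 ^+ i * a 1 0 ^+ (d - i) by rewrite -exprD subnKC.
  have := subXX (a 0 0 * b 1 0) (b 0 0 * a 1 0) i.
  set S := \sum_(j < _) _; rewrite !exprMn => E.
  transitivity (A l i * (a 1 0 ^+ (d - i) * b 1 0 ^+ (d - i)) * (a 0 0 ^+ i * b 1 0 ^+ i -
    b 0 0 ^+ i * a 1 0 ^+ i)); first by ring.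
  by rewrite E /wedge; ring.
Qed.

Lemma GqZ e A (a b : 'cV[K]_2) (x y : K) : (0 < d)%N ->
  Gq e A (x *: a) (y *: b) = (x * y) ^+ d.-1 *: Gq e A a b.
Proof.
move=> d0; apply/colP => l; rewrite !mxE.
have E (s t r u : K) n : \sum_(j < n) (x * s * (y * t)) ^+ (n - j.+1) * (y * r * (x * u)) ^+ j =
    (x * y) ^+ n.-1 * \sum_(j < n) (s * t) ^+ (n - j.+1) * (r * u) ^+ j.
  rewrite mulr_sumr; apply: eq_bigr => j _.
  have -> : n.-1 = (n - j.+1 + j)%N by have := ltn_ord j; lia.
  rewrite exprD; have -> : x * s * (y * t) = x * y * (s * t) by ring.
  have -> : y * r * (x * u) = x * y * (r * u) by ring.
  by rewrite !exprMn; ring.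
case: ifP => _; rewrite ?mulrN; [congr (- _)|]; rewrite mulr_sumr; apply: eq_bigr => i _;
  have id : (i <= d)%N by rewrite -ltnS ltn_ord.
- rewrite E; have [->|di] := eqVneq (d - i)%N 0%N; first by rewrite !big_ord0; ring.
  have -> : x * a 0 0 * (y * b 0 0) = x * y * (a 0 0 * b 0 0) by ring.
  have -> : d.-1 = (i + (d - i).-1)%N by lia.
  by rewrite exprD !exprMn; ring.
- rewrite E; have [i0|i0] := eqVneq (nat_of_ord i) 0%N; first by rewrite i0 !big_ord0; ring.
  have -> : x * a 1 0 * (y * b 1 0) = x * y * (a 1 0 * b 1 0) by ring.
  have -> : d.-1 = ((d - i) + i.-1)%N by lia.
  by rewrite exprD !exprMn; ring.
Qed.

(* The closure of the graph of h |-> Gam A h on pairs (h, X). *)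
Definition Xt (A : 'M[K]_(2, d.+1)) (h : 'M[K]_2) (X : 'M[K]_(2, d.+1)) : Prop :=
  (forall i j i' j', X i j * Gam A h i' j' = X i' j' * Gam A h i j) /\
  (forall e x z s l i, ev A (h *m s) l 0 *
     ((h *m z) e 0 ^+ d * ev X x i 0 - (h *m x) e 0 ^+ d * ev X z i 0) =
     (h *m ev X s) l 0 * (wedge x z * (\adj h *m Gq e A (h *m x) (h *m z)) i 0)).

(** The origin of the second family of equations: for X = [Gam A h] the difference on its left is
    det h times [wedge x z] times adj h applied to the difference quotient, while h X(s) = det h A(h
    s). Cross-multiplying removes det h and leaves conditions that still carry information when det
    h = 0. *)
Lemma Xt_Gam A h : Xt A h (Gam A h).
Proof.
split=> [i j i' j'|e x z s l i]; first by rewrite mulrC.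
have evG y : ev (Gam A h) y = \adj h *m ev A (h *m y) by rewrite /ev Gam_mon.
have -> : (h *m z) e 0 ^+ d * ev (Gam A h) x i 0 - (h *m x) e 0 ^+ d * ev (Gam A h) z i 0 =
    (\adj h *m ((h *m z) e 0 ^+ d *: ev A (h *m x) - (h *m x) e 0 ^+ d *: ev A (h *m z))) i 0.
  by rewrite mulmxBr -!scalemxAr !evG !mxE.
rewrite Gq_eq wedge_mul evG mulmxA mul_mx_adj mul_scalar_mx -scalemxAr !mxE.
by ring.
Qed.

Lemma XtZ A h X s t : (0 < d)%N -> Xt A h X -> Xt A (s *: h) (t *: X).
Proof.
move=> d0 [X1 X2]; split=> [i j i' j'|e x z r l i].
  have GZ : exists2 c, forall a b, Gam A (s *: h) a b = c * Gam A h a b & True.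
    exists (s ^+ d.+1) => // a b; rewrite /Gam adjZ2.
    have -> : Rm (s *: h) = s ^+ d *: Rm h.
      apply/matrixP => u w; rewrite !mxE.
      have linZ q : lin (s *: h) q = s *: lin h q by rewrite /lin !mxE scalerDr scalerA polyCM mul_polyC.
      rewrite !linZ !exprZn -scalerAl -scalerAr scalerA -exprD subnKC ?coefZ //.
      by rewrite -ltnS ltn_ord.
    by rewrite -!scalemxAl -scalemxAr scalerA !mxE exprS.
  case: GZ => c cE _; have tE a b : (t *: X) a b = t * X a b by rewrite mxE.
  rewrite !cE !tE; have E := X1 i j i' j'.
  transitivity (t * c * (X i j * Gam A h i' j')); first by ring.
  by rewrite E; ring.
have := X2 e x z r l i; rewrite -!scalemxAl !evZ adjZ2 GqZ // => E.
have evX y : ev (t *: X) y = t *: ev X y by rewrite /ev -scalemxAl.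
have scE m n a (B : 'M[K]_(m, n)) u v : (a *: B) u v = a * B u v by rewrite mxE.
rewrite !evX -scalemxAr -scalemxAl -scalemxAr !scE !exprMn.
transitivity (s ^+ d * s ^+ d * t * (ev A (h *m r) l 0 *
  ((h *m z) e 0 ^+ d * ev X x i 0 - (h *m x) e 0 ^+ d * ev X z i 0))); first by ring.
rewrite E; have dE : s ^+ d = s * s ^+ d.-1 by rewrite -exprS prednK.
by rewrite dE; ring.
Qed.

End Forms.

(** * Degenerate conjugates and derivatives over an algebraically closed field *)

Section FormsClosed.
Variables (k : closedFieldType) (d : nat).
Implicit Types (A X : 'M[k]_(2, d.+1)) (h g : 'M[k]_2) (x y z v : 'cV[k]_2).

Definition vec2 (a b : k) : 'cV[k]_2 := \col_i (if i == 0 then a else b).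

Lemma vec2_0 a b : vec2 a b 0 0 = a. Proof. by rewrite mxE. Qed.
Lemma vec2_1 a b : vec2 a b 1 0 = b. Proof. by rewrite mxE. Qed.

Lemma col2P x y : x 0 0 = y 0 0 -> x 1 0 = y 1 0 -> x = y.
Proof. by move=> x0 x1; apply: mx2P => j; rewrite [j]ord1. Qed.

Lemma mon_sep m (M M' : 'M[k]_(m, d.+1)) :
  (forall x, M *m mon d x = M' *m mon d x) -> M = M'.
Proof.
move=> H; apply/matrixP => i j; apply/eqP; rewrite -subr_eq0; apply/negPn/negP => nz.
have /poly_nz[t] : \poly_(l < d.+1) (M i (inord l) - M' i (inord l)) != 0.
  apply: contra_neq nz => /(congr1 (fun p : {poly k} => p`_j)).
  by rewrite coef_poly ltn_ord coef0 inord_val.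
rewrite horner_poly => /eqP[].
have := H (vec2 t 1); move/(congr1 (fun A : 'cV[k]_m => A i 0)); rewrite !mxE => E.
transitivity (\sum_j M i j * mon d (vec2 t 1) j 0 - \sum_j M' i j * mon d (vec2 t 1) j 0).
  rewrite -sumrB; apply: eq_bigr => l _.
  by rewrite inord_val [mon _ _ _ _]mxE vec2_0 vec2_1 expr1n mulr1 mulrBl.
by rewrite E subrr.
Qed.

Lemma ev_inj_mx A A' : (forall x, ev A x = ev A' x) -> A = A'.
Proof. exact: mon_sep. Qed.

Lemma ev_Gam A h x : ev (Gam A h) x = \adj h *m ev A (h *m x).
Proof. exact: Gam_mon. Qed.

Lemma GamM A h g : Gam A (h *m g) = Gam (Gam A h) g.
Proof.
by apply: ev_inj_mx => x; rewrite !ev_Gam adj_mul2 -!mulmxA.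
Qed.

Lemma Gam1 A : Gam A 1%:M = A.
Proof.
apply: ev_inj_mx => x; rewrite ev_Gam mul1mx.
by rewrite adj1 mul1mx.
Qed.

Lemma GamZ A h s : Gam A (s *: h) = s ^+ d.+1 *: Gam A h.
Proof.
apply: ev_inj_mx => x; rewrite ev_Gam adjZ2 -!scalemxAl evZ -scalemxAr scalerA -exprS.
by rewrite -ev_Gam /ev -scalemxAl.
Qed.

Lemma GamZl A h s : Gam (s *: A) h = s *: Gam A h.
Proof. by rewrite /Gam -scalemxAr -scalemxAl. Qed.

Lemma evZl A s x : ev (s *: A) x = s *: ev A x.
Proof. by rewrite /ev -scalemxAl. Qed.

(** No common zero on the projective line; over an algebraically closed field this is coprimality of
    the two forms. *)
Definition coprime_map A : Prop := forall x, x != 0 -> ev A x != 0.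

Lemma unit2 h : (h \in unitmx) = (\det h != 0).
Proof. by rewrite unitmxE unitfE. Qed.

Lemma Gam_inv A h : h \in unitmx -> Gam (Gam A h) (invmx h) = A.
Proof. by move=> hU; rewrite -GamM mulmxV // Gam1. Qed.

Lemma unitmx_vec h x : h \in unitmx -> x != 0 -> h *m x != 0.
Proof. by move=> hU; apply: contra_neq => hx; rewrite -[x](mulKmx hU) hx mulmx0. Qed.

Lemma adj_unit h : h \in unitmx -> \adj h \in unitmx.
Proof.
rewrite !unit2 => dh; have := congr1 (fun M : 'M[k]_2 => \det M) (mul_mx_adj h).
rewrite /= det_mulmx det_scalar => E; apply: contra_neq (expf_neq0 2 dh) => d0.
by rewrite -E d0 mulr0.
Qed.

Lemma rat_Gam A h : coprime_map A -> h \in unitmx -> coprime_map (Gam A h).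
Proof.
move=> rA hU x x0; rewrite ev_Gam; apply: unitmx_vec; first exact: adj_unit.
by apply: rA; apply: unitmx_vec.
Qed.

Lemma col_nz n (x : 'cV[k]_n) : x != 0 -> exists l, x l 0 != 0.
Proof.
move=> x0; apply: contrapT => H; move/eqP: x0; apply; apply/colP => i; rewrite [RHS]mxE.
by apply: contrapT => /eqP n0; apply: H; exists i.
Qed.

Lemma vec2_10 : vec2 1 0 != 0.
Proof. by apply/eqP => /(congr1 (fun x : 'cV[k]_2 => x 0 0)); rewrite vec2_0 mxE => /eqP; rewrite oner_eq0. Qed.

Lemma rat_neq0 A : coprime_map A -> A != 0.
Proof. by move=> /(_ _ vec2_10); apply: contra_neq => ->; rewrite /ev mul0mx. Qed.

Lemma wedge0 x y : x != 0 -> wedge x y = 0 -> exists c, y = c *: x.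
Proof.
move=> x0 w; have [x00|x00] := eqVneq (x 0 0) 0.
  have x10 : x 1 0 != 0.
    by apply: contra_neq x0 => x10; apply: col2P; rewrite mxE.
  exists (y 1 0 / x 1 0); apply: col2P; rewrite mxE ?x00 ?mulr0 ?divfK //.
  by apply/eqP; move: w; rewrite /wedge x00 mul0r sub0r => /eqP; rewrite oppr_eq0 mulf_eq0 (negPf x10) orbF.
exists (y 0 0 / x 0 0); apply: col2P; rewrite mxE ?divfK //.
by apply: (mulfI x00); rewrite mulrC; move/eqP: w; rewrite /wedge subr_eq0 mulrC => /eqP ->; field.
Qed.

Lemma Xt_prop A h X : Gam A h != 0 -> Xt A h X -> exists c, X = c *: Gam A h.
Proof.
move=> G0 [E _]; have [i [j gij]] : exists i j, Gam A h i j != 0.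
  apply: contrapT => H; move/eqP: G0; apply.
  apply/matrixP => i j; rewrite [RHS]mxE; apply: contrapT => /eqP n; apply: H.
  by exists i, j.
exists (X i j / Gam A h i j); apply/matrixP => a b; rewrite mxE mulrAC E mulfK //.
Qed.

Lemma Gam_neq0 A h : A != 0 -> h \in unitmx -> Gam A h != 0.
Proof.
move=> A0 hU; apply: contra_neq A0 => G0; rewrite -(Gam_inv A hU) G0.
by rewrite /Gam mulmx0 mul0mx.
Qed.

(* The limit forms: an affine map with a hole of order d - 1 at the kernel of w,
   whose slope is determined by kap, or a constant map. *)
Definition perp (w : 'rV[k]_2) : 'cV[k]_2 := vec2 (- w 0 1) (w 0 0).
Definition unitv (e : 'I_2) : 'cV[k]_2 := \col_i (i == e)%:R.

Definition bdry (kap : k) (e : 'I_2) (w m : 'rV[k]_2) : 'M[k]_(2, d.+1) :=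
  let R := Rm d (col_mx w (\row_j (if j == 0 then unitv e 1 0 else - unitv e 0 0))) in
  m^T *m row (inord d) R + (kap * (w *m m^T) 0 0) *: (perp w *m row (inord d.-1) R).

Lemma bdry_ev kap e w m x : (0 < d)%N -> ev (bdry kap e w m) x =
  (w *m x) 0 0 ^+ d *: m^T +
  (kap * (w *m m^T) 0 0 * (w *m x) 0 0 ^+ d.-1 * wedge x (unitv e)) *: perp w.
Proof.
move=> d0; rewrite /ev /bdry mulmxDl -scalemxAl -!mulmxA.
set h := col_mx _ _.
have rowE (i : 'I_d.+1) : row i (Rm d h) *m mon d x = ((h *m x) 0 0 ^+ i * (h *m x) 1 0 ^+ (d - i))%:M.
  by rewrite -row_mul Rm_mon [LHS]mx11_scalar !mxE.
rewrite !rowE !inordK ?leq_pred //; last by rewrite ltnS leq_pred.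
have i0 : (0 : 'I_2) = lshift 1 (0 : 'I_1) by apply: val_inj.
have i1 : (1 : 'I_2) = rshift 1 (0 : 'I_1) by apply: val_inj.
have h0 : (h *m x) 0 0 = (w *m x) 0 0.
  have E j : h 0 j = w 0 j by rewrite {1}i0 col_mxEu.
  by rewrite !mul2E !E.
have h1 : (h *m x) 1 0 = wedge x (unitv e).
  have E j : h 1 j = if j == 0 then unitv e 1 0 else - unitv e 0 0.
    by rewrite {1}i1 col_mxEd mxE.
  by rewrite mul2E !E /= /wedge; ring.
have dd : (d - d.-1)%N = 1%N by lia.
by rewrite h0 h1 subnn expr0 mulr1 dd expr1 !mul_mx_scalar scalerA mulrA.
Qed.

Lemma rank1 h : h != 0 -> \det h = 0 -> exists e v (w : 'rV[k]_2),
  [/\ v e 0 = 1, w != 0 & h = v *m w].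
Proof.
move=> h0 dh; have [i ri] : exists i, row i h != 0.
  apply: contrapT => H; move/eqP: h0; apply; apply/row_matrixP => i; rewrite row0.
  by apply: contrapT => /eqP n; apply: H; exists i.
have {}dh : h 0 0 * h 1 1 = h 0 1 * h 1 0 by apply/eqP; rewrite -subr_eq0 -det2E dh.
have mulE (v : 'cV[k]_2) (w : 'rV[k]_2) a b : (v *m w) a b = v a 0 * w 0 b by rewrite mxE big_ord1.
have E j b : h 0 j * h 1 b = h 1 j * h 0 b.
  by case: (I2P j) => ->; case: (I2P b) => ->; [ring|rewrite dh; ring|rewrite [RHS]mulrC dh; ring|ring].
case: (I2P i) => iE; rewrite iE in ri.
  have [j hj] := row_nz ri; rewrite mxE in hj.
  exists 0, (vec2 1 (h 1 j / h 0 j)), (row 0 h); split=> //; first by rewrite vec2_0.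
  apply: mx2P => b; rewrite mulE ?vec2_0 ?vec2_1 mxE ?mul1r //.
  by apply: (mulfI hj); rewrite E; field.
have [j hj] := row_nz ri; rewrite mxE in hj.
exists 1, (vec2 (h 0 j / h 1 j) 1), (row 1 h); split=> //; first by rewrite vec2_1.
apply: mx2P => b; rewrite mulE ?vec2_0 ?vec2_1 mxE ?mul1r //.
by apply: (mulfI hj); rewrite -E; field.
Qed.

Lemma adj_rank1 v (w : 'rV[k]_2) x : \adj (v *m w) *m x = wedge v x *: perp w.
Proof.
have [a b c e] := adj2E (v *m w).
have mulE i j : (v *m w) i j = v i 0 * w 0 j by rewrite mxE big_ord1.
by apply: col2P; rewrite mul2E ?a ?b ?c ?e !mulE mxE ?vec2_0 ?vec2_1 /wedge; ring.
Qed.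

Definition fixv A v : Prop := wedge v (ev A v) = 0.

(** Minus the multiplier of A at its fixed point v, in the chart at e: on the diagonal [Gq] is the
    derivative up to sign. *)
Definition slope A (e : 'I_2) v : k := wedge v (Gq e A v v) / ev A v e 0.

(** For h = v w the second family expresses X through its value m at a point z with w z = 1, up to
    the constant kap. If v is a fixed point of A, kap is read off from the multiplier. If not,
    [Gam A h] is nonzero and X is a multiple of it; then w m = 0, the term with kap drops out, and 0
    may be taken for kap. *)
Lemma Xt_sing A h X e v (w : 'rV[k]_2) : (0 < d)%N -> coprime_map A -> X != 0 ->
  v e 0 = 1 -> w != 0 -> h = v *m w -> Xt A h X ->
  exists kap e' t m, [/\ w 0 e' != 0, m != 0, w = w 0 e' *: chart e' t,
    X = bdry kap e' (chart e' t) m & fixv A v /\ kap = slope A e v \/ kap = 0].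
Proof.
move=> d0 rA X0 ve w0 hE XtX; have [e' we'] := row_nz w0.
have [t wE] := chartP we'; set w' := chart e' t in wE *.
have w'e : w' 0 e' = 1 by rewrite mxE unlift_none.
have Xt' : Xt A (v *m w') X.
  have -> : v *m w' = (w 0 e')^-1 *: h by rewrite hE {2}wE -scalemxAr scalerA mulVf // scale1r.
  by rewrite -[X]scale1r; apply: XtZ.
clearbody w'.
pose z := unitv e'.
have wz : (w' *m z) 0 0 = 1.
  by rewrite mul2E !mxE; case: (I2P e') w'e => -> ->; rewrite /= ?mulr1 ?mulr0 ?addr0 ?add0r.
have hx x : v *m w' *m x = (w' *m x) 0 0 *: v by rewrite -mulmxA {1}[w' *m x]mx11_scalar mul_mx_scalar.
have v0 : v != 0 by apply/eqP => v0; move/eqP: ve; rewrite v0 mxE eq_sym oner_eq0.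
have fv0 := rA v v0.
have scE (c : k) (y : 'cV[k]_2) j : (c *: y) j 0 = c * y j 0 by rewrite mxE.
(* The equations of [Xt] for the points x, z and once more z, where h z = v. *)
have key l' x i : ev A v l' 0 * (ev X x i 0 - (w' *m x) 0 0 ^+ d * ev X z i 0) =
    v l' 0 * (w' *m ev X z) 0 0 * wedge x z * (w' *m x) 0 0 ^+ d.-1 *
      (wedge v (Gq e A v v) * perp w' i 0).
  have := (Xt'.2) e x z z l' i; rewrite !hx !evZ wz !scale1r !expr1n.
  rewrite -[X in Gq e A _ X]scale1r GqZ // mulr1 -scalemxAr adj_rank1.
  rewrite !scE ve !mulr1 !expr1n !mul1r ?scale1r => ->.
  by ring.
pose m := (ev X z)^T.
have mE : ev X z = m^T by rewrite trmxK.
have XE l : ev A v l 0 != 0 -> X = bdry (v l 0 * wedge v (Gq e A v v) / ev A v l 0) e' w' m.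
  move=> fl; apply: ev_inj_mx => x; rewrite bdry_ev // -mE; apply/colP => i.
  rewrite [RHS]mxE [X in X + _]mxE [X in _ + X]mxE.
  apply: (mulfI fl); have := key l x i; rewrite mulrBr => /eqP; rewrite subr_eq => /eqP ->.
  by rewrite -/z; field.
have [l fl] := col_nz fv0.
have m0 : m != 0.
  apply: contra_neq X0 => m0; apply: ev_inj_mx => x; rewrite (XE l fl) bdry_ev // m0.
  by rewrite trmx0 mulmx0 (_ : (0 : 'M[k]_1) 0 0 = 0) ?mxE // mulr0 !mul0r scaler0 scale0r addr0 /ev mul0mx.
have [t' t'E] : exists t', w' = chart e' t'.
  have w'e0 : w' 0 e' != 0 by rewrite w'e oner_neq0.
  have [t' t'E] := chartP w'e0.
  by exists t'; rewrite t'E w'e scale1r.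
have [fv|nfv] := eqVneq (wedge v (ev A v)) 0.
  have [c cE] := wedge0 v0 fv.
  have fe : ev A v e 0 != 0.
    by rewrite cE mxE ve mulr1; apply: contra_neq fv0 => c0; rewrite cE c0 scale0r.
  exists (slope A e v), e', t', m; rewrite -t'E; split=> //; last by left.
  by rewrite /slope {1}(XE e fe) ve mul1r.
exists 0, e', t', m; rewrite -t'E; split=> //; last by right.
have G0 : Gam A (v *m w') != 0.
  apply: contra_neq nfv => G0; have := ev_Gam A (v *m w') z.
  rewrite G0 {1}/ev mul0mx hx wz scale1r adj_rank1 => E.
  have E0 := congr1 (fun x : 'cV[k]_2 => x 0 0) E; have E1 := congr1 (fun x : 'cV[k]_2 => x 1 0) E.
  move: E0 E1 w'e; rewrite /= !scE vec2_0 vec2_1 !mxE => E0 E1.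
  by case: (I2P e') => -> w'e; move: E0 E1; rewrite w'e ?mulr1 ?mulrN ?mulr1 => + /esym // => /esym/eqP; rewrite oppr_eq0 => /eqP.
have [c cE] := Xt_prop G0 Xt'.
have wm : (w' *m m^T) 0 0 = 0.
  rewrite -mE cE evZl ev_Gam hx wz scale1r adj_rank1 -!scalemxAr 2!mxE mul2E vec2_0 vec2_1.
  by ring.
apply: ev_inj_mx => x; rewrite {1}(XE l fl) !bdry_ev // wm.
by rewrite !mulr0 !mul0r.
Qed.

(** A derivative taken as the linear coefficient in a formal parameter. Expansions with a polynomial
    remainder of second order, as in [Gam_expand], do the work of calculus. *)
Definition dGam A h g : 'M[k]_(2, d.+1) :=
  map_mx (coefp 1) (Gam (map_mx polyC A) (map_mx polyC h + 'X *: map_mx polyC g)).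

Definition dmon x y : 'cV[k]_d.+1 := \col_j
  (((x 0 0)%:P + y 0 0 *: 'X) ^+ j * ((x 1 0)%:P + y 1 0 *: 'X) ^+ (d - j))`_1.

Lemma poly_expand (p : {poly k}) t : p.[t] = p`_0 + t * p`_1 + t ^+ 2 * (drop_poly 2 p).[t].
Proof.
have {1}-> : p = (p`_0)%:P + p`_1 *: 'X + 'X^2 * drop_poly 2 p.
  apply/polyP => -[|[|i]]; rewrite !coefD coefC coefZ coefX coefXnM coef_drop_poly /=.
  - by rewrite mulr0 !addr0.
  - by rewrite mulr1 add0r addr0.
  - by rewrite mulr0 !add0r; congr (p`_ _); lia.
by rewrite !hornerE /= ?hornerXn ?horner_exp ?hornerX; ring.
Qed.

Lemma map_Gam (K K' : comNzRingType) (f : {rmorphism K -> K'}) (A : 'M[K]_(2, d.+1)) (h : 'M[K]_2) :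
  map_mx f (Gam A h) = Gam (map_mx f A) (map_mx f h).
Proof.
rewrite /Gam !map_mxM map_mx_adj; congr (_ *m _ *m _).
apply/matrixP => i j; rewrite !mxE -coef_map rmorphM !rmorphXn /=.
have linE l : map_poly f (lin h l) = lin (map_mx f h) l.
  by rewrite /lin rmorphD /= map_polyZ map_polyX map_polyC !mxE.
by rewrite !linE.
Qed.

Lemma Gam_expand A h g : exists e : 'M[{poly k}]_(2, d.+1), forall t,
  Gam A (h + t *: g) = Gam A h + t *: dGam A h g + t ^+ 2 *: map_mx (horner^~ t) e.
Proof.
pose P := Gam (map_mx polyC A) (map_mx polyC h + 'X *: map_mx polyC g).
have PE t : map_mx (horner_eval t) P = Gam A (h + t *: g).
  rewrite map_Gam; congr Gam.
    by apply/matrixP => i j; rewrite !mxE /= horner_evalE hornerC.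
  by apply/matrixP => i j; rewrite !mxE /= horner_evalE hornerD hornerM hornerX !hornerC.
exists (map_mx (drop_poly 2) P) => t; rewrite -PE -[Gam A h](_ : map_mx (horner_eval 0) P = _); last first.
  by rewrite PE scale0r addr0.
rewrite /dGam -/P; clearbody P; apply/matrixP => i j.
by rewrite !mxE /= !horner_evalE horner_coef0 [LHS]poly_expand.
Qed.

Lemma dmonE x y j : dmon x y j 0 = j%:R * (x 0 0 ^+ j.-1 * y 0 0) * x 1 0 ^+ (d - j) +
  x 0 0 ^+ j * ((d - j)%:R * (x 1 0 ^+ (d - j).-1 * y 1 0)).
Proof.
have c1 (p : {poly k}) : p`_1 = (p^`()).[0] by rewrite horner_coef0 coef_deriv mulr1n.
rewrite mxE c1 derivM !deriv_exp !derivD !derivC !derivZ !derivX !add0r.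
rewrite !(hornerD, hornerM, hornerMn, horner_exp, hornerC, hornerZ, hornerX) !mulr0 !addr0.
rewrite -(mulr_natl _ j) -(mulr_natl _ (d - j)).
by ring.
Qed.

Lemma dmon_lin x a y b z : dmon x (a *: y + b *: z) = a *: dmon x y + b *: dmon x z.
Proof.
have cE n (u v : 'cV[k]_n) i : (a *: u + b *: v) i 0 = a * u i 0 + b * v i 0 by rewrite !mxE.
apply/colP => j; rewrite cE !dmonE !cE.
by ring.
Qed.

Lemma dmon_euler x : dmon x x = d%:R *: mon d x.
Proof.
apply/colP => j; rewrite dmonE !mxE.
have pr n (c : k) : n%:R * (c ^+ n.-1 * c) = n%:R * c ^+ n.
  by case: n => [|n]; [rewrite !mul0r|rewrite -exprSr].
rewrite !pr; have -> : d%:R = j%:R + (d - j)%:R :> k.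
  by rewrite -natrD subnKC // -ltnS ltn_ord.
by ring.
Qed.

Lemma mon_expand x y : exists e : 'cV[{poly k}]_d.+1, forall t,
  mon d (x + t *: y) = mon d x + t *: dmon x y + t ^+ 2 *: map_mx (horner^~ t) e.
Proof.
pose P (j : 'I_d.+1) : {poly k} := ((x 0 0)%:P + y 0 0 *: 'X) ^+ j * ((x 1 0)%:P + y 1 0 *: 'X) ^+ (d - j).
have PE t j : (P j).[t] = mon d (x + t *: y) j 0.
  by rewrite mxE /P hornerM !horner_exp !hornerE !mxE ![t * _]mulrC.
exists (\col_j drop_poly 2 (P j)) => t; apply/colP => j.
have P0 : (P j)`_0 = mon d x j 0 by rewrite -horner_coef0 PE scale0r addr0.
rewrite -PE poly_expand P0 [RHS]mxE [X in _ = X + _]mxE [X in _ = _ + X + _]mxE.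
by rewrite [X in _ = _ + X]mxE; congr (_ + t * _ + _ * _); rewrite !mxE.
Qed.

Definition dev A x y := A *m dmon x y.

Lemma dev_lin A x a y b z : dev A x (a *: y + b *: z) = a *: dev A x y + b *: dev A x z.
Proof. by rewrite /dev dmon_lin mulmxDr -!scalemxAr. Qed.

Lemma dev_euler A x : dev A x x = d%:R *: ev A x.
Proof. by rewrite /dev dmon_euler -scalemxAr. Qed.

Lemma expand_uniq m n (a b : 'M[k]_(m, n)) (e e' : 'M[{poly k}]_(m, n)) (c : 'M[k]_(m, n)) :
  (forall t, c + t *: a + t ^+ 2 *: map_mx (horner^~ t) e =
             c + t *: b + t ^+ 2 *: map_mx (horner^~ t) e') -> a = b.
Proof.
move=> H; apply/matrixP => i j; apply/eqP; rewrite -subr_eq0.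
have E : (a i j - b i j)%:P + 'X * (e i j - e' i j) = 0.
  apply: poly_eq_nz => t t0; rewrite horner0 !hornerE /=.
  have := congr1 (fun M : 'M[k]_(m, n) => M i j) (H t); rewrite !mxE => E.
  apply: (mulfI t0); rewrite mulr0 -[RHS](subrr (c i j + t * a i j + t ^+ 2 * (e i j).[t])).
  by rewrite [X in _ = _ - X]E; ring.
have := congr1 (fun p : {poly k} => p`_0) E.
by rewrite coefD coefC coefXM /= addr0 coef0 => ->.
Qed.

Lemma ev_dGam A h g x :
  ev (dGam A h g) x = \adj g *m ev A (h *m x) + \adj h *m dev A (h *m x) (g *m x).
Proof.
have [e eE] := Gam_expand A h g; have [f fE] := mon_expand (h *m x) (g *m x).
pose f' : 'cV[{poly k}]_2 := map_mx polyC (\adj g *m dev A (h *m x) (g *m x)) +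
  (map_mx polyC (\adj h) + 'X *: map_mx polyC (\adj g)) *m (map_mx polyC A *m f).
apply: (@expand_uniq 2 1 _ _ (e *m map_mx polyC (mon d x)) f' (\adj h *m ev A (h *m x))) => t.
have hM (m n p : nat) (a : 'M[{poly k}]_(m, n)) (b : 'M[{poly k}]_(n, p)) :
    map_mx (horner^~ t) (a *m b) = map_mx (horner^~ t) a *m map_mx (horner^~ t) b.
  exact: (map_mxM (horner_eval t)).
have hC (m n : nat) (a : 'M[k]_(m, n)) : map_mx (horner^~ t) (map_mx polyC a) = a.
  by apply/matrixP => i j; rewrite !mxE hornerC.
have hD (m n : nat) (a b : 'M[{poly k}]_(m, n)) :
    map_mx (horner^~ t) (a + b) = map_mx (horner^~ t) a + map_mx (horner^~ t) b.
  by apply/matrixP => i j; rewrite !mxE hornerD.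
have hX (m n : nat) (a : 'M[{poly k}]_(m, n)) :
    map_mx (horner^~ t) ('X *: a) = t *: map_mx (horner^~ t) a.
  by apply/matrixP => i j; rewrite !mxE hornerM hornerX.
rewrite hM hC /f' !(hD, hM, hC, hX).
have dist (a b : 'M[k]_2) (P Q S : 'cV[k]_2) :
    (a + t *: b) *m (P + t *: Q + t ^+ 2 *: S) =
    a *m P + t *: (b *m P + a *m Q) + t ^+ 2 *: (b *m Q + (a + t *: b) *m S).
  rewrite !(mulmxDl, mulmxDr) -!(scalemxAl, scalemxAr).
  move: (a *m P) (a *m Q) (a *m S) (b *m P) (b *m Q) (b *m S) => ? ? ? ? ? ?.
  by apply/colP => i; rewrite !mxE; ring.
rewrite /dev /ev -dist.
have -> : A *m mon d (h *m x) + t *: (A *m dmon (h *m x) (g *m x)) + t ^+ 2 *: (A *m map_mx (horner^~ t) f) =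
    ev A ((h + t *: g) *m x).
  by rewrite /ev mulmxDl -scalemxAl fE !mulmxDr -!scalemxAr.
rewrite -adjZ2 -adjD2 -(Gam_mon A (h + t *: g)) (eE t) !mulmxDl -!scalemxAl Gam_mon.
by [].
Qed.

End FormsClosed.

(** * Infinitesimal stabilizers are trivial *)

Section Stabilizer.
Variables (k : closedFieldType) (d : nat).
Hypothesis char0 : [pchar k] =i pred0.
Hypothesis hd : (2 <= d)%N.
Implicit Types (A X : 'M[k]_(2, d.+1)) (h g : 'M[k]_2) (x y z v : 'cV[k]_2).

Lemma natr_eq0 n : (n%:R == 0 :> k) = (n == 0%N).
Proof. exact: (pcharf0P k).1 char0 n. Qed.

Lemma deriv_expand (p : {poly k}) t : exists e : {poly k}, forall s,
  p.[t + s] = p.[t] + s * (p^`()).[t] + s ^+ 2 * e.[s].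
Proof.
exists (drop_poly 2 (p \Po ('X + t%:P))) => s.
have := poly_expand (p \Po ('X + t%:P)) s.
rewrite horner_comp hornerD hornerX hornerC addrC => ->; congr (_ + _ * _ + _).
  by rewrite -horner_coef0 horner_comp hornerD hornerX hornerC add0r.
have -> (q : {poly k}) : q`_1 = (q^`()).[0] by rewrite horner_coef0 coef_deriv mulr1n.
by rewrite deriv_comp derivD derivX derivC addr0 mulr1 horner_comp hornerD hornerX hornerC add0r.
Qed.

Lemma line_poly A w a i : exists p : {poly k},
  [/\ forall t, p.[t] = ev A (w + t *: a) i 0, p`_d = ev A a i 0 &
      forall t, (p^`()).[t] = dev A (w + t *: a) a i 0].
Proof.
have lE (u v : 'cV[k]_2) l t : ((u l 0)%:P + v l 0 *: 'X).[t] = (u + t *: v) l 0.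
  by rewrite hornerD hornerC hornerZ hornerX !mxE mulrC.
pose p : {poly k} := \sum_j A i j *: (((w 0 0)%:P + a 0 0 *: 'X) ^+ j * ((w 1 0)%:P + a 1 0 *: 'X) ^+ (d - j)).
have pE t : p.[t] = ev A (w + t *: a) i 0.
  rewrite /p horner_sum mxE; apply: eq_bigr => j _.
  by rewrite hornerZ hornerM !horner_exp !lE [mon _ _ _ _]mxE.
exists p; split=> //.
- pose q : {poly k} := \sum_j A i j *: (((a 0 0)%:P + w 0 0 *: 'X) ^+ j * ((a 1 0)%:P + w 1 0 *: 'X) ^+ (d - j)).
  have qE t : q.[t] = ev A (a + t *: w) i 0.
    rewrite /q horner_sum mxE; apply: eq_bigr => j _.
    by rewrite hornerZ hornerM !horner_exp !lE [mon _ _ _ _]mxE.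
  pose c (v : 'rV[k]_(1 + 1)) : 'cV[k]_2 := v 0 (lshift 1 0) *: a + v 0 (rshift 1 0) *: w.
  have cE s t : c (row_mx s%:M t%:M) = s *: a + t *: w.
    by rewrite /c row_mxEl row_mxEr !mxE eqxx !mulr1n.
  have [|||H _] := @homogeneous_coefs k 1 (fun v : 'rV[k]_(1 + 1) => ev A (c v) i 0) d 1%:M p q.
  + move=> v s; have -> : c (s *: v) = s *: c v by rewrite /c ![(s *: v) _ _]mxE scalerDr !scalerA.
    by rewrite evZ mxE.
  + by move=> t; rewrite pE cE scale1r addrC.
  + by move=> t; rewrite qE scalemx1 cE scale1r.
  + by rewrite H -(scale0r 1%:M) scalemx1 cE scale1r scale0r addr0.
- move=> t; have [e eE] := deriv_expand p t.
  have [f fE] := mon_expand d (w + t *: a) a.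
  pose r := \sum_j (A i j)%:P * f j 0.
  have rE s : (A *m map_mx (horner^~ s) f) i 0 = r.[s].
    by rewrite mxE horner_sum; apply: eq_bigr => j _; rewrite hornerM hornerC mxE.
  have addE (u v : 'cV[k]_2) : (u + v) i 0 = u i 0 + v i 0 by rewrite mxE.
  have scE s (u : 'cV[k]_2) : (s *: u) i 0 = s * u i 0 by rewrite mxE.
  have E : (p^`()).[t]%:P + 'X * e = (dev A (w + t *: a) a i 0)%:P + 'X * r.
    apply: poly_eq_nz => s s0; rewrite !hornerE; apply: (mulfI s0); apply: (addrI p.[t]).
    have := eE s; rewrite pE scalerDl addrA /ev fE !mulmxDr -!scalemxAr !addE !scE rE -/(ev _ _) -pE => E.
    by rewrite !mulrDr !mulrA -!expr2 addrA -E addrA.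
  have := congr1 (fun p : {poly k} => p`_0) E.
  by rewrite !coefD !coefC !coefXM /= !addr0.
Qed.

(** Subtracting an eigenvalue leaves g = a b of rank one, and the hypothesis becomes the relation E
    between A, its derivative along a, and the forms B = b x and phi = b A(x). If c' is nonzero, A
    maps the kernel of B to a, so c' = - tau, and the relation at a gives tau d = 0. If c' = 0 but
    tau = b a is nonzero, it gives tau (d - 1) = 0. Both are impossible in characteristic 0. *)
Lemma infinitesimal_stabilizer A g c : coprime_map A -> dGam A 1%:M g = c *: A -> exists s, g = s%:M.
Proof.
move=> rA H.
have {}H x : \adj g *m ev A x + dev A x (g *m x) = c *: ev A x.
  by rewrite -evZl -H ev_dGam mul1mx adj1 mul1mx.
have [lam lamE] : exists lam, \det (g - lam%:M) = 0.
  have [lam] : exists r : k, root ('X^2 - (g 0 0 + g 1 1) *: 'X + (\det g)%:P) r.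
    apply/closed_rootP; rewrite -addrA size_polyDl size_polyXn //.
    rewrite (leq_ltn_trans (size_polyD _ _)) // gtn_max size_polyN.
    rewrite (leq_ltn_trans (size_scale_leq _ _)) ?size_polyX //.
    by rewrite (leq_ltn_trans (size_polyC_leq1 _)).
  rewrite /root !hornerE /= => /eqP E; exists lam; rewrite det2E.
  move: E; rewrite det2E !mxE /= !mulr1n !mulr0n => E; rewrite -[RHS]E.
  by rewrite ?hornerXn; ring.
have [gl|gl] := eqVneq (g - lam%:M) 0; first by exists lam; apply/eqP; rewrite -subr_eq0 gl.
have [e [a [b [ae b0 gE]]]] := rank1 gl lamE.
have a0 : a != 0 by apply/eqP => a0; move/eqP: ae; rewrite a0 mxE eq_sym oner_eq0.
pose phi x := (b *m ev A x) 0 0; pose B x := (b *m x) 0 0.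
pose tau := B a; pose c' := c - lam - lam * d%:R - tau.
have gD : g = a *m b + lam%:M by rewrite -gE subrK.
have abx x : a *m b *m x = B x *: a by rewrite -mulmxA {1}[b *m x]mx11_scalar mul_mx_scalar.
have E x : B x *: dev A x a - phi x *: a = c' *: ev A x.
  have := H x; rewrite gD adjD2 !mulmxDl abx mul_scalar_mx adj_rank1.
  have -> : \adj (lam%:M : 'M[k]_2) = lam%:M.
    by rewrite -scalemx1 adjZ2 adj1.
  rewrite mul_scalar_mx dev_lin dev_euler => {}H.
  have W : wedge a (ev A x) *: perp b = tau *: ev A x - phi x *: a.
    have scE s (u : 'cV[k]_2) i : (s *: u) i 0 = s * u i 0 by rewrite mxE.
    have sbE (u u' : 'cV[k]_2) i : (u - u') i 0 = u i 0 - u' i 0 by rewrite !mxE.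
    by apply: col2P; rewrite sbE !scE /tau /phi /B !mul2E /wedge ?vec2_0 ?vec2_1; ring.
  rewrite W in H; rewrite /c' !scalerBl -H scalerA.
  move: (ev A x) (dev A x a) => u u'.
  by apply/colP => i; rewrite !mxE; ring.
have sc0 s : s *: a = 0 -> s = 0.
  by move/eqP; rewrite scaler_eq0 (negPf a0) orbF => /eqP.
have phia s x : ev A x = s *: a -> phi x = s * tau.
  by move=> xE; rewrite /phi xE -scalemxAr mxE.
have Ea : (tau * d%:R) *: ev A a - phi a *: a = c' *: ev A a.
  by rewrite -E dev_euler scalerA.
have fa0 := rA a a0.
have v0 : perp b != 0.
  apply/eqP => v0; move/eqP: b0; apply; apply/rowP => j; rewrite mxE.
  have := congr1 (fun x : 'cV[k]_2 => x 0 0) v0; have := congr1 (fun x : 'cV[k]_2 => x 1 0) v0.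
  rewrite /= vec2_0 vec2_1 !mxE => b00 /eqP; rewrite oppr_eq0 => /eqP b01.
  by case: (I2P j) => ->.
have Bv : B (perp b) = 0 by rewrite /B mul2E vec2_0 vec2_1; ring.
have Ev : - phi (perp b) *: a = c' *: ev A (perp b).
  by rewrite -E Bv scale0r add0r scaleNr.
exfalso; have [c0|c0] := eqVneq c' 0; last first.
  have fv : ev A (perp b) = (- phi (perp b) / c') *: a.
    by rewrite mulrC -scalerA Ev scalerA mulVf // scale1r.
  set kap := - _ / _ in fv.
  have kap0 : kap != 0 by apply: contra_neq (rA _ v0) => k0; rewrite fv k0 scale0r.
  have ct : c' = - tau.
    have : (- (kap * tau) - c' * kap) *: a = 0.
      by rewrite scalerBl -(phia _ _ fv) Ev fv scalerA subrr.
    move/sc0 => h; apply: (mulfI kap0); rewrite -[LHS]addr0 -{}h; ring.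
  have tau0 : tau != 0 by rewrite -oppr_eq0 -ct.
  have d1 : tau * d.+1%:R != 0 by rewrite mulf_neq0 // natr_eq0.
  have fa : ev A a = (phi a / (tau * d.+1%:R)) *: a.
    apply: (scalerI d1); rewrite scalerA mulrCA divff // mulr1.
    move: Ea; rewrite ct => /eqP; rewrite subr_eq addrC -subr_eq -scalerBl => /eqP <-.
    by congr (_ *: _); rewrite -natr1; ring.
  have pa := phia _ _ fa; set kap' := phi a / _ in fa pa.
  have k'0 : kap' != 0 by apply: contra_neq fa0 => k0; rewrite fa k0 scale0r.
  have : tau * d.+1%:R * kap' = kap' * tau by rewrite -pa /kap' mulrCA divff // mulr1.
  move/eqP; rewrite -subr_eq0 -natr1.
  have -> : tau * (d%:R + 1) * kap' - kap' * tau = tau * kap' * d%:R by ring.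
  apply/negP; apply: mulf_neq0; last by rewrite natr_eq0; lia.
  by clearbody kap'; rewrite mulf_neq0.
have Ea0 : (tau * d%:R) *: ev A a = phi a *: a.
  by apply/eqP; rewrite -subr_eq0 Ea c0 scale0r.
have [t0|t0] := eqVneq tau 0; last first.
  have d1 : tau * d%:R != 0 by rewrite mulf_neq0 // natr_eq0; lia.
  have fa : ev A a = (phi a / (tau * d%:R)) *: a.
    by apply: (scalerI d1); rewrite scalerA mulrCA divff // mulr1.
  have pa := phia _ _ fa; set kap' := phi a / _ in fa pa.
  have k'0 : kap' != 0 by apply: contra_neq fa0 => k0; rewrite fa k0 scale0r.
  have : tau * d%:R * kap' = kap' * tau.
    by rewrite -pa /kap' mulrCA divff // mulr1.
  move/eqP; rewrite -subr_eq0; have -> : d%:R = d.-1%:R + 1 :> k by rewrite natr1 prednK //; lia.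
  have -> : tau * (d.-1%:R + 1) * kap' - kap' * tau = tau * kap' * d.-1%:R by ring.
  apply/negP; apply: mulf_neq0; last by rewrite natr_eq0; lia.
  by clearbody kap'; rewrite mulf_neq0.
(* Now a b is nilpotent. The line w + t a stays in B = 1, where A has derivative phi a along a and
   phi has derivative 0. So the coefficient of phi in degree d - 1 > 0 is zero, and with it the
   coefficient A(a) of t ^ d. *)
have [j bj] := row_nz b0; pose w := (b 0 j)^-1 *: unitv k j.
have Bw : B w = 1.
  rewrite /B /w -scalemxAr mxE mul2E !mxE.
  by case: (I2P j) bj => -> bj; rewrite /= ?mulr1 ?mulr0 ?addr0 ?add0r mulVf.
have Bt t : B (w + t *: a) = 1.
  have -> : B (w + t *: a) = B w + t * B a by rewrite /B !mul2E !mxE; ring.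
  by rewrite -/tau t0 mulr0 addr0.
have [p0 [p0E p0d p0']] := line_poly A w a 0; have [p1 [p1E p1d p1']] := line_poly A w a 1.
pose Q := b 0 0 *: p0 + b 0 1 *: p1.
have Et t : dev A (w + t *: a) a = phi (w + t *: a) *: a.
  by apply/eqP; rewrite -subr_eq0; have := E (w + t *: a); rewrite Bt c0 scale0r scale1r => ->.
have QE t : Q.[t] = phi (w + t *: a) by rewrite /Q hornerD !hornerZ p0E p1E /phi mul2E.
have Q' : Q^`() = 0.
  apply: poly_eq_nz => t _; rewrite /Q derivD !derivZ hornerD !hornerZ p0' p1' Et horner0.
  have -> : b 0 0 * (phi (w + t *: a) *: a) 0 0 + b 0 1 * (phi (w + t *: a) *: a) 1 0 =
     phi (w + t *: a) * tau by rewrite /tau /B mul2E !mxE; ring.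
  by rewrite t0 mulr0.
have Qd : Q`_d.-1 = 0.
  have := congr1 (fun p : {poly k} => p`_(d.-2)) Q'; rewrite coef_deriv coef0.
  have -> : d.-2.+1 = d.-1 by lia.
  by rewrite -mulr_natr => /eqP; rewrite mulf_eq0 natr_eq0 => /orP[/eqP//|]; lia.
have fin (p : {poly k}) i : (forall t, (p^`()).[t] = dev A (w + t *: a) a i 0) -> p`_d = 0.
  move=> p'; have pQ : p^`() = a i 0 *: Q.
    by apply: poly_eq_nz => t _; rewrite p' Et hornerZ QE mxE mulrC.
  have := congr1 (fun p : {poly k} => p`_(d.-1)) pQ; rewrite coefZ Qd mulr0 coef_deriv.
  have -> : d.-1.+1 = d by lia.
  by rewrite -mulr_natr => /eqP; rewrite mulf_eq0 natr_eq0 => /orP[/eqP//|]; lia.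
by move/eqP: fa0; apply; apply: col2P; rewrite [RHS]mxE -?p0d -?p1d; [apply: fin p0'|apply: fin p1'].
Qed.

Lemma dGam_mul A h g : dGam A h (h *m g) = dGam (Gam A h) 1%:M g.
Proof.
have [e eE] := Gam_expand A h (h *m g); have [f fE] := Gam_expand (Gam A h) 1%:M g.
apply: (@expand_uniq k _ _ (dGam A h (h *m g)) (dGam (Gam A h) 1%:M g) e f (Gam A h)) => t.
have E : Gam (Gam A h) (1%:M + t *: g) = Gam A (h + t *: (h *m g)).
  by rewrite -GamM mulmxDr mulmx1 -scalemxAr.
have G1 : Gam (Gam A h) 1%:M = Gam A h by exact: Gam1.
by have := fE t; rewrite E (eE t) G1.
Qed.

(** Translation by h moves the question to the identity; modulo scalars the orbit map is an
    immersion. *)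
Lemma tangent_indep A h g c : coprime_map A -> h \in unitmx ->
  dGam A h g = c *: Gam A h -> exists s, g = s *: h.
Proof.
move=> rA hU H; have gE : g = h *m (invmx h *m g) by rewrite mulKVmx.
rewrite gE dGam_mul in H.
have [s sE] := infinitesimal_stabilizer (rat_Gam rA hU) H.
by exists s; rewrite gE sE mul_mx_scalar.
Qed.

End Stabilizer.

(** * Polynomial dependence and closedness of the constructions *)

Section PolyForms.
Variables (k : closedFieldType) (d : nat).

Lemma zcl_eq T {hT : aff k T} (f g : T -> k) : pf f -> pf g -> zcl (fun t => f t = g t).
Proof.
move=> hf hg t n; exists (fun t => f t - g t); split.
- by apply: pf_add => //; apply: pf_opp.
- by move=> s ->; rewrite subrr.
- by rewrite subr_eq0; apply/eqP.
Qed.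

Lemma zcl_forall T {hT : aff k T} I (C : I -> T -> Prop) :
  (forall i, zcl (C i)) -> zcl (fun t => forall i, C i t).
Proof.
move=> H t /existsNP[i ni]; have [f [pf_f fC ft]] := H i t ni.
by exists f; split=> // s Cs; exact: fC.
Qed.

Lemma zcl_and T {hT : aff k T} (C D : T -> Prop) : zcl C -> zcl D -> zcl (fun t => C t /\ D t).
Proof.
move=> hC hD t /not_andP[nC|nD].
  by have [f [pf_f fC ft]] := hC t nC; exists f; split=> // s [/fC].
by have [f [pf_f fC ft]] := hD t nD; exists f; split=> // s [_ /fC].
Qed.

Lemma zcl_comp T T' {hT : aff k T} {hT' : aff k T'} (C : T' -> Prop) (f : T -> T') :
  zcl C -> pmap f -> zcl (fun t => C (f t)).
Proof.
move=> hC hf t /hC[g [pf_g gC gt]]; exists (fun t => g (f t)); split=> //.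
  exact: pf_comp pf_g hf.
by move=> s; exact: gC.
Qed.

Lemma zcl_ext T {hT : aff k T} (C D : T -> Prop) : (forall t, C t <-> D t) -> zcl C -> zcl D.
Proof.
move=> e hC t nD; have [|f [pf_f fC ft]] := hC t; first by rewrite e.
by exists f; split=> // s /e /fC.
Qed.

Lemma pf_coef T {hT : aff k T} (f : T -> {poly k}) i :
  pf (fun t : T * k => (f t.1).[t.2]) -> pf (fun t => (f t)`_i).
Proof.
move=> /pf_poly[Q QE]; exists Q`_i => t.
have -> : f t = evp (cof t) Q by apply: poly_eq_nz => s _; rewrite -(QE t s).
by rewrite /evp coef_map.
Qed.

Context (T : Type) {hT : aff k T}.

Lemma pmap_Rm (h : T -> 'M[k]_2) : pmap h -> pmap (fun t => Rm d (h t)).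
Proof.
move=> hh; rewrite /Rm; apply: pmap_matrix => i j; apply: pf_coef.
have H l : pf (fun t : T * k => (lin (h t.1) l).[t.2]).
  have E : (fun t : T * k => h t.1 l 0 * t.2 + h t.1 l 1) =1 (fun t => (lin (h t.1) l).[t.2]).
    by move=> t; rewrite !hornerE.
  by apply: (pf_ext E); pfs; apply: (pmap_comp hh); pfs.
have E : (fun t : T * k => (lin (h t.1) 0).[t.2] ^+ i * (lin (h t.1) 1).[t.2] ^+ (d - i)) =1
    (fun t => (lin (h t.1) 0 ^+ i * lin (h t.1) 1 ^+ (d - i)).[t.2]).
  by move=> t; rewrite hornerM !horner_exp.
by apply: (pf_ext E); pfs.
Qed.

Lemma pmap_Gam (A : T -> 'M[k]_(2, d.+1)) (h : T -> 'M[k]_2) :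
  pmap A -> pmap h -> pmap (fun t => Gam (A t) (h t)).
Proof. by move=> hA hh; rewrite /Gam; pfs; exact: pmap_Rm. Qed.

Lemma pmap_ev (A : T -> 'M[k]_(2, d.+1)) (x : T -> 'cV[k]_2) :
  pmap A -> pmap x -> pmap (fun t => ev (A t) (x t)).
Proof. by move=> hA hx; rewrite /ev /mon; pfs. Qed.

Lemma pmap_Gq e (A : T -> 'M[k]_(2, d.+1)) (x y : T -> 'cV[k]_2) :
  pmap A -> pmap x -> pmap y -> pmap (fun t => Gq e (A t) (x t) (y t)).
Proof. by move=> hA hx hy; rewrite /Gq; pfs. Qed.
End PolyForms.

Ltac pfx := repeat first [pfstep | apply: pmap_Gam | apply: pmap_ev | apply: pmap_Gq | apply: pmap_Rm].

Section PolyForms2.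
Variables (k : closedFieldType) (d : nat).
Context (T : Type) {hT : aff k T}.

Lemma pmap_dGam (A : T -> 'M[k]_(2, d.+1)) (h g : T -> 'M[k]_2) :
  pmap A -> pmap h -> pmap g -> pmap (fun t => dGam (A t) (h t) (g t)).
Proof.
move=> hA hh hg; apply: pmap_mx => i j.
pose P t := Gam (map_mx polyC (A t)) (map_mx polyC (h t) + 'X *: map_mx polyC (g t)).
have E : (fun t => (P t i j)`_1) =1 (fun t => dGam (A t) (h t) (g t) i j).
  by move=> t; rewrite /dGam -/(P t) [RHS]mxE.
apply: (pf_ext E); apply: (pf_coef (f := fun t => P t i j)).
have E' : (fun t : T * k => Gam (A t.1) (h t.1 + t.2 *: g t.1) i j) =1 (fun t => (P t.1 i j).[t.2]).
  have mapE s (M : 'M[{poly k}]_(2, d.+1)) : (M i j).[s] = map_mx (horner_eval s) M i j by rewrite mxE.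
  move=> [t s] /=; rewrite mapE map_Gam; congr (Gam _ _ _ _); apply/matrixP => u v; rewrite !mxE /= horner_evalE.
    by rewrite hornerC.
  by rewrite hornerD hornerM hornerX !hornerC.
have cA : pmap (fun t : T * k => A t.1) by apply: (pmap_comp hA); pfs.
have ch : pmap (fun t : T * k => h t.1) by apply: (pmap_comp hh); pfs.
have cg : pmap (fun t : T * k => g t.1) by apply: (pmap_comp hg); pfs.
by apply: (pf_ext E'); pfx.
Qed.

Lemma zcl_Xt (A X : T -> 'M[k]_(2, d.+1)) (h : T -> 'M[k]_2) :
  pmap A -> pmap X -> pmap h -> zcl (fun t => Xt (A t) (h t) (X t)).
Proof.
move=> hA hX hh; apply: zcl_and.
  by do 4!(apply: zcl_forall => ?); apply: zcl_eq; pfx.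
do 6!(apply: zcl_forall => ?); apply: zcl_eq; rewrite /wedge; pfx.
Qed.

End PolyForms2.

(** * Partial derivatives and expansions along polynomial paths *)

Section Calculus.
Variable k : closedFieldType.

Lemma mpoly_ring_ind n (Q : {mpoly k[n]} -> Prop) :
  (forall c, Q c%:MP) -> (forall i, Q 'X_i) ->
  (forall p q, Q p -> Q q -> Q (p + q)) -> (forall p q, Q p -> Q q -> Q (p * q)) ->
  forall p, Q p.
Proof.
move=> QC QX QD QM p; rewrite [p]mpolyE; apply: big_ind => [||m _]; [by rewrite -mpolyC0; exact: QC|exact: QD|].
rewrite -mul_mpolyC; apply: (QM) => //; rewrite mpolyXE_id.
apply: big_ind => [||i _]; [by rewrite -mpolyC1; exact: QC|exact: QM|].
elim: (m i) => [|e IHe]; first by rewrite expr0 -mpolyC1; exact: QC.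
by rewrite exprS; exact: QM.
Qed.

Definition dirder n (c : {mpoly k[n]}) (v w : 'I_n -> k) := \sum_i c^`M(i).@[v] * w i.

Lemma chain_rule n (c : {mpoly k[n]}) (v w : 'I_n -> k) (e : 'I_n -> {poly k}) :
  exists r : {poly k}, forall t, c.@[fun i => v i + t * w i + t ^+ 2 * (e i).[t]] =
    c.@[v] + t * dirder c v w + t ^+ 2 * r.[t].
Proof.
rewrite /dirder; elim/mpoly_ring_ind: c => [a|i|p q [r rE] [s sE]|p q [r rE] [s sE]].
- exists 0 => t; rewrite !mevalC big1 ?horner0 ?mulr0 ?addr0 // => i _.
  by rewrite mderivC meval0 mul0r.
- exists (e i) => t; rewrite !mevalXU (bigD1 i) //= big1 ?addr0.
    by rewrite mderivX mnm1E eqxx scale1r -{1}[U_(i)%MM]add0m addmK mpolyX0 meval1 mul1r.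
  by move=> j ji; rewrite mderivX mnm1E eq_sym (negPf ji) scale0r meval0 mul0r.
- exists (r + s) => t; rewrite !mevalD rE sE hornerD.
  have -> : \sum_i (p + q)^`M(i).@[v] * w i = \sum_i p^`M(i).@[v] * w i + \sum_i q^`M(i).@[v] * w i.
    by rewrite -big_split; apply: eq_bigr => i _; rewrite mderivD mevalD mulrDl.
  by ring.
- set P := \sum_i p^`M(i).@[v] * w i in rE; set Q := \sum_i q^`M(i).@[v] * w i in sE.
  exists ((p.@[v])%:P * s + (q.@[v])%:P * r + (P * Q)%:P + 'X * (P *: s + Q *: r) + 'X^2 * (r * s)) => t.
  have -> : \sum_i (p * q)^`M(i).@[v] * w i = P * q.@[v] + p.@[v] * Q.
    rewrite mulr_suml mulr_sumr -big_split; apply: eq_bigr => i _.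
    by rewrite mderivM mevalD !mevalM /=; ring.
  by rewrite !mevalM rE sE !(hornerD, hornerM, hornerC, hornerX, hornerZ, hornerXn) ; ring.
Qed.

Lemma pf_k (f : k -> k) : pf f -> exists q : {poly k}, forall t, f t = q.[t].
Proof.
move=> hf; have [|Q QE] := @pf_poly k 'M[k]_(0, 0) _ (fun x => f x.2).
  by apply: (pf_comp hf); pfs.
by exists (evp (cof (0 : 'M[k]_(0, 0))) Q) => t; rewrite -QE.
Qed.

Lemma pf_k_poly (q : {poly k}) : pf (fun t : k => q.[t]).
Proof.
have : pf (fun t : k => \sum_(i < size q) q`_i * t ^+ i) by pfs.
by apply: pf_ext => t; rewrite horner_coef.
Qed.

Lemma quadratic0 (a b : k) (r : {poly k}) :
  (forall t, a + t * b + t ^+ 2 * r.[t] = 0) -> a = 0 /\ b = 0.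
Proof.
move=> H; have E : a%:P + 'X * (b%:P + 'X * r) = 0.
  apply: poly_eq_nz => t _; rewrite !(hornerD, hornerM, hornerC, hornerX) ?horner0 -[RHS](H t).
  by ring.
split; [have := congr1 (fun p : {poly k} => p`_0) E|have := congr1 (fun p : {poly k} => p`_1) E];
  rewrite coefD coefXM coefC /= coef0 ?coefD ?coefC ?coefXM /= ?addr0 ?add0r //.
Qed.

Lemma pf_meval T (a : aff k T) (c : {mpoly k[@adim k T a]}) : pf (fun u : T => c.@[cof u]).
Proof. by exists c. Qed.

Lemma pf_meval_comp T T' (a : aff k T) (b : aff k T') (c : {mpoly k[@adim k T a]}) (f : T' -> T) :
  pmap f -> pf (fun t => c.@[cof (f t)]).
Proof. exact: pf_comp (pf_meval c). Qed.

Lemma mderiv_const n (c : {mpoly k[n]}) : [pchar k] =i pred0 ->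
  (forall i, c^`M(i) = 0) -> c = (c@_0)%:MP.
Proof.
move=> ch H; apply/mpolyP => m; rewrite mcoeffC; have [->|m0] := eqVneq m 0%MM.
  by rewrite mulr1.
rewrite mulr0.
have [i mi] : exists i, m i != 0%N.
  apply: contrapT => /forallNP H'; move/eqP: m0; apply; apply/mnmP => i; rewrite mnm0E.
  by apply: contrapT => /eqP; exact: H'.
have mE : m = (m - U_(i) + U_(i))%MM.
  by rewrite submK //; apply/mnm_lepP => j; rewrite mnm1E; case: eqP => [<-|//]; rewrite lt0n.
have := congr1 (fun p => p@_(m - U_(i))) (H i).
rewrite mcoeff_deriv mcoeff0 -mE -mulr_natr => /eqP; rewrite mulf_eq0 => /orP[/eqP //|].
by rewrite (pcharf0P k).1.
Qed.

Lemma msize_mderiv n (c : {mpoly k[n]}) i : c^`M(i) != 0 -> (msize c^`M(i) < msize c)%N.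
Proof.
move=> c0; rewrite -mlead_deg //; have := mlead_supp c0.
rewrite mcoeff_msupp mcoeff_deriv => nz.
have : (mlead c^`M(i) + U_(i))%MM \in msupp c.
  by rewrite mcoeff_msupp; apply: contra_neq nz => ->; rewrite mul0rn.
by move/msize_mdeg_lt; rewrite mdegD mdeg1 addn1.
Qed.

End Calculus.

Opaque dGam Gam.

(** When the first-order terms cancel, the path of hyperplanes misses the moving point only in order
    t ^ 2; [hit_gradient] repairs this by a correction of the same order. *)
Lemma path_kill (k : closedFieldType) m n (u D : 'M[k]_(m, n)) (x x1 y : 'rV[k]_n) t :
  u *m x^T = 0 -> u *m x1^T = - (D *m x^T) ->
  (u + t *: D) *m (x + t *: x1 + t ^+ 2 *: y)^T = t ^+ 2 *: (D *m x1^T + (u + t *: D) *m y^T).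
Proof.
move=> ux ux1; have -> : (x + t *: x1 + t ^+ 2 *: y)^T = x^T + t *: x1^T + t ^+ 2 *: y^T.
  by apply/matrixP => i j; rewrite !mxE.
rewrite 2!mulmxDr -!scalemxAr mulmxDl ux -scalemxAl add0r.
rewrite [in X in _ + X + _]mulmxDl ux1 -scalemxAl scalerDr scalerA -expr2 scalerDr.
by rewrite scalerN addrA addrN add0r.
Qed.

Lemma path_expand (k : closedFieldType) m n (u D S : 'M[k]_(m, n)) a b c t :
  (a + t * b + t ^+ 2 * c) *: (u + t *: D) - t ^+ 2 *: S =
  a *: u + t *: (b *: u + a *: D) + t ^+ 2 *: (b *: D + c *: (u + t *: D) - S).
Proof. by apply/matrixP => i j; rewrite !mxE; ring. Qed.

(** * A generic triple of hyperplanes meets the orbit *)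

Section Dominance.
Variables (k : closedFieldType) (d : nat).
Hypothesis char0 : [pchar k] =i pred0.
Hypothesis hd : (2 <= d)%N.
Implicit Types (A X : 'M[k]_(2, d.+1)) (h g : 'M[k]_2).
Local Notation N := (2 * d.+1)%N.

Definition xv X : 'rV[k]_N := mxvec X.

Lemma xv_lin a X b Y : xv (a *: X + b *: Y) = a *: xv X + b *: xv Y.
Proof. by rewrite /xv linearD !linearZ. Qed.

Lemma xvD X Y : xv (X + Y) = xv X + xv Y.
Proof. by rewrite /xv linearD. Qed.

Lemma xvZ a X : xv (a *: X) = a *: xv X.
Proof. by rewrite /xv linearZ. Qed.

Lemma xv_eq0 X : (xv X == 0) = (X == 0).
Proof. exact: mxvec_eq0. Qed.

Lemma xv_inj : injective xv.
Proof. exact: can_inj mxvecK. Qed.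

Lemma dGam_lin A h a g b g' : dGam A h (a *: g + b *: g') = a *: dGam A h g + b *: dGam A h g'.
Proof.
apply: ev_inj_mx => x.
have ED g0 := ev_dGam A h g0 x; move: (dGam A h) ED => D ED.
have L (B C : 'M[k]_(2, d.+1)) : ev (a *: B + b *: C) x = a *: ev B x + b *: ev C x.
  by rewrite /ev mulmxDl -!scalemxAl.
rewrite [RHS]L 3!ED adjD2 !adjZ2.
have -> : (a *: g + b *: g') *m x = a *: (g *m x) + b *: (g' *m x) by rewrite mulmxDl -!scalemxAl.
rewrite dev_lin; move: (ev A _) (dev A _ _) (dev A _ _) (\adj g) (\adj g') (\adj h) => u v w G G' H.
by rewrite mulmxDl -!scalemxAl mulmxDr -!scalemxAr !scalerDr addrACA.
Qed.

Lemma dGam0 A h : dGam A h 0 = 0.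
Proof. by have := dGam_lin A h 0 0 0 0; rewrite !scale0r !addr0. Qed.

Definition dirs (e : 'I_4) (a : 'rV[k]_3) : 'M[k]_2 := vec_mx (chart0 e a : 'rV[k]_(2 * 2)).

Lemma dirs_lin e a (v : 'rV[k]_3) b w : dirs e (a *: v + b *: w) = a *: dirs e v + b *: dirs e w.
Proof.
have E : chart0 e (a *: v + b *: w) = a *: chart0 e v + b *: chart0 e w.
  by apply/rowP => j; rewrite !mxE; case: unlift => [i|]; rewrite ?mxE ?mulr0 ?addr0.
by apply/matrixP => i j; rewrite /dirs E !mxE.
Qed.

Lemma dirs_indep e h v s : mxvec h 0 e != 0 -> dirs e v = s *: h -> v = 0.
Proof.
move=> he H; have E : (chart0 e v : 'rV[k]_(2 * 2)) = s *: mxvec h.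
  by have := congr1 mxvec H; rewrite /dirs vec_mxK linearZ.
have s0 : s = 0.
  have := congr1 (fun x : 'rV[k]_(2 * 2) => x 0 e) E.
  by rewrite mxE unlift_none mxE => /esym/eqP; rewrite mulf_eq0 (negPf he) orbF => /eqP.
apply/rowP => i; have := congr1 (fun x : 'rV[k]_(2 * 2) => x 0 (lift e i)) E.
by rewrite s0 scale0r !mxE liftK.
Qed.

Definition dGv A e h (v : 'rV[k]_3) : 'rV[k]_N := xv (dGam A h (dirs e v)).

Lemma dGv_lin A e h a v b w : dGv A e h (a *: v + b *: w) = a *: dGv A e h v + b *: dGv A e h w.
Proof. by rewrite /dGv dirs_lin dGam_lin xv_lin. Qed.

Definition Mg A e h : 'M[k]_(3, N) := \matrix_i dGv A e h (delta_mx 0 i).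

Lemma dGv_Mg A e h v : dGv A e h v = v *m Mg A e h.
Proof.
have L : linear (dGv A e h) by move=> a u w; rewrite -[w in LHS]scale1r dGv_lin scale1r.
pose F : {linear 'rV[k]_3 -> 'rV[k]_N} := HB.pack (dGv A e h) (GRing.isLinear.Build _ _ _ _ _ L).
rewrite {1}[v]row_sum_delta -[LHS]/(F _) linear_sum mulmx_sum_row; apply: eq_bigr => i _.
by rewrite linearZ rowK.
Qed.

(** The 1 + 3 rows are a point of the orbit cone and three tangent directions; a dependency between
    them would be an infinitesimal stabilizer. *)
Lemma tangent_free A e h : coprime_map A -> h \in unitmx -> mxvec h 0 e != 0 ->
  row_free (col_mx (xv (Gam A h)) (Mg A e h)).
Proof.
move=> rA hU he; apply/inj_row_free => v; rewrite -[v]hsubmxK mul_row_col.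
set a := lsubmx v; set b := rsubmx v; rewrite [a]mx11_scalar mul_scalar_mx -dGv_Mg => H.
have H' : dGam A h (dirs e b) = (- a 0 0) *: Gam A h.
  apply: xv_inj; rewrite xvZ scaleNr; apply/eqP; rewrite -addr_eq0 addrC.
  by apply/eqP.
have [s sE] := tangent_indep char0 hd rA hU H'.
have b0 := dirs_indep he sE; move: H'; rewrite b0.
have -> : dirs e 0 = 0 by have := dirs_lin e 0 0 0 0; rewrite !scale0r !addr0.
rewrite dGam0 => /esym/eqP; rewrite scaler_eq0 oppr_eq0 (negPf (Gam_neq0 (rat_neq0 rA) hU)) orbF.
by move=> /eqP ->; rewrite raddf0 row_mx0.
Qed.

Section Gradient.
Local Notation cf := (@cof k 'M[k]_(3, N) (aff_mx k 3 N)).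
Variables (A : 'M[k]_(2, d.+1)) (rA : coprime_map A) (o : 'M[k]_2 -> k) (pf_o : pf o).
Variables (h0 : 'M[k]_2) (h0U : h0 \in unitmx) (oh0 : o h0 != 0).
Variables (e : 'I_4) (he : mxvec h0 0 e != 0).

Lemma cfD (u v : 'M[k]_(3, N)) i : cf (u + v) i = cf u i + cf v i.
Proof. by rewrite /cof [in LHS]/aco /= linearD mxE. Qed.

Lemma cfZ s (v : 'M[k]_(3, N)) i : cf (s *: v) i = s * cf v i.
Proof. by rewrite /cof [in LHS]/aco /= linearZ mxE. Qed.

(** A transversal solution: the determinant says that u is invertible on the tangent directions of
    the orbit at h. *)
Definition hit (u : 'M[k]_(3, N)) h : Prop :=
  [/\ h \in unitmx, o h != 0, u *m (xv (Gam A h))^T = 0 & \det (u *m (Mg A e h)^T) != 0].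

Lemma hit_exists : exists u, hit u h0.
Proof.
have /row_freeP[B BE] := tangent_free rA h0U he.
exists (rsubmx (B : 'M_(N, 1 + 3)))^T; have := BE.
rewrite -[B in LHS](hsubmxK (B : 'M_(N, 1 + 3))) mul_col_row => E.
have E2 : xv (Gam A h0) *m rsubmx (B : 'M_(N, 1 + 3)) = 0.
  by have := congr1 ursubmx E; rewrite block_mxKur => ->; rewrite (@scalar_mx_block _ 1 3) block_mxKur.
have E3 : Mg A e h0 *m rsubmx (B : 'M_(N, 1 + 3)) = 1%:M.
  by have := congr1 drsubmx E; rewrite block_mxKdr => ->; rewrite (@scalar_mx_block _ 1 3) block_mxKdr.
split=> //; first by rewrite -trmx_mul E2 trmx0.
by rewrite -trmx_mul E3 det_tr det1 oner_neq0.
Qed.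

Lemma hitZ s u h : s != 0 -> hit u h -> hit (s *: u) h.
Proof.
move=> s0 [hU oh u0 J]; split=> //; first by rewrite -scalemxAl u0 scaler0.
by rewrite -scalemxAl detZ mulf_neq0 // expf_neq0.
Qed.

Lemma pmap_xvGam : pmap (fun h => xv (Gam A h)).
Proof. by rewrite /xv; pfx. Qed.

Lemma pmap_Mg : pmap (fun h => Mg A e h).
Proof.
rewrite /Mg; apply: pmap_mx => i j.
have E : (fun h => dGv A e h (delta_mx 0 i) 0 j) =1 (fun h => (\matrix_i dGv A e h (delta_mx 0 i)) i j).
  by move=> h; rewrite [RHS]mxE.
by apply: (pf_ext E); rewrite /dGv /xv; pfs; apply: pmap_dGam; pfs.
Qed.

(** In each direction D there is a polynomial path U of solutions with U(0) = u: h moves along g,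
    chosen so that the first-order terms cancel. The tangent of U is D up to a multiple of u, and
    the derivative of c along u is zero because [hit] is invariant under scaling. *)
Lemma hit_gradient (c : {mpoly k[3 * N]}) u h D :
  (forall u h, hit u h -> c.@[cf u] = 0) -> hit u h ->
  dirder c (cf u) (cf (D : 'M[k]_(3, N))) = 0.
Proof.
move=> cH hu; have [hU oh _ _] := hu.
have [j xj] : exists j, xv (Gam A h) 0 j != 0.
  apply: row_nz; rewrite xv_eq0; exact: Gam_neq0 (rat_neq0 rA) hU.
set x := xv (Gam A h) in xj *.
have radial u1 : hit u1 h -> dirder c (cf u1) (cf u1) = 0.
  move=> hu1; have [r rE] := chain_rule c (cf u1) (cf u1) (fun=> 0).
  have pz : pf (fun t : k => c.@[cf (u1 + t *: u1)]).
    have pu : pmap (fun t : k => u1 + t *: u1) by pfs.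
    exact: (@pf_meval_comp k 'M[k]_(3, N) k _ _ c _ pu).
  have z t : c.@[cf (u1 + t *: u1)] * (1 + t) = 0.
    have [->|t1] := eqVneq (1 + t) 0; first by rewrite mulr0.
    by rewrite -[u1 in u1 + _]scale1r -scalerDl (cH _ h) ?mul0r //; apply: hitZ.
  have p1 : pf (fun t : k => 1 + t) by pfs.
  have [z0|z1] := pf_mul_eq0 pz p1 z; last first.
    by have := z1 0; rewrite addr0 => /eqP; rewrite oner_eq0.
  apply: (quadratic0 (a := c.@[cf u1]) (r := r) _).2 => t; rewrite -rE -[RHS](z0 t).
  by apply: meval_eq => i; rewrite horner0 mulr0 addr0 cfD cfZ.
pose u1 := (x 0 j)^-1 *: u.
have hu1 : hit u1 h by apply: hitZ => //; rewrite invr_eq0.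
have uE : u = x 0 j *: u1 by rewrite scalerA divff // scale1r.
pose D1 := (x 0 j)^-1 *: D.
have DE : D = x 0 j *: D1 by rewrite scalerA divff // scale1r.
have [_ _ u1x J1] := hu1; rewrite -/x in u1x.
pose v := - (invmx (u1 *m (Mg A e h)^T) *m (D1 *m x^T))^T.
have vE : u1 *m (dGv A e h v)^T = - (D1 *m x^T).
  rewrite dGv_Mg trmx_mul mulmxA /v linearN /= trmxK mulmxN mulKVmx //.
  by rewrite unitmxE unitfE.
pose g := dirs e v; set x1 := dGv A e h v in vE.
have [E EE] := Gam_expand A h g.
pose xe t := xv (map_mx (horner^~ t) E).
have xt t : xv (Gam A (h + t *: g)) = x + t *: x1 + t ^+ 2 *: xe t.
  by rewrite EE !xvD !xvZ.
(* By [path_kill], u1 + t D1 takes the value t ^ 2 [ep t] at the moving point x(t). Multiplying by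
   the coordinate x_j(t) and subtracting t ^ 2 [ep t] times the j-th coordinate form makes the value
   zero without a division. *)
pose U t := xv (Gam A (h + t *: g)) 0 j *: (u1 + t *: D1) -
  t ^+ 2 *: ((D1 *m x1^T + (u1 + t *: D1) *m (xe t)^T) *m delta_mx 0 j).
pose ep t := D1 *m x1^T + (u1 + t *: D1) *m (xe t)^T.
have xjE t : delta_mx 0 j *m (xv (Gam A (h + t *: g)))^T = (xv (Gam A (h + t *: g)) 0 j)%:M :> 'M[k]_1.
  by rewrite -rowE [LHS]mx11_scalar; congr (_%:M); rewrite mxE [LHS]mxE.
have Ux t : U t *m (xv (Gam A (h + t *: g)))^T = 0.
  rewrite /U -/(ep t) mulmxBl -[in X in X - _]scalemxAl -[in X in _ - X]scalemxAl -mulmxA xjE mul_mx_scalar.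
  have -> : (u1 + t *: D1) *m (xv (Gam A (h + t *: g)))^T = t ^+ 2 *: ep t.
    by rewrite xt; exact: path_kill.
  by rewrite scalerA [_ * t ^+ 2]mulrC -scalerA subrr.
have pxe : pmap xe by rewrite /xe /xv; apply: pmap_mxvec; apply: pmap_mx => a b;
  apply: (pf_ext (f := fun t => (E a b).[t])) => [t|]; [by rewrite mxE|exact: pf_k_poly].
have pg : pmap (fun t : k => h + t *: g) by pfs.
have pxg : pmap (fun t : k => xv (Gam A (h + t *: g))) by exact: pmap_comp pmap_xvGam pg.
have pU : pmap U by rewrite /U; pfs.
have U0 : U 0 = u by rewrite /U expr0n /= !scale0r subr0 !addr0 -uE.
have pc : pf (fun t => c.@[cf (U t)]) by exact: (@pf_meval_comp k 'M[k]_(3, N) k _ _ c _ pU).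
have cU t : c.@[cf (U t)] = 0.
  have q1 : pf (fun t : k => \det (h + t *: g)) by pfs.
  have q2 : pf (fun t : k => o (h + t *: g)) by exact: pf_comp pf_o pg.
  have q3 : pf (fun t : k => \det (U t *m (Mg A e (h + t *: g))^T)).
    by have := pmap_comp pmap_Mg pg; move=> ?; pfs.
  have z s : c.@[cf (U s)] * (\det (h + s *: g) * (o (h + s *: g) * \det (U s *m (Mg A e (h + s *: g))^T))) = 0.
    have [->|n1] := eqVneq (\det (h + s *: g)) 0; first by rewrite mul0r mulr0.
    have [->|n2] := eqVneq (o (h + s *: g)) 0; first by rewrite mul0r !mulr0.
    have [->|n3] := eqVneq (\det (U s *m (Mg A e (h + s *: g))^T)) 0; first by rewrite !mulr0.
    have hs : hit (U s) (h + s *: g) by split; [rewrite unitmxE unitfE|exact: n2|exact: Ux|exact: n3].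
    by rewrite (cH _ _ hs) mul0r.
  have [//|/(_ 0)] := pf_mul_eq0 pc (pf_mul q1 (pf_mul q2 q3)) z.
  rewrite U0 scale0r addr0 => /eqP; rewrite !mulf_eq0 (negPf oh); have [_ _ _ J] := hu.
  by rewrite (negPf J) orbF; move: hU; rewrite unitmxE unitfE => /negPf ->.
pose ee t := x1 0 j *: D1 + xe t 0 j *: (u1 + t *: D1) - ep t *m delta_mx 0 j.
have pee : pmap ee by rewrite /ee /ep; pfs.
have UE t : U t = u + t *: (x1 0 j *: u1 + D) + t ^+ 2 *: ee t.
  rewrite {1}/U -/(ep t) /ee [in RHS]uE [in RHS]DE -path_expand; congr (_ *: _ - _).
  by rewrite xt mxE [X in X + _]mxE [X in _ + X]mxE [X in _ + X + _]mxE.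
have /choice[q qE] : forall i, exists p : {poly k}, forall t, cf (ee t) i = p.[t].
  by move=> i; apply: pf_k; exact: pee.
have [r rE] := chain_rule c (cf u) (cf (x1 0 j *: u1 + D)) q.
have [|_ H] := quadratic0 (a := c.@[cf u]) (b := dirder c (cf u) (cf (x1 0 j *: u1 + D))) (r := r).
  move=> t; rewrite -rE -[RHS](cU t) UE; apply: meval_eq => i.
  by rewrite -qE !(cfD, cfZ).
have R := radial u hu; rewrite uE in R.
move: H; rewrite {1}uE.
have -> : dirder c (cf (x 0 j *: u1)) (cf (x1 0 j *: u1 + D)) =
   x1 0 j / x 0 j * dirder c (cf (x 0 j *: u1)) (cf (x 0 j *: u1)) +
   dirder c (cf (x 0 j *: u1)) (cf D).
  rewrite /dirder.
  rewrite mulr_sumr -big_split; apply: eq_bigr => i _.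
  rewrite /= !(cfD, cfZ); field; exact: xj.
by rewrite R mulr0 add0r -uE.
Qed.

(** By [hit_gradient] the partial derivatives of c vanish on all transversal solutions too, so by
    induction on the degree they are zero; in characteristic 0 this makes c constant, and c has a
    zero. *)
Lemma dominance (c : {mpoly k[3 * N]}) :
  (forall u h, h \in unitmx -> o h != 0 -> u *m (xv (Gam A h))^T = 0 -> c.@[cf (u : 'M[k]_(3, N))] = 0) -> c = 0.
Proof.
move=> cH; have {cH} : forall u h, hit u h -> c.@[cf u] = 0.
  by move=> u h [hU oh u0 _]; exact: cH u0.
have [n] := ubnP (msize c); elim: n c => // n IHn c /ltnSE cn cH.
have D i : c^`M(i) = 0.
  have [//|nz] := eqVneq c^`M(i) 0.
  apply: IHn => [|u h hu]; first exact: leq_trans (msize_mderiv nz) cn.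
  have := hit_gradient (vec_mx (delta_mx 0 i)) cH hu; rewrite /dirder.
  rewrite (bigD1 i) //= big1 ?addr0 => [|j ji]; rewrite /cof /= vec_mxK mxE eqxx.
    by rewrite eqxx mulr1.
  by rewrite (negPf ji) mulr0.
have [u hu] := hit_exists; have := cH _ _ hu.
by rewrite (mderiv_const char0 D) mevalC => ->; rewrite mpolyC0.
Qed.

End Gradient.
End Dominance.

(** * The equation of the incidence variety *)

Section SkewParametrization.
Variable k : closedFieldType.

(** The forms orthogonal to a nonzero x are the x S with S antisymmetric. So the pairs (x, u) with u
    x = 0 are parametrized by an affine space, which is how incidence conditions are shown to be
    irreducible. *)
Definition skew n r (x : 'rV[k]_n) (O : 'M[k]_(r, n * n)) : 'M[k]_(r, n) :=
  \matrix_(i, j) (x *m (vec_mx (row i O) - (vec_mx (row i O))^T)) 0 j.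

Lemma skew_orth n r (x : 'rV[k]_n) (O : 'M[k]_(r, n * n)) : skew x O *m x^T = 0.
Proof.
apply/matrixP => i j; rewrite [RHS]mxE !ord1 {j}.
set w := vec_mx (row i O).
have E : (skew x O *m x^T) i 0 = ((x *m (w - w^T)) *m x^T) 0 0.
  by rewrite mxE [RHS]mxE; apply: eq_bigr => j _; rewrite [skew _ _ _ _]mxE.
rewrite E mulmxBr mulmxBl mxE [X in _ + X]mxE; apply/eqP; rewrite subr_eq0; apply/eqP.
have -> : x *m w^T *m x^T = (x *m w *m x^T)^T by rewrite !trmx_mul trmxK mulmxA.
by rewrite [RHS]mxE.
Qed.

Lemma skew_onto n r (x : 'rV[k]_n) (u : 'M[k]_(r, n)) : x != 0 -> u *m x^T = 0 ->
  exists O, u = skew x O.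
Proof.
move=> /row_nz[j xj] ux; pose z : 'rV[k]_n := (x 0 j)^-1 *: delta_mx 0 j.
have xz : x *m z^T = 1%:M.
  rewrite /z linearZ /= -scalemxAr trmx_delta -colE [col _ _]mx11_scalar.
  by rewrite scale_scalar_mx mxE mulVf.
exists (\matrix_i mxvec (z^T *m row i u)); apply/row_matrixP => i; apply/rowP => l.
rewrite [in LHS]mxE [RHS]mxE [RHS]mxE rowK mxvecK mulmxBr mulmxA xz mul1mx.
rewrite trmx_mul trmxK mulmxA.
have -> : x *m (row i u)^T = 0.
  by rewrite -[LHS]trmxK trmx_mul trmxK -row_mul ux row0 trmx0.
by rewrite mul0mx subr0 mxE.
Qed.

Lemma pmap_skew T {hT : aff k T} n r (x : T -> 'rV[k]_n) (O : T -> 'M[k]_(r, n * n)) :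
  pmap x -> pmap O -> pmap (fun t => skew (x t) (O t)).
Proof.
move=> px pO; rewrite /skew; apply: pmap_matrix => i j; pfs.
  by apply: pmap_mx => a b; apply: (pf_ext (f := fun t => O t i b)) => [t|]; [rewrite mxE|pfs].
by apply: pmap_mx => a b; apply: (pf_ext (f := fun t => O t i b)) => [t|]; [rewrite mxE|pfs].
Qed.

Lemma split_orth n (v : 'rV[k]_(1 + n)) c (w : 'rV[k]_n) : v *m (row_mx c%:M w)^T = 0 ->
  v 0 0 * c + (rsubmx v *m w^T) 0 0 = 0.
Proof.
rewrite -{1}[v]hsubmxK tr_row_mx mul_row_col tr_scalar_mx mul_mx_scalar.
move: (rsubmx v *m w^T) => z E; have := congr1 (fun M : 'M[k]_1 => M 0 0) E.
by rewrite !mxE mulrC => <-; congr (v _ _ * _ + _); apply: val_inj.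
Qed.

Lemma zcl_eq0mx T {hT : aff k T} m n (F : T -> 'M[k]_(m, n)) : pmap F -> zcl (fun t => F t = 0).
Proof.
move=> pF; apply: (zcl_ext (C := fun t => forall i j, F t i j = 0)).
  by move=> t; split=> [H|-> i j]; [apply/matrixP => i j; rewrite H mxE|rewrite mxE].
by apply: zcl_forall => i; apply: zcl_forall => j; apply: zcl_eq; pfs.
Qed.

End SkewParametrization.

Section GenericHypersurface.
Variables (k : closedFieldType) (d : nat).
Hypothesis char0 : [pchar k] =i pred0.
Hypothesis hd : (2 <= d)%N.
Implicit Types (A X : 'M[k]_(2, d.+1)) (h g : 'M[k]_2).
Local Notation N := (2 * d.+1)%N.

(** Having a common zero is a closed condition by elimination, and the power map x ^ d violates
    it. *)
Lemma rat_dense (f : 'M[k]_(2, d.+1) -> k) : pf f -> (forall A, coprime_map A -> f A = 0) -> forall A, f A = 0.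
Proof.
move=> pff fr.
have zc : zcl (fun A => exists x : 'rV[k]_2, x != 0 /\ ev A x^T = 0).
  apply: (@elimination k _ _ 2 (fun A x => ev A x^T = 0)).
    by apply: zcl_eq0mx; pfx.
  by move=> A y s s0 H; rewrite linearZ /= evZ H scaler0.
pose A0 : 'M[k]_(2, d.+1) := \matrix_(i, j) (if i == 0 then (j == ord_max)%:R else (j == 0)%:R).
have r0 : ~ exists x : 'rV[k]_2, x != 0 /\ ev A0 x^T = 0.
  case=> x [x0 H]; move/eqP: x0; apply.
  have E0 : ev A0 x^T 0 0 = x 0 0 ^+ d.
    rewrite mxE (bigD1 ord_max) //= big1 ?addr0 => [|j jm]; rewrite !mxE eqxx; last by rewrite (negPf jm) mul0r.
    by rewrite eqxx mul1r subnn expr0 mulr1.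
  have E1 : ev A0 x^T 1 0 = x 0 1 ^+ d.
    rewrite mxE (bigD1 0) //= big1 ?addr0 => [|j jm]; rewrite !mxE /=; last by rewrite (negPf jm) mul0r.
    by rewrite mul1r subn0 expr0 mul1r.
  move: E0 E1; rewrite H !mxE => /esym/eqP; rewrite expf_eq0 => /andP[_ /eqP a0].
  move/esym/eqP; rewrite expf_eq0 => /andP[_ /eqP a1].
  by apply/rowP => j; rewrite mxE; case: (I2P j) => ->.
have [g [pg gz gA0]] := zc _ r0.
have [|H//|H] := pf_mul_eq0 pff pg.
  move=> A; have [rA|nA] := EM (coprime_map A); first by rewrite fr ?mul0r.
  rewrite gz ?mulr0 //; apply: contrapT => nx; apply: nA => x x0; apply/eqP => H.
  apply: nx; exists x^T; rewrite trmxK; split=> //; apply: contra x0 => /eqP xt.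
  by rewrite -[x]trmxK xt trmx0.
by rewrite H eqxx in gA0.
Qed.

Lemma elim2 P {hP : aff k P} (C : P -> 'M[k]_2 -> 'M[k]_(2, d.+1) -> Prop) :
  zcl (fun q : P * 'M[k]_2 * 'M[k]_(2, d.+1) => C q.1.1 q.1.2 q.2) ->
  (forall p h X s t, s != 0 -> t != 0 -> C p h X -> C p (s *: h) (t *: X)) ->
  zcl (fun p => exists h X, [/\ h != 0, X != 0 & C p h X]).
Proof.
move=> zC conic.
have z1 : zcl (fun q : P * 'rV[k]_4 => exists x : 'rV[k]_N, x != 0 /\ C q.1 (vec_mx (q.2 : 'rV_(2 * 2))) (vec_mx x)).
  apply: (@elimination k (P * 'rV[k]_4) _ N (fun q x => C q.1 (vec_mx (q.2 : 'rV_(2 * 2))) (vec_mx x))).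
    apply: (zcl_comp zC (f := fun q : P * 'rV[k]_4 * 'rV[k]_N =>
      ((q.1.1, vec_mx (q.1.2 : 'rV_(2 * 2))), vec_mx q.2 : 'M_(2, d.+1)))).
    by apply: pmap_pair; [apply: pmap_pair|]; pfs.
  move=> q x s s0 H; rewrite linearZ; rewrite -[vec_mx (q.2 : 'rV_(2 * 2))]scale1r.
  by apply: conic => //; exact: oner_neq0.
have z2 : zcl (fun p => exists y : 'rV[k]_4, y != 0 /\
    exists x : 'rV[k]_N, x != 0 /\ C p (vec_mx (y : 'rV_(2 * 2))) (vec_mx x)).
  apply: (@elimination k P _ 4 (fun p (y : 'rV[k]_4) =>
     exists x : 'rV[k]_N, x != 0 /\ C p (vec_mx (y : 'rV_(2 * 2))) (vec_mx x)) z1).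
  move=> p y s s0 [x [x0 H]]; exists x; split=> //.
  have -> : vec_mx (s *: y : 'rV_(2 * 2)) = s *: vec_mx (y : 'rV_(2 * 2)) :> 'M[k]_2 by exact: linearZ.
  rewrite -[vec_mx x]scale1r.
  by apply: conic => //; exact: oner_neq0.
apply: zcl_ext z2 => p; split=> [[y [y0 [x [x0 H]]]]|[h [X [h0 X0 H]]]].
  by exists (vec_mx (y : 'rV_(2 * 2))), (vec_mx x); split=> //; rewrite vec_mx_eq0.
have h0' : mxvec h != 0 by rewrite mxvec_eq0.
have X0' : mxvec X != 0 by rewrite mxvec_eq0.
by exists (mxvec h); split=> //; exists (mxvec X); split=> //; rewrite !mxvecK.
Qed.

Section Instance.
Variables (n : nat) (y : 'M[k]_2 * 'M[k]_(2, d.+1) -> 'rV[k]_n) (o : 'M[k]_2 * 'M[k]_(2, d.+1) -> k).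
Hypotheses (py : pmap y) (po : pf o).
Hypothesis yZ : forall h X s t, s != 0 -> t != 0 ->
  exists2 c, c != 0 & y (s *: h, t *: X) = c *: y (h, X) /\ o (s *: h, t *: X) = c * o (h, X).
Hypothesis y_neq0 : forall h X, h != 0 -> X != 0 -> y (h, X) != 0.
Hypothesis o_dense : forall A, coprime_map A -> exists2 h, h \in unitmx & o (h, Gam A h) != 0.

Definition base := ('M[k]_(2, d.+1) * 'M[k]_(3, N) * 'rV[k]_n)%type.
Definition yv h X : 'rV[k]_(1 + n) := row_mx (o (h, X))%:M (y (h, X)).
(** The linear form with coefficients (T, l) at the point with coordinates (o, y). The coefficient T
    is kept apart because equations will be polynomials in T over a factorial ring. *)
Definition pairing (l : 'rV[k]_n) T h X : k := T * o (h, X) + (l *m (y (h, X))^T) 0 0.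

Definition on_hit (p : base) T : Prop := p.1.1 != 0 /\ exists h,
  [/\ h \in unitmx, p.1.2 *m (xv (Gam p.1.1 h))^T = 0 & pairing p.2 T h (Gam p.1.1 h) = 0].

Definition on_closure (p : base) T : Prop := exists h X, [/\ h != 0, X != 0 &
  [/\ Xt p.1.1 h X, p.1.2 *m (xv X)^T = 0 & pairing p.2 T h X = 0]].

Hypothesis missed : exists p T, ~ on_closure p T.

Local Notation B := {mpoly k[@adim k base _]}.

Definition vanishing (Q : {poly B}) : Prop :=
  forall p T, on_hit p T -> (evp (cof p) Q).[T] = 0.

Lemma unit_neq0 h : h \in unitmx -> h != 0.
Proof.
by apply: contraTneq => ->; rewrite unitmxE det0 unitr0.
Qed.

Lemma hit_closure p T : on_hit p T -> on_closure p T.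
Proof.
move=> [A0 [h [hU u0 l0]]]; exists h, (Gam p.1.1 h); split; first exact: unit_neq0.
  exact: Gam_neq0.
by split=> //; exact: Xt_Gam.
Qed.

Lemma zcl_closure : zcl (fun q : base * k => on_closure q.1 q.2).
Proof.
apply: (@elim2 (base * k) _ (fun q h X =>
  [/\ Xt q.1.1.1 h X, q.1.1.2 *m (xv X)^T = 0 & pairing q.1.2 q.2 h X = 0])).
  pose Q := (base * k * 'M[k]_2 * 'M[k]_(2, d.+1))%type.
  have z1 : zcl (fun q : Q => Xt q.1.1.1.1.1 q.1.2 q.2) by apply: zcl_Xt; rewrite /base; pfs.
  have z2 : zcl (fun q : Q => q.1.1.1.1.2 *m (xv q.2)^T = 0).
    by apply: zcl_eq0mx; rewrite /xv /base; pfs.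
  have z3 : zcl (fun q : Q => pairing q.1.1.1.2 q.1.1.2 q.1.2 q.2 = 0).
    have pq : pmap (fun q : Q => (q.1.2, q.2)) by apply: pmap_pair; pfs.
    have po' := pf_comp po pq; have py' := pmap_comp py pq.
    by apply: zcl_eq; rewrite /pairing /base; pfs.
  by apply: zcl_ext (zcl_and z1 (zcl_and z2 z3)) => q; split=> [[? [? ?]]|[? ? ?]]; split.
move=> q h X s t s0 t0 [E u0 l0]; split; first by apply: XtZ => //; exact: ltnW.
  by rewrite xvZ linearZ -scalemxAr u0 scaler0.
have [c c0 [yE oE]] := yZ h X s0 t0.
by rewrite /pairing yE oE linearZ -scalemxAr mxE mulrCA -mulrDr -[_ + _]/(pairing _ _ _ _) l0 mulr0.
Qed.

Lemma pf_vanishing (f : base * k -> k) : pf f ->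
  exists Q : {poly B}, forall p T, f (p, T) = (evp (cof p) Q).[T].
Proof. exact: pf_poly. Qed.

(** By [dominance] the triples u with a solution h at which o is nonzero are dense, and at such an h
    every l can be completed by some T to a hyperplane through the point. So nothing nonzero that
    depends on (A, u, l) alone vanishes on the incidence variety. *)
Lemma no_T (r : B) : (forall p T, on_hit p T -> r.@[cof p] = 0) -> r = 0.
Proof.
move=> rH; apply: ev_inj => p; rewrite meval0.
have pr : pf (fun p : base => r.@[cof p]) by exact: pf_meval.
case: p => [[A u] l].
pose f B := r.@[cof ((B, u), l : 'rV[k]_n)].
have pA : pmap (fun B : 'M[k]_(2, d.+1) => ((B, u), l)).
  by apply: pmap_pair; [apply: pmap_pair|]; pfs.
suff fr B : coprime_map B -> f B = 0 by exact: (rat_dense (pf_comp pr pA) fr A).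
move=> rB; have [h0 h0U oh0] := o_dense rB.
have pu : pmap (fun u : 'M[k]_(3, N) => ((B, u), l)).
  by apply: pmap_pair; [apply: pmap_pair|]; pfs.
have [c cE] := pf_comp pr pu.
have po' : pf (fun h => o (h, Gam B h)).
  by apply: (pf_comp po); apply: pmap_pair; pfx.
have [e he] : exists e : 'I_4, mxvec h0 0 e != 0.
  have : mxvec h0 != 0 by rewrite mxvec_eq0; exact: unit_neq0.
  by move=> /row_nz.
rewrite /f; have := cE u; rewrite /= => ->.
rewrite (dominance char0 hd rB po' h0U oh0 he (c := c)) ?meval0 // => v h hU oh vx.
have -> : c.@[@cof k 'M[k]_(3, N) (aff_mx k 3 N) v] = r.@[cof ((B, v), l)] by rewrite cE.
apply: (rH _ (- (l *m (y (h, Gam B h))^T) 0 0 / o (h, Gam B h))).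
split; first exact: rat_neq0.
by exists h; split=> //; rewrite /pairing /= divfK // addNr.
Qed.

(** The incidence variety is covered by the image under psi of a dense open part of an affine space,
    both orthogonality conditions being parametrized by antisymmetric matrices. *)
Lemma vanishing_prime P Q : vanishing (P * Q) -> vanishing P \/ vanishing Q.
Proof.
move=> H.
pose T4 := ('M[k]_(2, d.+1) * 'M[k]_2 * 'M[k]_(3, N * N) * 'rV[k]_((1 + n) * (1 + n)))%type.
pose x (t : T4) := xv (Gam t.1.1.1 t.1.1.2).
pose L (t : T4) : 'rV[k]_(1 + n) := skew (yv t.1.1.2 (Gam t.1.1.1 t.1.1.2)) t.2.
pose psi (t : T4) : base * k := ((t.1.1.1, skew (x t) t.1.2, rsubmx (L t)), L t 0 0).
have px : pmap x by rewrite /x /xv; apply: pmap_mxvec; pfx.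
have pG : pmap (fun t : T4 => (t.1.1.2, Gam t.1.1.1 t.1.1.2)).
  by apply: pmap_pair; pfx.
have pL : pmap L.
  rewrite /L /yv; apply: pmap_skew; last by pfs.
  have po' := pf_comp po pG; have py' := pmap_comp py pG.
  by apply: pmap_row_mx => //; apply: pmap_scalar.
have ppsi : pmap psi.
  rewrite /psi; apply: pmap_pair; last by apply: pmap_k; apply: pf_entry.
  apply: pmap_pair; last by apply: pmap_rsubmx.
  by apply: pmap_pair; [pfs|apply: pmap_skew; pfs].
have pev R : pf (fun t : T4 => (evp (cof (psi t).1) R).[(psi t).2]).
  exact: (pf_comp (pf_evp R) ppsi).
have pd : pf (fun t : T4 => t.1.1.1 0 0 * \det t.1.1.2) by pfs.
have Lpair t : L t 0 0 * o (t.1.1.2, Gam t.1.1.1 t.1.1.2) +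
    (rsubmx (L t) *m (y (t.1.1.2, Gam t.1.1.1 t.1.1.2))^T) 0 0 = 0.
  exact: split_orth (skew_orth _ _).
have hit_psi t : t.1.1.1 != 0 -> t.1.1.2 \in unitmx -> on_hit (psi t).1 (psi t).2.
  move=> A0 hU; split=> //; exists t.1.1.2; split=> //; first exact: skew_orth.
  exact: Lpair.
have onto p T : on_hit p T -> exists t, psi t = (p, T).
  case: p => [[A u] l] /= [A0 [h [hU u0 l0]]].
  rewrite /= in A0 u0 l0.
  have yv0 : yv h (Gam A h) != 0.
    apply: contraNneq (y_neq0 (unit_neq0 hU) (Gam_neq0 A0 hU)) => E.
    by rewrite -[y _](@row_mxKr _ 1 1 n (o (h, Gam A h))%:M) -/(yv _ _) E linear0.
  have [|w wE] := @skew_onto k (1 + n) 1 (yv h (Gam A h)) (row_mx T%:M l) yv0.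
    rewrite /yv tr_row_mx mul_row_col tr_scalar_mx mul_scalar_mx scale_scalar_mx.
    by apply/matrixP => i j; rewrite !ord1 mxE [X in X + _]mxE eqxx mulr1n [RHS]mxE; exact: l0.
  have [|O' uE'] := @skew_onto k N 3 (xv (Gam A h)) u _ u0.
    by rewrite xv_eq0; exact: Gam_neq0.
  exists (((A, h), O'), w); rewrite /psi /x /L /= -uE' -wE row_mxKr; congr (_, _).
  by rewrite mxE; case: splitP => [j _|j //]; rewrite !ord1 mxE.
have z t : (evp (cof (psi t).1) P).[(psi t).2] *
    ((evp (cof (psi t).1) Q).[(psi t).2] * (t.1.1.1 0 0 * \det t.1.1.2)) = 0.
  have [->|a0] := eqVneq (t.1.1.1 0 0) 0; first by rewrite mul0r !mulr0.
  have [->|d0] := eqVneq (\det t.1.1.2) 0; first by rewrite !mulr0.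
  rewrite mulrA -hornerM -evpM H ?mul0r //; apply: hit_psi; last by rewrite unitmxE unitfE.
  by apply: contraNneq a0 => ->; rewrite mxE.
have [PE|QE] := pf_mul_eq0 (pev P) (pf_mul (pev Q) pd) z.
  by left=> p T /onto[t tE]; have := PE t; rewrite tE.
right=> p T /onto[t tE].
have [QE'|dE] := pf_mul_eq0 (pev Q) pd QE; first by have := QE' t; rewrite tE.
have := dE (((const_mx 1, 1%:M), 0), 0); rewrite /= det1 mxE mulr1 => /eqP.
by rewrite oner_eq0.
Qed.

(** Some prime factor Phi of a nonzero vanishing polynomial is vanishing itself. If it did not
    divide a vanishing Q, the eliminant of Phi and Q would be free of T and contradict [no_T]. As
    [on_closure] is cut out by vanishing polynomials, all multiples of Phi, it contains the zeros of
    Phi. *)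
Theorem generic_form : exists Phi : {poly B},
  [/\ rprime Phi, (1 < size Phi)%N, vanishing Phi,
    (forall Q, vanishing Q -> rdvd Phi Q) &
    (forall p T, (evp (cof p) Phi).[T] = 0 -> on_closure p T)].
Proof.
have U : ufd {poly B} by apply: ufd_poly; exact: ufd_mpoly.
have big Q : Q != 0 -> vanishing Q -> (1 < size Q)%N.
  move=> Q0 vQ; rewrite ltnNge; apply/negP => /size1_polyC; move: (Q`_0) => q0 QE.
  have c0 : q0 = 0 by apply: no_T => p T /vQ; rewrite QE evpC hornerC.
  by rewrite QE c0 polyC0 eqxx in Q0.
have cl p T : ~ on_closure p T -> exists2 Q : {poly B}, vanishing Q & (evp (cof p) Q).[T] != 0.
  move=> np; have [f [pff fz fn]] := @zcl_closure (p, T) np.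
  have [Q QE] := pf_vanishing pff; exists Q; last by rewrite -QE.
  by move=> q S /hit_closure qS; rewrite -QE fz.
have [Phi pPhi vPhi] : exists2 Phi, rprime Phi & vanishing Phi.
  have [p [T /cl[Q vQ Qn]]] := missed.
  have Q0 : Q != 0 by apply: contraNneq Qn => ->; rewrite /evp rmorph0 horner0.
  have [u [s [uU sp QE]]] := U _ Q0; rewrite {Qn Q0}QE in vQ.
  elim: s u uU sp vQ => [|q s IHs] u uU sp.
    rewrite big_nil mulr1 => vu; have [v vE] : exists v, u * v = 1 by exists u^-1; rewrite divrr.
    have v1 : vanishing 1 by move=> p' T' hp; rewrite -vE evpM hornerM vu ?mul0r.
    by have := big _ (oner_neq0 _) v1; rewrite size_poly1.
  rewrite big_cons mulrCA => /vanishing_prime[vq|]; first by exists q => //; apply: sp; rewrite mem_head.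
  by apply: IHs => // r rs; apply: sp; rewrite in_cons rs orbT.
have sPhi : (1 < size Phi)%N by apply: big => //; case: pPhi.
have dv Q : vanishing Q -> rdvd Phi Q.
  move=> vQ; apply: contrapT => nQ.
  have [r r0 rH] := prime_elim_root (@ufd_mpoly k _) pPhi sPhi nQ.
  move/eqP: r0; apply; apply: no_T => p T hp.
  exact: (rH _ (meval (cof p)) T (vPhi _ _ hp) (vQ _ _ hp)).
exists Phi; split=> // p T z; apply: contrapT => /cl[Q /dv[R ->]].
by rewrite evpM hornerM z mulr0 eqxx.
Qed.

End Instance.
End GenericHypersurface.

(** * Polynomial difference quotients *)

Section DifferenceQuotient.
Variable k : closedFieldType.

Lemma pf_cofc T {hT : aff k T} i : pf (fun t : T => cof t i).
Proof. exact: pf_cof. Qed.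

Lemma cof_pair A B {hA : aff k A} {hB : aff k B} (i : 'I_(@adim k (A * B) _)) :
  (exists j, forall a b, cof (a, b) i = cof (a : A) j) \/
  (exists j, forall a b, cof (a, b) i = cof (b : B) j).
Proof.
case: (splitP (i : 'I_(@adim k A hA + @adim k B hB))) => j ij; [left|right]; exists j => a b.
  by rewrite /cof /aco /= (_ : i = lshift _ j) ?row_mxEl //; apply: val_inj.
by rewrite /cof /aco /= (_ : i = rshift _ j) ?row_mxEr //; apply: val_inj.
Qed.

Lemma pf_ind T {hT : aff k T} (Q : (T -> k) -> Prop) :
  (forall f g, f =1 g -> Q f -> Q g) -> (forall c, Q (fun _ => c)) ->
  (forall i, Q (fun t => cof t i)) ->
  (forall f g, Q f -> Q g -> Q (fun t => f t + g t)) ->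
  (forall f g, Q f -> Q g -> Q (fun t => f t * g t)) -> forall f, pf f -> Q f.
Proof.
move=> Qe Qc Qi QD QM f [p pE]; apply: (Qe _ _ (fun t => esym (pE t))) => {f pE}.
elim/mpoly_ring_ind: p => [c|i|p q hp hq|p q hp hq].
- by apply: Qe (Qc c) => t; rewrite mevalC.
- by apply: Qe (Qi i) => t; rewrite mevalXU.
- by apply: Qe (QD _ _ hp hq) => t; rewrite mevalD.
- by apply: Qe (QM _ _ hp hq) => t; rewrite mevalM.
Qed.

Definition quotient P {hP : aff k P} n (f : P * 'rV[k]_n -> k) := pf f /\
  exists M : P * 'rV[k]_n * 'rV[k]_n -> 'rV[k]_n, pmap M /\
    forall p a b, f (p, b) - f (p, a) = (M (p, a, b) *m (b - a)^T) 0 0.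

(** Built by the rules for sums and products. On the diagonal M is the differential of f, see
    [quotient_diag]; so a relation between two distinct points specializes to one for tangent
    vectors. *)
Lemma difference_quotient P {hP : aff k P} n (f : P * 'rV[k]_n -> k) : pf f ->
  exists M : P * 'rV[k]_n * 'rV[k]_n -> 'rV[k]_n, pmap M /\
    forall p a b, f (p, b) - f (p, a) = (M (p, a, b) *m (b - a)^T) 0 0.
Proof.
have pa : pmap (fun q : P * 'rV[k]_n * 'rV[k]_n => q.1) by pfs.
have pb : pmap (fun q : P * 'rV[k]_n * 'rV[k]_n => (q.1.1, q.2)) by apply: pmap_pair; pfs.
move=> pff; refine (proj2 (@pf_ind (P * 'rV[k]_n)%type _ (@quotient P hP n) _ _ _ _ _ f pff)) => {f pff} [f g fg|c|i|f g [pf_f [M [pM ME]]] [pf_g [L [pL LE]]]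
    |f g [pf_f [M [pM ME]]] [pf_g [L [pL LE]]]].
- move=> [pf_f [M [pM ME]]]; split; first exact: pf_ext fg pf_f.
  by exists M; split=> // p a b; rewrite -!fg.
- split; first exact: pf_const.
  by exists (fun=> 0); split=> [|p a b]; [exact: pmap_const|rewrite subrr mul0mx mxE].
- split; first exact: pf_cofc.
  have [[j jE]|[j jE]] := cof_pair i.
    by exists (fun=> 0); split=> [|p a b]; [exact: pmap_const|rewrite !jE subrr mul0mx mxE].
  exists (fun=> vec_mx (delta_mx 0 j)); split=> [|p a b]; first exact: pmap_const.
  have co (v : 'rV[k]_n) : cof v j = (vec_mx (delta_mx 0 j) *m v^T) 0 0.
    rewrite /cof /aco /=; case/mxvec_indexP: j {jE} => a0 b0; rewrite mxvecE -mxvec_delta mxvecK.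
    by rewrite ord1 -rowE !mxE.
  by rewrite !jE !co linearB /= mulmxBr [in RHS]mxE [X in _ = _ + X]mxE.
- split; first exact: pf_add.
  exists (fun q => M q + L q); split=> [|p a b]; first exact: pmap_addmx.
  by rewrite mulmxDl mxE -ME -LE; ring.
- split; first exact: pf_mul.
  exists (fun q => g (q.1.1, q.2) *: M q + f q.1 *: L q); split=> [|p a b].
    have ga := pf_comp pf_g pb; have fa := pf_comp pf_f pa.
    by apply: pmap_addmx; apply: pmap_scale.
  move: (ME p a b) (LE p a b); rewrite mulmxDl -!scalemxAl; move: (M _ *m _) (L _ *m _) => X Y E1 E2.
  by rewrite !mxE -E1 -E2 /=; ring.
Qed.

Lemma difference_quotient_mx P {hP : aff k P} n m (F : P * 'rV[k]_n -> 'M[k]_(m, 1)) : pmap F ->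
  exists M : P * 'rV[k]_n * 'rV[k]_n -> 'M[k]_(m, n), pmap M /\
    forall p a b, F (p, b) - F (p, a) = M (p, a, b) *m (b - a)^T.
Proof.
move=> pF; have /choice[M ME] : forall i : 'I_m, exists M : P * 'rV[k]_n * 'rV[k]_n -> 'rV[k]_n,
    pmap M /\ forall p a b, F (p, b) i 0 - F (p, a) i 0 = (M (p, a, b) *m (b - a)^T) 0 0.
  by move=> i; apply: (difference_quotient (f := fun q => F q i 0)); pfs.
exists (fun q => \matrix_(i, j) M i q 0 j); split=> [|p a b].
  by apply: pmap_matrix => i j; apply: pf_entry; exact: (ME i).1.
apply/matrixP => i j; rewrite ord1 mxE [X in _ + X]mxE (ME i).2 !mxE.
by apply: eq_bigr => l _; rewrite [in RHS]mxE.
Qed.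

Lemma quotient_diag n m (F : 'rV[k]_n -> 'M[k]_(m, 1)) (M : 'rV[k]_n -> 'rV[k]_n -> 'M[k]_(m, n))
    (a v : 'rV[k]_n) (D : 'M[k]_(m, 1)) (e : 'M[{poly k}]_(m, 1)) :
  pmap (fun q : 'rV[k]_n * 'rV[k]_n => M q.1 q.2) ->
  (forall a b, F b - F a = M a b *m (b - a)^T) ->
  (forall t, F (a + t *: v) = F a + t *: D + t ^+ 2 *: map_mx (horner^~ t) e) ->
  M a a *m v^T = D.
Proof.
move=> pM ME FE; apply/matrixP => i j; rewrite ord1 {j}.
have p1 : pf (fun t : k => (M a (a + t *: v) *m v^T) i 0).
  have pp : pmap (fun t : k => (a, a + t *: v)) by apply: pmap_pair; pfs.
  by have pM' := pmap_comp pM pp; pfs.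
have [q qE] := pf_k p1.
have E : q = (D i 0)%:P + 'X * e i 0.
  apply: poly_eq_nz => t t0; rewrite -qE !(hornerD, hornerM, hornerC, hornerX).
  apply: (mulfI t0); have := ME a (a + t *: v); rewrite FE -[F a + _ + _]addrA [F a + _]addrC addrK [a + _]addrC addrK => H.
  have := congr1 (fun B : 'M[k]_(m, 1) => B i 0) H.
  rewrite linearZ /= -scalemxAr; move: (M _ _ *m _) => Y; rewrite !mxE => <-; rewrite mulrDr mulrA -expr2 addrC; congr (_ + _).
by have := qE 0; rewrite scale0r addr0 E !(hornerD, hornerM, hornerC, hornerX) mul0r addr0.
Qed.

End DifferenceQuotient.

(** * Double roots as limits of pairs of distinct roots *)

Section DoubleRoot.
Variable k : closedFieldType.
Implicit Types (c : {poly {poly k}}) (E : {poly {poly {poly k}}}).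

Definition ev2 t T : {poly {poly k}} -> k := horner_eval t \o horner_eval T%:P.
HB.instance Definition _ t T := GRing.RMorphism.on (ev2 t T).

Lemma ev2E c t T : ev2 t T c = (map_poly (horner_eval t) c).[T].
Proof.
transitivity ((map_poly (horner_eval t) c).[horner_eval t T%:P]); last by rewrite horner_evalE hornerC.
exact: esym (horner_map (horner_eval t) c T%:P).
Qed.

Lemma ev2C a t T : ev2 t T a%:P = a.[t].
Proof. by rewrite /ev2 /= !horner_evalE hornerC. Qed.

Lemma ev2X t T : ev2 t T 'X = T.
Proof. by rewrite /ev2 /= !horner_evalE hornerX hornerC. Qed.

Lemma cof_k (x : k) i : cof x i = x.
Proof. by rewrite /cof /aco /= ord1 mxE eqxx. Qed.

Lemma pf_ev2 (f : k * k -> k) : pf f -> exists c, forall t T, f (t, T) = ev2 t T c.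
Proof.
move: f; apply: (pf_ind (Q := fun f : k * k -> k => exists c, forall t T, f (t, T) = ev2 t T c))
  => [f g fg [c cE]|a|i|f g [c cE] [b bE]|f g [c cE] [b bE]].
- by exists c => t T; rewrite -fg.
- by exists a%:P%:P => t T; rewrite ev2C hornerC.
- have [[j jE]|[j jE]] := cof_pair i.
    by exists ('X)%:P => t T; rewrite jE ev2C hornerX cof_k.
  by exists 'X => t T; rewrite jE ev2X cof_k.
- by exists (c + b) => t T; rewrite rmorphD /= -cE -bE.
- by exists (c * b) => t T; rewrite rmorphM /= -cE -bE.
Qed.

Lemma pf_ev3 (f : k * k * k -> k) : pf f ->
  exists E, forall t T S, f ((t, T), S) = (map_poly (ev2 t T) E).[S].
Proof.
move: f; apply: (pf_ind (Q := fun f : k * k * k -> k =>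
    exists E, forall t T S, f ((t, T), S) = (map_poly (ev2 t T) E).[S]))
  => [f g fg [c cE]|a|i|f g [c cE] [b bE]|f g [c cE] [b bE]].
- by exists c => t T S; rewrite -fg.
- by exists a%:P%:P%:P => t T S; rewrite map_polyC hornerC /= ev2C hornerC.
- have [[j jE]|[j jE]] := cof_pair i; last first.
    by exists 'X => t T S; rewrite jE map_polyX hornerX cof_k.
  have [c cE] := pf_ev2 (pf_cof (T := (k * k)%type) j).
  by exists c%:P => t T S; rewrite jE map_polyC hornerC /= -cE.
- by exists (c + b) => t T S; rewrite rmorphD hornerD /= -cE -bE.
- by exists (c * b) => t T S; rewrite rmorphM hornerM /= -cE -bE.
Qed.

Lemma size_map_le (A B : nzRingType) (f : {additive A -> B}) (p : {poly A}) :
  (size (map_poly f p) <= size p)%N.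
Proof. by apply/leq_sizeP => j /(nth_default 0) E; rewrite coef_map E raddf0. Qed.

Lemma many_roots (p : {poly k}) n (rs : seq k) : (size p <= n)%N -> uniq rs -> size rs = n ->
  (forall x, x \in rs -> p.[x] = 0) -> p = 0.
Proof.
move=> sp ur sr pr; apply/eqP; apply: contraT => p0.
have : (size rs < size p)%N by apply: max_poly_roots p0 _ ur; apply/allP => x /pr /eqP.
by rewrite sr ltnNge sp.
Qed.

Section Family.
Variables (Psi : {poly {poly k}}) (n : nat) (r : {poly k}) (t0 T0 : k).
Hypotheses (sPsi : (size Psi <= n.+1)%N) (lc : (Psi`_n).[t0] != 0) (r0 : r != 0).
Hypothesis generic : forall t, r.[t] != 0 ->
  exists rs : seq k, [/\ uniq rs, size rs = n & forall T, T \in rs -> ev2 t T Psi = 0].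
Hypothesis root0 : ev2 t0 T0 Psi = 0.

Lemma Psi_size : size Psi = n.+1.
Proof.
apply/eqP; rewrite eqn_leq sPsi ltnNge; apply: contra lc => /(nth_default 0) ->.
by rewrite horner0.
Qed.

Lemma Psi_lead : lead_coef Psi = Psi`_n.
Proof. by rewrite /lead_coef Psi_size. Qed.

Lemma Psi_neq0 : Psi != 0.
Proof. by rewrite -size_poly_gt0 Psi_size. Qed.

Lemma generic0 (a : {poly k}) : (forall t, r.[t] != 0 -> a.[t] = 0) -> a = 0.
Proof.
move=> H; have /eqP : r * a = 0.
  apply: poly_eq_nz => t _; rewrite hornerM horner0.
  by have [->|/H ->] := eqVneq r.[t] 0; rewrite ?mul0r ?mulr0.
by rewrite mulf_eq0 (negPf r0) => /eqP.
Qed.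

(** The remainder of c modulo Psi has degree less than n in T and, for generic t, has n roots; so it
    is zero, and a power of the leading coefficient times c is a multiple of Psi. That power
    survives at t0. *)
Lemma vanish_closure c :
  (forall t T, r.[t] != 0 -> ev2 t T Psi = 0 -> ev2 t T c = 0) -> ev2 t0 T0 c = 0.
Proof.
move=> cH; have E := Pdiv.Idomain.divp_eq c Psi.
have sR : (size (c %% Psi)%R <= n)%N by rewrite -ltnS -Psi_size Pdiv.Idomain.ltn_modp Psi_neq0.
have R0 : (c %% Psi)%R = 0.
  apply/polyP => i; rewrite coef0; apply: generic0 => t rt.
  have [rs [ur sr rz]] := generic rt.
  have : map_poly (horner_eval t) (c %% Psi)%R = 0.
    apply: (many_roots _ ur sr); first exact: leq_trans (size_map_le _ _) sR.
    move=> T Trs; rewrite -ev2E; have := congr1 (ev2 t T) E.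
    rewrite rmorphD rmorphM /= rz // mulr0 add0r -mul_polyC rmorphM /= cH ?mulr0 ?rz // => <-.
  by move/(congr1 (fun p : {poly k} => p`_i)); rewrite coef_map coef0.
have := congr1 (ev2 t0 T0) E; rewrite R0 addr0 rmorphM /= root0 mulr0 -mul_polyC rmorphM /=.
rewrite ev2C horner_exp Psi_lead => /eqP; rewrite mulf_eq0 expf_eq0 (negPf lc) andbF.
by move=> /eqP.
Qed.

(** For generic t the polynomial (S - T) E vanishes at all pairs of roots, so at (t0, T0) it is a
    multiple of Psi (t0, S) and hence of (S - T0) ^ 2. One factor S - T0 cancels: two roots that
    merge at T0 still satisfy E. *)
Lemma double_root E :
  (forall t T S, r.[t] != 0 -> ev2 t T Psi = 0 -> ev2 t S Psi = 0 -> T != S ->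
     (map_poly (ev2 t T) E).[S] = 0) ->
  ('X - T0%:P) ^+ 2 %| map_poly (horner_eval t0) Psi -> (map_poly (ev2 t0 T0) E).[T0] = 0.
Proof.
move=> EH /dvdpP[b bE]; pose Psi2 := map_poly polyC Psi.
pose F : {poly {poly {poly k}}} := ('X - ('X)%:P) * E.
have mP t T : map_poly (ev2 t T) Psi2 = map_poly (horner_eval t) Psi.
  by apply/polyP => i; rewrite !coef_map /= ev2C.
have mF t T S : (map_poly (ev2 t T) F).[S] = (S - T) * (map_poly (ev2 t T) E).[S].
  by rewrite rmorphM rmorphB /= map_polyX map_polyC /= ev2X hornerM hornerXsubC.
have D := Pdiv.Idomain.divp_eq F Psi2.
have sP2 : size Psi2 = n.+1 by rewrite size_map_polyC Psi_size.
have P20 : Psi2 != 0 by rewrite -size_poly_gt0 sP2.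
have sR : (size (F %% Psi2)%R <= n)%N by rewrite -ltnS -sP2 Pdiv.Idomain.ltn_modp.
have R0 : map_poly (ev2 t0 T0) (F %% Psi2)%R = 0.
  apply/polyP => i; rewrite coef0 coef_map /=; apply: vanish_closure => t T rt zT.
  have [rs [ur sr rz]] := generic rt.
  have : map_poly (ev2 t T) (F %% Psi2)%R = 0.
    apply: (many_roots _ ur sr); first exact: leq_trans (size_map_le _ _) sR.
    move=> S Srs; have := congr1 (fun p => (map_poly (ev2 t T) p).[S]) D.
    rewrite rmorphD rmorphM /= mP hornerD hornerM -ev2E rz // mulr0 add0r => <-.
    rewrite -mul_polyC rmorphM hornerM mF.
    have [->|ST] := eqVneq S T; first by rewrite subrr mul0r mulr0.
    by rewrite (EH t T S rt zT (rz _ Srs)) ?mulr0 // eq_sym.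
  by move/(congr1 (fun p : {poly k} => p`_i)); rewrite coef_map coef0.
have := congr1 (map_poly (ev2 t0 T0)) D.
rewrite rmorphD rmorphM /= mP R0 addr0 bE -mul_polyC rmorphM /= map_polyC /=.
have -> : ev2 t0 T0 (lead_coef Psi2 ^+ Pdiv.Idomain.scalp F Psi2) = (Psi`_n).[t0] ^+ Pdiv.Idomain.scalp F Psi2.
  by rewrite rmorphXn /= lead_coef_map_inj ?Psi_lead /= ?ev2C //; exact: polyC_inj.
set l := _ ^+ _; have l0 : l != 0 by rewrite expf_neq0.
rewrite rmorphM rmorphB /= map_polyX map_polyC /= ev2X => H.
have X0 : 'X - T0%:P != 0 by rewrite polyXsubC_eq0.
have : l%:P * map_poly (ev2 t0 T0) E = map_poly (ev2 t0 T0) (F %/ Psi2)%R * b * ('X - T0%:P).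
  by apply: (mulfI X0); rewrite mulrCA H; ring.
move/(congr1 (horner^~ T0)); rewrite !hornerM hornerXsubC subrr mulr0 hornerC => /eqP.
by rewrite mulf_eq0 (negPf l0) => /eqP.
Qed.

End Family.
End DoubleRoot.

(** * Three-cycles of the power map *)

Section PowerMap.
Variables (k : closedFieldType) (d : nat).
Hypothesis char0 : [pchar k] =i pred0.
Hypothesis hd : (2 <= d)%N.
Implicit Types (A X : 'M[k]_(2, d.+1)) (h g : 'M[k]_2) (x y z v : 'cV[k]_2).
Local Notation N := (2 * d.+1)%N.

Definition powA : 'M[k]_(2, d.+1) :=
  \matrix_(i, j) (if i == 0 then (j == ord_max)%:R else (j == 0)%:R).

Lemma ev_pow x : ev powA x = vec2 (x 0 0 ^+ d) (x 1 0 ^+ d).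
Proof.
apply: col2P; rewrite ?vec2_0 ?vec2_1 mxE.
  rewrite (bigD1 ord_max) //= big1 ?addr0 => [|j jm]; rewrite !mxE eqxx; last by rewrite (negPf jm) mul0r.
  by rewrite eqxx mul1r subnn expr0 mulr1.
rewrite (bigD1 0) //= big1 ?addr0 => [|j jm]; rewrite !mxE /=; last by rewrite (negPf jm) mul0r.
by rewrite mul1r subn0 expr0 mul1r.
Qed.

Lemma d_gt0 : (0 < d)%N. Proof. exact: ltnW. Qed.

Lemma rat_pow : coprime_map powA.
Proof.
move=> x x0; apply: contra x0; rewrite ev_pow => /eqP E; apply/eqP/col2P; rewrite mxE.
  have := congr1 (fun v : 'cV[k]_2 => v 0 0) E; rewrite vec2_0 mxE => /eqP.
  by rewrite expf_eq0 d_gt0 => /eqP.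
have := congr1 (fun v : 'cV[k]_2 => v 1 0) E; rewrite vec2_1 mxE => /eqP.
by rewrite expf_eq0 d_gt0 => /eqP.
Qed.

Lemma dmon_first x y : dmon d x y 0 0 = d%:R * (x 1 0 ^+ d.-1 * y 1 0).
Proof. by rewrite dmonE subn0 /= !mul0r !expr0 add0r mul1r. Qed.

Lemma dmon_last x y : dmon d x y ord_max 0 = d%:R * (x 0 0 ^+ d.-1 * y 0 0).
Proof. by rewrite dmonE subnn /= !mul0r !mulr0 addr0 expr0 mulr1. Qed.

Lemma dev_pow x y : dev powA x y = vec2 (d%:R * (x 0 0 ^+ d.-1 * y 0 0)) (d%:R * (x 1 0 ^+ d.-1 * y 1 0)).
Proof.
apply: col2P; rewrite ?vec2_0 ?vec2_1 mxE.
  rewrite (bigD1 ord_max) //= big1 ?addr0 => [|j jm]; rewrite [powA _ _]mxE eqxx; last by rewrite (negPf jm) mul0r.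
  by rewrite eqxx mul1r dmon_last.
rewrite (bigD1 0) //= big1 ?addr0 => [|j jm]; rewrite [powA _ _]mxE /=; last by rewrite (negPf jm) mul0r.
by rewrite mul1r dmon_first.
Qed.

Lemma Gq0_pow v : v 0 0 = 1 -> Gq 0 powA v v = vec2 0 (- (d%:R * v 1 0 ^+ d.-1)).
Proof.
move=> v0; have E i : \sum_(j < d - i) (v 1 0 * v 0 0) ^+ (d - i - j.+1) * (v 1 0 * v 0 0) ^+ j =
    (d - i)%:R * v 1 0 ^+ (d - i).-1.
  rewrite v0 mulr1 (eq_bigr (fun=> v 1 0 ^+ (d - i).-1)) ?sumr_const ?card_ord ?mulr_natl // => j _.
  by rewrite -exprD; congr (_ ^+ _); move: (ltn_ord j); lia.
apply: col2P; rewrite ?vec2_0 ?vec2_1 mxE /=.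
  rewrite big1 ?oppr0 // => i _; rewrite E mxE eqxx; case: eqP => [->|_]; last by rewrite mul0r.
  by rewrite subnn mul0r !mulr0.
rewrite (eq_bigr (fun i : 'I_d.+1 => (i == 0)%:R * ((d - i)%:R * v 1 0 ^+ (d - i).-1))) => [|i _].
  rewrite (bigD1 0) //= big1 ?addr0 => [|j jm]; last by rewrite (negPf jm) mul0r.
  by rewrite mul1r subn0.
by rewrite E mxE /= v0 mulr1 expr1n mul1r.
Qed.

Lemma Gq1_pow v : v 1 0 = 1 -> Gq 1 powA v v = vec2 (d%:R * v 0 0 ^+ d.-1) 0.
Proof.
move=> v1; have E i : \sum_(j < i) (v 0 0 * v 1 0) ^+ (i - j.+1) * (v 0 0 * v 1 0) ^+ j =
    i%:R * v 0 0 ^+ i.-1.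
  rewrite v1 mulr1 (eq_bigr (fun=> v 0 0 ^+ i.-1)) ?sumr_const ?card_ord ?mulr_natl // => j _.
  by rewrite -exprD; congr (_ ^+ _); move: (ltn_ord j); lia.
apply: col2P; rewrite ?vec2_0 ?vec2_1 mxE /=.
  rewrite (eq_bigr (fun i : 'I_d.+1 => (i == ord_max)%:R * (i%:R * v 0 0 ^+ i.-1))) => [|i _].
    rewrite (bigD1 ord_max) //= big1 ?addr0 => [|j jm]; last by rewrite (negPf jm) mul0r.
    by rewrite eqxx mul1r.
  by rewrite E mxE /= v1 mulr1 expr1n mul1r.
rewrite big1 // => i _; rewrite E mxE /=; case: eqP => [->|_]; last by rewrite mul0r.
by rewrite mul0r !mulr0.
Qed.

Lemma pow_fix (v : k) : v = v ^+ d -> v = 0 \/ v ^+ d.-1 = 1.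
Proof.
move=> E; have [->|v0] := eqVneq v 0; [by left|right].
by apply: (mulfI v0); rewrite -exprS prednK ?d_gt0 // -E mulr1.
Qed.

(** The multiplier of x ^ d is 0 at 0 and infinity, and d at the fixed roots of unity. *)
Lemma slope_pow e v : v e 0 = 1 -> fixv powA v -> slope powA e v = 0 \/ slope powA e v = - d%:R.
Proof.
have d1 : (0 < d.-1)%N by rewrite -ltnS prednK ?d_gt0.
rewrite /fixv /slope ev_pow /wedge vec2_0 vec2_1; case: (I2P e) => -> ve; rewrite ve expr1n.
  rewrite mul1r mul1r => /eqP; rewrite subr_eq0 eq_sym => /eqP /pow_fix.
  rewrite (Gq0_pow ve) vec2_0 vec2_1 mul0r subr0 mul1r vec2_0 ?expr1n divr1 => -[->|->].
    by left; rewrite expr0n (gtn_eqF d1) mulr0 oppr0.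
  by right; rewrite mulr1.
rewrite !mulr1 => /eqP; rewrite subr_eq0 => /eqP /pow_fix.
rewrite (Gq1_pow ve) vec2_0 vec2_1 mulr0 sub0r ?mulr1 vec2_1 ?expr1n divr1 => -[->|->].
  by left; rewrite expr0n (gtn_eqF d1) mulr0 oppr0.
by right; rewrite mulr1.
Qed.

Definition x1 : 'cV[k]_2 := vec2 0 1.
Definition x2 : 'cV[k]_2 := vec2 1 0.
Definition x3 : 'cV[k]_2 := vec2 1 1.

Lemma x1_0 : x1 0 0 = 0. Proof. exact: vec2_0. Qed.
Lemma x1_1 : x1 1 0 = 1. Proof. exact: vec2_1. Qed.
Lemma x2_0 : x2 0 0 = 1. Proof. exact: vec2_0. Qed.
Lemma x2_1 : x2 1 0 = 0. Proof. exact: vec2_1. Qed.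
Lemma x3_0 : x3 0 0 = 1. Proof. exact: vec2_0. Qed.
Lemma x3_1 : x3 1 0 = 1. Proof. exact: vec2_1. Qed.
Local Notation xE := (x1_0, x1_1, x2_0, x2_1, x3_0, x3_1).

(* X maps 0 to infinity, infinity to 1 and 1 to 0. *)
Definition cyc X : Prop :=
  [/\ wedge (ev X x1) x2 = 0, wedge (ev X x2) x3 = 0 & wedge (ev X x3) x1 = 0].

Definition cycL X : 'cV[k]_3 :=
  \col_i (if i == 0 then wedge (ev X x1) x2 else if i == 1 then wedge (ev X x2) x3 else wedge (ev X x3) x1).

(** The three cycle conditions are linear in X; this is the triple of hyperplanes they define. *)
Definition cycu : 'M[k]_(3, N) := \matrix_(i, j) cycL (vec_mx (delta_mx 0 j)) i 0.

Lemma cycuE X : cycu *m (xv X)^T = cycL X.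
Proof.
have L : linear cycL.
  move=> a Y Z; apply/matrixP => i j; rewrite 2![in RHS]mxE ![cycL _ _ _]mxE.
  have E x : ev (a *: Y + Z) x = a *: ev Y x + ev Z x by rewrite /ev mulmxDl -scalemxAl.
  have W x y z : wedge (a *: x + y) z = a * wedge x z + wedge y z by rewrite /wedge !mxE; ring.
  by rewrite !E !W; do 2 case: ifP => // _.
pose F : {linear 'M[k]_(2, d.+1) -> 'cV[k]_3} := HB.pack cycL (GRing.isLinear.Build _ _ _ _ _ L).
rewrite -[X in RHS]mxvecK -/(xv X) [xv X in RHS]row_sum_delta -[RHS]/(F _) !linear_sum.
apply/matrixP => i j; rewrite ord1 mxE summxE; apply: eq_bigr => l _.
by rewrite !linearZ /= [RHS]mxE mxE [X in _ * X = _]mxE mulrC.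
Qed.

Lemma cycuP X : cycu *m (xv X)^T = 0 <-> cyc X.
Proof.
rewrite cycuE; split=> [H|[c1 c2 c3]].
  have E i : cycL X i 0 = 0 by rewrite H mxE.
  split; first by move: (E 0); rewrite mxE.
    by move: (E 1); rewrite mxE.
  by move: (E (inord 2)); rewrite mxE -!val_eqE /= inordK.
by apply/matrixP => i j; rewrite [RHS]mxE mxE; do 2 case: ifP => // _.
Qed.

Lemma wedge_self x : wedge x x = 0.
Proof. by rewrite /wedge mulrC subrr. Qed.

Lemma wedgeZl c x y : wedge (c *: x) y = c * wedge x y.
Proof. by rewrite /wedge !mxE; ring. Qed.

Lemma wedgeZr c x y : wedge x (c *: y) = c * wedge x y.
Proof. by rewrite /wedge !mxE; ring. Qed.

Lemma wedgeC x y : wedge x y = - wedge y x.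
Proof. by rewrite /wedge; ring. Qed.

Lemma wedge_neq0l x y : wedge x y != 0 -> x != 0.
Proof. by apply: contra_neq => ->; rewrite /wedge !mxE; ring. Qed.

Lemma wedge_neq0r x y : wedge x y != 0 -> y != 0.
Proof. by rewrite wedgeC oppr_eq0; exact: wedge_neq0l. Qed.

Lemma col_row_mul m n (u : 'cV[k]_m) (v : 'rV[k]_n) i j : (u *m v) i j = u i 0 * v 0 j.
Proof. by rewrite mxE big_ord1. Qed.

Section NoCycle.
Variables (w m : 'rV[k]_2) (s kap : k) (M : 'M[k]_2).
Hypotheses (wM : w *m M = s *: w) (dM : \det M = - kap * s ^+ 2)
  (M0 : s = 0 -> forall x, M *m x = (w *m x) 0 0 *: m^T) (m0 : m != 0) (w0 : w != 0)
  (kap3 : (- kap) ^+ 3 != 1).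
Let q x := (w *m x) 0 0.

Lemma qM x c y : M *m x = c *: y -> s * q x = c * q y.
Proof.
move=> E; have := congr1 (fun v => (w *m v) 0 0) E.
have Z a (v : 'M[k]_1) : (a *: v) 0 0 = a * v 0 0 by rewrite mxE.
by rewrite mulmxA wM -scalemxAl -scalemxAr !Z.
Qed.

Lemma to_multiple x y : y != 0 -> wedge (M *m x) y = 0 -> exists c, M *m x = c *: y.
Proof. by move=> y0; rewrite wedgeC => /eqP; rewrite oppr_eq0 => /eqP /(wedge0 y0). Qed.

Lemma no_cycle0 a b c : wedge a b != 0 -> wedge b c != 0 -> wedge c a != 0 -> q a = 0 ->
  q b != 0 -> q c != 0 -> wedge (M *m b) c = 0 -> wedge (M *m c) a = 0 -> False.
Proof.
move=> ab bc ca qa qb qc /(to_multiple (wedge_neq0r bc))[cb bE] /(to_multiple (wedge_neq0r ca))[cc cE].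
have s0 : s = 0.
  by have /eqP := qM cE; rewrite qa mulr0 mulf_eq0 (negPf qc) orbF => /eqP.
rewrite !(M0 s0) in bE cE; have [r1 mb] : exists r1, m^T = r1 *: c.
  by exists (cb / q b); apply: (scalerI qb); rewrite bE scalerA mulrC divfK.
have [r2 mc] : exists r2, m^T = r2 *: a.
  by exists (cc / q c); apply: (scalerI qc); rewrite cE scalerA mulrC divfK.
have /eqP : wedge m^T m^T = 0 by exact: wedge_self.
rewrite {1}mb mc wedgeZl wedgeZr !mulf_eq0 (negPf ca) orbF => /orP[/eqP z|/eqP z].
  by move: m0; rewrite -[m]trmxK mb z scale0r trmx0 eqxx.
by move: m0; rewrite -[m]trmxK mc z scale0r trmx0 eqxx.
Qed.

(** M is the linear map by which a limit form acts off its hole, the kernel of w. If none of the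
    points is the hole, the covector w gives c1 c2 c3 = s ^ 3 and the determinants give (c1 c2 c3) ^
    2 = (det M) ^ 3, hence (- kap) ^ 3 = 1 or s = 0. If one of them is the hole, then s = 0 as well.
    For s = 0 the map is constant, which excludes a cycle. *)
Lemma no_cycle a b c : wedge a b != 0 -> wedge b c != 0 -> wedge c a != 0 ->
  (q a != 0 -> wedge (M *m a) b = 0) -> (q b != 0 -> wedge (M *m b) c = 0) ->
  (q c != 0 -> wedge (M *m c) a = 0) -> False.
Proof.
move=> ab bc ca Ha Hb Hc.
have two x y : wedge x y != 0 -> q x = 0 -> q y != 0.
  move=> xy qx; apply: contra xy => /eqP qy.
  have [e we] := row_nz w0; move: qx qy; rewrite /q !mul2E => qx qy.
  have E0 : w 0 0 * wedge x y = 0.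
    rewrite /wedge; transitivity ((w 0 0 * x 0 0 + w 0 1 * x 1 0) * y 1 0 - (w 0 0 * y 0 0 + w 0 1 * y 1 0) * x 1 0).
      by ring.
    by rewrite qx qy; ring.
  have E1 : w 0 1 * wedge x y = 0.
    rewrite /wedge; transitivity ((w 0 0 * y 0 0 + w 0 1 * y 1 0) * x 0 0 - (w 0 0 * x 0 0 + w 0 1 * x 1 0) * y 0 0).
      by ring.
    by rewrite qx qy; ring.
  by case: (I2P e) we => -> we; [move/eqP: E0|move/eqP: E1]; rewrite mulf_eq0 (negPf we).
have [qa|qa] := eqVneq (q a) 0.
  have qb := two _ _ ab qa; have qc : q c != 0 by apply: two qa; rewrite wedgeC oppr_eq0.
  exact: no_cycle0 ab bc ca qa qb qc (Hb qb) (Hc qc).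
have [qb|qb] := eqVneq (q b) 0.
  have qc := two _ _ bc qb.
  exact: no_cycle0 bc ca ab qb qc qa (Hc qc) (Ha qa).
have [qc|qc] := eqVneq (q c) 0; first exact: no_cycle0 ca ab bc qc qa qb (Ha qa) (Hb qb).
have [c1 E1] := to_multiple (wedge_neq0r ab) (Ha qa).
have [c2 E2] := to_multiple (wedge_neq0r bc) (Hb qb).
have [c3 E3] := to_multiple (wedge_neq0r ca) (Hc qc).
have [F1 [F2 F3]] := (qM E1, (qM E2, qM E3)).
have W1 : c1 * c2 * wedge b c = \det M * wedge a b by rewrite -wedge_mul E1 E2 wedgeZl wedgeZr mulrA.
have W2 : c2 * c3 * wedge c a = \det M * wedge b c by rewrite -wedge_mul E2 E3 wedgeZl wedgeZr mulrA.
have W3 : c3 * c1 * wedge a b = \det M * wedge c a by rewrite -wedge_mul E3 E1 wedgeZl wedgeZr mulrA.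
have q0 : q a * q b * q c != 0 by rewrite !mulf_neq0.
have C : c1 * c2 * c3 = s ^+ 3.
  apply: (mulIf q0); transitivity ((c1 * q b) * (c2 * q c) * (c3 * q a)); first by ring.
  by rewrite -F1 -F2 -F3; ring.
have w3 : wedge a b * wedge b c * wedge c a != 0 by rewrite !mulf_neq0.
have D : s ^+ 6 = (- kap) ^+ 3 * s ^+ 6.
  apply: (mulIf w3); transitivity ((c1 * c2 * wedge b c) * (c2 * c3 * wedge c a) * (c3 * c1 * wedge a b)).
    by rewrite (_ : s ^+ 6 = (c1 * c2 * c3) ^+ 2); [ring|rewrite C -exprM].
  by rewrite W1 W2 W3 dM; ring.
have [s0|s0] := eqVneq s 0.
  move/eqP: F1; rewrite s0 mul0r eq_sym mulf_eq0 (negPf qb) orbF => /eqP c10.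
  move: E1; rewrite c10 scale0r (M0 s0) => /eqP; rewrite scaler_eq0 (negPf qa) /= => /eqP mT.
  by move: m0; rewrite -[m]trmxK mT trmx0 eqxx.
move/eqP: kap3; apply; apply: (mulIf (expf_neq0 6 s0)); rewrite mul1r; exact: esym D.
Qed.

End NoCycle.

Lemma wx12 : wedge x1 x2 != 0. Proof. by rewrite /wedge !xE mul0r mul1r sub0r oppr_eq0 oner_neq0. Qed.
Lemma wx23 : wedge x2 x3 != 0. Proof. by rewrite /wedge !xE mulr0 mul1r subr0 oner_neq0. Qed.
Lemma wx31 : wedge x3 x1 != 0. Proof. by rewrite /wedge !xE mul0r mul1r subr0 oner_neq0. Qed.

Lemma natr_inj (a b : nat) : a%:R = b%:R :> k -> a = b.
Proof.
wlog ab : a b / (a <= b)%N => [H E|/eqP].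
  by case/orP: (leq_total a b) => /H; [exact|move/(_ (esym E))].
rewrite eq_sym -subr_eq0 -natrB // (natr_eq0 char0) subn_eq0 => ba.
by apply/eqP; rewrite eqn_leq ab.
Qed.

(** Here kap is 0 or minus a multiplier of the power map, so (- kap) ^ 3 is 0 or d ^ 3 and never
    1. *)
Lemma cyc_no_boundary h X : h != 0 -> X != 0 -> \det h = 0 -> Xt powA h X -> cyc X -> False.
Proof.
move=> h0 X0 dh XX [C1 C2 C3]; have [e [v [w [ve w0 hE]]]] := rank1 h0 dh.
have [kap [e' [t [m [we m0 _ XE kE]]]]] := Xt_sing d_gt0 rat_pow X0 ve w0 hE XX.
have kap3 : (- kap) ^+ 3 != 1.
  have d3 : (- - d%:R : k) ^+ 3 != 1.
    rewrite opprK -natrX; apply/eqP => /(@natr_inj _ 1) /eqP.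
    by rewrite -[X in _ == X](exp1n 3) eqn_exp2r // gtn_eqF.
  have z3 : (- 0 : k) ^+ 3 != 1 by rewrite oppr0 expr0n eq_sym oner_neq0.
  case: kE => [[fv ->]|-> //]; by case: (slope_pow ve fv) => ->.
set w' := chart e' t in XE; have we' : w' 0 e' = 1 by rewrite mxE unlift_none.
clearbody w'; set s := (w' *m m^T) 0 0.
pose M : 'M[k]_2 := m^T *m w' + (kap * s) *: (perp w' *m (\row_j (if j == 0 then unitv k e' 1 0 else - unitv k e' 0 0))).
have ME x : M *m x = (w' *m x) 0 0 *: m^T + (kap * s * wedge x (unitv k e')) *: perp w'.
  rewrite mulmxDl -scalemxAl -!mulmxA [X in m^T *m X]mx11_scalar [X in perp w' *m X]mx11_scalar.
  rewrite !mul_mx_scalar scalerA; congr (_ + (_ * _) *: _).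
  by rewrite /wedge mul2E !mxE /=; ring.
have evX x : ev X x = (w' *m x) 0 0 ^+ d.-1 *: (M *m x).
  rewrite XE (bdry_ev _ _ _ _ _ d_gt0) ME scalerDr !scalerA -exprSr prednK ?d_gt0 //.
  by congr (_ + _ *: _); rewrite -/s; ring.
have wp : w' *m perp w' = 0.
  by apply/matrixP => i j; rewrite !ord1 mul2E [RHS]mxE /perp vec2_0 vec2_1; ring.
have wM : w' *m M = s *: w'.
  by rewrite mulmxDr -scalemxAr [X in _ *: X]mulmxA wp mul0mx scaler0 addr0 mulmxA [w' *m m^T]mx11_scalar mul_scalar_mx.
have dM : \det M = - kap * s ^+ 2.
  have Mij i j : M i j = m 0 i * w' 0 j + kap * s * (perp w' i 0 *
      (if j == 0 then unitv k e' 1 0 else - unitv k e' 0 0)).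
    by rewrite /M mxE col_row_mul [m^T _ _]mxE [X in _ + X]mxE col_row_mul [X in _ * (_ * X)]mxE.
  have sE : s = w' 0 0 * m 0 0 + w' 0 1 * m 0 1 by rewrite /s mul2E ![m^T _ _]mxE.
  rewrite det2E !Mij /perp !vec2_0 !vec2_1 /= ![unitv _ _ _ _]mxE sE.
  by move: we'; case: (I2P e') => -> we'; rewrite /= we'; ring.
have w'0 : w' != 0 by apply: contra_eqN we' => /eqP ->; rewrite mxE eq_sym oner_neq0.
have M0 : s = 0 -> forall x, M *m x = (w' *m x) 0 0 *: m^T.
  by move=> s0 x; rewrite ME s0 mulr0 mul0r scale0r addr0.
have red x y : wedge (ev X x) y = 0 -> (w' *m x) 0 0 != 0 -> wedge (M *m x) y = 0.
  move=> + qx; rewrite evX wedgeZl => /eqP; rewrite mulf_eq0 expf_eq0 (negPf qx) andbF.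
  by move=> /eqP.
exact: (no_cycle wM dM M0 m0 w'0 kap3 wx12 wx23 wx31 (red _ _ C1) (red _ _ C2) (red _ _ C3)).
Qed.

End PowerMap.

(** * Homogeneity from equivariance *)

Section Characters.
Variable k : closedFieldType.

Lemma pf_unit_const T (hT : aff k T) (f g : T -> k) : pf f -> pf g -> (forall t, f t * g t = 1) ->
  exists2 c, c != 0 & forall t, f t = c.
Proof.
move=> [p pE] [q qE] H; have pq : p * q = 1.
  by apply: (@ev_inj k T hT) => t; rewrite mevalM meval1 -pE -qE.
have : p \is a GRing.unit by apply/unitrP; exists q; rewrite mulrC.
by case/mpoly_unitE => c c0 pc; exists c => // t; rewrite pE pc mevalC.
Qed.

Lemma no_root_monomial (q : {poly k}) : q.[1] = 1 -> (forall s, s != 0 -> q.[s] != 0) ->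
  exists n, q = 'X^n.
Proof.
move=> q1 qn; have q0 : q != 0.
  by apply: contra_eq_neq q1 => ->; rewrite horner0 eq_sym oner_neq0.
have [r rE] := closed_field_poly_normal q.
have r0 x : x \in r -> x = 0.
  move=> xr; apply: contrapT => /eqP /qn; rewrite rE hornerZ horner_prod (big_rem _ xr) /=.
  by rewrite hornerXsubC subrr mul0r mulr0 eqxx.
have E : q = lead_coef q *: 'X^(size r).
  rewrite {1}rE; congr (_ *: _); rewrite (eq_big_seq (fun=> 'X)) => [|x /r0 ->]; last by rewrite subr0.
  by rewrite big_const_seq count_predT; elim: (size r) => [|m IH]; rewrite ?expr0 //= IH exprS.
have l1 : lead_coef q = 1 by rewrite -q1 [in RHS]E hornerZ hornerXn expr1n mulr1.
by exists (size r); rewrite E l1 scale1r.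
Qed.

(** The factor by which s acts is a polynomial in s with value 1 at 1 and without nonzero roots,
    hence a power of s. *)
Lemma character_degree T (hT : aff k T) (f : T -> k) (act : k -> T -> T) :
  (exists t, f t != 0) -> (forall t, act 1 t = t) -> (forall t, pf (fun s => f (act s t))) ->
  (forall s, s != 0 -> exists2 c, c != 0 & forall t, f (act s t) = c * f t) ->
  exists n, forall s t, f (act s t) = s ^+ n * f t.
Proof.
move=> [t0 ft0] a1 fa H; have [q0 q0E] := pf_k (fa t0).
pose q := (f t0)^-1 *: q0.
have qE s : q.[s] = f (act s t0) / f t0 by rewrite hornerZ -q0E mulrC.
have cE s t : s != 0 -> f (act s t) = q.[s] * f t.
  by move=> /H[c c0 cH]; rewrite qE !cH mulfK.
have [n qn] : exists n, q = 'X^n.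
  apply: no_root_monomial => [|s s0]; rewrite qE ?a1 ?divff //.
  by have [c c0 ->] := H s s0; rewrite mulfK.
exists n => s t; have [p pE] := pf_k (fa t).
have -> : f (act s t) = p.[s] by rewrite -pE.
have -> : p = f t *: 'X^n.
  by apply: poly_eq_nz => x x0; rewrite -pE cE // qn hornerZ !hornerXn mulrC.
by rewrite hornerZ hornerXn mulrC.
Qed.

Lemma homogeneous_line (L : lmodType k) (g : L -> k) n (M T : L) (p q : {poly k}) :
  (forall v s, g (s *: v) = s ^+ n * g v) ->
  (forall t, p.[t] = g (M + t *: T)) -> (forall t, q.[t] = g (T + t *: M)) ->
  p`_n = g T /\ forall j, (n < j)%N -> p`_j = 0.
Proof.
move=> gH pE qE.
have gz t : t != 0 -> p.[t] = t ^+ n * q.[t^-1].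
  by move=> t0; rewrite pE qE -gH scalerDr scalerA divff // scale1r addrC.
pose m := maxn (size p) (maxn (size q) n.+1).
have sp : (size p <= m)%N by rewrite leq_maxl.
have sq : (size q <= m)%N by rewrite /m leq_max leq_max leqnn orbT.
have nm : (n < m)%N by rewrite /m !leq_max leqnn !orbT.
have E : p * 'X^m = 'X^n * \sum_(i < m) q`_i *: 'X^(m - i).
  apply: poly_eq_nz => t t0; rewrite !hornerM !hornerXn gz // -mulrA; congr (_ * _).
  rewrite horner_sum (horner_coef_wide _ sq) mulr_suml; apply: eq_bigr => i _.
  rewrite hornerZ hornerXn -mulrA; congr (_ * _).
  by rewrite exprVn mulrC -expfB // ltnW.
have co j : p`_j = ('X^n * \sum_(i < m) q`_i *: 'X^(m - i))`_(j + m).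
  by rewrite -E coefMXn ltnNge leq_addl /= addnK.
have gT : q`_0 = g T by rewrite -horner_coef0 qE scale0r addr0.
split=> [|j nj]; rewrite co coefXnM.
  rewrite ltnNge leq_addr /= addKn coef_sum.
  have m0 : (0 < m)%N by exact: leq_ltn_trans nm.
  rewrite (bigD1 (Ordinal m0)) //= big1 ?addr0 => [|i i0].
    by rewrite coefZ coefXn subn0 eqxx mulr1.
  rewrite coefZ coefXn; case: eqP => [E'|_]; last by rewrite mulr0.
  by case/negP: i0; apply/eqP/val_inj => /=; move: (ltn_ord i); lia.
case: ltnP => // _; rewrite coef_sum big1 // => i _; rewrite coefZ coefXn.
by case: eqP => [E'|_]; [lia|rewrite mulr0].
Qed.

End Characters.

Section Equivariance.
Variables (k : closedFieldType) (d : nat).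
Hypothesis hd : (2 <= d)%N.
Local Notation N := (2 * d.+1)%N.
Variables (n : nat) (y : 'M[k]_2 * 'M[k]_(2, d.+1) -> 'rV[k]_n) (o : 'M[k]_2 * 'M[k]_(2, d.+1) -> k).
Local Notation base := (@base k d n).
Local Notation on_hit := (@on_hit k d n y o).
Variable Phi : {poly {mpoly k[@adim k base _]}}.
Hypotheses (Phi0 : Phi != 0) (vPhi : vanishing y o Phi) (dPhi : forall Q, vanishing y o Q -> rdvd Phi Q).

Definition form (q : base * k) : k := (evp (cof q.1) Phi).[q.2].

Lemma pf_form : pf form.
Proof. exact: pf_evp. Qed.

Lemma form_neq0 : exists q, form q != 0.
Proof.
apply: contrapT => /forallNP H; move/eqP: Phi0; apply; apply/polyP => i; rewrite coef0.
apply: ev_inj => p; rewrite meval0.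
have E : evp (cof p) Phi = 0.
  apply: poly_eq_nz => t _; rewrite horner0; apply: contrapT => /eqP.
  exact: (H (p, t)).
by have := congr1 (fun q : {poly k} => q`_i) E; rewrite /evp coef_map coef0.
Qed.

Lemma form_divides (f : base * k -> k) : pf f -> (forall p T, on_hit p T -> f (p, T) = 0) ->
  exists2 r : base * k -> k, pf r & forall q, f q = r q * form q.
Proof.
move=> pff fz; have [Q QE] := pf_poly pff.
have [R RE] : rdvd Phi Q by apply: dPhi => p T /fz; rewrite QE.
exists (fun q => (evp (cof q.1) R).[q.2]); first exact: pf_evp.
by case=> p T; rewrite QE RE evpM hornerM.
Qed.

(** As a preserves the incidence variety, the composite of the form with a is a multiple of the
    generator, and likewise for the inverse b; the two cofactors multiply to 1, so they are
    constant. *)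
Lemma equivariance (a b : base * k -> base * k) : pmap a -> pmap b -> cancel a b -> cancel b a ->
  (forall q, on_hit q.1 q.2 -> on_hit (a q).1 (a q).2) ->
  (forall q, on_hit q.1 q.2 -> on_hit (b q).1 (b q).2) ->
  exists2 c, c != 0 & forall q, form (a q) = c * form q.
Proof.
move=> pa pb ab ba ha hb.
have vform q : on_hit q.1 q.2 -> form q = 0 by exact: vPhi.
have [r pr rE] : exists2 r : base * k -> k, pf r & forall q, form (a q) = r q * form q.
  apply: (form_divides (pf_comp pf_form pa)) => p T hp; apply: vform; exact: (ha (p, T)).
have [r' pr' rE'] : exists2 r : base * k -> k, pf r & forall q, form (b q) = r q * form q.
  apply: (form_divides (pf_comp pf_form pb)) => p T hp; apply: vform; exact: (hb (p, T)).
have prb := pf_comp pr pb.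
have z q : (r (b q) * r' q - 1) * form q = 0.
  by rewrite mulrBl mul1r -mulrA -rE' -rE ba subrr.
have pz : pf (fun q => r (b q) * r' q - 1) by pfs.
have [one|zero] := pf_mul_eq0 pz pf_form z; last first.
  by have [q] := form_neq0; rewrite zero eqxx.
have [|c c0 cE] := pf_unit_const prb pr'; first by move=> q; apply/eqP; rewrite -subr_eq0 one.
by exists c => // q; rewrite rE -(ab q) cE.
Qed.

Lemma scaling_degree (act : k -> base * k -> base * k) :
  (forall s, pmap (act s)) -> (forall q, pmap (fun s => act s q)) -> (forall q, act 1 q = q) ->
  (forall s t q, act s (act t q) = act (s * t) q) ->
  (forall s q, s != 0 -> on_hit q.1 q.2 -> on_hit (act s q).1 (act s q).2) ->
  exists e, forall s q, form (act s q) = s ^+ e * form q.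
Proof.
move=> ps pq a1 am ah; apply: (@character_degree k (base * k)%type _ form act form_neq0 a1) => [t|s s0].
  exact: pf_comp pf_form (pq t).
have s1 : s^-1 != 0 by rewrite invr_eq0.
apply: (@equivariance (act s) (act s^-1)) => // q.
- by rewrite am mulVf // a1.
- by rewrite am divff // a1.
- exact: ah.
- exact: ah.
Qed.

End Equivariance.

Lemma row_first (k : closedFieldType) n (a : 'M[k]_1) (v : 'rV[k]_n) : row_mx a v 0 0 = a 0 0.
Proof. by rewrite mxE; case: splitP => [j _|j //]; rewrite !ord1. Qed.

(** The top coefficient is the value at l = 0, T = 1, that is at the hyperplane o = 0; it will be
    nonzero where no solution lies on that hyperplane. *)
Lemma form_degree (k : closedFieldType) d n (Phi : {poly {mpoly k[@adim k (@base k d n) _]}}) e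
  (homPhi : forall (p : @base k d n) T s, form Phi ((p.1, s *: p.2), s * T) = s ^+ e * form Phi (p, T))
  b l (p : {poly k}) : (forall T, p.[T] = form Phi ((b, l), T)) ->
  p`_e = form Phi ((b, 0), 1) /\ (size p <= e.+1)%N.
Proof.
move=> pE; pose g (v : 'rV[k]_(1 + n)) := form Phi ((b, rsubmx v), v 0 0).
have pg : pf (fun t : k => g (row_mx 1%:M 0 + t *: row_mx 0 l)).
  apply: (pf_comp (pf_form Phi)); apply: pmap_pair; last by apply: pmap_k; pfs.
  by apply: pmap_pair; pfs.
have [q qE] := pf_k pg.
have [|||pe pj] := @homogeneous_line k 'rV[k]_(1 + n) g e (row_mx 0 l) (row_mx 1%:M 0) p q.
- move=> v s; rewrite /g linearZ mxE; exact: (homPhi (b, rsubmx v)).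
- move=> t; rewrite pE /g; congr (form Phi (_, _)).
    by rewrite linearD linearZ /= !row_mxKr scaler0 addr0.
  by rewrite mxE row_first mxE add0r mxE row_first mxE eqxx mulr1.
- by move=> t; rewrite -qE.
split; last by apply/leq_sizeP.
rewrite pe /g row_mxKr; congr (form Phi (_, _)).
by rewrite row_first mxE eqxx.
Qed.

Local Notation xE := (x1_0, x1_1, x2_0, x2_1, x3_0, x3_1).

(** * The two incidence equations: for conjugates and for Segre coordinates *)

Section Instances.
Variables (k : closedFieldType) (d : nat).
Hypothesis char0 : [pchar k] =i pred0.
Hypothesis hd : (2 <= d)%N.
Implicit Types (A X : 'M[k]_(2, d.+1)) (h g : 'M[k]_2) (x v : 'cV[k]_2).
Local Notation x1 := (x1 k).
Local Notation x2 := (x2 k).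
Local Notation x3 := (x3 k).
Local Notation N := (2 * d.+1)%N.

(** If every point were fixed, then f_1 = t f_0 in the affine coordinate t of (1 : t); coprimality
    makes f_0 constant, and since d >= 2 both forms vanish at the remaining point (0 : 1). *)
Lemma fixed_form_neq0 A : coprime_map A -> exists2 v, v != 0 & wedge v (ev A v) != 0.
Proof.
move=> rA; apply: contrapT => H.
have F v : wedge v (ev A v) = 0.
  have [->|v0] := eqVneq v 0; first by rewrite /wedge !mxE !mul0r mulr0 subrr.
  by apply: contrapT => /eqP nv; apply: H; exists v.
pose p i := \sum_(j < d.+1) A i j *: 'X^(d - j) : {poly k}.
have pE i t : (p i).[t] = ev A (vec2 1 t) i 0.
  rewrite /p horner_sum mxE; apply: eq_bigr => j _.
  by rewrite hornerZ hornerXn !mxE /= expr1n mul1r.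
have sp i : (size (p i) <= d.+1)%N.
  apply: (leq_trans (size_sum _ _ _)); apply/bigmax_leqP => j _.
  by apply: (leq_trans (size_scale_leq _ _)); rewrite size_polyXn ltnS leq_subr.
have E : p 1 = 'X * p 0.
  apply: poly_eq_nz => t _; rewrite hornerM hornerX !pE; apply/eqP; rewrite -subr_eq0.
  by have := F (vec2 1 t); rewrite /wedge vec2_0 vec2_1 mul1r [X in _ - X]mulrC => ->.
have p0c : (size (p 0%R) <= 1)%N.
  rewrite leqNgt; apply/negP => s1; have [t /rootP tr] : exists t, root (p 0) t.
    by apply: closed_rootP; rewrite gtn_eqF.
  have v0 : vec2 (1 : k) t != 0.
    by apply/eqP => /(congr1 (fun v : 'cV[k]_2 => v 0 0)) /eqP; rewrite vec2_0 mxE oner_eq0.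
  have := rA _ v0; rewrite [ev _ _](_ : _ = 0) ?eqxx //.
  by apply: col2P; rewrite -pE mxE // E hornerM tr mulr0.
have cA i (j : 'I_d.+1) : A i j = (p i)`_(d - j).
  rewrite /p coef_sum (bigD1 j) //= coefZ coefXn eqxx mulr1 big1 ?addr0 // => l lj.
  rewrite coefZ coefXn; case: eqP => [e|_]; last by rewrite mulr0.
  by case/eqP: lj; apply/val_inj => /=; move: (ltn_ord l) (ltn_ord j); lia.
have z : ev A (vec2 0 1) = 0.
  have c0 i : ev A (vec2 0 1) i 0 = A i 0.
    rewrite mxE (bigD1 0) //= big1 ?addr0 => [|j j0]; rewrite !mxE /= ?expr0 ?mul1r ?expr1n ?mulr1 //.
    by rewrite expr0n; case: eqP => [e|_]; rewrite ?mul0r ?mulr0 //; case/eqP: j0; apply: val_inj.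
  apply: col2P; rewrite c0 cA subn0 mxE.
    by rewrite nth_default // (leq_trans p0c) // ltnW.
  rewrite E coefXM; case: eqP => [e|_]; first by move: (hd); rewrite e.
  by rewrite nth_default // (leq_trans p0c) // -ltnS prednK // ltnW.
have := rA (vec2 0 1); rewrite z eqxx => H'.
have : vec2 (0 : k) 1 != 0.
  by apply/eqP => /(congr1 (fun v : 'cV[k]_2 => v 1 0)) /eqP; rewrite vec2_1 mxE oner_eq0.
by move/H'.
Qed.

Lemma first_entry X : X 0 0 = ev X x1 0 0.
Proof.
rewrite mxE (bigD1 0) //= big1 ?addr0 => [|j j0]; rewrite !mxE /= ?expr0 ?mul1r ?expr1n ?mulr1 //.
by rewrite expr0n; case: eqP => [e|_]; rewrite ?mul0r ?mulr0 //; case/eqP: j0; apply: val_inj.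
Qed.

(** So the first entry of a conjugate vanishes exactly when h maps x1 to a fixed point of A. *)
Lemma Gam_first A h : Gam A h 0 0 = - wedge (h *m x1) (ev A (h *m x1)).
Proof.
rewrite first_entry ev_Gam; set u := ev A _; rewrite mul2E.
have [-> -> _ _] := adj2E h; rewrite /wedge !mul2E !xE; ring.
Qed.

Lemma exists_generic_frame A : coprime_map A -> exists h, [/\ h \in unitmx, h 0 0 != 0 & Gam A h 0 0 != 0].
Proof.
move=> rA; have [v v0 wv] := fixed_form_neq0 rA.
have [a av] : exists a, v 1 0 - a * v 0 0 != 0.
  have [z|nz] := eqVneq (v 0 0) 0.
    exists 0; rewrite mul0r subr0; apply: contra v0 => /eqP z'; apply/eqP.
    by apply: col2P; rewrite mxE.
  by exists ((v 1 0 - 1) / v 0 0); rewrite divfK // opprB addrC subrK oner_neq0.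
pose h : 'M[k]_2 := \matrix_(i, j) (if j == 0 then vec2 1 a i 0 else v i 0).
have h0 i : h i 0 = vec2 1 a i 0 by rewrite mxE.
have h1 i : h i 1 = v i 0 by rewrite mxE.
exists h; split; first by rewrite unit2 det2E !h0 !h1 vec2_0 vec2_1 mul1r mulrC.
  by rewrite h0 vec2_0 oner_neq0.
have -> : Gam A h 0 0 = - wedge v (ev A v).
  rewrite Gam_first; have -> : h *m x1 = v by apply: col2P; rewrite mul2E h1 !xE mulr0 add0r mulr1.
  by [].
by rewrite oppr_eq0.
Qed.

Definition yX (q : 'M[k]_2 * 'M[k]_(2, d.+1)) : 'rV[k]_N := xv q.2.
Definition oX (q : 'M[k]_2 * 'M[k]_(2, d.+1)) : k := q.2 0 0.
(* The Segre coordinates of (h, X). *)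
Definition yY (q : 'M[k]_2 * 'M[k]_(2, d.+1)) : 'rV[k]_(2 * 2 * N) :=
  mxvec ((mxvec q.1)^T *m xv q.2).
Definition oY (q : 'M[k]_2 * 'M[k]_(2, d.+1)) : k := q.1 0 0 * q.2 0 0.

Lemma pmap_yX : pmap yX. Proof. by rewrite /yX /xv; pfs. Qed.
Lemma pf_oX : pf oX. Proof. by rewrite /oX; pfs. Qed.
Lemma pmap_yY : pmap yY. Proof. by rewrite /yY /xv; pfs. Qed.
Lemma pf_oY : pf oY. Proof. by rewrite /oY; pfs. Qed.

Lemma yXZ h X s t : s != 0 -> t != 0 ->
  exists2 c, c != 0 & yX (s *: h, t *: X) = c *: yX (h, X) /\ oX (s *: h, t *: X) = c * oX (h, X).
Proof. by move=> s0 t0; exists t => //; rewrite /yX /oX /= xvZ mxE. Qed.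

Lemma yYZ h X s t : s != 0 -> t != 0 ->
  exists2 c, c != 0 & yY (s *: h, t *: X) = c *: yY (h, X) /\ oY (s *: h, t *: X) = c * oY (h, X).
Proof.
move=> s0 t0; exists (s * t); first exact: mulf_neq0.
rewrite /yY /oY /= xvZ !mxE; split; last by ring.
by rewrite [mxvec (s *: h)]linearZ [(s *: _)^T]linearZ -scalemxAl -scalemxAr scalerA linearZ.
Qed.

Lemma yX_neq0 h X : h != 0 -> X != 0 -> yX (h, X) != 0.
Proof. by move=> _; rewrite /yX xv_eq0. Qed.

Lemma outer_eq0 m n (u : 'rV[k]_m) (v : 'rV[k]_n) i j : (u^T *m v) i j = u 0 i * v 0 j.
Proof. by rewrite mxE big_ord1 mxE. Qed.

Lemma yY_neq0 h X : h != 0 -> X != 0 -> yY (h, X) != 0.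
Proof.
rewrite /yY mxvec_eq0 /= -[h == 0]mxvec_eq0 -[X == 0]xv_eq0 => /row_nz[i hi] /row_nz[j Xj].
apply/eqP => /matrixP /(_ i j); rewrite outer_eq0 mxE => /eqP.
by rewrite mulf_eq0 (negPf hi) (negPf Xj).
Qed.

Lemma oX_dense A : coprime_map A -> exists2 h, h \in unitmx & oX (h, Gam A h) != 0.
Proof. by move=> /exists_generic_frame[h [hU _ G]]; exists h. Qed.

Lemma oY_dense A : coprime_map A -> exists2 h, h \in unitmx & oY (h, Gam A h) != 0.
Proof.
by move=> /exists_generic_frame[h [hU h0 G]]; exists h => //; rewrite /oY mulf_neq0.
Qed.

Lemma cyc_unit h X : h != 0 -> X != 0 -> Xt (powA k d) h X -> cyc X ->
  [/\ h \in unitmx, exists2 c, c != 0 & X = c *: Gam (powA k d) h, cyc (Gam (powA k d) h),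
    h 0 0 != 0 & X 0 0 != 0].
Proof.
move=> h0 X0 XX cX; have hU : h \in unitmx.
  rewrite unit2; apply/eqP => dh; exact: (cyc_no_boundary char0 hd h0 X0 dh XX cX).
have [c XE] := Xt_prop (Gam_neq0 (rat_neq0 (@rat_pow k d hd)) hU) XX.
have c0 : c != 0 by apply: contra_neq X0 => c0; rewrite XE c0 scale0r.
have cG : cyc (Gam (powA k d) h).
  case: cX => a b e; split; apply: (mulfI c0); rewrite mulr0 -wedgeZl -evZl -XE //.
have rX : coprime_map X.
  move=> x x0; rewrite XE evZl scaler_eq0 (negPf c0) /=; exact: (rat_Gam (@rat_pow k d hd) hU x0).
split=> //; first by exists c.
  apply/eqP => z; case: cG => _ e2 _.
  have E : wedge (ev (powA k d) (h *m x2)) (h *m x3) = 0 by rewrite -wedge_adj -ev_Gam.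
  have W : wedge (h *m x2) (h *m x3) != 0 by rewrite wedge_mul mulf_neq0 -?unit2 ?wx23.
  have p0 : (h *m x2) 0 0 = 0 by rewrite mul2E z !xE mul0r mulr0 addr0.
  move/eqP: W; apply; move: E; rewrite ev_pow /wedge vec2_0 vec2_1 p0 expr0n gtn_eqF ?(d_gt0 hd) //=.
  rewrite !mul0r !sub0r => /eqP; rewrite oppr_eq0 mulf_eq0 expf_eq0 (d_gt0 hd) /= => /orP[|] /eqP ->.
    by rewrite mul0r oppr0.
  by rewrite mulr0 oppr0.
have x10 : x1 != 0 by exact: wedge_neq0l (wx12 k).
have [l] := col_nz (rX _ x10); rewrite first_entry; case: (I2P l) => -> //.
case: cX => + _ _; rewrite /wedge !xE mulr0 mul1r sub0r => /eqP; rewrite oppr_eq0 => /eqP ->.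
by rewrite eqxx.
Qed.

(** With l = 0 and T = 1 the hyperplane is o = 0, and by [cyc_unit] no solution for the power map
    and [cycu] lies on it. *)
Lemma cyc_missed n y o : (forall h X, o (h, X) = 0 -> h 0 0 != 0 -> X 0 0 != 0 -> False) ->
  exists p T, ~ @on_closure k d n y o p T.
Proof.
move=> oH; exists ((powA k d, cycu k d), 0), 1 => -[h [X [h0 X0 [XX /cycuP cX]]]].
rewrite /pairing mul0mx mxE addr0 mul1r => z.
by have [_ _ _ h00 X00] := cyc_unit h0 X0 XX cX; exact: oH z h00 X00.
Qed.

Lemma missed_X : exists p T, ~ @on_closure k d N yX oX p T.
Proof. by apply: cyc_missed => h X; rewrite /oX /= => -> _; rewrite eqxx. Qed.

Lemma missed_Y : exists p T, ~ @on_closure k d (2 * 2 * N) yY oY p T.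
Proof.
apply: cyc_missed => h X; rewrite /oY /= => /eqP; rewrite mulf_eq0 => /orP[]/eqP->; by rewrite eqxx.
Qed.

Definition form_X := generic_form char0 hd pmap_yX pf_oX yXZ yX_neq0 oX_dense missed_X.
Definition form_Y := generic_form char0 hd pmap_yY pf_oY yYZ yY_neq0 oY_dense missed_Y.

End Instances.

(** * The number of three-cycles and their simplicity *)

Section ThreeCycles.
Variables (k : closedFieldType) (d : nat).
Hypothesis char0 : [pchar k] =i pred0.
Hypothesis hd : (2 <= d)%N.
Implicit Types (h g : 'M[k]_2) (x v : 'cV[k]_2).
Local Notation x1 := (x1 k).
Local Notation x2 := (x2 k).
Local Notation x3 := (x3 k).
Local Notation powA := (powA k d).

Lemma unity_roots n : (0 < n)%N ->
  exists rs : seq k, [/\ uniq rs, size rs = n & forall z, (z \in rs) = (z ^+ n == 1)].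
Proof.
move=> n0; pose p : {poly k} := 'X^n - 1.
have sp : size p = n.+1 by rewrite size_XnsubC.
have mp : p \is monic by rewrite monicXnsubC.
have [rs rsE] := closed_field_poly_normal p.
rewrite (monicP mp) scale1r in rsE.
exists rs; split.
- have : separable_poly p by apply: separable_Xn_sub_1; rewrite (natr_eq0 char0) -lt0n.
  by rewrite rsE separable_prod_XsubC.
- by apply/eqP; rewrite -eqSS -(size_prod_XsubC rs id) -rsE sp.
- by move=> z; rewrite -root_prod_XsubC -rsE rootE !hornerE subr_eq0.
Qed.

(** The nonzero points fixed by the third iterate of the power map but not by the map itself; they
    number (d ^ 3 - 1) - (d - 1). Since 3 is prime, each of them runs through three distinct
    points. *)
Lemma cycle_points : exists zs : seq k, [/\ uniq zs, size zs = (d ^ 3 - d)%N &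
  forall z, (z \in zs) = (z ^+ (d ^ 3 - 1) == 1) && (z ^+ (d - 1) != 1)].
Proof.
have d3 : (d < d ^ 3)%N by rewrite -[X in (X < _)%N]expn1 ltn_exp2l.
have [rs [ur sr rsP]] := @unity_roots (d ^ 3 - 1) ltac:(lia).
have [qs [uq sq qsP]] := @unity_roots (d - 1) ltac:(lia).
exists [seq z <- rs | z ^+ (d - 1) != 1]; split; first exact: filter_uniq.
  have := count_predC (fun z => z ^+ (d - 1) == 1) rs; rewrite sr -!size_filter.
  have -> : size [seq z <- rs | z ^+ (d - 1) == 1] = (d - 1)%N.
    rewrite -[RHS]sq; apply/eqP; rewrite -uniq_size_uniq ?filter_uniq // => z.
    rewrite mem_filter rsP qsP; have [z1|//] := eqVneq (z ^+ (d - 1)) 1; rewrite /=.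
    have -> : (d ^ 3 - 1 = (d - 1) * (d ^ 2 + d + 1))%N by rewrite mulnBl !mulnDr -!expnS; lia.
    by rewrite exprM z1 expr1n eqxx.
  have -> : size [seq z <- rs | z ^+ (d - 1) != 1] =
    size [seq x <- rs | predC (fun z => z ^+ (d - 1) == 1) x] by [].
  by move: (size _) => a; lia.
by move=> z; rewrite mem_filter rsP andbC.
Qed.

Lemma cyc_Gam h : cyc (Gam powA h) <->
  [/\ wedge (ev powA (h *m x1)) (h *m x2) = 0, wedge (ev powA (h *m x2)) (h *m x3) = 0 &
      wedge (ev powA (h *m x3)) (h *m x1) = 0].
Proof. by rewrite /cyc !ev_Gam !wedge_adj. Qed.

Lemma image_wedges h : h \in unitmx -> [/\ wedge (h *m x1) (h *m x2) != 0,
  wedge (h *m x2) (h *m x3) != 0 & wedge (h *m x3) (h *m x1) != 0].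
Proof. by rewrite unit2 => hU; rewrite !wedge_mul !mulf_neq0 ?wx12 ?wx23 ?wx31. Qed.

(* A cycle of distinct points avoids the two fixed points 0 and infinity. *)
Lemma cycle_nonzero a b : wedge a b != 0 -> wedge (ev powA a) b = 0 -> a 0 0 != 0 /\ a 1 0 != 0.
Proof.
rewrite ev_pow /wedge vec2_0 vec2_1 => W E; split; apply: contraNneq W => z; move: E;
  rewrite z expr0n gtn_eqF ?(d_gt0 hd) //= !(mul0r, mulr0) ?sub0r ?subr0 => /eqP.
  by rewrite oppr_eq0 mulf_eq0 expf_eq0 (d_gt0 hd) => /orP[/eqP->|/eqP->]; rewrite ?mulr0 ?mul0r oppr0.
by rewrite mulf_eq0 expf_eq0 (d_gt0 hd) => /orP[/eqP->|/eqP->]; rewrite ?mulr0 ?mul0r.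
Qed.

Lemma d3_neq1 : d%:R ^+ 3 != 1 :> k.
Proof.
rewrite -natrX; apply/eqP => /(@natr_inj _ char0 _ 1) /eqP.
by rewrite -[X in _ == X](exp1n 3) eqn_exp2r // gtn_eqF.
Qed.

(* Infinitesimally, the multiplier d^3 of a three-cycle differs from 1. *)
Lemma cyc_etale h g : h \in unitmx -> cyc (Gam powA h) -> cyc (dGam powA h g) -> exists s, g = s *: h.
Proof.
move=> hU /cyc_Gam[C1 C2 C3] [D1 D2 D3]; have [W1 W2 W3] := image_wedges hU.
have [a10 a11] := cycle_nonzero W1 C1; have [a20 a21] := cycle_nonzero W2 C2.
have [a30 a31] := cycle_nonzero W3 C3.
have key x y : (h *m x) 0 0 != 0 -> (h *m x) 1 0 != 0 -> (h *m y) 0 0 != 0 -> (h *m y) 1 0 != 0 ->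
    wedge (ev powA (h *m x)) (h *m y) = 0 -> wedge (ev (dGam powA h g) x) y = 0 ->
    exists s, [/\ s != 0, s ^+ 2 * ((h *m y) 0 0 * (h *m y) 1 0) = ((h *m x) 0 0 * (h *m x) 1 0) ^+ d &
      s ^+ 2 * wedge (g *m y) (h *m y) =
      d%:R * ((h *m x) 0 0 * (h *m x) 1 0) ^+ d.-1 * wedge (g *m x) (h *m x)].
  set p := h *m x; set q := h *m y => p0 p1 q0 q1 C D.
  pose s := p 0 0 ^+ d / q 0 0.
  have s0 : s != 0 by rewrite mulf_neq0 ?invr_eq0 ?expf_neq0.
  have E0 : p 0 0 ^+ d = s * q 0 0 by rewrite divfK.
  have E1 : p 1 0 ^+ d = s * q 1 0.
    move: C; rewrite ev_pow /wedge vec2_0 vec2_1 E0 => /eqP; rewrite subr_eq0 => /eqP C.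
    by apply: (mulfI q0); rewrite -C; ring.
  clearbody s; exists s; split=> //; first by rewrite exprMn E0 E1; ring.
  move: D; rewrite ev_dGam -/p ev_pow dev_pow // E0 E1.
  have -> : wedge (\adj g *m vec2 (s * q 0 0) (s * q 1 0) + \adj h *m
      vec2 (d%:R * (p 0 0 ^+ d.-1 * (g *m x) 0 0)) (d%:R * (p 1 0 ^+ d.-1 * (g *m x) 1 0))) y =
      wedge (vec2 (s * q 0 0) (s * q 1 0)) (g *m y) +
      wedge (vec2 (d%:R * (p 0 0 ^+ d.-1 * (g *m x) 0 0)) (d%:R * (p 1 0 ^+ d.-1 * (g *m x) 1 0))) q.
    rewrite -wedge_adj -(wedge_adj h); move: (\adj g *m _) (\adj h *m _) => u v.
    by rewrite /wedge !mxE; ring.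
  rewrite /wedge !vec2_0 !vec2_1; move: ((g *m x) 0 0) ((g *m x) 1 0) ((g *m y) 0 0) ((g *m y) 1 0).
  move=> u0 u1 v0 v1 D.
  have dd : (d = d.-1.+1)%N by rewrite prednK // (d_gt0 hd).
  have F0 : p 0 0 * p 0 0 ^+ d.-1 = s * q 0 0 by rewrite -exprS -dd.
  have F1 : p 1 0 * p 1 0 ^+ d.-1 = s * q 1 0 by rewrite -exprS -dd.
  have D' : s * (s * q 0 0 * v1 - v0 * (s * q 1 0)) + (d%:R * (p 0 0 ^+ d.-1 * u0) * (s * q 1 0) -
    (s * q 0 0) * (d%:R * (p 1 0 ^+ d.-1 * u1))) = 0 by rewrite -[RHS](mulr0 s) -D; ring.
  move: D'; rewrite -{2}F1 -{2}F0 exprMn => /eqP; rewrite addr_eq0 => /eqP D'.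
  by apply: oppr_inj; rewrite -[RHS]mulrN; transitivity (s * (s * q 0 0 * v1 - v0 * (s * q 1 0)));
    [ring|rewrite D'; ring].
have [s1 [n1 P1' Q1]] := key _ _ a10 a11 a20 a21 C1 D1.
have [s2 [n2 P2' Q2]] := key _ _ a20 a21 a30 a31 C2 D2.
have [s3 [n3 P3' Q3]] := key _ _ a30 a31 a10 a11 C3 D3.
have pn1 := mulf_neq0 a10 a11; have pn2 := mulf_neq0 a20 a21; have pn3 := mulf_neq0 a30 a31.
move: P1' P2' P3' Q1 Q2 Q3 pn1 pn2 pn3.
move: ((h *m x1) 0 0 * (h *m x1) 1 0) ((h *m x2) 0 0 * (h *m x2) 1 0) ((h *m x3) 0 0 * (h *m x3) 1 0).
move=> e1 e2 e3 Pa Pb Pc Q1 Q2 Q3 en1 en2 en3.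
have dd : (d = d.-1.+1)%N by rewrite prednK // (d_gt0 hd).
have S : (s1 * s2 * s3) ^+ 2 = (e1 * e2 * e3) ^+ d.-1.
  apply: (mulIf (mulf_neq0 (mulf_neq0 en1 en2) en3)); rewrite -exprSr -dd !exprMn -Pa -Pb -Pc; ring.
have Sn : (s1 * s2 * s3) ^+ 2 != 0 by rewrite expf_neq0 // !mulf_neq0.
(* Going once around the cycle gives w1 = d ^ 3 w1, the factors t and f cancelling by S. *)
have loop (w1 w2 w3 t1 t2 t3 f1 f2 f3 : k) : t1 ^+ 2 * w2 = d%:R * f1 ^+ d.-1 * w1 ->
    t2 ^+ 2 * w3 = d%:R * f2 ^+ d.-1 * w2 -> t3 ^+ 2 * w1 = d%:R * f3 ^+ d.-1 * w3 ->
    (t1 * t2 * t3) ^+ 2 = (f1 * f2 * f3) ^+ d.-1 -> (t1 * t2 * t3) ^+ 2 != 0 -> w1 = 0.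
  move=> R1 R2 R3 T Tn; apply: contrapT => /eqP w0; move/eqP: d3_neq1; apply.
  apply: (mulIf (mulf_neq0 Tn w0)); rewrite mul1r.
  transitivity (t1 ^+ 2 * t2 ^+ 2 * (t3 ^+ 2 * w1)); last by ring.
  rewrite R3; transitivity (t1 ^+ 2 * (t2 ^+ 2 * w3) * (d%:R * f3 ^+ d.-1)); last by ring.
  rewrite R2; transitivity (t1 ^+ 2 * w2 * (d%:R * f2 ^+ d.-1) * (d%:R * f3 ^+ d.-1)); last by ring.
  by rewrite R1 T !exprMn; ring.
have V1 := loop _ _ _ _ _ _ _ _ _ Q1 Q2 Q3 S Sn.
have rs1 : s2 * s3 * s1 = s1 * s2 * s3 by ring.
have rs2 : s3 * s1 * s2 = s1 * s2 * s3 by ring.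
have re1 : e2 * e3 * e1 = e1 * e2 * e3 by ring.
have re2 : e3 * e1 * e2 = e1 * e2 * e3 by ring.
have V2 := loop _ _ _ _ _ _ _ _ _ Q2 Q3 Q1.
have {}V2 : wedge (g *m x2) (h *m x2) = 0 by apply: V2; rewrite ?rs1 ?re1.
have V3 := loop _ _ _ _ _ _ _ _ _ Q3 Q1 Q2.
have {}V3 : wedge (g *m x3) (h *m x3) = 0 by apply: V3; rewrite ?rs2 ?re2.
pose m := \adj h *m g.
have mV x : wedge (g *m x) (h *m x) = 0 -> wedge (m *m x) x = 0.
  by rewrite /m -mulmxA wedge_adj.
have [M1 [M2 M3]] := (mV _ V1, (mV _ V2, mV _ V3)).
have [m01 [m10 m00]] : m 0 1 = 0 /\ m 1 0 = 0 /\ m 0 0 = m 1 1.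
  move: M1 M2 M3; rewrite /wedge !mul2E !(x1_0, x1_1, x2_0, x2_1, x3_0, x3_1).
  rewrite !(mulr0, mulr1, mul1r, mul0r, add0r, addr0, subr0, sub0r) => -> /eqP; rewrite oppr_eq0 => /eqP ->.
  by rewrite addr0 add0r => /eqP; rewrite subr_eq0 => /eqP.
have hd0 : \det h != 0 by rewrite -unit2.
exists (m 0 0 / \det h); have : h *m m = \det h *: g by rewrite mulmxA mul_mx_adj mul_scalar_mx.
have mE : m = (m 0 0)%:M.
  by apply/matrixP => i j; rewrite [RHS]mxE; case: (I2P i) => ->; case: (I2P j) => ->; rewrite ?m01 ?m10 -?m00 ?eqxx.
rewrite [X in h *m X]mE mul_mx_scalar => E.
by apply: (scalerI hd0); rewrite -E scalerA [\det h * _]mulrC divfK.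
Qed.

(** The columns represent z ^ d and z, the images of x2 and x1; the scale b is the one for which
    their sum, the image of x3, represents z ^ (d ^ 2). *)
Definition cyc_frame (z : k) : 'M[k]_2 :=
  let b := (z ^+ (d ^ 2) - z ^+ d) / (z - z ^+ (d ^ 2)) in
  \matrix_(i, j) (if i == 0 then if j == 0 then 1 else b else if j == 0 then z ^+ d else b * z).

Lemma three_cycles : exists rs : seq 'M[k]_2, [/\ uniq rs, size rs = (d ^ 3 - d)%N,
  (forall h, h \in rs -> [/\ h \in unitmx, h 0 0 = 1 & cyc (Gam powA h)]) &
  (forall h, h \in unitmx -> h 0 0 = 1 -> cyc (Gam powA h) -> h \in rs)].
Proof.
have [zs [uz sz zsP]] := cycle_points.
have d0 := d_gt0 hd.
have dist z : z \in zs -> [/\ z != 0, z ^+ (d ^ 3) = z, z != z ^+ d, z ^+ d != z ^+ (d ^ 2) & z != z ^+ (d ^ 2)].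
  rewrite zsP => /andP[/eqP z3 z1].
  have d3 : (0 < d ^ 3 - 1)%N by rewrite subn_gt0 -[X in (X < _)%N](exp1n 3) ltn_exp2r.
  have z0 : z != 0 by apply: contra_eq_neq z3 => ->; rewrite expr0n gtn_eqF //= eq_sym oner_neq0.
  have zc : z ^+ (d ^ 3) = z.
    by rewrite -[in LHS](@subnK 1 (d ^ 3)) ?expn_gt0 ?d0 // exprD z3 mul1r expr1.
  have n1 : z != z ^+ d.
    apply: contra z1 => /eqP E; apply/eqP; apply: (mulfI z0).
    by rewrite -exprS -addn1 subnK // -E mulr1.
  have n3 : z != z ^+ (d ^ 2).
    apply: contra n1 => /eqP E; rewrite -{1}zc [X in (d ^ X)%N](_ : 3 = 2 + 1)%N // expnD exprM -E expn1.
    by [].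
  split=> //; apply: contra n3 => /eqP E.
  apply/eqP; transitivity ((z ^+ (d ^ 2)) ^+ d); first by rewrite -exprM -expnSr zc.
  by rewrite -E -exprM mulnn.
have fE z : let b := (z ^+ (d ^ 2) - z ^+ d) / (z - z ^+ (d ^ 2)) in
  [/\ cyc_frame z 0 0 = 1, cyc_frame z 0 1 = b, cyc_frame z 1 0 = z ^+ d & cyc_frame z 1 1 = b * z].
  by split; rewrite mxE.
exists [seq cyc_frame z | z <- zs]; split; last first.
- move=> h hU h00 /cyc_Gam[C1 C2 C3]; have [W1 W2 W3] := image_wedges hU.
  have [a10 a11] := cycle_nonzero W1 C1; have [a20 a21] := cycle_nonzero W2 C2.
  have [a30 a31] := cycle_nonzero W3 C3.
  have next (a b : 'cV[k]_2) : a 0 0 != 0 -> b 0 0 != 0 -> wedge (ev powA a) b = 0 ->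
      b 1 0 / b 0 0 = (a 1 0 / a 0 0) ^+ d.
    move=> a0 b0; rewrite ev_pow /wedge vec2_0 vec2_1 => /eqP; rewrite subr_eq0 => /eqP E.
    rewrite expr_div_n; apply: (mulIf b0); apply: (mulfI (expf_neq0 d a0)).
    by rewrite divfK // E; field; rewrite expf_neq0.
  have N1 := next _ _ a10 a20 C1; have N2 := next _ _ a20 a30 C2; have N3 := next _ _ a30 a10 C3.
  move: a10 a11 a20 a30 W1 W2 W3 N1 N2 N3; rewrite /wedge !mul2E !(x1_0, x1_1, x2_0, x2_1, x3_0, x3_1) h00.
  rewrite !(mulr0, mulr1, mul1r, mul0r, add0r, addr0) divr1.
  set b := h 0 1; set e := h 1 1; set c := h 1 0 => b0 e0 _ b1 W1 W2 W3 N1 N2 N3.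
  pose z := e / b.
  have cE : c = z ^+ d by [].
  have z3E : (c + e) / (1 + b) = z ^+ (d ^ 2) by rewrite N2 cE -exprM.
  have zcE : z ^+ (d ^ 3) = z.
    by transitivity ((z ^+ (d ^ 2)) ^+ d); [rewrite -exprM -expnSr|rewrite -z3E -N3].
  have z0 : z != 0 by rewrite mulf_neq0 ?invr_eq0.
  have eE : e = z * b by rewrite divfK.
  have z12 : z != z ^+ d.
    by rewrite -cE; apply: contra W1 => /eqP zc; rewrite eE zc; apply/eqP; ring.
  have z13 : z != z ^+ (d ^ 2).
    rewrite -z3E; apply: contra W3 => /eqP zc; apply/eqP.
    have -> : c + e = z * (1 + b) by rewrite zc divfK.
    by rewrite eE; ring.
  have zz : z \in zs.
    rewrite zsP; apply/andP; split; last first.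
      by apply: contra z12 => /eqP z1; rewrite -(@subnK 1 d) // exprD z1 mul1r expr1.
    apply/eqP; apply: (mulfI z0); rewrite -exprS -addn1 subnK ?expn_gt0 ?d0 //.
    by rewrite zcE mulr1.
  apply/mapP; exists z => //; have [f00 f01 f10 f11] := fE z.
  have bE : b = (z ^+ (d ^ 2) - z ^+ d) / (z - z ^+ (d ^ 2)).
    have zn : z - z ^+ (d ^ 2) != 0 by rewrite subr_eq0.
    apply: (mulIf zn); rewrite divfK // -cE.
    have E : c + z * b = z ^+ (d ^ 2) * (1 + b) by rewrite -eE -z3E divfK.
    move: (z ^+ (d ^ 2)) E => z3 E; apply/eqP; rewrite -subr_eq0; apply/eqP.
    transitivity (c + z * b - z3 * (1 + b)); [ring|by rewrite E subrr].
  apply: mx2P => j; case: (I2P j) => ->; rewrite ?f00 ?f01 ?f10 ?f11 -?bE //.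
  by rewrite -/e eE mulrC.
- move=> h /mapP[z /dist[z0 zc n1 n2 n3] ->]; have [f00 f01 f10 f11] := fE z.
  set b := _ / _ in f01 f11; have zn : z - z ^+ (d ^ 2) != 0 by rewrite subr_eq0.
  have b0 : b != 0 by rewrite mulf_neq0 ?invr_eq0 // subr_eq0 eq_sym.
  have bE : b * (z - z ^+ (d ^ 2)) = z ^+ (d ^ 2) - z ^+ d by rewrite divfK.
  clearbody b; split=> //.
    rewrite unit2 det2E f00 f01 f10 f11 mul1r -mulrBr mulf_neq0 // subr_eq0 //.
  have E : z ^+ d + b * z = z ^+ (d ^ 2) * (1 + b).
    by apply/eqP; rewrite -subr_eq0; apply/eqP; transitivity (b * (z - z ^+ (d ^ 2)) - (z ^+ (d ^ 2) - z ^+ d)); [ring|rewrite bE subrr].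
  apply/cyc_Gam; rewrite !ev_pow /wedge !vec2_0 !vec2_1 !mul2E !(x1_0, x1_1, x2_0, x2_1, x3_0, x3_1).
  rewrite f00 f01 f10 f11 !(mulr0, mulr1, mul1r, mul0r, add0r, addr0) E expr1n !exprMn -!exprM -expnSr.
  rewrite (_ : (d * d = d ^ 2)%N) // zc; split; ring.
- by rewrite size_map.
rewrite map_inj_in_uniq // => z z' /dist[z0 zc _ _ _] /dist[z0' zc' _ _ _] E.
have [_ _ f10 _] := fE z; have [_ _ f10' _] := fE z'.
have : z ^+ d = z' ^+ d by rewrite -f10 E f10'.
move=> E2; rewrite -zc -zc' [X in (d ^ X)%N](_ : 3 = 1 + 2)%N // expnD expn1 !exprM E2 //.
Qed.

End ThreeCycles.

(** * Generic triples of hyperplanes *)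

Section GoodSections.
Variables (k : closedFieldType) (d : nat).
Hypothesis char0 : [pchar k] =i pred0.
Hypothesis hd : (2 <= d)%N.
Implicit Types (A X : 'M[k]_(2, d.+1)) (h g : 'M[k]_2) (x v : 'cV[k]_2).
Local Notation N := (2 * d.+1)%N.
Local Notation "u '_|_' X" := (u *m (xv X)^T = 0) (at level 60).

Definition solution A (u : 'M[k]_(3, N)) h : Prop := h \in unitmx /\ u _|_ Gam A h.

Definition no_boundary r A (u : 'M[k]_(r, N)) : Prop :=
  forall h X, h != 0 -> X != 0 -> \det h = 0 -> Xt A h X -> ~ (u _|_ X).

Definition etale A (u : 'M[k]_(3, N)) : Prop :=
  forall h g, solution A u h -> h 0 0 = 1 -> u _|_ dGam A h g -> exists s, g = s *: h.

(* The last two conditions allow to normalize the solutions by their first entries. *)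
Definition good A (u : 'M[k]_(3, N)) : Prop :=
  [/\ coprime_map A, no_boundary A u, etale A u,
    (forall h, solution A u h -> h 0 0 != 0) & forall h, solution A u h -> Gam A h 0 0 != 0].

Section LemmaM.
Local Notation B := (2 * 2 * N)%N.
Local Notation base := (@base k d B).
Local Notation yY := (@yY k d).
Local Notation oY := (@oY k d).
Local Notation on_hit := (@on_hit k d B yY oY).
Local Notation on_closure := (@on_closure k d B yY oY).
Variable Phi : {poly {mpoly k[@adim k base _]}}.
Hypotheses (pPhi : rprime Phi) (sPhi : (1 < size Phi)%N) (vPhi : vanishing yY oY Phi)
  (cPhi : forall p T, (evp (cof p) Phi).[T] = 0 -> on_closure p T).
Variable e : nat.
Hypothesis homPhi : forall (p : base) T s,
  form Phi ((p.1, s *: p.2), s * T) = s ^+ e * form Phi (p, T).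

Local Notation first b := (form Phi ((b, 0), 1)).

Lemma closure_solution A u l T : good A u -> on_closure ((A, u), l) T ->
  exists h, [/\ solution A u h, h 0 0 = 1 & pairing yY oY l T h (Gam A h) = 0].
Proof.
move=> [rA nb _ g00 _] [h [X [h0 X0 [XX uX pX]]]].
have hU : h \in unitmx by rewrite unit2; apply/eqP => dh; exact: nb h0 X0 dh XX uX.
have [c XE] := Xt_prop (Gam_neq0 (rat_neq0 rA) hU) XX.
have c0 : c != 0 by apply: contra_neq X0 => c0; rewrite XE c0 scale0r.
have sh : solution A u h.
  split=> //; move: uX; rewrite /= XE xvZ linearZ -scalemxAr => /eqP.
  by rewrite scaler_eq0 (negPf c0) => /eqP.
have h00 := g00 _ sh; have i0 : (h 0 0)^-1 != 0 by rewrite invr_eq0.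
exists ((h 0 0)^-1 *: h); split.
- case: sh => _ uG; split; first by rewrite unitmxZ // unitfE.
  by rewrite GamZ xvZ linearZ -scalemxAr uG scaler0.
- by rewrite mxE mulVf.
rewrite GamZ; have iG : (h 0 0)^-1 ^+ d.+1 / c != 0 by rewrite mulf_neq0 ?invr_eq0 // expf_neq0.
have GE : (h 0 0)^-1 ^+ d.+1 *: Gam A h = ((h 0 0)^-1 ^+ d.+1 / c) *: X.
  by rewrite XE scalerA divfK.
have [a a0 [yE oE]] := yYZ h X i0 iG.
rewrite /pairing GE yE oE linearZ -scalemxAr mxE mulrCA -mulrDr.
by move: pX; rewrite /pairing /= => ->; rewrite mulr0.
Qed.

Lemma form_hit A u l T h : A != 0 -> solution A u h -> pairing yY oY l T h (Gam A h) = 0 ->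
  form Phi (((A, u), l), T) = 0.
Proof. by move=> A0 [hU uG] pz; apply: vPhi; split=> //; exists h. Qed.

Lemma first_neq0 A u : good A u -> first (A, u) != 0.
Proof.
move=> gA; apply/eqP => /cPhi /(closure_solution gA)[h [sh h00]].
rewrite /pairing mul0mx mxE addr0 mul1r /yY /oY /= h00 mul1r => /eqP.
by case: gA => _ _ _ _ /(_ _ sh) /negPf ->.
Qed.

(** The value of T for which the Segre hyperplane (T, l) passes through a solution h with h 0 0 =
    1. *)
Definition froot A (l : 'rV[k]_B) h : k := - (l *m (yY (h, Gam A h))^T) 0 0 / Gam A h 0 0.

Lemma pairing_froot A l T h : h 0 0 = 1 -> Gam A h 0 0 != 0 ->
  pairing yY oY l T h (Gam A h) = (T - froot A l h) * Gam A h 0 0.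
Proof.
move=> h00 G0; rewrite /pairing /oY /= h00 mul1r mulrBl /froot divfK //; ring.
Qed.

(** Tested on the Segre coordinate h_ij X_00, equality of the roots for all l gives equality of all
    entries of h. The coordinates of the conjugate alone would not separate solutions that differ by
    an automorphism. *)
Lemma froot_separates A h h' : h 0 0 = 1 -> h' 0 0 = 1 -> Gam A h 0 0 != 0 -> Gam A h' 0 0 != 0 ->
  h != h' -> exists l, froot A l h - froot A l h' != 0.
Proof.
move=> h00 h00' G0 G0' hh'; apply: contrapT => /forallNP H; move/eqP: hh'; apply.
have E i j : h i j = h' i j.
  have [l lE] : exists l : 'rV[k]_B, forall g Y, (l *m (yY (g, Y))^T) 0 0 = g i j * Y 0 0.
    exists (delta_mx 0 (mxvec_index (mxvec_index i j) (mxvec_index 0 0))) => g Y.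
    rewrite -rowE !mxE /yY mxvecE outer_eq0 /xv !mxvecE //.
  have /negP := H l; rewrite negbK subr_eq0 /froot !lE !mulNr eqr_opp => /eqP.
  by rewrite !mulfK.
by apply/matrixP => i j.
Qed.

Lemma pf_froot A h : pf (fun l => froot A l h).
Proof. by rewrite /froot; pfs. Qed.

Lemma separating_l A (rs : seq 'M[k]_2) : uniq rs ->
  (forall h, h \in rs -> h 0 0 = 1 /\ Gam A h 0 0 != 0) ->
  exists2 f : 'rV[k]_B -> k, pfnz f & forall l, f l != 0 -> {in rs &, injective (froot A l)}.
Proof.
move=> ur rsP; pose f (l : 'rV[k]_B) := \prod_(q <- [seq (h, h') | h <- rs, h' <- rs] |
   (q.1 \in rs) && (q.2 \in rs) && (q.1 != q.2)) (froot A l q.1 - froot A l q.2).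
exists f.
  apply: pfnz_prod => [|q /andP[/andP[/rsP[a b] /rsP[a' b']] n]]; first exact: 0.
  split; last exact: froot_separates.
  by have p1 := pf_froot A q.1; have p2 := pf_froot A q.2; pfs.
move=> l fl h h' hr hr' E; apply: contrapT => /eqP n; move/eqP: fl; apply.
rewrite /f; apply/eqP; rewrite prodf_seq_eq0; apply/hasP; exists (h, h').
  by apply/allpairsP; exists (h, h').
by rewrite /= hr hr' n E subrr eqxx.
Qed.

Section AtGoodPoint.
Variables (A0 : 'M[k]_(2, d.+1)) (u0 : 'M[k]_(3, N)).
Hypothesis g0 : good A0 u0.
Local Notation b0 := (A0, u0).

Definition nsol (rs : seq 'M[k]_2) := uniq rs /\ forall h, h \in rs -> solution A0 u0 h /\ h 0 0 = 1.

Lemma nsol_Gam rs h : nsol rs -> h \in rs -> h 0 0 = 1 /\ Gam A0 h 0 0 != 0.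
Proof. by move=> [_ sr] /sr[sh h00]; split=> //; case: g0 => _ _ _ _; exact. Qed.

Lemma line_form l : exists p : {poly k}, [/\ forall T, p.[T] = form Phi ((b0, l), T), p != 0,
  size p = e.+1 & p`_e = first b0].
Proof.
exists (evp (cof ((b0, l) : base)) Phi).
have [pe sp] := @form_degree k d _ Phi e homPhi b0 l (evp (cof ((b0, l) : base)) Phi) (fun=> erefl).
have f0 := first_neq0 g0.
have n0 : (evp (cof ((b0, l) : base)) Phi)`_e != 0 by rewrite pe.
split=> //; first by apply: contraNneq n0 => ->; rewrite coef0.
by apply/eqP; rewrite eqn_leq sp ltnNge; apply: contra n0 => /(nth_default 0) ->.
Qed.

Lemma nsol_bounded rs : nsol rs -> (size rs <= e)%N.
Proof.
move=> nr; have [f fnz fP] := separating_l nr.1 (fun h => nsol_Gam nr (h := h)).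
case: fnz => pff [l fl]; have [p [pE p0 sp _]] := line_form l.
rewrite -ltnS -sp -(size_map (froot A0 l)); apply: max_poly_roots => //; last first.
  by rewrite map_inj_in_uniq; [exact: nr.1|exact: fP].
apply/allP => _ /mapP[h hr ->]; have [h00 G0] := nsol_Gam nr hr.
rewrite /root pE (form_hit (h := h)) //.
- by case: g0 => /rat_neq0.
- exact: (nr.2 _ hr).1.
- by rewrite pairing_froot // subrr mul0r.
Qed.

(** For a suitable l the normalized solutions are distinct roots of a polynomial of degree e, so
    there are at most e of them and a maximal list is complete. *)
Lemma maximal_nsol : exists2 rs, nsol rs & forall h, solution A0 u0 h -> h 0 0 = 1 -> h \in rs.
Proof.
have [n] := ubnP e; have : nsol [::] by split.
have : (e <= size ([::] : seq 'M[k]_2) + e)%N by [].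
move: [::] {2}e => rs m; elim: m rs n => [|m IHm] rs n le nr _.
  exists rs => // h sh h00; apply: contrapT => /negP hn.
  have : nsol (h :: rs).
    split=> [|h']; first by rewrite /= hn nr.1.
    by rewrite in_cons => /orP[/eqP->|/nr.2].
  by move/nsol_bounded => /=; rewrite addn0 in le; lia.
have [[h [sh h00 hn]]|H] := EM (exists h, [/\ solution A0 u0 h, h 0 0 = 1 & h \notin rs]); last first.
  by exists rs => // h sh h00; apply: contrapT => /negP hn; apply: H; exists h.
apply: (IHm (h :: rs) e.+1) => //=; first by rewrite addSnnS.
split=> [|h']; first by rewrite /= hn nr.1.
by rewrite in_cons => /orP[/eqP->|/nr.2].
Qed.

End AtGoodPoint.
End LemmaM.
End GoodSections.

Section GoodSections.
Variables (k : closedFieldType) (d : nat).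
Hypothesis char0 : [pchar k] =i pred0.
Hypothesis hd : (2 <= d)%N.
Implicit Types (A X : 'M[k]_(2, d.+1)) (h g : 'M[k]_2) (x v : 'cV[k]_2).
Local Notation N := (2 * d.+1)%N.
Local Notation "u '_|_' X" := (u *m (xv X)^T = 0) (at level 60).

Section LemmaM.
Local Notation B := (2 * 2 * N)%N.
Local Notation base := (@base k d B).
Local Notation yY := (@yY k d).
Local Notation oY := (@oY k d).
Local Notation on_hit := (@on_hit k d B yY oY).
Local Notation on_closure := (@on_closure k d B yY oY).
Variable Phi : {poly {mpoly k[@adim k base _]}}.
Hypotheses (pPhi : rprime Phi) (sPhi : (1 < size Phi)%N) (vPhi : vanishing yY oY Phi)
  (cPhi : forall p T, (evp (cof p) Phi).[T] = 0 -> on_closure p T).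
Variable e : nat.
Hypothesis homPhi : forall (p : base) T s,
  form Phi ((p.1, s *: p.2), s * T) = s ^+ e * form Phi (p, T).

Local Notation first b := (form Phi ((b, 0), 1)).
Local Notation V4 := 'rV[k]_(2 * 2).

Section OffDiagonal.
Variable J : ('M[k]_(2, d.+1) * 'M[k]_(3, N)) * V4 * V4 -> 'M[k]_(3, 2 * 2).
Hypothesis pJ : pmap J.

Definition jac p (a b : V4) : 'M[k]_4 := col_mx (J ((p, a), b)) (mxvec (delta_mx 0 0 : 'M_2)).

(** The two points are scaled to the same first entry, so that for two solutions the matrix [jac]
    annihilates their difference. Asking for all s makes the condition invariant under scaling
    although J need not be homogeneous. *)
Definition off_diag p h1 X1 h2 X2 : Prop := forall s : {s : k | s != 0},
  oY (h1, X1) * oY (h2, X2) * (\det h1 * \det h2) *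
  \det (jac p (sval s *: (h2 0 0 *: mxvec h1)) (sval s *: (h1 0 0 *: mxvec h2))) = 0.

Lemma off_diagZ p h1 X1 h2 X2 s1 t1 s2 t2 : s1 != 0 -> s2 != 0 ->
  off_diag p h1 X1 h2 X2 -> off_diag p (s1 *: h1) (t1 *: X1) (s2 *: h2) (t2 *: X2).
Proof.
move=> n1 n2 H [s s0]; rewrite /oY /= !detZ !mxE.
have ss : s * (s1 * s2) != 0 by rewrite !mulf_neq0.
have := H (exist (fun s : k => is_true (s != 0)) _ ss); rewrite /oY /=.
have -> : s *: (s2 * h2 0 0 *: mxvec (s1 *: h1)) = s * (s1 * s2) *: (h2 0 0 *: mxvec h1).
  by rewrite [mxvec (s1 *: h1)]linearZ !scalerA; congr (_ *: _); ring.
have -> : s *: (s1 * h1 0 0 *: mxvec (s2 *: h2)) = s * (s1 * s2) *: (h1 0 0 *: mxvec h2).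
  by rewrite [mxvec (s2 *: h2)]linearZ !scalerA; congr (_ *: _); ring.
move: (\det (jac _ _ _)) => D E.
transitivity ((s1 * t1) * (s2 * t2) * (s1 ^+ 2 * s2 ^+ 2) *
  (h1 0 0 * X1 0 0 * (h2 0 0 * X2 0 0) * (\det h1 * \det h2) * D)); first by ring.
by rewrite E mulr0.
Qed.

Local Notation P3 := (base * k * k)%type.

Definition two_points (q : P3) h1 X1 h2 X2 : Prop :=
  [/\ Xt q.1.1.1.1 h1 X1, q.1.1.1.2 _|_ X1, pairing yY oY q.1.1.2 q.1.2 h1 X1 = 0 &
   [/\ Xt q.1.1.1.1 h2 X2, q.1.1.1.2 _|_ X2, pairing yY oY q.1.1.2 q.2 h2 X2 = 0 &
    off_diag q.1.1.1 h1 X1 h2 X2]].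

Lemma pairingZ l T h X s t : s != 0 -> t != 0 -> pairing yY oY l T h X = 0 ->
  pairing yY oY l T (s *: h) (t *: X) = 0.
Proof.
move=> s0 t0; have [c c0 [yE oE]] := yYZ h X s0 t0.
have -> : pairing yY oY l T (s *: h) (t *: X) = c * pairing yY oY l T h X.
  rewrite /pairing yE oE linearZ -scalemxAr; move: (oY _) (l *m _) => z Z.
  by rewrite mxE mulrDr mulrCA.
by move=> ->; rewrite mulr0.
Qed.

Lemma two_pointsZ q h1 X1 h2 X2 s1 t1 s2 t2 : s1 != 0 -> t1 != 0 -> s2 != 0 -> t2 != 0 ->
  two_points q h1 X1 h2 X2 -> two_points q (s1 *: h1) (t1 *: X1) (s2 *: h2) (t2 *: X2).
Proof.
move=> n1 m1 n2 m2 [a b c [a' b' c' H]]; have d0 := ltnW hd; split.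
- exact: XtZ.
- by rewrite xvZ linearZ -scalemxAr b scaler0.
- exact: pairingZ.
split; [exact: XtZ| |exact: pairingZ|exact: off_diagZ].
by rewrite xvZ linearZ -scalemxAr b' scaler0.
Qed.

Local Notation Q5 := (P3 * 'M[k]_2 * 'M[k]_(2, d.+1) * 'M[k]_2 * 'M[k]_(2, d.+1))%type.

Lemma zcl_two_points : zcl (fun q : P3 => exists h1 X1, [/\ h1 != 0, X1 != 0 &
  exists h2 X2, [/\ h2 != 0, X2 != 0 & two_points q h1 X1 h2 X2]]).
Proof.
have one := oner_neq0 k.
apply: (@elim2 k d P3 _ (fun q h1 X1 => exists h2 X2, [/\ h2 != 0, X2 != 0 & two_points q h1 X1 h2 X2])); last first.
  move=> q h X s t s0 t0 [h2 [X2 [h20 X20 H]]]; exists h2, X2; split=> //.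
  by rewrite -[h2]scale1r -[X2]scale1r; apply: two_pointsZ.
apply: (@elim2 k d (P3 * 'M[k]_2 * 'M[k]_(2, d.+1))%type _
  (fun r h2 X2 => two_points r.1.1 r.1.2 r.2 h2 X2)); last first.
  move=> r h X s t s0 t0 H; rewrite -[r.1.2]scale1r -[r.2]scale1r; exact: two_pointsZ.
have f1 : pmap (fun t : Q5 => t.1) by exact: @pmap_fst0 k _ _ _ _.
have f2 : pmap (fun t : Q5 => t.1.1) by exact: pmap_fst f1.
have f3 : pmap (fun t : Q5 => t.1.1.1) by exact: pmap_fst f2.
have f4 : pmap (fun t : Q5 => t.1.1.1.1) by exact: pmap_fst f3.
have f5 : pmap (fun t : Q5 => t.1.1.1.1.1) by exact: pmap_fst f4.
have f6 : pmap (fun t : Q5 => t.1.1.1.1.1.1) by exact: pmap_fst f5.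
have f7 : pmap (fun t : Q5 => t.1.1.1.1.1.1.1) by exact: pmap_fst f6.
have pA : pmap (fun t : Q5 => t.1.1.1.1.1.1.1.1) by exact: pmap_fst f7.
have pu : pmap (fun t : Q5 => t.1.1.1.1.1.1.1.2) by exact: pmap_snd f7.
have pl : pmap (fun t : Q5 => t.1.1.1.1.1.1.2) by exact: pmap_snd f6.
have pT : pmap (fun t : Q5 => t.1.1.1.1.1.2) by exact: pmap_snd f5.
have pS : pmap (fun t : Q5 => t.1.1.1.1.2) by exact: pmap_snd f4.
have ph1 : pmap (fun t : Q5 => t.1.1.1.2) by exact: pmap_snd f3.
have pX1 : pmap (fun t : Q5 => t.1.1.2) by exact: pmap_snd f2.
have ph2 : pmap (fun t : Q5 => t.1.2) by exact: pmap_snd f1.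
have pX2 : pmap (fun t : Q5 => t.2) by exact: @pmap_snd0 k _ _ _ _.
have q1 := pmap_pair ph1 pX1; have q2 := pmap_pair ph2 pX2.
have pair (T : Q5 -> k) (h : Q5 -> 'M[k]_2) (X : Q5 -> 'M[k]_(2, d.+1)) : pmap T -> pmap h -> pmap X ->
    zcl (fun t : Q5 => pairing yY oY t.1.1.1.1.1.1.2 (T t) (h t) (X t) = 0).
  move=> hT hh hX; have qq := pmap_pair hh hX.
  have yy := pmap_comp (@pmap_yY k d) qq; have oo := pf_comp (@pf_oY k d) qq.
  have {}hT := pf_pmap hT; apply: zcl_eq; rewrite /pairing; pfs.
have orth (X : Q5 -> 'M[k]_(2, d.+1)) : pmap X -> zcl (fun t : Q5 => t.1.1.1.1.1.1.1.2 _|_ X t).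
  by move=> hX; apply: zcl_eq0mx; rewrite /xv; pfs.
have off : zcl (fun t : Q5 => off_diag t.1.1.1.1.1.1.1 t.1.1.1.2 t.1.1.2 t.1.2 t.2).
  apply: zcl_forall => -[s s0] /=.
  have o1 := pf_comp (@pf_oY k d) q1; have o2 := pf_comp (@pf_oY k d) q2.
  have pJ' : pmap (fun t : Q5 => J ((t.1.1.1.1.1.1.1, s *: (t.1.2 0 0 *: mxvec t.1.1.1.2)),
      s *: (t.1.1.1.2 0 0 *: mxvec t.1.2))).
    apply: (pmap_comp pJ); apply: pmap_pair; last by pfs.
    by apply: pmap_pair; [exact: f7|pfs].
  have pj : pmap (fun t : Q5 => jac t.1.1.1.1.1.1.1 (s *: (t.1.2 0 0 *: mxvec t.1.1.1.2))
      (s *: (t.1.1.1.2 0 0 *: mxvec t.1.2))).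
    by apply: (@pmap_col_mx k Q5 _ 3 1 4); pfs.
  by apply: zcl_eq; pfs.
have H := zcl_and (zcl_Xt pA pX1 ph1) (zcl_and (orth _ pX1) (zcl_and (pair _ _ _ pT ph1 pX1)
  (zcl_and (zcl_Xt pA pX2 ph2) (zcl_and (orth _ pX2) (zcl_and (pair _ _ _ pS ph2 pX2) off))))).
apply: zcl_ext H => t; split=> [[a [b [c [a' [b' [c' f]]]]]]|[a b c [a' b' c' f]]]; do ?split=> //.
Qed.

End OffDiagonal.

Section AtGoodPoint.
Variables (A0 : 'M[k]_(2, d.+1)) (u0 : 'M[k]_(3, N)).
Hypothesis g0 : good A0 u0.
Local Notation b0 := (A0, u0).

Lemma deriv_not_divisible : ~ rdvd Phi Phi^`().
Proof.
have n0 : Phi != 0 by case: pPhi.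
have D0 : Phi^`() != 0.
  apply/eqP => /(congr1 (fun P : {poly _} => P`_(size Phi).-2)); rewrite coef_deriv coef0.
  have -> : ((size Phi).-2.+1 = (size Phi).-1)%N by case: (size Phi) sPhi => [|[|m]].
  rewrite -mulr_natr => /eqP; rewrite mulf_eq0 -/(lead_coef Phi) lead_coef_eq0 (negPf n0) /=.
  rewrite -mpolyC_nat mpolyC_eq0 (natr_eq0 char0) => /eqP E.
  by case: (size Phi) sPhi E => [|[|m]].
by move/(rdvd_size D0); rewrite leqNgt lt_size_deriv.
Qed.

(** In characteristic 0 the prime Phi does not divide its derivative in T, so their eliminant is
    nonzero; off its zeros and those of the top coefficient there are e distinct roots. *)
Lemma generic_simple : exists2 rho : base -> k, pfnz rho & forall p, rho p != 0 -> p.1.1 != 0 /\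
  exists rs : seq k, [/\ uniq rs, size rs = e & forall T, T \in rs -> form Phi (p, T) = 0].
Proof.
have [r r0 rH] := prime_elim_root (@ufd_mpoly k _) pPhi sPhi deriv_not_divisible.
have pr : pfnz (fun p : base => r.@[cof p]) by split; [exact: pf_meval|exact: ev_nz].
have pf1 : pfnz (fun p : base => first p.1).
  split; last by exists (b0, 0); exact: (first_neq0 cPhi g0).
  apply: (pf_comp (pf_form Phi)); apply: pmap_pair; last by apply: pmap_k; pfs.
  by apply: pmap_pair; rewrite /base; pfs.
have pe : pfnz (fun p : base => p.1.1 0 0).
  by split; [rewrite /base; pfs|exists ((const_mx 1, 0), 0); rewrite mxE oner_neq0].
exists (fun p => r.@[cof p] * first p.1 * p.1.1 0 0); first exact: pfnz_mul (pfnz_mul pr pf1) pe.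
move=> p; rewrite mulf_eq0 negb_or => /andP[+ p00]; rewrite mulf_eq0 negb_or => /andP[rp fp].
split; first by apply: contraNneq p00 => ->; rewrite mxE.
pose P := evp (cof p) Phi; case: p rp fp p00 @P => b l rp fp _ P.
have [Pe sP] := @form_degree k d _ Phi e homPhi b l P (fun=> erefl).
have P0 : P`_e != 0 by rewrite Pe.
have {}sP : size P = e.+1.
  by apply/eqP; rewrite eqn_leq sP ltnNge; apply: contra P0 => /(nth_default 0) ->.
have [rs rsE] := closed_field_poly_normal P.
have lP : lead_coef P != 0 by rewrite lead_coef_eq0 -size_poly_gt0 sP.
have sep : separable_poly P.
  rewrite separable_poly.unlock; apply: Pdiv.ClosedField.root_coprimep => x /rootP Px; apply/eqP => Dx; move/eqP: rp; apply.
  apply: (rH _ (meval (cof ((b, l) : base))) x Px).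
  by rewrite -deriv_map.
exists rs; split.
- move: sep; rewrite -separable_prod_XsubC rsE !separable_poly.unlock derivZ.
  by rewrite coprimepZl // coprimepZr.
- by apply/eqP; rewrite -eqSS -sP rsE size_scale // (size_prod_XsubC rs id).
move=> T Trs; rewrite -[form _ _]/(P.[T]) rsE hornerZ horner_prod (big_rem _ Trs) /=.
by rewrite hornerXsubC subrr mul0r mulr0.
Qed.

(** Deform (A0, u0, l0) along a line to a point with simple roots. There distinct roots come from
    distinct solutions, so by [double_root] a double root T0 would satisfy the closed condition of
    [two_points] at (T0, T0). At a good point both solutions are then one and the same h, and the
    vanishing determinant yields a tangent vector excluded by [etale]. *)
Lemma simple_root rs l0 T0 (p0 : {poly k}) : nsol A0 u0 rs ->
  (forall h, solution A0 u0 h -> h 0 0 = 1 -> h \in rs) -> {in rs &, injective (froot A0 l0)} ->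
  (forall T, p0.[T] = form Phi ((b0, l0), T)) -> p0.[T0] = 0 -> ~~ (('X - T0%:P) ^+ 2 %| p0).
Proof.
move=> nr max inj pE pT; apply/negP => dv.
pose G (q : ('M[k]_(2, d.+1) * 'M[k]_(3, N)) * V4) : 'M[k]_(3, 1) := q.1.2 *m (xv (Gam q.1.1 (vec_mx q.2)))^T.
have pG : pmap G.
  by rewrite /G /xv; apply: pmap_mul; [pfs|apply: pmap_tr; apply: pmap_mxvec; apply: pmap_Gam; pfs].
have [J [pJ JE]] := difference_quotient_mx pG.
have e00 (w : V4) : (mxvec (delta_mx 0 0 : 'M[k]_2) *m w^T) 0 0 = (vec_mx w : 'M_2) 0 0.
  by rewrite mxvec_delta -rowE !mxE.
have uniq_sol h X : h != 0 -> X != 0 -> Xt A0 h X -> u0 _|_ X -> pairing yY oY l0 T0 h X = 0 ->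
    exists h', [/\ h' \in rs, froot A0 l0 h' = T0, h 0 0 != 0, X 0 0 != 0 & \det h != 0 /\ h = h 0 0 *: h'].
  move=> h0 X0 XX uX pX; have [rA nb _ g00 gG] := g0.
  have hU : h \in unitmx by rewrite unit2; apply/eqP => dh; exact: nb h0 X0 dh XX uX.
  have [c XE] := Xt_prop (Gam_neq0 (rat_neq0 rA) hU) XX.
  have c0 : c != 0 by apply: contra_neq X0 => c0; rewrite XE c0 scale0r.
  have sh : solution A0 u0 h.
    split=> //; move: uX; rewrite XE xvZ linearZ -scalemxAr => /eqP.
    by rewrite scaler_eq0 (negPf c0) => /eqP.
  have h00 := g00 _ sh; have i0 : (h 0 0)^-1 != 0 by rewrite invr_eq0.
  pose h' := (h 0 0)^-1 *: h.
  have h'00 : h' 0 0 = 1 by rewrite mxE mulVf.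
  have hE : h = h 0 0 *: h' by rewrite scalerA divff // scale1r.
  have sh' : solution A0 u0 h'.
    case: sh => _ uG; split; first by rewrite unitmxZ // unitfE.
    by rewrite GamZ xvZ linearZ -scalemxAr uG scaler0.
  have hr := max _ sh' h'00; exists h'; split=> //; last by rewrite -unit2.
    have G0 := gG _ sh'; have iG : (h 0 0)^-1 ^+ d.+1 / c != 0 by rewrite mulf_neq0 ?invr_eq0 // expf_neq0.
    have := pairingZ i0 iG pX; rewrite -/h'.
    have -> : ((h 0 0)^-1 ^+ d.+1 / c) *: X = Gam A0 h' by rewrite GamZ XE scalerA divfK.
    rewrite pairing_froot // => /eqP; rewrite mulf_eq0 (negPf G0) orbF subr_eq0 => /eqP.
    by move=> ->.
  by rewrite XE mxE mulf_neq0 // gG.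
have nbad : ~ exists h1 X1, [/\ h1 != 0, X1 != 0 & exists h2 X2,
    [/\ h2 != 0, X2 != 0 & two_points J (((b0, l0), T0), T0) h1 X1 h2 X2]].
  move=> [h1 [X1 [h10 X10 [h2 [X2 [h20 X20 [a1 b1 c1 [a2 b2 c2 off]]]]]]]].
  have [h [hr hT n1 m1 [d1 h1E]]] := uniq_sol _ _ h10 X10 a1 b1 c1.
  have [h' [hr' hT' n2 m2 [d2 h2E]]] := uniq_sol _ _ h20 X20 a2 b2 c2.
  have hh : h' = h by apply: inj => //; rewrite hT hT'.
  have n12 : (h2 0 0 * h1 0 0)^-1 != 0 by rewrite invr_eq0 mulf_neq0.
  have := off (exist (fun s : k => is_true (s != 0)) _ n12) => /eqP; rewrite /= !mulf_eq0.
  rewrite (negPf n1) (negPf m1) (negPf n2) (negPf m2) (negPf d1) (negPf d2) /=.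
  have v1 : mxvec h1 = h1 0 0 *: mxvec h by rewrite {1}h1E linearZ.
  have v2 : mxvec h2 = h2 0 0 *: mxvec h by rewrite {1}h2E hh linearZ.
  have aE : (h2 0 0 * h1 0 0)^-1 *: (h2 0 0 *: mxvec h1) = mxvec h.
    by rewrite v1 !scalerA -?mulrA mulVf ?scale1r // mulf_neq0.
  have bE : (h2 0 0 * h1 0 0)^-1 *: (h1 0 0 *: mxvec h2) = mxvec h.
    by rewrite v2 !scalerA -?mulrA [h1 0 0 * _]mulrC mulVf ?scale1r // mulf_neq0.
  have [sa a00] := nr.2 _ hr; move: (h) sa a00 aE bE => a sa a00 aE bE.
  rewrite aE bE -det_tr => /det0P[v v0 vJ].
  have vJ' : jac J b0 (mxvec a) (mxvec a) *m v^T = 0.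
    by rewrite -[LHS]trmxK trmx_mul trmxK vJ trmx0.
  have vJ1 : col_mx (J ((b0, mxvec a), mxvec a)) (mxvec (delta_mx 0 0 : 'M_2)) *m (v : V4)^T = 0 by exact: vJ'.
  rewrite mul_col_mx in vJ1.
  have JV : J ((b0, mxvec a), mxvec a) *m (v : V4)^T = 0.
    by have := congr1 usubmx vJ1; rewrite col_mxKu linear0.
  have v00 : (vec_mx (v : V4) : 'M_2) 0 0 = 0.
    by rewrite -e00; have := congr1 dsubmx vJ1; rewrite col_mxKd linear0 => ->; rewrite mxE.
  have [E EE] := Gam_expand A0 a (vec_mx (v : V4)).
  have D : J ((b0, mxvec a), mxvec a) *m (v : V4)^T = u0 *m (xv (dGam A0 a (vec_mx (v : V4))))^T.
    apply: (@quotient_diag k _ _ (fun w => G (b0, w)) (fun w w' => J ((b0, w), w')) (mxvec a) v _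
      (map_mx polyC u0 *m (mxvec E)^T)).
    - by apply: (pmap_comp pJ); apply: pmap_pair; [apply: pmap_pair|]; pfs.
    - by move=> w w'; exact: JE.
    have L X Y c : u0 *m (xv (X + c *: Y))^T = u0 *m (xv X)^T + c *: (u0 *m (xv Y)^T).
      rewrite xvD xvZ; have -> : (xv X + c *: xv Y)^T = (xv X)^T + c *: (xv Y)^T.
        by apply/matrixP => i j; rewrite !mxE.
      by rewrite mulmxDr -scalemxAr.
    move=> t; rewrite /G /= linearD linearZ /= mxvecK EE !L.
    congr (_ + _ *: _); apply/matrixP => i j; rewrite (ord1 j) mxE [RHS]mxE [X in X.[t]]mxE horner_sum.
    apply: eq_bigr => l _; rewrite [map_mx _ _ _ _]mxE hornerM hornerC ![_^T _ _]mxE; congr (_ * _).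
    by case/mxvec_indexP: l => i' j'; rewrite /xv !mxvecE mxE.
  rewrite JV in D; have [_ _ et _ _] := g0; have [s sE] := et _ _ sa a00 (esym D).
  move: v00; rewrite sE mxE a00 mulr1 => s0.
  by move/eqP: v0; apply; rewrite -[LHS](@vec_mxK k 2 2) sE s0 scale0r linear0.
have [f [pff fz fn]] := zcl_two_points pJ nbad.
have [rho [prho [p1 rho1]] rhoP] := generic_simple.
pose path (t : k) : base := ((A0 + t *: (p1.1.1 - A0), u0 + t *: (p1.1.2 - u0)), l0 + t *: (p1.2 - l0)).
have ppath : pmap path.
  by apply: pmap_pair; [apply: pmap_pair|]; pfs.
have path0 : path 0 = (b0, l0) by rewrite /path !scale0r !addr0.
have path1 : path 1 = p1 by rewrite /path !scale1r !subrKC; case: (p1) => [[]].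
have ppath1 : pmap (fun q : k * k => path q.1) by apply: (pmap_comp ppath); pfs.
have [Psi PsiE] : exists c, forall t T, form Phi (path t, T) = ev2 t T c.
  apply: (pf_ev2 (f := fun q => form Phi (path q.1, q.2))).
  by apply: (pf_comp (pf_form Phi)); apply: pmap_pair => //; pfs.
have [E EE] : exists E, forall t T S, f ((path t, T), S) = (map_poly (ev2 t T) E).[S].
  apply: (pf_ev3 (f := fun q => f ((path q.1.1, q.1.2), q.2))).
  apply: (pf_comp pff); apply: pmap_pair; last by pfs.
  by apply: pmap_pair; [apply: (pmap_comp ppath)|]; pfs.
have [r rE] := pf_k (pf_comp prho ppath).
have r0 : r != 0 by apply: contraNneq rho1 => r0; rewrite -path1 rE r0 horner0.
have deg t : (map_poly (horner_eval t) Psi)`_e = first (path t).1 /\ (size (map_poly (horner_eval t) Psi) <= e.+1)%N.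
  apply: (@form_degree k d _ Phi e homPhi (path t).1 (path t).2) => T.
  by rewrite -ev2E -PsiE; case: (path t).
have sPsi : (size Psi <= e.+1)%N.
  apply/leq_sizeP => j ej; apply: poly_eq_nz => t _; rewrite horner0.
  have := (deg t).2 => /leq_sizeP /(_ j ej); rewrite coef_map /= horner_evalE.
  by [].
have lc : (Psi`_e).[0] != 0.
  have -> : (Psi`_e).[0] = (map_poly (horner_eval 0) Psi)`_e by rewrite coef_map.
  by rewrite (deg 0).1 path0; exact: (first_neq0 cPhi g0).
have root0 : ev2 0 T0 Psi = 0 by rewrite -PsiE path0 -pE.
have gen t : r.[t] != 0 -> exists rs : seq k, [/\ uniq rs, size rs = e & forall T, T \in rs -> ev2 t T Psi = 0].
  by rewrite -rE => /rhoP[_ [rs' [a b c]]]; exists rs'; split=> // T /c <-; rewrite PsiE.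
move/eqP: fn; apply; rewrite /= -path0 EE.
apply: (@double_root k Psi e r 0 T0 sPsi lc r0 gen root0); last first.
  have -> : map_poly (horner_eval 0) Psi = p0; last by [].
  by apply: poly_eq_nz => T _; rewrite -ev2E -PsiE path0 pE.
move=> t T S; rewrite -rE => /rhoP[A1n _] zT zS TS; rewrite -EE; apply: fz.
rewrite -PsiE in zT; rewrite -PsiE in zS.
have [h1 [X1 [h10 X10 [a1 b1 c1]]]] := cPhi zT.
have [h2 [X2 [h20 X20 [a2 b2 c2]]]] := cPhi zS.
exists h1, X1; split=> //; exists h2, X2; split=> //; split=> //; split=> //.
move=> [s s0] /=; set b := (path t).1 in a1 b1 a2 b2 *; set l := (path t).2 in c1 c2.
have [->|o1] := eqVneq (oY (h1, X1)) 0; first by rewrite !mul0r.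
have [->|o2] := eqVneq (oY (h2, X2)) 0; first by rewrite mulr0 !mul0r.
have [->|d1] := eqVneq (\det h1) 0; first by rewrite mul0r mulr0 mul0r.
have [->|d2] := eqVneq (\det h2) 0; first by rewrite !mulr0 mul0r.
have hU1 : h1 \in unitmx by rewrite unit2. have hU2 : h2 \in unitmx by rewrite unit2.
have multiple h X : h \in unitmx -> X != 0 -> Xt b.1 h X -> exists2 c, c != 0 & X = c *: Gam b.1 h.
  move=> hU X0 /(Xt_prop (Gam_neq0 A1n hU))[c XE]; exists c => //.
  by apply: contra_neq X0 => c0; rewrite XE c0 scale0r.
have [e1 e10 E1] := multiple _ _ hU1 X10 a1; have [e2 e20 E2] := multiple _ _ hU2 X20 a2.
have orthG h X c : c != 0 -> X = c *: Gam b.1 h -> b.2 _|_ X -> b.2 _|_ Gam b.1 h.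
  move=> c0 ->; rewrite xvZ linearZ -scalemxAr => /eqP; rewrite scaler_eq0 (negPf c0).
  by move=> /eqP.
have G1 := orthG _ _ _ e10 E1 b1; have G2 := orthG _ _ _ e20 E2 b2.
set v := s *: _; set w := s *: _; have Gv c h : b.2 _|_ Gam b.1 h -> G (b, c *: mxvec h) = 0.
  move=> H; rewrite /G /= linearZ /= mxvecK GamZ xvZ linearZ -scalemxAr H scaler0 //.
have JV : J ((b, v), w) *m (w - v)^T = 0.
  by rewrite -JE /v /w !scalerA !Gv // subrr.
(* Otherwise h2 and X2 would be multiples of h1 and X1, and the roots T and S would agree. *)
have wv : w - v != 0.
  rewrite subr_eq0; apply: contra TS => /eqP wv.
  have [n1 n2] : h1 0 0 != 0 /\ h2 0 0 != 0.
    by move: o1 o2; rewrite /oY /= !mulf_eq0 !negb_or => /andP[-> _] /andP[-> _].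
  have m12 : h1 0 0 *: h2 = h2 0 0 *: h1.
    by apply: (can_inj mxvecK); rewrite !linearZ; apply: (scalerI s0).
  pose c := h2 0 0 / h1 0 0; have c0 : c != 0 by rewrite mulf_neq0 ?invr_eq0.
  have h2E : h2 = c *: h1 by apply: (scalerI n1); rewrite m12 scalerA mulrC divfK.
  pose c' := e2 * c ^+ d.+1 / e1.
  have c'0 : c' != 0 by rewrite !mulf_neq0 ?invr_eq0 ?expf_neq0.
  have X2E : X2 = c' *: X1 by rewrite E2 h2E GamZ E1 !scalerA divfK.
  have i1 : c^-1 != 0 by rewrite invr_eq0. have i2 : c'^-1 != 0 by rewrite invr_eq0.
  have := pairingZ i1 i2 c2; rewrite h2E X2E !scalerA !mulVf // !scale1r => c3.
  by have := etrans c1 (esym c3); rewrite /pairing /= => /addIr /(mulIf o1) ->; exact: eqxx.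
have -> : \det (jac J b v w) = 0.
  apply/eqP; rewrite -det_tr; apply/det0P; exists (w - v) => //.
  rewrite -[LHS]trmxK trmx_mul trmxK -[RHS]trmx0; congr (_^T).
  have : col_mx (J ((b, v), w)) (mxvec (delta_mx 0 0 : 'M_2)) *m ((w - v) : V4)^T = 0; last by [].
  rewrite mul_col_mx JV.
  have -> : mxvec (delta_mx 0 0 : 'M_2) *m (w - v)^T = 0; last exact: col_mx0.
  apply/matrixP => i j; rewrite !ord1 [RHS]mxE e00 linearB /= /v /w !linearZ /= !mxvecK !mxE; ring.
by rewrite mulr0.
Qed.

End AtGoodPoint.
End LemmaM.
End GoodSections.

(** * Generic triples of hyperplanes are good *)

Section GenericGood.
Variables (k : closedFieldType) (d : nat).
Hypothesis char0 : [pchar k] =i pred0.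
Hypothesis hd : (2 <= d)%N.
Implicit Types (A X : 'M[k]_(2, d.+1)) (h g : 'M[k]_2) (x v : 'cV[k]_2).
Local Notation N := (2 * d.+1)%N.
Local Notation "u '_|_' X" := (u *m (xv X)^T = 0) (at level 60).

Definition generic r (P : 'M[k]_(r, N) -> Prop) : Prop :=
  exists c : 'M[k]_(r, N) -> k, pfnz c /\ forall u, ~ P u -> c u = 0.

Lemma generic_and r (P Q : 'M[k]_(r, N) -> Prop) : generic P -> generic Q -> generic (fun u => P u /\ Q u).
Proof.
move=> [c [cn cz]] [f [fn fz]]; exists (fun u => c u * f u); split; first exact: pfnz_mul.
by move=> u /not_andP[/cz ->|/fz ->]; rewrite ?mul0r ?mulr0.
Qed.

Lemma generic_all r (I : eqType) (s : seq I) (P : I -> 'M[k]_(r, N) -> Prop) :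
  (forall i, generic (P i)) -> generic (fun u => forall i, i \in s -> P i u).
Proof.
move=> H; elim: s => [|i s IHs].
  exists (fun=> 1); split; last by move=> u; case.
  by split; [exact: pf_const|exists 0; rewrite oner_neq0].
have [c [cn cz]] := generic_and (H i) IHs; exists c; split=> // u nP; apply: cz => -[Pi Ps].
by apply: nP => j; rewrite in_cons => /orP[/eqP->|/Ps].
Qed.

Lemma generic_sub r (P Q : 'M[k]_(r, N) -> Prop) : (forall u, P u -> Q u) -> generic P -> generic Q.
Proof. by move=> PQ [c [cn cz]]; exists c; split=> // u nQ; apply: cz => /PQ. Qed.

Lemma generic_row s r (Y : 'rV[k]_s -> 'M[k]_(2, d.+1)) : pmap Y -> (s < r)%N ->
  generic (fun u : 'M[k]_(r, N) => forall z, Y z != 0 -> ~ (u _|_ Y z)).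
Proof.
move=> pY sr; have [||c [cn cz]] := @generic_avoid k s r N 1 (fun z => (xv (Y z))^T).
- by rewrite /xv; pfs.
- by rewrite muln1.
exists c; split=> // u /existsNP[z] /not_implyP[Y0 /contrapT uY]; apply: cz uY.
by rewrite mxrank_tr; apply/eqP; rewrite eqn_leq rank_leq_row lt0n mxrank_eq0 xv_eq0.
Qed.

Lemma orthZ r (u : 'M[k]_(r, N)) c X : c != 0 -> u _|_ (c *: X) -> u _|_ X.
Proof.
move=> c0; rewrite xvZ linearZ -scalemxAr => /eqP; rewrite scaler_eq0 (negPf c0).
by move=> /eqP.
Qed.

Lemma orth_lin r (u : 'M[k]_(r, N)) a X b Y : u _|_ X -> u _|_ Y -> u _|_ (a *: X + b *: Y).
Proof.
move=> uX uY; rewrite xv_lin; have -> : (a *: xv X + b *: xv Y)^T = a *: (xv X)^T + b *: (xv Y)^T.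
  by apply/matrixP => i j; rewrite !mxE.
by rewrite mulmxDr -!scalemxAr uX uY !scaler0 addr0.
Qed.

Definition fpoint (e : 'I_2) (t : k) : 'cV[k]_2 := \col_i (if i == e then 1 else t).

Lemma fpointE e v : v e 0 = 1 -> v = fpoint e (v (lift e 0) 0).
Proof.
move=> ve; apply/matrixP => i j; rewrite ord1 mxE; case: (unliftP e i) => [l ->|->].
  by rewrite eq_sym (negPf (neq_lift _ _)) ord1.
by rewrite eqxx.
Qed.

Lemma fixed_points A : coprime_map A -> exists s : seq ('I_2 * k), forall e v, v e 0 = 1 -> fixv A v ->
  exists2 t, (e, t) \in s & v = fpoint e t.
Proof.
move=> rA; suff H (e : 'I_2) : exists s : seq k, forall v, v e 0 = 1 -> fixv A v ->
    exists2 t, t \in s & v = fpoint e t.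
  have [s0 H0] := H 0; have [s1 H1] := H 1.
  exists ([seq (0, t) | t <- s0] ++ [seq (1, t) | t <- s1]) => e v; case: (I2P e) => ->.
    by move=> a /(H0 _ a)[t ts ->]; exists t => //; rewrite mem_cat map_f.
  by move=> a /(H1 _ a)[t ts ->]; exists t => //; rewrite mem_cat map_f ?orbT.
have pp : pmap (fpoint e).
  by apply: pmap_mx => i j; apply: (pf_ext (f := fun t => if i == e then 1 else t)) => [t|];
    [rewrite mxE|apply: pf_if; pfs].
have pw : pf (fun v => wedge v (ev A v)) by rewrite /wedge; pfx.
have [q qE] := pf_k (pf_comp pw pp).
have q0 : q != 0.
  apply/eqP => q0; have [v v0 nv] := fixed_form_neq0 hd rA.
  have pv : pf (fun v : 'cV[k]_2 => v e 0) by pfs.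
  have [|z|z] := pf_mul_eq0 pw pv; last 2 first.
  - by rewrite z eqxx in nv.
  - by have := z (const_mx 1); rewrite mxE => /eqP; rewrite oner_eq0.
  move=> w; have [->|we] := eqVneq (w e 0) 0; first by rewrite mulr0.
  have wE : w = w e 0 *: ((w e 0)^-1 *: w) by rewrite scalerA divff // scale1r.
  set w' := _ *: w in wE; have w'e : w' e 0 = 1 by rewrite mxE mulVf.
  rewrite {1 2}wE evZ wedgeZl wedgeZr (fpointE w'e) qE q0 horner0 !mulr0 mul0r //.
have [rs rsE] := closed_field_poly_normal q.
exists rs => v ve fv; exists (v (lift e 0) 0); last exact: fpointE.
have : root q (v (lift e 0) 0) by rewrite /root -qE -fpointE // fv.
by rewrite {1}rsE rootE hornerZ mulf_eq0 lead_coef_eq0 (negPf q0) /= -rootE root_prod_XsubC.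
Qed.

Lemma bdryZm kap e (w m : 'rV[k]_2) c : bdry d kap e w (c *: m) = c *: bdry d kap e w m.
Proof.
rewrite /bdry; set R := Rm _ _.
have -> : (w *m (c *: m)^T) 0 0 = c * (w *m m^T) 0 0.
  have -> : (c *: m)^T = c *: m^T by apply/matrixP => i j; rewrite !mxE.
  by rewrite -scalemxAr mxE.
have -> : (c *: m)^T = c *: m^T by apply/matrixP => i j; rewrite !mxE.
by rewrite -scalemxAl scalerDr scalerA; congr (_ + _ *: _); ring.
Qed.

(** The limits form finitely many two-parameter families: kap is 0 or the slope at one of finitely
    many fixed points, and w and m each move on a projective line. Three hyperplanes avoid them. *)
Lemma generic_no_boundary r A : (3 <= r)%N -> coprime_map A -> generic (@no_boundary k d r A).
Proof.
move=> r3 rA; have [s sP] := fixed_points rA.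
pose K : seq k := 0 :: [seq slope A q.1 (fpoint q.1 q.2) | q <- s].
pose I := (k * 'I_2 * 'I_2)%type.
pose Y (i : I) (z : 'rV[k]_(1 + 1)) := bdry d i.1.1 i.1.2 (chart i.1.2 (lsubmx z)) (chart i.2 (rsubmx z)).
have pY i : pmap (Y i).
  have pc e : pmap (fun z : 'rV[k]_(1 + 1) => chart e (lsubmx z)) by apply: pmap_chart; apply: pmap_lsubmx; exact: pmap_id.
  have pc' e : pmap (fun z : 'rV[k]_(1 + 1) => chart e (rsubmx z)) by apply: pmap_chart; apply: pmap_rsubmx; exact: pmap_id.
  have p1 := pc i.1.2; have p2 := pc' i.2.
  have pR : pmap (fun z : 'rV[k]_(1 + 1) => Rm d (col_mx (chart i.1.2 (lsubmx z))
      (\row_j (if j == 0 then unitv k i.1.2 1 0 else - unitv k i.1.2 0 0)))).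
    by apply: pmap_Rm; apply: (@pmap_col_mx k _ _ 1 1 2); [exact: p1|exact: pmap_const].
  have pr l : pmap (fun z : 'rV[k]_(1 + 1) => row l (Rm d (col_mx (chart i.1.2 (lsubmx z))
      (\row_j (if j == 0 then unitv k i.1.2 1 0 else - unitv k i.1.2 0 0))))).
    apply: pmap_mx => a b; have := pf_entry l b pR; apply: pf_ext => z; by rewrite [RHS]mxE.
  have pp : pmap (fun z : 'rV[k]_(1 + 1) => perp (chart i.1.2 (lsubmx z))).
    rewrite /perp /vec2; apply: pmap_mx => a b.
    have h0 := pf_entry 0 0 p1; have h1 := pf_opp (pf_entry 0 1 p1).
    apply: (pf_ext (f := fun z => if a == 0 then - chart i.1.2 (lsubmx z) 0 1 else chart i.1.2 (lsubmx z) 0 0)).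
      by move=> z; rewrite [RHS]mxE.
    exact: pf_if.
  rewrite /Y /bdry /=; have q1 := pr (inord d); have q2 := pr (inord d.-1).
  apply: pmap_addmx; first by apply: pmap_mul => //; apply: pmap_tr.
  apply: pmap_scale; last exact: pmap_mul.
  by apply: pf_mul; [exact: pf_const|apply: pf_entry; apply: pmap_mul => //; apply: pmap_tr].
pose L : seq I := [seq (q, f) | q <- [seq (kp, e) | kp <- K, e <- enum 'I_2], f <- enum 'I_2].
have := generic_all L (fun i => generic_row (r := r) (pY i) r3).
apply: generic_sub => u H h X h0 X0 dh XX uX.
have [e [v [w [ve w0 hE]]]] := rank1 h0 dh.
have [kap [e' [t [m [we m0 _ XE kE]]]]] := Xt_sing (ltnW hd) rA X0 ve w0 hE XX.
have [f mf] := row_nz m0; have [t' mE] := chartP mf.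
have kK : kap \in K.
  rewrite in_cons; case: kE => [[fv kE]|->]; last by rewrite eqxx.
  have [t0 ts vE] := sP _ _ ve fv; apply/orP; right; apply/mapP; exists (e, t0) => //=.
  by rewrite kE vE.
have iL : ((kap, e'), f) \in L.
  have kI : (kap, e') \in [seq (kp, e) | kp <- K, e <- enum 'I_2].
    by apply/allpairsP; exists (kap, e'); split; [exact: kK|exact: mem_enum|].
  by apply/allpairsP; exists ((kap, e'), f); split; [exact: kI|exact: mem_enum|].
have YE : X = m 0 f *: Y ((kap, e'), f) (row_mx t t') by rewrite /Y /= row_mxKl row_mxKr -bdryZm -mE.
apply: (H _ iL (row_mx t t')); first by apply: contra X0 => /eqP z; rewrite YE z scaler0.
by apply: (orthZ mf); rewrite -YE.
Qed.

Lemma Gam_orthZ r A (u : 'M[k]_(r, N)) c h : c != 0 -> u _|_ Gam A (c *: h) -> u _|_ Gam A h.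
Proof. by move=> c0; rewrite GamZ; apply: orthZ; rewrite expf_neq0. Qed.

(** The h with first entry 0 form a projective plane, one parameter too few for three conditions. *)
Lemma generic_corner A : coprime_map A -> generic (fun u : 'M[k]_(3, N) => forall h, solution A u h -> h 0 0 != 0).
Proof.
move=> rA; pose hv (w : 'rV[k]_3) : 'M[k]_2 := \matrix_(i, j)
  (if i == 0 then if j == 0 then 0 else w 0 0 else if j == 0 then w 0 1 else w 0 (inord 2)).
have phv : pmap hv.
  apply: pmap_mx => i j; apply: (pf_ext (f := fun w : 'rV[k]_3 => if i == 0 then if j == 0 then 0 else w 0 0
    else if j == 0 then w 0 1 else w 0 (inord 2))) => [w|]; first by rewrite mxE.
  by repeat apply: pf_if; pfs.
have pY e : pmap (fun z : 'rV[k]_2 => Gam A (hv (chart e z))).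
  by apply: pmap_Gam; [pfs|apply: (pmap_comp phv); apply: pmap_chart; pfs].
have := generic_all (enum 'I_3) (fun e => generic_row (r := 3) (pY e) isT).
apply: generic_sub => u H h [hU uG]; apply/eqP => h00.
pose w : 'rV[k]_3 := \row_i (if i == 0 then h 0 1 else if i == 1 then h 1 0 else h 1 1).
have hE : h = hv w.
  apply: mx2P => j; case: (I2P j) => ->; rewrite !mxE //=.
  by rewrite -!val_eqE /= inordK.
have w0 : w != 0.
  by apply: contraTneq hU => wz0; rewrite hE wz0 unit2 det2E !mxE /= !mul0r subrr eqxx.
have [e we] := row_nz w0; have [z wz] := chartP we.
have hZ : h = w 0 e *: hv (chart e z).
  rewrite {1}hE {1}wz; apply/matrixP => i j; rewrite !mxE; do 2 case: ifP => // _; rewrite ?mulr0 //.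
apply: (H e (mem_enum _ e) z); last by apply: (Gam_orthZ we); rewrite -hZ.
have : Gam A h != 0 by exact: Gam_neq0 (rat_neq0 rA) hU.
by apply: contraNneq => G0; rewrite hZ GamZ G0 scaler0.
Qed.

(** By [Gam_first] the second column of such an h is, up to scale, one of finitely many fixed
    points; the first column leaves two parameters. *)
Lemma generic_entry A : coprime_map A -> generic (fun u : 'M[k]_(3, N) => forall h, solution A u h -> Gam A h 0 0 != 0).
Proof.
move=> rA; have [s sP] := fixed_points rA.
pose hv (q : 'I_2 * k) (z : 'rV[k]_2) : 'M[k]_2 := \matrix_(i, j)
  (if j == 0 then z 0 i else fpoint q.1 q.2 i 0).
have phv q : pmap (hv q).
  apply: pmap_mx => i j; apply: (pf_ext (f := fun z : 'rV[k]_2 => if j == 0 then z 0 i else fpoint q.1 q.2 i 0)) => [w|].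
    by rewrite [RHS]mxE.
  by apply: pf_if; pfs.
have pY q : pmap (fun z : 'rV[k]_2 => Gam A (hv q z)) by apply: pmap_Gam; [pfs|exact: phv].
have := generic_all s (fun q => generic_row (r := 3) (pY q) isT).
apply: generic_sub => u H h [hU uG]; rewrite Gam_first oppr_eq0; apply/eqP => wz.
set v := h *m x1 k in wz; have v0 : v != 0.
  by apply: unitmx_vec => //; exact: wedge_neq0l (wx12 k).
have [e ve] := col_nz v0; have ie : (v e 0)^-1 != 0 by rewrite invr_eq0.
have v'e : ((v e 0)^-1 *: v) e 0 = 1 by rewrite mxE mulVf.
have fv : fixv A ((v e 0)^-1 *: v) by rewrite /fixv evZ wedgeZl wedgeZr wz !mulr0.
have [t ts tE] := sP _ _ v'e fv.
have vE i : v i 0 = h i 1 by rewrite mul2E x1_0 x1_1 mulr0 add0r mulr1.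
have hE : h = v e 0 *: hv (e, t) (\row_i ((v e 0)^-1 * h i 0)).
  apply/matrixP => i j; rewrite [RHS]mxE [hv _ _ _ _]mxE /=; case: (I2P j) => -> /=.
    by rewrite [X in _ * X]mxE mulrA divff // mul1r.
  by rewrite -tE [X in _ * X]mxE mulrA divff // mul1r vE.
apply: (H _ ts (\row_i ((v e 0)^-1 * h i 0))); last by apply: (Gam_orthZ ve); rewrite -hE.
have : Gam A h != 0 by exact: Gam_neq0 (rat_neq0 rA) hU.
by apply: contraNneq => G0; rewrite hE GamZ G0 scaler0.
Qed.

Definition e00 : 'I_4 := mxvec_index (0 : 'I_2) (0 : 'I_2).

(** A violation consists of a point h and a tangent direction, 3 + 2 parameters, such that u kills
    two independent vectors, which is 6 conditions. *)
Lemma generic_etale A : coprime_map A -> generic (etale A).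
Proof.
move=> rA.
pose hz (z : 'rV[k]_(3 + 2)) : 'M[k]_2 := vec_mx (chart e00 (lsubmx z) : 'rV_(2 * 2)).
pose gz (f : 'I_3) (z : 'rV[k]_(3 + 2)) : 'M[k]_2 := dirs e00 (chart f (rsubmx z)).
have ph : pmap hz by apply: pmap_vec_mx; apply: pmap_chart; apply: pmap_lsubmx; exact: pmap_id.
have pg f : pmap (gz f).
  by apply: pmap_vec_mx; apply: pmap_chart0; apply: pmap_chart; apply: pmap_rsubmx; exact: pmap_id.
pose Y f z : 'M[k]_(N, 1 + 1) := row_mx (xv (Gam A (hz z)))^T (xv (dGam A (hz z) (gz f z)))^T.
have pY f : pmap (Y f).
  have p1 := ph; have p2 := pg f.
  by apply: pmap_row_mx; apply: pmap_tr; rewrite /xv; apply: pmap_mxvec; [apply: pmap_Gam; pfs|apply: pmap_dGam; pfs].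
have gen f : generic (fun u : 'M[k]_(3, N) => forall z, \rank (Y f z) = 2 -> u *m Y f z <> 0).
  have [|c [cn cz]] := @generic_avoid k (3 + 2) 3 N 2 (Y f) (pY f); first by [].
  by exists c; split=> // u /existsNP[z] /not_implyP[rk /contrapT uY]; apply: cz uY.
have := generic_all (enum 'I_3) gen; apply: generic_sub => u H h g [hU uG] h00 uD.
have he : mxvec h 0 e00 = 1 by rewrite /e00 mxvecE.
have hne : mxvec h 0 e00 != 0 by rewrite he oner_neq0.
have [z1 hE] := chartP (y := mxvec h : 'rV_4) hne; rewrite he scale1r in hE.
pose g' := g - g 0 0 *: h; have g'00 : mxvec g' 0 e00 = 0.
  by rewrite /e00 mxvecE !mxE h00 mulr1 subrr.
have [w wE] := chart0P (y := mxvec g' : 'rV_4) g'00.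
have [w0|w0] := eqVneq w 0.
  exists (g 0 0); apply/eqP; rewrite -subr_eq0 -/g' -[g']mxvecK wE w0.
  have -> : chart0 e00 0 = 0 :> 'rV[k]_4 by apply/rowP => j; rewrite !mxE; case: unlift => // ?; rewrite mxE.
  by apply/eqP; exact: linear0.
have [f wf] := row_nz w0; have [z2 w2] := chartP wf.
have hz1 : hz (row_mx z1 z2) = h by rewrite /hz row_mxKl -hE mxvecK.
have gz1 : g' = w 0 f *: gz f (row_mx z1 z2).
  rewrite /gz row_mxKr /dirs -[g' in LHS]mxvecK wE {1}w2.
  have -> : chart0 e00 (w 0 f *: chart f z2) = w 0 f *: chart0 e00 (chart f z2).
    by apply/rowP => j; rewrite !mxE; case: unlift => [l|]; rewrite ?mxE ?mulr0.
  by rewrite linearZ.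
have g10 : gz f (row_mx z1 z2) 0 0 = 0.
  have := g'00; rewrite /e00 mxvecE gz1 mxE => /eqP; rewrite mulf_eq0 (negPf wf).
  by move=> /eqP.
have uD' : u _|_ dGam A h (gz f (row_mx z1 z2)).
  have -> : gz f (row_mx z1 z2) = (w 0 f)^-1 *: g + (- ((w 0 f)^-1 * g 0 0)) *: h.
    by apply: (scalerI wf); rewrite -gz1 /g' scalerDr !scalerA divff // scale1r mulrN mulrA divff // mul1r scaleNr.
  (* Euler's relation, [Gam] being of degree d + 1 in h; by it the direction g can be changed by
     multiples of h. *)
  have euler : dGam A h h = d.+1%:R *: Gam A h.
    have [E EE] := Gam_expand A h h.
    have [q qE] : exists q : {poly k}, forall t, (1 + t) ^+ d.+1 = 1 + t * d.+1%:R + t ^+ 2 * q.[t].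
      exists (drop_poly 2 ((1 + 'X) ^+ d.+1)) => t; have := poly_expand ((1 + 'X) ^+ d.+1) t.
      rewrite horner_exp hornerD hornerX hornerC => ->; congr (_ + _ * _ + _).
        by rewrite -horner_coef0 horner_exp !hornerE ?addr0 ?expr1n.
      have := coef_deriv ((1 + 'X : {poly k}) ^+ d.+1) 0; rewrite mulr1n => <-.
      by rewrite deriv_exp derivD derivC derivX add0r mul1r -horner_coef0 hornerMn horner_exp !hornerE ?addr0 ?expr1n.
    apply: (@expand_uniq k _ _ _ _ E (q *: map_mx polyC (Gam A h)) (Gam A h)) => t.
    rewrite -EE -{1}[h]scale1r -scalerDl GamZ qE !scalerDl scale1r !scalerA; congr (_ + _ *: _ + _).
    by apply/matrixP => i j; rewrite !mxE hornerM hornerC mulrA.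
  rewrite dGam_lin euler; move: (dGam A h g) (Gam A h) uD uG => D G uD uG.
  by rewrite scalerA; apply: orth_lin.
exfalso; apply: (H f (mem_enum _ f) (row_mx z1 z2)); last first.
  by rewrite /Y mul_mx_row hz1 uG uD' row_mx0.
rewrite -mxrank_tr /Y tr_row_mx !trmxK hz1; apply/eqP.
have : row_free (col_mx (xv (Gam A h)) (xv (dGam A h (gz f (row_mx z1 z2))))); last by [].
apply/inj_row_free => v; rewrite -[v]hsubmxK mul_row_col.
set a := lsubmx v; set b := rsubmx v; rewrite [a]mx11_scalar [b]mx11_scalar !mul_scalar_mx => E.
have b0 : b 0 0 = 0.
  apply: contrapT => /eqP bn.
  have E' : dGam A h (gz f (row_mx z1 z2)) = (- a 0 0 / b 0 0) *: Gam A h.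
    apply: xv_inj; rewrite xvZ; apply: (scalerI bn); rewrite scalerA [_ * (_ / _)]mulrC divfK //.
    by rewrite scaleNr; apply/eqP; rewrite -addr_eq0 addrC E.
  have [s sE] := tangent_indep char0 hd rA hU E'.
  have s0 : s = 0 by rewrite -g10 sE mxE h00 mulr1.
  have : chart f z2 = 0.
    apply: (dirs_indep (e := e00) (h := h) (s := 0)) => //; rewrite scale0r.
    by move: sE; rewrite s0 scale0r /gz row_mxKr.
  by move/(congr1 (fun c : 'rV[k]_3 => c 0 f)) => /eqP; rewrite mxE unlift_none mxE oner_eq0.
move: E; rewrite b0 scale0r addr0 => /eqP; rewrite scaler_eq0 xv_eq0.
rewrite (negPf (Gam_neq0 (rat_neq0 rA) hU)) orbF => /eqP ->.
by apply/rowP => i; rewrite mxE; case: splitP => j _; rewrite !mxE ?mul0rn.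
Qed.

Theorem generic_good A : coprime_map A -> generic (good A).
Proof.
move=> rA; have := generic_and (generic_no_boundary (leqnn 3) rA) (generic_and (generic_etale rA)
  (generic_and (generic_corner rA) (generic_entry rA))).
by apply: generic_sub => u [a [b [c e]]].
Qed.

Theorem generic_miss A : coprime_map A -> generic (fun u : 'M[k]_(4, N) =>
  forall h X, h != 0 -> X != 0 -> Xt A h X -> ~ (u _|_ X)).
Proof.
move=> rA; have pY (e : 'I_4) : pmap (fun z : 'rV[k]_3 => Gam A (vec_mx (chart e z : 'rV_(2 * 2)))).
  by apply: pmap_Gam; [pfs|apply: pmap_vec_mx; apply: pmap_chart; pfs].
have := generic_and (@generic_no_boundary 4 A isT rA)
  (generic_all (enum 'I_4) (fun e => generic_row (r := 4) (pY e) isT)).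
apply: generic_sub => u [nb H] h X h0 X0 XX uX.
have [dh|dh] := eqVneq (\det h) 0; first exact: nb h0 X0 dh XX uX.
have hU : h \in unitmx by rewrite unit2.
have G0 := Gam_neq0 (rat_neq0 rA) hU; have [c XE] := Xt_prop G0 XX.
have c0 : c != 0 by apply: contra_neq X0 => c0; rewrite XE c0 scale0r.
have uG : u _|_ Gam A h by apply: (orthZ c0); rewrite -XE.
have : mxvec h != 0 by rewrite mxvec_eq0.
move=> /(@row_nz k 4)[e he]; have [z hE] := chartP (y := mxvec h : 'rV_4) he.
have hZ : h = mxvec h 0 e *: vec_mx (chart e z : 'rV_(2 * 2)).
  by rewrite -[LHS]mxvecK {1}hE linearZ.
apply: (H e (mem_enum _ e) z); last by apply: (Gam_orthZ he); rewrite -hZ.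
by apply: contra G0 => /eqP G0; rewrite hZ GamZ G0 scaler0.
Qed.

End GenericGood.

Section GoodSections.
Variables (k : closedFieldType) (d : nat).
Hypothesis char0 : [pchar k] =i pred0.
Hypothesis hd : (2 <= d)%N.
Implicit Types (A X : 'M[k]_(2, d.+1)) (h g : 'M[k]_2) (x v : 'cV[k]_2).
Local Notation N := (2 * d.+1)%N.
Local Notation "u '_|_' X" := (u *m (xv X)^T = 0) (at level 60).

Section LemmaM.
Local Notation B := (2 * 2 * N)%N.
Local Notation base := (@base k d B).
Local Notation yY := (@yY k d).
Local Notation oY := (@oY k d).
Local Notation on_hit := (@on_hit k d B yY oY).
Local Notation on_closure := (@on_closure k d B yY oY).
Variable Phi : {poly {mpoly k[@adim k base _]}}.
Hypotheses (pPhi : rprime Phi) (sPhi : (1 < size Phi)%N) (vPhi : vanishing yY oY Phi)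
  (cPhi : forall p T, (evp (cof p) Phi).[T] = 0 -> on_closure p T).
Variable e : nat.
Hypothesis homPhi : forall (p : base) T s,
  form Phi ((p.1, s *: p.2), s * T) = s ^+ e * form Phi (p, T).

Local Notation first b := (form Phi ((b, 0), 1)).
Local Notation V4 := 'rV[k]_(2 * 2).

Lemma uniq_simple_roots (ts : seq k) :
  (forall x : k, x \in ts -> ~~ (('X - x%:P) ^+ 2 %| \prod_(z <- ts) ('X - z%:P))) -> uniq ts.
Proof.
elim: ts => [//|a ts IH] H /=; apply/andP; split.
  apply/negP => ats; have /negP := H a (mem_head _ _); apply.
  by rewrite big_cons (big_rem _ ats) /= mulrA -expr2 dvdp_mulr.
apply: IH => x xts; have := H x; rewrite in_cons xts orbT => /(_ isT); apply: contra => dv.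
by rewrite big_cons dvdp_mull.
Qed.

(** For l separating the solutions, the roots in T are exactly their [froot], each simple by
    [simple_root], so both sides agree as polynomials in T. The other l follow because the
    separating ones are dense. *)
Theorem good_factorization A0 u0 : good A0 u0 -> exists rs : seq 'M[k]_2, [/\ uniq rs, size rs = e,
  forall h, (h \in rs) <-> (solution A0 u0 h /\ h 0 0 = 1) &
  exists2 c, c != 0 & forall l T, form Phi (((A0, u0), l), T) =
    c * \prod_(h <- rs) pairing yY oY l T h (Gam A0 h)].
Proof.
move=> g0; have [rs nr max] := maximal_nsol hd sPhi vPhi cPhi homPhi g0.
have [f [pff [l1 fl1]] fP] := separating_l nr.1 (fun h => nsol_Gam g0 nr (h := h)).
have f0 := first_neq0 cPhi g0.
have A0n : A0 != 0 by case: g0 => /rat_neq0.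
have main l : f l != 0 -> size rs = e /\ forall T, form Phi (((A0, u0), l), T) =
    first (A0, u0) * \prod_(h <- rs) (T - froot A0 l h).
  move=> /fP inj; have [p [pE p0 sp pe]] := line_form cPhi homPhi g0 l.
  have [ts tsE] := closed_field_poly_normal p.
  have lp : lead_coef p = first (A0, u0) by rewrite /lead_coef sp.
  have root_ts (x : k) : (x \in ts) = (p.[x] == 0).
    by rewrite -root_prod_XsubC [in RHS]tsE hornerZ mulf_eq0 lead_coef_eq0 (negPf p0).
  have uts : uniq ts.
    apply: uniq_simple_roots => x xts; have := simple_root char0 hd pPhi sPhi cPhi homPhi g0 nr max inj pE.
    have px : p.[x] = 0 by apply/eqP; rewrite -root_ts.
    by move/(_ x px); rewrite tsE dvdpZr ?lead_coef_eq0.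
  have A1 T : T \in ts -> T \in map (froot A0 l) rs.
    rewrite root_ts pE => /eqP /cPhi /(closure_solution g0)[h [sh h00 pz]].
    have hr := max _ sh h00; apply/mapP; exists h => //; have [_ G0] := nsol_Gam g0 nr hr.
    by move/eqP: pz; rewrite pairing_froot // mulf_eq0 (negPf G0) orbF subr_eq0 => /eqP.
  have A2 T : T \in map (froot A0 l) rs -> T \in ts.
    move=> /mapP[h hr ->]; have [h00 G0] := nsol_Gam g0 nr hr; rewrite root_ts pE.
    by rewrite (form_hit vPhi A0n (nr.2 _ hr).1) // pairing_froot // subrr mul0r.
  have um : uniq (map (froot A0 l) rs) by rewrite map_inj_in_uniq; [exact: nr.1|exact: inj].
  have pq : perm_eq ts (map (froot A0 l) rs).
    by apply: uniq_perm => // T; apply/idP/idP; [exact: A1|exact: A2].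
  split.
    have := perm_size pq; rewrite size_map => <-; apply/eqP; rewrite -eqSS -sp {1}tsE.
    by rewrite size_scale ?lead_coef_eq0 // (size_prod_XsubC ts id).
  move=> T; rewrite -pE {1}tsE lp hornerZ horner_prod (perm_big _ pq) big_map; congr (_ * _).
  by apply: eq_bigr => h _; rewrite hornerXsubC.
have G0 h : h \in rs -> Gam A0 h 0 0 != 0 by move=> /(nsol_Gam g0 nr)[].
exists rs; split; [exact: nr.1|exact: (main _ fl1).1| |].
  by move=> h; split=> [/nr.2[]|[]]; [|exact: max].
pose c := first (A0, u0) / \prod_(h <- rs) Gam A0 h 0 0.
have P0 : \prod_(h <- rs) Gam A0 h 0 0 != 0 by rewrite prodf_seq_neq0; apply/allP => h /G0 ->.
exists c => [|l T]; first by rewrite mulf_neq0 ?invr_eq0.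
pose F (l : 'rV[k]_B) := form Phi (((A0, u0), l), T) - c * \prod_(h <- rs) pairing yY oY l T h (Gam A0 h).
have pF : pf F.
  apply: pf_add.
    by apply: (pf_comp (pf_form Phi)); apply: pmap_pair; [apply: pmap_pair|]; pfs.
  by apply: pf_opp; apply: pf_mul; [exact: pf_const|apply: pf_prod => h]; rewrite /pairing; pfs.
have z l' : F l' * f l' = 0.
  have [->|/main[_ fl']] := eqVneq (f l') 0; first by rewrite mulr0.
  have E : \prod_(h <- rs) pairing yY oY l' T h (Gam A0 h) =
      (\prod_(h <- rs) Gam A0 h 0 0) * \prod_(h <- rs) (T - froot A0 l' h).
    rewrite -big_split; apply: eq_big_seq => h hr /=; have [h00 g00] := nsol_Gam g0 nr hr.
    by rewrite pairing_froot // mulrC.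
  by rewrite /F fl' E /c mulrA divfK // subrr mul0r.
have [Fz|fz] := pf_mul_eq0 pF pff z; last by rewrite fz eqxx in fl1.
by apply/eqP; rewrite -subr_eq0 -/(F l) Fz.
Qed.

End LemmaM.
End GoodSections.

(** * A map with trivial automorphism group *)

Section RigidMap.
Variables (k : closedFieldType) (d : nat).
Hypothesis char0 : [pchar k] =i pred0.
Hypothesis hd : (2 <= d)%N.

(* The map x + x^d / (x + 1): its only fixed points are 0, of multiplicity d, and infinity. *)
Definition rigidA : 'M[k]_(2, d.+1) := \matrix_(i, j)
  (if i == 0 then (j == d :> nat)%:R + (j == 1 :> nat)%:R + (j == 2 :> nat)%:R
   else (j == 1 :> nat)%:R + (j == 0 :> nat)%:R).

Lemma sum_delta n (F : nat -> k) m : (m < n)%N -> \sum_(j < n) (j == m :> nat)%:R * F j = F m.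
Proof.
move=> mn; rewrite (bigD1 (Ordinal mn)) //= eqxx mul1r big1 ?addr0 // => j jm.
by rewrite (_ : (j == m :> nat) = false) ?mul0r //; apply: contraNF jm => /eqP jm; apply/eqP/val_inj.
Qed.

Lemma ev_rigid x : ev rigidA x = vec2
  (x 0 0 ^+ d + x 0 0 * x 1 0 ^+ d.-1 + x 0 0 ^+ 2 * x 1 0 ^+ d.-2)
  (x 0 0 * x 1 0 ^+ d.-1 + x 1 0 ^+ d).
Proof.
pose F j := x 0 0 ^+ j * x 1 0 ^+ (d - j); have d0 := ltnW hd.
have Fd : F d = x 0 0 ^+ d by rewrite /F subnn mulr1.
have F1 : F 1%N = x 0 0 * x 1 0 ^+ d.-1 by rewrite /F subn1.
have F2 : F 2%N = x 0 0 ^+ 2 * x 1 0 ^+ d.-2 by rewrite /F subn2.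
have F0 : F 0%N = x 1 0 ^+ d by rewrite /F mul1r subn0.
apply: col2P; rewrite ?vec2_0 ?vec2_1 mxE.
  under eq_bigr => j _ do rewrite !mxE /= -/(F j) !mulrDl.
  by rewrite !big_split /= !sum_delta ?Fd ?F1 ?F2 // ltnS.
under eq_bigr => j _ do rewrite !mxE /= -/(F j) !mulrDl.
by rewrite !big_split /= !sum_delta ?F0 ?F1 // ltnS.
Qed.

Lemma rigid_fix x : wedge x (ev rigidA x) = - (x 0 0 ^+ d * x 1 0).
Proof.
have dd : (d = d.-2.+2)%N by move: hd; case: (d) => [|[|m]].
have d1 : (d.-1 = d.-2.+1)%N by rewrite {1}dd.
rewrite ev_rigid /wedge vec2_0 vec2_1 d1 {2}dd {5}dd; move: (d.-2) (x 0 0 ^+ d) => m z.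
rewrite !exprS; ring.
Qed.

Lemma rat_rigid : coprime_map rigidA.
Proof.
have dd : (d = d.-2.+2)%N by move: hd; case: (d) => [|[|m]].
have d1 : (d.-1 = d.-2.+1)%N by rewrite {1}dd.
have d0 : (0 < d)%N by exact: ltnW.
move=> x x0; apply: contra x0 => /eqP E.
have /eqP := rigid_fix x; rewrite E /wedge !mxE mulr0 mul0r subrr eq_sym oppr_eq0 mulf_eq0 expf_eq0 d0 /=.
have E0 : (ev rigidA x) 0 0 = 0 by rewrite E mxE.
have E1 : (ev rigidA x) 1 0 = 0 by rewrite E mxE.
move: E0 E1; rewrite ev_rigid vec2_0 vec2_1 => E0 E1 /orP[] /eqP z.
  move/eqP: E1; rewrite z mul0r add0r expf_eq0 d0 => /eqP z1.
  by apply/eqP/col2P; rewrite ?z ?z1 mxE.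
have x00 : x 0 0 ^+ d = 0.
  have [m0|m0] := eqVneq d.-2 0%N; last first.
    by move: E0; rewrite z d1 [0 ^+ d.-2.+1]expr0n [0 ^+ d.-2]expr0n (negPf m0) /= !mulr0 !addr0.
  move: E0; rewrite z d1 m0 expr0 expr1 mulr0 addr0 mulr1 dd m0 -mulr2n -mulr_natr => /eqP.
  by rewrite mulf_eq0 (natr_eq0 char0) orbF => /eqP.
by move/eqP: x00; rewrite expf_eq0 d0 => /eqP z0; apply/eqP/col2P; rewrite ?z ?z0 mxE.
Qed.

(** The fixed points have different multiplicities d and 1, so h preserves each of them and is
    diagonal; comparing the denominators at the pole -1 makes the two diagonal entries equal. *)
Lemma rigid_trivial h c : h \in unitmx -> Gam rigidA h = c *: rigidA -> exists s, h = s%:M.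
Proof.
have d0 : (0 < d)%N by exact: ltnW.
move=> hU E.
have fixE (x : 'cV[k]_2) : (h *m x) 0 0 ^+ d * (h *m x) 1 0 = c * (x 0 0 ^+ d * x 1 0).
  have : wedge x (ev (Gam rigidA h) x) = wedge (h *m x) (ev rigidA (h *m x)).
    by rewrite ev_Gam wedgeC wedge_adj -wedgeC.
  by rewrite E evZl wedgeZr !rigid_fix mulrN => /oppr_inj.
have hx a b : (h *m vec2 a b) 0 0 = h 0 0 * a + h 0 1 * b /\ (h *m vec2 a b) 1 0 = h 1 0 * a + h 1 1 * b.
  by rewrite !mul2E vec2_0 vec2_1.
have F a b : (h 0 0 * a + h 0 1 * b) ^+ d * (h 1 0 * a + h 1 1 * b) = c * (a ^+ d * b).
  by have [<- <-] := hx a b; rewrite fixE vec2_0 vec2_1.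
have dh : h 0 0 * h 1 1 - h 0 1 * h 1 0 != 0 by rewrite -det2E -unit2.
have /eqP := F 0 1; have /eqP := F 1 0.
rewrite !mulr0 !mulr1 !addr0 !add0r [0 ^+ d]expr0n gtn_eqF //= ?mul0r ?mulr0.
rewrite !mulf_eq0 !expf_eq0 d0 /= => /orP[] /eqP h1 /orP[] /eqP h2.
- by move: dh; rewrite h1 h2 !mul0r subrr eqxx.
- exfalso; have := F 1 1; have := F 1 2%:R; rewrite h1 h2 !mul0r !add0r !addr0 !mulr1 !expr1n !mul1r ?mulr1 => F2 F1.
  move: dh; rewrite h1 mul0r sub0r oppr_eq0 mulf_eq0 negb_or => /andP[b0 p0].
  move: F2; rewrite -F1 exprMn mulrAC => /(mulfI (mulf_neq0 (expf_neq0 d b0) p0)).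
  rewrite -natrX => /(@natr_inj k char0) /eqP; rewrite -[X in _ == X]expn1 eqn_exp2l // => /eqP d1.
  by move: hd; rewrite d1.
- rewrite h1 h2 mul0r subr0 in dh; move: (dh); rewrite mulf_eq0 negb_or => /andP[a0 q0].
  have ev1 t : (ev (Gam rigidA h) (vec2 1 t)) 1 0 = c * (ev rigidA (vec2 1 t)) 1 0.
    by rewrite E evZl mxE.
  have [adj0 adj1 adj2 adj3] := adj2E h.
  have G t : h 0 0 * (h 0 0 * (h 1 1 * t) ^+ d.-1 + (h 1 1 * t) ^+ d) = c * (t ^+ d.-1 + t ^+ d).
    have := ev1 t; rewrite ev_Gam mul2E adj2 adj3 h1 oppr0 mul0r add0r !ev_rigid !vec2_1.
    by have [-> ->] := hx 1 t; rewrite h1 h2 vec2_0 !mul0r add0r addr0 !mulr1 mul1r.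
  have dd : (d = d.-1.+1)%N by rewrite prednK.
  have := G (-1); rewrite {2 4}dd !exprS mulN1r addrN mulr0 mulrN1 mulNr -mulrBl => /eqP.
  rewrite !mulf_eq0 (negPf a0) /= expf_eq0 oppr_eq0 (negPf q0) andbF orbF subr_eq0 => /eqP e.
  exists (h 0 0); apply/matrixP => i j; rewrite [RHS]mxE.
  by case: (I2P i) => ->; case: (I2P j) => ->; rewrite ?h1 ?h2 -?e.
- by move: dh; rewrite h1 h2 !mulr0 subrr eqxx.
Qed.

Lemma rigid_separates h h' c : h \in unitmx -> h' \in unitmx -> h 0 0 = 1 -> h' 0 0 = 1 ->
  Gam rigidA h = c *: Gam rigidA h' -> h = h'.
Proof.
move=> hU hU' h00 h00' E; have [||s sE] := @rigid_trivial (h *m invmx h') c.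
- by rewrite unitmx_mul hU unitmx_inv.
- rewrite GamM E GamZl; congr (_ *: _); exact: Gam_inv.
have hE : h = s *: h' by rewrite -[LHS](mulmxKV hU') sE mul_scalar_mx.
by move: h00; rewrite hE mxE h00' mulr1 => ->; rewrite scale1r.
Qed.

End RigidMap.

(** * The incidence form for all maps *)

Section Universal.
Variables (k : closedFieldType) (d : nat).
Hypothesis char0 : [pchar k] =i pred0.
Hypothesis hd : (2 <= d)%N.
Implicit Types (A X : 'M[k]_(2, d.+1)) (h g : 'M[k]_2).
Local Notation N := (2 * d.+1)%N.
Local Notation B := (2 * 2 * N)%N.
Local Notation "u '_|_' X" := (u *m (xv X)^T = 0) (at level 60).

Lemma good_pow : good (powA k d) (cycu k d).
Proof.
have sol h : solution (powA k d) (cycu k d) h -> [/\ h \in unitmx, cyc (Gam (powA k d) h),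
    h 0 0 != 0 & Gam (powA k d) h 0 0 != 0].
  move=> [hU /cycuP cG]; have G0 := Gam_neq0 (rat_neq0 (@rat_pow k d hd)) hU.
  by have [_ _ _ h00 G00] := cyc_unit char0 hd (unit_neq0 hU) G0 (Xt_Gam _ h) cG.
split; first exact: rat_pow.
- by move=> h X h0 X0 dh XX /cycuP cX; exact: (cyc_no_boundary char0 hd h0 X0 dh XX cX).
- by move=> h g /sol[hU cG _ _] _ /cycuP; exact: (cyc_etale char0 hd hU cG).
- by move=> h /sol[].
- by move=> h /sol[].
Qed.

Lemma form_hom n y o (Phi : {poly {mpoly k[@adim k (@base k d n) _]}}) : Phi != 0 ->
  @vanishing k d n y o Phi -> (forall Q, vanishing y o Q -> rdvd Phi Q) ->
  exists e, forall (p : @base k d n) T s, form Phi ((p.1, s *: p.2), s * T) = s ^+ e * form Phi (p, T).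
Proof.
move=> P0 vP dP.
have [|||||e eP] := @scaling_degree k d n y o Phi P0 vP dP (fun s q => ((q.1.1, s *: q.1.2), s * q.2)).
- by move=> s; apply: pmap_pair; [apply: pmap_pair|]; rewrite /base; pfs; apply: pmap_k; pfs.
- by move=> q; apply: pmap_pair; [apply: pmap_pair|]; pfs; apply: pmap_k; pfs.
- by move=> [[b l] T]; rewrite /= scale1r mul1r.
- by move=> s t [[b l] T]; rewrite /= scalerA mulrA.
- move=> s [[[A u] l] T] s0 [A0 [h [hU uG pz]]]; split=> //; exists h; split=> //.
  move: pz; rewrite /= /pairing -scalemxAl => pz.
  by rewrite [X in _ + X]mxE -mulrA -mulrDr pz mulr0.
by exists e => p T s; have := eP s (p, T).
Qed.

Lemma perm_solutions A u rs rs' : (forall h, (h \in rs) <-> (solution A u h /\ h 0 0 = 1)) ->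
  uniq rs -> uniq rs' -> (forall h, (h \in rs') <-> (solution A u h /\ h 0 0 = 1)) -> size rs = size rs'.
Proof.
move=> H u1 u2 H'; apply: perm_size; apply: uniq_perm => // h.
by apply/idP/idP => [/H /H'|/H' /H].
Qed.

(** The Segre form on the hyperplanes [emb l] is r times the form for conjugates. At the rigid map
    different solutions have different conjugates, which forces the two degrees in (l, T) to agree.
    So r depends on (A, u) only, and the factorization over the solutions passes to G, the value at
    T = 0. *)
Theorem universal_form : exists G : 'M[k]_(2, d.+1) * 'M[k]_(4, N) -> k,
  [/\ pf G, (exists m, forall A U s, G (s *: A, U) = s ^+ m * G (A, U)),
   (forall A U h, A != 0 -> h \in unitmx -> U _|_ Gam A h -> G (A, U) = 0),
   (forall A U, G (A, U) = 0 -> exists h X, [/\ h != 0, X != 0, Xt A h X & U _|_ X]) &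
   (forall A u, good A u -> exists rs : seq 'M[k]_2, [/\ uniq rs, size rs = (d ^ 3 - d)%N,
     forall h, (h \in rs) <-> (solution A u h /\ h 0 0 = 1) &
     exists2 c, c != 0 & forall v : 'rV[k]_N, G (A, (col_mx u v : 'M_(3 + 1, N))) =
       c * \prod_(h <- rs) (v *m (xv (Gam A h))^T) 0 0])].
Proof.
have [PX [pX sX vX dX cX]] := form_X char0 hd.
have [PY [pY sY vY dY cY]] := form_Y char0 hd.
have X0 : PX != 0 by case: pX.
have Y0 : PY != 0 by case: pY.
have [eX homX] := form_hom X0 vX dX; have [eY homY] := form_hom Y0 vY dY.
have fact := good_factorization char0 hd pY sY vY cY homY.
(* The degree is the number of normalized solutions at any good point, so it may be counted at the
   power map. *)
have eYE : eY = (d ^ 3 - d)%N.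
  have [rs [ur sr rP _]] := fact _ _ good_pow.
  have [qs [uq sq qP1 qP2]] := @three_cycles k d char0 hd.
  rewrite -sr -sq; apply: (perm_solutions rP) => // h; split.
    by move=> /qP1[hU h00 cG]; split=> //; split=> //; apply/cycuP.
  by move=> [[hU /cycuP cG] h00]; exact: qP2.
(* The Segre form that equals h_00 times l in X; on normalized solutions it agrees with l. *)
pose emb (l : 'rV[k]_N) : 'rV[k]_B := mxvec ((mxvec (delta_mx 0 0 : 'M_2))^T *m l).
have embE l T h Y : pairing (@yY k d) (@oY k d) (emb l) T h Y = h 0 0 * pairing (@yX k d) (@oX k d) l T h Y.
  rewrite /pairing /oY /oX /yY /yX /= mulrDr; congr (_ + _); first by ring.
  rewrite [LHS]mxE [in RHS]mxE (reindex (uncurry (@mxvec_index (2 * 2) N))) /=; last first.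
    exact: (curry_mxvec_bij _ _).
  rewrite (eq_bigr (fun q => (mxvec (delta_mx 0 0 : 'M[k]_2) 0 q.1 * mxvec h 0 q.1) * (l 0 q.2 * xv Y 0 q.2))).
    rewrite -(pair_bigA _ (fun a b => (mxvec (delta_mx 0 0 : 'M[k]_2) 0 a * mxvec h 0 a) * (l 0 b * xv Y 0 b))) /=.
    rewrite (eq_bigr (fun a => (mxvec (delta_mx 0 0 : 'M[k]_2) 0 a * mxvec h 0 a) * \sum_j l 0 j * (xv Y)^T j 0)).
      rewrite -mulr_suml; congr (_ * _).
      rewrite (bigD1 (mxvec_index 0 0)) //= !mxvecE mxE !eqxx mul1r big1 ?addr0 // => q.
      case/mxvec_indexP: q => i j ij; rewrite mxvecE mxE.
      case: eqP => [i0|]; last by rewrite mul0r. case: eqP => [j0|]; last by rewrite mul0r.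
      by rewrite i0 j0 eqxx in ij.
    by move=> a _; rewrite mulr_sumr; apply: eq_bigr => b _; rewrite [(xv Y)^T _ _]mxE.
  move=> [a b] _ /=; rewrite [(_^T) _ _]mxE /emb !mxvecE !outer_eq0; ring.
pose f (q : @base k d N * k) := form PY ((q.1.1, emb q.1.2), q.2).
have pf_f : pf f.
  apply: (pf_comp (pf_form PY)); apply: pmap_pair; last by apply: pmap_k; rewrite /base; pfs.
  by apply: pmap_pair; rewrite /base /emb; pfs.
have [r pr rE] : exists2 r : @base k d N * k -> k, pf r & forall q, f q = r q * form PX q.
  apply: (form_divides dX pf_f) => -[[A u] l] T [A0 [h [hU uG pz]]]; apply: vY.
  split=> //; exists h; split=> //.
  by rewrite /= embE; move: pz; rewrite /= => ->; rewrite mulr0.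
have fhom b l T s : f ((b, s *: l), s * T) = s ^+ eY * f ((b, l), T).
  rewrite /f -homY /=; congr (form PY ((_, _), _)).
  by rewrite /emb -scalemxAr linearZ.
have ffact A u : good A u -> exists rs : seq 'M[k]_2, [/\ uniq rs, size rs = eY,
    forall h, (h \in rs) <-> (solution A u h /\ h 0 0 = 1) &
    exists2 c, c != 0 & forall l T, f (((A, u), l), T) =
      c * \prod_(h <- rs) pairing (@yX k d) (@oX k d) l T h (Gam A h)].
  move=> /fact[rs [ur sr rP [c c0 cE]]]; exists rs; split=> //; exists c => // l T.
  rewrite /f cE; congr (_ * _); apply: eq_big_seq => h /rP[_ h00].
  by rewrite embE h00 mul1r.
have eXY : eX = eY.
  have rA := rat_rigid char0 hd; have [c [[pc [u cu]] cz]] := generic_good char0 hd rA.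
  have gu : good (rigidA k d) u by apply: contrapT => /cz z; rewrite z eqxx in cu.
  have [rs [ur sr rP [c' c'0 cE]]] := ffact _ _ gu.
  have G00 h : h \in rs -> Gam (rigidA k d) h 0 0 != 0.
    by move=> /rP[sh _]; case: gu => _ _ _ _ /(_ _ sh).
  pose tau (l : 'rV[k]_N) h := - (l *m (xv (Gam (rigidA k d) h))^T) 0 0 / Gam (rigidA k d) h 0 0.
  have ptau h : pf (fun l => tau l h) by rewrite /tau; pfs.
  have [l inj] : exists l, {in rs &, injective (tau l)}.
    pose g (l : 'rV[k]_N) := \prod_(q <- [seq (h, h') | h <- rs, h' <- rs] |
      (q.1 \in rs) && (q.2 \in rs) && (q.1 != q.2)) (tau l q.1 - tau l q.2).
    have [_ [l gl]] : pfnz g.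
      apply: pfnz_prod => [|q /andP[/andP[r1 r2] n]]; first exact: 0.
      split; first by have p1 := ptau q.1; have p2 := ptau q.2; pfs.
      apply: contrapT => /forallNP H; move/eqP: n; apply.
      have [[[hU1 _] h1] [[hU2 _] h2]] := (proj1 (rP _) r1, proj1 (rP _) r2).
      apply: (rigid_separates char0 hd hU1 hU2 h1 h2
        (c := Gam (rigidA k d) q.1 0 0 / Gam (rigidA k d) q.2 0 0)).
      apply: xv_inj; rewrite xvZ; apply/rowP => j; rewrite [RHS]mxE.
      have := H (delta_mx 0 j) => /negP; rewrite negbK subr_eq0 /tau !mulNr eqr_opp -!rowE.
      rewrite [row _ _ _ _]mxE [X in X / _]mxE [X in _ == X / _]mxE [X in _ == X / _]mxE => /eqP e.
      have n1 := G00 _ r1; rewrite mulrAC -mulrA -e mulrCA mulfV // mulr1 //.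
    exists l => h h' hr hr' E; apply: contrapT => /eqP n; move/eqP: gl; apply.
    rewrite /g; apply/eqP; rewrite prodf_seq_eq0; apply/hasP; exists (h, h').
      by apply/allpairsP; exists (h, h').
    by rewrite /= hr hr' n E subrr eqxx.
  pose p := evp (cof (((rigidA k d, u), l) : @base k d N)) PX.
  have [_ sp] := @form_degree k d N PX eX homX (rigidA k d, u) l p (fun=> erefl).
  have pn T : f (((rigidA k d, u), l), T) != 0 -> p.[T] != 0.
    by rewrite rE; apply: contra => /eqP z; rewrite /form -/p z mulr0.
  have pair_tau T h : h \in rs -> pairing (@yX k d) (@oX k d) l T h (Gam (rigidA k d) h) =
      (T - tau l h) * Gam (rigidA k d) h 0 0.
    by move=> hr; rewrite /pairing /oX /yX /= mulrBl /tau divfK ?G00 // opprK.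
  have p0 : p != 0.
    have [T Tn] := @poly_avoid k [seq 'X - (tau l h)%:P | h <- rs] ltac:(by move=> q /mapP[h _ ->]; rewrite polyXsubC_eq0).
    apply: contraTneq (pn T _) => [->|]; first by rewrite horner0 eqxx.
    rewrite cE mulf_neq0 // prodf_seq_neq0; apply/allP => h hr /=.
    rewrite pair_tau // mulf_neq0 ?G00 //.
    by have := Tn _ (map_f (fun h => 'X - (tau l h)%:P) hr); rewrite hornerXsubC.
  have le1 : (eY <= eX)%N.
    rewrite -ltnS -sr -(size_map (tau l)); apply: leq_trans sp; apply: max_poly_roots => //; last first.
      by rewrite map_inj_in_uniq.
    apply/allP => _ /mapP[h hr ->]; rewrite /root; apply/eqP; apply: vX.
    have [[hU uG] h00] := proj1 (rP _) hr.
    split; first exact: rat_neq0 rA.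
    by exists h; split=> //; rewrite pair_tau // subrr mul0r.
  (* For the reverse inequality scale (l, T) by s: a polynomial divisible by s ^ eX equals s ^ eY
     times a nonzero constant. *)
  apply/eqP; rewrite eqn_leq le1 andbT leqNgt; apply/negP => lt.
  have [T fT] : exists T, f (((rigidA k d, u), l), T) != 0.
    have [T Tn] := @poly_avoid k [seq 'X - (tau l h)%:P | h <- rs] ltac:(by move=> q /mapP[h _ ->]; rewrite polyXsubC_eq0).
    exists T; rewrite cE mulf_neq0 // prodf_seq_neq0; apply/allP => h hr /=.
    rewrite pair_tau // mulf_neq0 ?G00 //.
    by have := Tn _ (map_f (fun h => 'X - (tau l h)%:P) hr); rewrite hornerXsubC.
  have [q qE] : exists q : {poly k}, forall s, r (((rigidA k d, u), s *: l), s * T) = q.[s].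
    apply: pf_k; apply: (pf_comp pr); apply: pmap_pair; last by apply: pmap_k; pfs.
    by apply: pmap_pair; pfs.
  have E : q * 'X^eX * (form PX (((rigidA k d, u), l), T))%:P = 'X^eY * (f (((rigidA k d, u), l), T))%:P.
    apply: poly_eq_nz => s _; rewrite !hornerM !hornerXn !hornerC -fhom rE -qE -mulrA; congr (_ * _).
    exact: esym (homX ((rigidA k d, u), l) T s).
  have := congr1 (fun P : {poly k} => P`_eY) E; rewrite coefMC coefMXn lt mul0r coefXnM ltnn subnn coefC eqxx.
  by move=> z; rewrite -z eqxx in fT.
(* The quotient is homogeneous of degree 0 in (l, T) and polynomial, so it equals its value at (0,
   0). *)
have rconst b l T : r ((b, l), T) = r ((b, 0), 0).
  have [q qE] : exists q : {poly k}, forall s, r ((b, s *: l), s * T) = q.[s].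
    apply: pf_k; apply: (pf_comp pr); apply: pmap_pair; last by apply: pmap_k; pfs.
    by apply: pmap_pair; pfs.
  have key : (fun q : @base k d N * k => r ((q.1.1, 0), 0) - r q) =1 fun=> 0.
    pose g := fun q : @base k d N * k => r ((q.1.1, 0), 0) - r q.
    have pg : pf g.
      apply: pf_add; last exact: pf_opp.
      apply: (pf_comp pr); apply: pmap_pair; last by apply: pmap_k; pfs.
      by apply: pmap_pair; rewrite /base; pfs.
    have [|//|z] := pf_mul_eq0 pg (pf_form PX); last by have [q'] := form_neq0 X0; rewrite z eqxx.
    move=> [[b' l'] T']; rewrite /g /=.
    have [q' qE'] : exists q : {poly k}, forall s, r ((b', s *: l'), s * T') = q.[s].
      apply: pf_k; apply: (pf_comp pr); apply: pmap_pair; last by apply: pmap_k; pfs.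
      by apply: pmap_pair; pfs.
    set F := form PX _; have E : q' * F%:P = (r ((b', l'), T') * F)%:P.
      apply: poly_eq_nz => s s0; rewrite hornerM !hornerC.
      apply: (mulIf (expf_neq0 eX s0)); rewrite -qE' -mulrA [F * _]mulrC -(homX (b', l') T' s).
      by rewrite -[X in X = _](rE ((b', s *: l'), s * T')) fhom rE -eXY mulrC.
    have := congr1 (fun P : {poly k} => P.[0]) E; rewrite hornerM !hornerC -qE' scale0r mul0r => E0.
    by rewrite mulrBl E0 subrr.
  by apply/eqP; rewrite eq_sym -subr_eq0 (key ((b, l), T)).
pose G (q : 'M[k]_(2, d.+1) * 'M[k]_(4, N)) : k :=
  form PX (((q.1, usubmx (q.2 : 'M_(3 + 1, N))), dsubmx (q.2 : 'M_(3 + 1, N))), 0).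
have orth (U : 'M[k]_(3 + 1, N)) Y : U _|_ Y <-> (usubmx U _|_ Y /\ dsubmx U _|_ Y).
  rewrite -{1}[U]vsubmxK mul_col_mx; split=> [E|[-> ->]]; last exact: col_mx0.
  by split; [have := congr1 usubmx E; rewrite col_mxKu linear0|have := congr1 dsubmx E; rewrite col_mxKd linear0].
have pair0 l h Y : pairing (@yX k d) (@oX k d) l 0 h Y = 0 <-> l _|_ Y.
  rewrite /pairing mul0r add0r /yX /=; split=> [E|->]; last by rewrite mxE.
  by apply/matrixP => i j; rewrite !ord1 [RHS]mxE.
exists G; split.
- apply: (pf_comp (pf_form PX)); apply: pmap_pair; last by apply: pmap_k; pfs.
  by apply: pmap_pair; [apply: pmap_pair|]; [pfs|apply: (@pmap_usubmx k _ _ 3 1)|apply: (@pmap_dsubmx k _ _ 3 1)]; pfs.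
- have [|||||m mP] := @scaling_degree k d N _ _ PX X0 vX dX (fun s q => (((s *: q.1.1.1, q.1.1.2), q.1.2), q.2)).
  + by move=> s; apply: pmap_pair; [apply: pmap_pair; [apply: pmap_pair|]|]; rewrite /base; pfs.
  + by move=> q; apply: pmap_pair; [apply: pmap_pair; [apply: pmap_pair|]|]; pfs.
  + by move=> [[[A u] l] T]; rewrite /= scale1r.
  + by move=> s t [[[A u] l] T]; rewrite /= scalerA.
  + move=> s [[[A u] l] T] s0 [A0 [h [hU uG pz]]]; split; first by rewrite /= scaler_eq0 negb_or s0.
    exists h; split=> //=; rewrite GamZl; first by rewrite xvZ linearZ -scalemxAr uG scaler0.
    have [c c0 [yE oE]] := yXZ h (Gam A h) (oner_neq0 k) s0; rewrite scale1r in yE oE.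
    rewrite /pairing yE oE linearZ -scalemxAr mxE mulrCA -mulrDr; move: pz; rewrite /pairing /= => ->.
    by rewrite mulr0.
  by exists m => A U s; exact: (mP s (((A, _), _), 0)).
- move=> A U h A0 hU /orth[uG lG]; apply: vX; split=> //; exists h; split=> //.
  exact/pair0.
- move=> A U /cX[h [Y [h0 Yn [XX uX /pair0 lX]]]]; exists h, Y; split=> //.
  by apply/orth.
move=> A u gu; have [rs [ur sr rP [c c0 cE]]] := ffact _ _ gu.
exists rs; split=> //; first by rewrite -eYE.
have prodE v : \prod_(h <- rs) (v *m (xv (Gam A h))^T) 0 0 =
    \prod_(h <- rs) pairing (@yX k d) (@oX k d) v 0 h (Gam A h).
  by apply: eq_bigr => h _; rewrite /pairing mul0r add0r.
have GE v : r (((A, u), 0), 0) * G (A, (col_mx u v : 'M_(3 + 1, N))) = c * \prod_(h <- rs) (v *m (xv (Gam A h))^T) 0 0.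
  rewrite prodE -cE rE (rconst _ v) /G /= col_mxKu col_mxKd //.
have r0 : r (((A, u), 0), 0) != 0.
  pose q := (((A, u), 0), 1) : @base k d N * k.
  have : f q != 0.
    rewrite cE mulf_neq0 // prodf_seq_neq0; apply/allP => h hr /=.
    rewrite /pairing mul0mx mxE addr0 mul1r /oX /=.
    by have [sh _] := proj1 (rP _) hr; case: gu => _ _ _ _ /(_ _ sh).
  by rewrite rE rconst; apply: contraNneq => ->; rewrite mul0r.
exists (c / r (((A, u), 0), 0)); first by rewrite mulf_neq0 ?invr_eq0.
by move=> v; apply: (mulfI r0); rewrite GE mulrA mulrCA mulfV // mulr1.
Qed.

End Universal.

(** * The Chow form of an orbit closure *)

Section FixedMap.
Variables (k : closedFieldType) (d : nat).
Hypothesis char0 : [pchar k] =i pred0.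
Hypothesis hd : (2 <= d)%N.
Implicit Types (A X : 'M[k]_(2, d.+1)) (h g : 'M[k]_2).
Local Notation N := (2 * d.+1)%N.
Local Notation "u '_|_' X" := (u *m (xv X)^T = 0) (at level 60).
Local Notation cf := (@cof k 'M[k]_(4, N) (aff_mx k 4 N)).
Local Notation D := (d ^ 3 - d)%N.

Lemma orth_rows (U : 'M[k]_(3 + 1, N)) X : U _|_ X <-> (usubmx U _|_ X /\ dsubmx U _|_ X).
Proof.
rewrite -{1}[U]vsubmxK mul_col_mx; split=> [E|[-> ->]]; last exact: col_mx0.
by split; [have := congr1 usubmx E; rewrite col_mxKu linear0|have := congr1 dsubmx E; rewrite col_mxKd linear0].
Qed.

Lemma orth_row' (U : 'M[k]_(4, N)) i X : U _|_ X -> (row' i U : 'M_(3, N)) _|_ X.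
Proof.
move=> E; apply/matrixP => a b; transitivity ((U *m (xv X)^T) (lift i a) b); last by rewrite E !mxE.
by rewrite mxE [RHS]mxE; apply: eq_bigr => j _; congr (_ * _); rewrite mxE.
Qed.

Definition cidx (i : 'I_4) (j : 'I_N) : 'I_(4 * N) := mxvec_index i j.

Lemma cf_entry (U : 'M[k]_(4, N)) i j : cf U (cidx i j) = U i j.
Proof. by rewrite /cof /cidx /= mxvecE. Qed.

Lemma sum_cf_delta (F : 'I_(4 * N) -> k) i j : \sum_l F l * cf (delta_mx i j) l = F (cidx i j).
Proof.
rewrite (bigD1 (cidx i j)) //= cf_entry mxE !eqxx mulr1 big1 ?addr0 // => l li.
case/mxvec_indexP: l => a b in li *; rewrite -/(cidx a b) cf_entry mxE.
case: eqP => [ai|]; last by rewrite mulr0. case: eqP => [bj|]; last by rewrite mulr0.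
by rewrite ai bj eqxx in li.
Qed.

Lemma mderiv_line (p : {mpoly k[4 * N]}) i j (U : 'M[k]_(4, N)) : exists r : {poly k}, forall t,
  p.@[cf (U + t *: delta_mx i j)] = p.@[cf U] + t * p^`M(cidx i j).@[cf U] + t ^+ 2 * r.[t].
Proof.
have [r rE] := chain_rule p (cf U) (cf (delta_mx i j)) (fun=> 0).
exists r => t; rewrite -[X in _ + t * X](_ : dirder p (cf U) (cf (delta_mx i j)) = _); last exact: sum_cf_delta.
rewrite -rE; apply: meval_eq => l; rewrite horner0 mulr0 addr0.
by case/mxvec_indexP: l => a b; rewrite -/(cidx a b) !cf_entry !mxE.
Qed.

Section Form.
Variables (A : 'M[k]_(2, d.+1)) (Q : {mpoly k[4 * N]}).
Hypothesis rA : coprime_map A.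
Hypothesis Qhit : forall (U : 'M[k]_(4, N)) h, h \in unitmx -> U _|_ Gam A h -> Q.@[cf U] = 0.
Hypothesis Qcl : forall U : 'M[k]_(4, N), Q.@[cf U] = 0 -> exists h X, [/\ h != 0, X != 0, Xt A h X & U _|_ X].
Hypothesis Qgood : forall u, good A u -> exists rs : seq 'M[k]_2, [/\ uniq rs, size rs = D,
  forall h, (h \in rs) <-> (solution A u h /\ h 0 0 = 1) &
  exists2 c, c != 0 & forall v : 'rV[k]_N, Q.@[cf (col_mx u v : 'M_(3 + 1, N))] =
    c * \prod_(h <- rs) (v *m (xv (Gam A h))^T) 0 0].

Definition on_orbit (q : {mpoly k[4 * N]}) : Prop :=
  forall (U : 'M[k]_(4, N)) h, h \in unitmx -> U _|_ Gam A h -> q.@[cf U] = 0.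

Lemma Q_neq0 : Q != 0.
Proof.
have [c [[pc [u cu]] cz]] := generic_miss hd rA.
apply: contraNneq cu => Q0; apply/eqP/cz => H.
have [|h [X [h0 X0 XX uX]]] := @Qcl u; first by rewrite Q0 meval0.
exact: H h0 X0 XX uX.
Qed.

(** Along the lines V + t delta_ij the polynomial q is constant. If pi divided q, it would be a unit
    on each such line where q is nonzero, hence constant there, and its derivative would be zero. *)
Lemma row_free_ndvd (pi : {mpoly k[4 * N]}) i j (c : 'M[k]_(3, N) -> k) (q : {mpoly k[4 * N]}) :
  pi^`M(cidx i j) != 0 -> pfnz c -> (forall U, q.@[cf U] = c (row' i U)) -> ~ rdvd pi q.
Proof.
move=> D0 [pc [u0 cu0]] qE [s sE]; move/eqP: D0; apply.
apply: (@ev_inj k 'M[k]_(4, N) _) => U; rewrite meval0.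
have pq : pf (fun U : 'M[k]_(4, N) => q.@[cf U]) by exists q.
have pD : pf (fun U : 'M[k]_(4, N) => (pi^`M(cidx i j)).@[cf U]) by exists (pi^`M(cidx i j)).
have z (V : 'M[k]_(4, N)) : (pi^`M(cidx i j)).@[cf V] * q.@[cf V] = 0.
  have [->|qV] := eqVneq q.@[cf V] 0; first by rewrite mulr0.
  have qt t : q.@[cf (V + t *: delta_mx i j)] = q.@[cf V].
    rewrite !qE; congr c; apply/matrixP => a b; rewrite !mxE.
    by rewrite (negPf (neq_lift _ _)) eq_sym (negPf (neq_lift _ _)) mulr0 addr0 || rewrite eq_sym (negPf (neq_lift _ _)) mulr0 addr0.
  have pl : pmap (fun t : k => V + t *: delta_mx i j) by pfs.
  have p1 := @pf_meval_comp k 'M[k]_(4, N) k (aff_mx k 4 N) _ pi _ pl.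
  have p2 := @pf_meval_comp k 'M[k]_(4, N) k (aff_mx k 4 N) _ s _ pl.
  have [||e e0 eE] := @pf_unit_const k k _ (fun t => pi.@[cf (V + t *: delta_mx i j)])
    (fun t => s.@[cf (V + t *: delta_mx i j)] / q.@[cf V]) p1.
  - by apply: pf_mul => //; exact: pf_const.
  - by move=> t; rewrite mulrA [X in X / _]mulrC -mevalM -sE qt divff.
  have [r rE] := mderiv_line pi i j V.
  have [|_ ->] := quadratic0 (a := pi.@[cf V] - e) (b := pi^`M(cidx i j).@[cf V]) (r := r).
    by move=> t; rewrite -[RHS](subrr e) -{2}(eE t) rE; ring.
  by rewrite mul0r.
have [->//|z'] := pf_mul_eq0 pD pq z.
have [U' UE] : exists U' : 'M[k]_(4, N), row' i U' = u0.
  exists (\matrix_(a, b) if unlift i a is Some a' then u0 a' b else 0).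
  by apply/matrixP => a b; rewrite !mxE liftK.
by have := z' U'; rewrite qE UE => z0; rewrite z0 eqxx in cu0.
Qed.

Lemma depends_on_row (pi : {mpoly k[4 * N]}) : rprime pi -> exists i j, pi^`M(cidx i j) != 0.
Proof.
move=> [p0 pU _]; apply: contrapT => H; move/negP: pU; apply; apply/mpoly_unitE.
have : forall l, pi^`M(l) = 0.
  move=> l; case/mxvec_indexP: l => i j; apply: contrapT => /eqP n; apply: H; exists i, j.
  exact: n.
move/(mderiv_const char0) => E; exists pi@_0 => //.
by apply: contraNneq p0 => z; rewrite E z mpolyC0.
Qed.

(* An irreducible factor of Q involves some row; the points of its zero set whose other three rows
   avoid the boundary lie on the orbit, and they are dense in it. *)
Lemma factor_divides (pi q : {mpoly k[4 * N]}) : rprime pi -> rdvd pi Q -> on_orbit q -> rdvd pi q.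
Proof.
move=> pP [s sE] qO; apply: contrapT => nq.
have [i [j ij]] := depends_on_row pP.
have [c [cn cz]] := generic_no_boundary hd (leqnn 3) rA.
have [w wE] : pf (fun U : 'M[k]_(4, N) => c (row' i U)).
  by apply: (pf_comp cn.1); apply: pmap_mx => a b; apply: (pf_ext (f := fun U : 'M[k]_(4, N) => U (lift i a) b));
    [move=> U; rewrite [RHS]mxE|pfs].
have nw := row_free_ndvd ij cn (fun U => esym (wE U)).
have nqw : ~ rdvd pi (q * w) by case: pP => _ _ H /H[].
have [v [pv qv]] := nullstellensatz_prime pP nqw.
pose U : 'M[k]_(4, N) := @amk k 'M[k]_(4, N) (aff_mx k 4 N) (\row_l v l).
have UE p : p.@[v] = p.@[cf U] by apply: meval_eq => l; rewrite (@cof_amk k 'M[k]_(4, N) (aff_mx k 4 N)).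
rewrite !UE in pv qv; move: qv; rewrite mevalM mulf_eq0 negb_or -wE => /andP[qU cU].
have [h [X [h0 X0 XX uX]]] : exists h X, [/\ h != 0, X != 0, Xt A h X & U _|_ X].
  by apply: Qcl; rewrite sE mevalM pv mulr0.
have nb : no_boundary A (row' i U : 'M_(3, N)) by apply: contrapT => /cz z; rewrite z eqxx in cU.
have hU : h \in unitmx.
  by rewrite unit2; apply/eqP => dh; apply: (nb h X h0 X0 dh XX); exact: orth_row'.
have [e XE] := Xt_prop (Gam_neq0 (rat_neq0 rA) hU) XX.
have e0 : e != 0 by apply: contra_neq X0 => e0; rewrite XE e0 scale0r.
by move/eqP: qU; apply; apply: (qO _ h hU); apply: (orthZ e0); rewrite -XE.
Qed.

Lemma on_orbit_prime p q : on_orbit (p * q) -> on_orbit p \/ on_orbit q.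
Proof.
move=> H; pose T := ('M[k]_2 * 'M[k]_(4, N * N))%type.
pose psi (t : T) : 'M[k]_(4, N) := skew (xv (Gam A t.1)) t.2.
have ppsi : pmap psi.
  by apply: pmap_skew; [rewrite /xv; apply: pmap_mxvec; apply: pmap_Gam; pfs|pfs].
have p1 := @pf_meval_comp k 'M[k]_(4, N) T (aff_mx k 4 N) _ p _ ppsi.
have p2 := @pf_meval_comp k 'M[k]_(4, N) T (aff_mx k 4 N) _ q _ ppsi.
have p3 : pf (fun t : T => \det t.1) by pfs.
have z t : p.@[cf (psi t)] * (q.@[cf (psi t)] * \det t.1) = 0.
  have [->|dt] := eqVneq (\det t.1) 0; first by rewrite !mulr0.
  rewrite mulrA -mevalM (H _ t.1) ?mul0r //; first by rewrite unit2.
  exact: skew_orth.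
have onto (U : 'M[k]_(4, N)) h : h \in unitmx -> U _|_ Gam A h -> exists t, psi t = U.
  move=> hU uG; have [|O OE] := skew_onto (x := xv (Gam A h)) _ uG.
    by rewrite xv_eq0; exact: Gam_neq0 (rat_neq0 rA) hU.
  by exists (h, O).
have [z1|z1] := pf_mul_eq0 p1 (pf_mul p2 p3) z.
  by left=> U h hU /(onto _ _ hU)[t <-].
have [z2|z2] := pf_mul_eq0 p2 p3 z1; first by right=> U h hU /(onto _ _ hU)[t <-].
by have := z2 (1%:M, 0); rewrite /= det1 => /eqP; rewrite oner_eq0.
Qed.

Lemma assoc_scalar (p q : {mpoly k[4 * N]}) : p != 0 -> rdvd p q -> rdvd q p -> q != 0 ->
  exists2 c, c != 0 & p = c *: q.
Proof.
move=> p0 [a qE] [b pE] q0; have ab : b * a = 1.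
  by apply: (mulIf p0); rewrite mul1r -mulrA -qE.
have : b \is a GRing.unit by apply/unitrP; exists a; rewrite ab mulrC ab.
by case/mpoly_unitE => c c0 bE; exists c => //; rewrite pE bE mul_mpolyC.
Qed.

(** The ideal of the incidence variety is prime, so some prime factor rho of Q vanishes on it; by
    [factor_divides] every prime factor divides rho and is thus associated to it. *)
Lemma form_power : exists rho m c, [/\ rprime rho, on_orbit rho, c != 0, Q = c *: rho ^+ m &
  forall q, on_orbit q -> rdvd rho q].
Proof.
have [w [s [wU sp QE]]] := ufd_mpoly (k := k) Q_neq0.
have dvQ p : p \in s -> rdvd p Q.
  move=> ps; exists (w * \prod_(q <- rem p s) q); rewrite QE (big_rem _ ps) /=.
  by rewrite -mulrA [_ * p]mulrC.
have [rho rs rO] : exists2 rho, rho \in s & on_orbit rho.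
  have : on_orbit (w * \prod_(q <- s) q) by rewrite -QE.
  elim: (s) => [|p s' IH].
    rewrite big_nil mulr1; case/mpoly_unitE: wU => c c0 wc H.
    have := H (0 : 'M[k]_(4, N)) 1%:M (unitmx1 _ _); rewrite mul0mx => /(_ erefl).
    by rewrite wc mevalC => z; rewrite z eqxx in c0.
  rewrite big_cons mulrCA => /on_orbit_prime[pO|/IH[r r1 r2]].
    by exists p => //; rewrite mem_head.
  by exists r => //; rewrite in_cons r1 orbT.
have all_assoc p : p \in s -> exists2 c, c != 0 & p = c *: rho.
  move=> ps; apply: assoc_scalar; try by case: (sp _ ps); try by case: (sp _ rs).
  - exact: factor_divides (sp _ ps) (dvQ _ ps) rO.
  - have [b bE] := factor_divides (sp _ ps) (dvQ _ ps) rO.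
    have [_ _ /(_ b p)] := sp _ rs; rewrite -bE => /(_ (rdvd_refl _))[[c cE]|//].
    have [r0 _ _] := sp _ rs; have [p0 pU _] := sp _ ps.
    exfalso; move/negP: pU; apply; apply/unitrP; exists c.
    have E : c * p = 1 by apply: (mulIf r0); rewrite mul1r mulrAC -cE -bE.
    by split; [exact: E|rewrite mulrC; exact: E].
case/mpoly_unitE: wU => c0 c0n wE.
suff [c cn cE] : exists2 c, c != 0 & \prod_(q <- s) q = c *: rho ^+ size s.
  exists rho, (size s), (c0 * c); split=> //; first exact: sp.
  - exact: mulf_neq0.
  - by rewrite QE wE cE mul_mpolyC scalerA.
  by move=> q; exact: factor_divides (sp _ rs) (dvQ _ rs).
elim: (s) all_assoc => [|p s' IH] H; first by exists 1; rewrite ?oner_neq0 // big_nil scale1r.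
have [|c cn cE] := IH; first by move=> q qs; apply: H; rewrite in_cons qs orbT.
have [e en eE] := H p (mem_head _ _); exists (e * c); first exact: mulf_neq0.
by rewrite big_cons cE eE -scalerAl -scalerAr scalerA exprS.
Qed.

End Form.
End FixedMap.

Section Lines.
Variables (k : fieldType) (n : nat).
Implicit Types v w : 'rV[k]_n.

Lemma line_scale c v : c != 0 -> <[c *: v]>%VS = <[v]>%VS.
Proof.
move=> c0; apply/eqP; rewrite eqEsubv -!memvE; apply/andP; split; first exact/memvZ/memv_line.
by rewrite -[X in X \in _](scale1r v) -(mulVf c0) -scalerA; exact/memvZ/memv_line.
Qed.

Lemma line_eq v w : v != 0 -> <[v]>%VS = <[w]>%VS -> exists2 c, c != 0 & v = c *: w.
Proof.
move=> v0 E; have /vlineP[c vE] : v \in <[w]>%VS by rewrite -E memv_line.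
by exists c => //; apply: contra_neq v0 => c0; rewrite vE c0 scale0r.
Qed.

Lemma line_vpick v : v != 0 -> exists2 c, c != 0 & v = c *: vpick <[v]>%VS.
Proof.
move=> v0; have L0 : (<[v]> != 0)%VS by rewrite -dimv_eq0 dim_vline v0.
have /vlineP[c cE] := memv_pick <[v]>%VS.
have c0 : c != 0 by apply: contraNneq L0 => c0; rewrite -vpick0 cE c0 scale0r.
by exists c^-1; rewrite ?invr_eq0 // cE scalerA mulVf ?scale1r.
Qed.

End Lines.

(** * Automorphisms and coinciding conjugates *)

Section Automorphisms.
Variables (k : closedFieldType) (d : nat).
Hypothesis char0 : [pchar k] =i pred0.
Hypothesis hd : (2 <= d)%N.
Implicit Types (A X : 'M[k]_(2, d.+1)) (h g : 'M[k]_2).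
Local Notation N := (2 * d.+1)%N.
Local Notation "u '_|_' X" := (u *m (xv X)^T = 0) (at level 60).
Local Notation D := (d ^ 3 - d)%N.

Definition stab A g : Prop := g \in unitmx /\ exists c, Gam A g = c *: A.

(** Automorphisms are points of PGL_2 and are listed as lines of matrices, the form in which [proj]
    records points. *)
Definition aut_lines A (ls : seq {vspace 'rV[k]_(2 * 2)}) : Prop :=
  uniq ls /\ forall L, (L \in ls) <-> exists2 g, stab A g & L = <[mxvec g]>%VS.

Lemma aut_lines_size A ls ls' : aut_lines A ls -> aut_lines A ls' -> size ls = size ls'.
Proof.
move=> [U E] [U' E']; apply/perm_size/uniq_perm => // L.
by apply/idP/idP => [/E/E'|/E'/E].
Qed.

Definition gline A h : {vspace 'rV[k]_N} := <[xv (Gam A h)]>%VS.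

Lemma xvGam_neq0 A h : coprime_map A -> h \in unitmx -> xv (Gam A h) != 0.
Proof. by move=> rA hU; rewrite xv_eq0; exact: Gam_neq0 (rat_neq0 rA) hU. Qed.

Lemma mxvec_neq0 h : h \in unitmx -> mxvec h != 0.
Proof. by move=> hU; rewrite mxvec_eq0; exact: unit_neq0. Qed.

(** Solutions with the same conjugate as h0 are the g h0 with g an automorphism; as no solution has
    first entry 0, each g h0 can be renormalized to a member of the list. *)
Lemma fiber_aut A u rs h0 : good A u -> uniq rs ->
  (forall h, (h \in rs) <-> (solution A u h /\ h 0 0 = 1)) -> h0 \in rs ->
  aut_lines A [seq <[mxvec (h *m invmx h0)]>%VS | h <- rs & gline A h == gline A h0].
Proof.
move=> gA Urs rsP h0s; have [rA _ _ corner _] := gA.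
have [[h0U h0u] h01] := (rsP h0).1 h0s.
have h0V : invmx h0 \in unitmx by rewrite unitmx_inv.
split.
  rewrite map_inj_in_uniq ?filter_uniq // => h h'; rewrite !mem_filter => /andP[_ hs] /andP[_ hs'].
  have [[hU _] h1] := (rsP h).1 hs; have [[hU' _] h1'] := (rsP h').1 hs'.
  case/line_eq; first by rewrite mxvec_neq0 // unitmx_mul hU h0V.
  move=> c c0; rewrite -linearZ => /(can_inj mxvecK).
  rewrite scalemxAl => /(can_inj (mulmxK h0V)) hE.
  by have := h1; rewrite {1}hE mxE h1' mulr1 => c1; rewrite hE c1 scale1r.
move=> L; split.
  case/mapP => h; rewrite mem_filter => /andP[/eqP hE hs] ->.
  have [[hU _] h1] := (rsP h).1 hs.
  exists (h *m invmx h0) => //; split; first by rewrite unitmx_mul hU.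
  have [c _] := line_eq (xvGam_neq0 rA hU) hE; rewrite -xvZ => /xv_inj E.
  by exists c; rewrite GamM E GamZl Gam_inv.
case=> g [gU [c gE]] ->; set h := g *m h0.
have hU : h \in unitmx by rewrite unitmx_mul gU.
have hE : Gam A h = c *: Gam A h0 by rewrite GamM gE GamZl.
have hS : solution A u h by split=> //; rewrite hE xvZ linearZ /= -scalemxAr h0u scaler0.
have h00 := corner h hS.
have c0 : c != 0 by apply: contraTneq (Gam_neq0 (rat_neq0 rA) hU) => c0; rewrite hE c0 scale0r eqxx.
pose h1 := (h 0 0)^-1 *: h; have i0 : (h 0 0)^-1 != 0 by rewrite invr_eq0.
have h1s : h1 \in rs.
  apply/rsP; split; last by rewrite mxE mulVf.
  split; first by rewrite unit2 detZ mulf_neq0 ?expf_neq0 // -unit2.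
  by rewrite GamZ xvZ linearZ /= -scalemxAr hS.2 scaler0.
apply/mapP; exists h1.
  by rewrite mem_filter h1s andbT /gline GamZ hE scalerA xvZ line_scale ?mulf_neq0 ?expf_neq0.
by rewrite /h1 -scalemxAl /h mulmxK // linearZ line_scale.
Qed.

Lemma aut_lines_exist A : coprime_map A -> (forall u, good A u -> exists rs : seq 'M[k]_2, [/\ uniq rs,
    size rs = D & forall h, (h \in rs) <-> (solution A u h /\ h 0 0 = 1)]) ->
  exists2 ls, aut_lines A ls & (0 < size ls)%N.
Proof.
move=> rA H; have [c [[_ [u cu]] cz]] := generic_good char0 hd rA.
have gu : good A u by apply: contrapT => /cz z; rewrite z eqxx in cu.
have [rs [U S P]] := H u gu.
have D0 : (0 < D)%N by rewrite subn_gt0 -[X in (X < _)%N]expn1 ltn_exp2l.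
case: rs U S P => [|h0 rs] U S P; first by rewrite -S in D0.
exists [seq <[mxvec (h *m invmx h0)]>%VS | h <- h0 :: rs & gline A h == gline A h0].
  exact: (fiber_aut gu U P (mem_head _ _)).
by rewrite size_map /= eqxx.
Qed.

(** Each conjugate arises from exactly [size ls] of the normalized solutions, which gives the
    exponent and the count. *)
Lemma good_section A u ls (rs : seq 'M[k]_2) : good A u -> aut_lines A ls -> uniq rs ->
  (forall h, (h \in rs) <-> (solution A u h /\ h 0 0 = 1)) ->
  exists ys : seq {vspace 'rV[k]_N}, [/\ uniq ys, (size ys * size ls)%N = size rs,
    (forall y, (y \in ys) <-> exists2 h, solution A u h & y = gline A h) &
    exists2 c, c != 0 & forall v : 'rV[k]_N, \prod_(h <- rs) (v *m (xv (Gam A h))^T) 0 0 =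
      c * \prod_(y <- ys) (v *m (vpick y)^T) 0 0 ^+ size ls].
Proof.
move=> gA al U P; have [rA _ _ corner _] := gA.
have cnt y : y \in map (gline A) rs -> count_mem y (map (gline A) rs) = size ls.
  case/mapP => h0 h0s ->; rewrite count_map -size_filter.
  by rewrite -(aut_lines_size (fiber_aut gA U P h0s) al) size_map.
have prodE (F : {vspace 'rV[k]_N} -> k) : \prod_(h <- rs) F (gline A h) =
    \prod_(y <- undup (map (gline A) rs)) F y ^+ size ls.
  rewrite -(big_map (gline A) xpredT F) -big_undup_iterop_count.
  by rewrite big_seq_cond [RHS]big_seq_cond; apply: eq_bigr => y; rewrite andbT mem_undup => /cnt ->.
have rsU h : h \in rs -> h \in unitmx by case/P => -[].
exists (undup (map (gline A) rs)); split.
- exact: undup_uniq.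
- rewrite -(size_map (gline A) rs).
  have := perm_count_undup (map (gline A) rs) => /perm_size <-.
  rewrite size_flatten /shape -map_comp.
  have : forall ys : seq {vspace 'rV[k]_N}, {subset ys <= map (gline A) rs} ->
      (size ys * size ls)%N = sumn (map (size \o (fun x => nseq (count_mem x (map (gline A) rs)) x)) ys).
    elim=> [|y ys IH] H //=; rewrite mulSn IH; last by move=> z zs; apply: H; rewrite in_cons zs orbT.
    by rewrite size_nseq cnt // H // mem_head.
  by apply=> y; rewrite mem_undup.
- move=> y; rewrite mem_undup; split.
    by case/mapP => h hs ->; exists h => //; case/P: hs.
  case=> h hS ->; apply/mapP; exists ((h 0 0)^-1 *: h).
    apply/P; split; last by rewrite mxE mulVf ?corner.
    split; first by rewrite unit2 detZ mulf_neq0 ?expf_neq0 ?invr_eq0 ?corner // -unit2 hS.1.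
    by rewrite GamZ xvZ linearZ /= -scalemxAr hS.2 scaler0.
  by rewrite /gline GamZ xvZ line_scale // expf_neq0 // invr_eq0 corner.
have [c c0 cE] : exists2 c, c != 0 & forall v : 'rV[k]_N, \prod_(h <- rs) (v *m (xv (Gam A h))^T) 0 0 =
    c * \prod_(h <- rs) (v *m (vpick (gline A h))^T) 0 0.
  elim: (rs) rsU => [|h s IH] H; first by exists 1 => [|v]; rewrite ?oner_neq0 // !big_nil mulr1.
  have [|c c0 cE] := IH; first by move=> h' hs; apply: H; rewrite in_cons hs orbT.
  have [e e0 eE] := line_vpick (xvGam_neq0 rA (H h (mem_head _ _))).
  exists (e * c) => [|v]; first exact: mulf_neq0.
  by rewrite !big_cons cE {1}eE linearZ /= -scalemxAr mxE mulrACA.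
by exists c => // v; rewrite cE (prodE (fun y => (v *m (vpick y)^T) 0 0)).
Qed.

End Automorphisms.
From mathcomp Require Import perm mpoly.

(** * Exponent and degree of the form of a fixed map *)

Section FixedMapForm.
Variables (k : closedFieldType) (d : nat).
Hypothesis char0 : [pchar k] =i pred0.
Hypothesis hd : (2 <= d)%N.
Implicit Types (A X : 'M[k]_(2, d.+1)) (h g : 'M[k]_2).
Local Notation N := (2 * d.+1)%N.
Local Notation "u '_|_' X" := (u *m (xv X)^T = 0) (at level 60).
Local Notation cf := (@cof k 'M[k]_(4, N) (aff_mx k 4 N)).
Local Notation D := (d ^ 3 - d)%N.

Variables (A : 'M[k]_(2, d.+1)) (Q : {mpoly k[4 * N]}).
Hypothesis rA : coprime_map A.
Hypothesis Qhit : forall (U : 'M[k]_(4, N)) h, h \in unitmx -> U _|_ Gam A h -> Q.@[cf U] = 0.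
Hypothesis Qcl : forall U : 'M[k]_(4, N), Q.@[cf U] = 0 -> exists h X, [/\ h != 0, X != 0, Xt A h X & U _|_ X].
Hypothesis Qgood : forall u, good A u -> exists rs : seq 'M[k]_2, [/\ uniq rs, size rs = D,
  forall h, (h \in rs) <-> (solution A u h /\ h 0 0 = 1) &
  exists2 c, c != 0 & forall v : 'rV[k]_N, Q.@[cf (col_mx u v : 'M_(3 + 1, N))] =
    c * \prod_(h <- rs) (v *m (xv (Gam A h))^T) 0 0].
Variable ls : seq {vspace 'rV[k]_(2 * 2)}.
Hypothesis lsP : aut_lines A ls.
Local Notation a := (size ls).

Lemma D_gt0 : (0 < D)%N.
Proof. by rewrite subn_gt0 -[X in (X < _)%N]expn1 ltn_exp2l. Qed.

Lemma form_section u : good A u -> exists ys : seq {vspace 'rV[k]_N}, [/\ uniq ys,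
  (size ys * a)%N = D, (forall y, (y \in ys) <-> exists2 h, solution A u h & y = gline A h) &
  exists2 c, c != 0 & forall v : 'rV[k]_N, Q.@[cf (col_mx u v : 'M_(3 + 1, N))] =
    c * \prod_(y <- ys) (v *m (vpick y)^T) 0 0 ^+ a].
Proof.
move=> gu; have [rs [U S P [c c0 cE]]] := Qgood gu.
have [ys [Uy Sy Py [e e0 eE]]] := good_section gu lsP U P.
exists ys; split=> //; first by rewrite Sy.
by exists (c * e) => [|v]; [exact: mulf_neq0|rewrite cE eE mulrA].
Qed.

Local Notation "u '/+/' v" := (col_mx u v : 'M[k]_(3 + 1, N)) (at level 50).

Lemma pf_Q : pf (fun U : 'M[k]_(4, N) => Q.@[cf U]). Proof. by exists Q. Qed.

Lemma good_nz_exists : exists u v, good A u /\ Q.@[cf (u /+/ v)] != 0.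
Proof.
have [c [cn cz]] := generic_good char0 hd rA.
have [U0 U0n] := @ev_nz k 'M[k]_(4, N) (aff_mx k 4 N) Q (Q_neq0 hd rA Qcl).
have [u0 u0n] := cn.2.
have pc : pf (fun U : 'M[k]_(3 + 1, N) => c (usubmx U)) by apply: (pf_comp cn.1 (f := fun U : 'M[k]_(3 + 1, N) => usubmx U)); apply: pmap_usubmx; exact: pmap_id.
have [||U [cU QU]] := pf_common_nz pc pf_Q.
- by exists (col_mx u0 0); rewrite col_mxKu.
- by exists U0.
exists (usubmx (U : 'M_(3 + 1, N))), (dsubmx (U : 'M_(3 + 1, N))); split.
  by apply: contrapT => /cz z; rewrite z eqxx in cU.
by rewrite vsubmxK.
Qed.

Variables (rho : {mpoly k[4 * N]}) (m : nat) (c0 : k).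
Hypothesis rhoP : rprime rho.
Hypothesis rhoO : on_orbit A rho.
Hypothesis c0n : c0 != 0.
Hypothesis QE : Q = c0 *: rho ^+ m.
Hypothesis rhoD : forall q, on_orbit A q -> rdvd rho q.

Lemma Qrho U : Q.@[cf U] = c0 * rho.@[cf U] ^+ m.
Proof. by rewrite QE mevalZ rmorphXn. Qed.

Lemma line_last u (v w : 'rV[k]_N) s : (u /+/ v : 'M_(4, N)) + s *: (0 /+/ w : 'M_(4, N)) = u /+/ (v + s *: w).
Proof.
change (col_mx u v + s *: col_mx 0 w = col_mx u (v + s *: w)).
by rewrite scale_col_mx scaler0 add_col_mx addr0.
Qed.

Lemma rho_line (U E : 'M[k]_(4, N)) : exists p : {poly k}, [/\ forall t, p.[t] = rho.@[cf (U + t *: E)],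
   p`_0 = rho.@[cf U] & p`_1 = \sum_i rho^`M(i).@[cf U] * cf E i].
Proof.
have [r rE] := chain_rule rho (cf U) (cf E) (fun=> 0).
exists ((rho.@[cf U])%:P + 'X * (dirder rho (cf U) (cf E))%:P + 'X^2 * r); split=> [t||].
- rewrite !hornerD [('X * _).[t]]hornerM ['X.[t]]hornerX !hornerC [('X^2 * _).[t]]hornerM hornerXn -rE; apply: meval_eq => l; rewrite horner0 mulr0 addr0.
  by case/mxvec_indexP: l => x y; rewrite -/(cidx x y) !cf_entry !mxE.
- by rewrite !coefD coefXM coefXnM coefC /= !addr0.
by rewrite !coefD coefXM coefXnM !coefC /= add0r addr0.
Qed.

Lemma form_row_scale u v s : good A u -> Q.@[cf (u /+/ (s *: v))] = s ^+ D * Q.@[cf (u /+/ v)].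
Proof.
move=> gu; have [ys [_ Sy _ [c cn cE]]] := form_section gu.
rewrite !cE mulrCA -Sy [(size ys * a)%N]mulnC exprM; congr (_ * _).
elim: (ys) => [|y l IH]; first by rewrite !big_nil mulr1.
rewrite !big_cons IH -scalemxAl [X in X ^+ _ * _]mxE exprMn [size _]/= exprS; exact: mulrACA.
Qed.

Lemma derivX0 (p : {poly k}) : p`_1 = 0 -> (p ^+ m)^`().[0] = 0.
Proof. by move=> p1; rewrite deriv_exp hornerMn hornerM [_.[0]]horner_coef0 coef_deriv p1 mul0rn mul0r mul0rn. Qed.

(** For good u the form Q is homogeneous of degree D > 0 in the last row. If rho did not involve
    that row, the derivative of Q in the radial direction would vanish, although it is D times a
    nonzero value. *)
Lemma depends_on_last : exists j, rho^`M(cidx ord_max j) != 0.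
Proof.
apply: contrapT => H; have z j : rho^`M(cidx ord_max j) = 0.
  by apply: contrapT => /eqP n; apply: H; exists j.
have [u [v [gu nz]]] := good_nz_exists.
pose E : 'M[k]_(3 + 1, N) := 0 /+/ v.
have [p [pE p0 p1]] := rho_line (u /+/ v) E.
have p1z : p`_1 = 0.
  rewrite p1 big1 // => l _; case/mxvec_indexP: l => i j; rewrite -/(cidx i j) cf_entry.
  have [->|iN] := eqVneq i ord_max; first by rewrite z meval0 mul0r.
  have [i' ->] : exists i' : 'I_3, i = lshift 1 i'.
    case: (splitP (i : 'I_(3 + 1))) => i' ii; first by exists i'; apply: val_inj.
    by case/eqP: iN; apply: val_inj; rewrite [LHS]ii [i']ord1.
  by rewrite /E (col_mxEu (0 : 'M_(3, N)) v i' j) mxE mulr0.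
have key : (c0 *: p ^+ m) = Q.@[cf (u /+/ v)] *: ('X + 1%:P) ^+ D.
  apply: (poly_eq_nz (k := k)) => s _.
  rewrite !hornerZ !horner_exp pE -Qrho /E line_last.
  by rewrite !hornerE -{1}[v]scale1r -scalerDl form_row_scale // mulrC addrC.
have := congr1 (fun q : {poly k} => q^`().[0]) key.
rewrite /= !derivZ !hornerZ derivX0 // mulr0 deriv_exp !hornerMn hornerM horner_exp derivD derivX derivC.
rewrite !hornerE ?expr1n ?mulr1 => /esym/eqP; rewrite mulf_eq0 (negPf nz) /=.
rewrite hornerD hornerX -[1.[0]]/((1%:P).[0]) !hornerC add0r expr1n addr0 mul1r.
by rewrite natr_eq0 //; have := D_gt0; case: (D).
Qed.

(** On a line of last rows through a form v vanishing at an orbit point, Q is read in two ways: as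
    c0 rho ^ m with rho divisible by the parameter, and as a product of a-th powers of linear forms,
    one of them divisible by the parameter. *)
Lemma line_factor u v w h (ys : seq {vspace 'rV[k]_N}) c : good A u -> uniq ys ->
  (forall y, (y \in ys) <-> exists2 h, solution A u h & y = gline A h) ->
  (forall v : 'rV[k]_N, Q.@[cf (u /+/ v)] = c * \prod_(y <- ys) (v *m (vpick y)^T) 0 0 ^+ a) ->
  solution A u h -> v *m (vpick (gline A h))^T = 0 ->
  exists q T : {poly k}, [/\ q`_0 = \sum_i rho^`M(i).@[cf (u /+/ v)] * cf (0 /+/ w) i,
    c0 *: ('X ^+ m * q ^+ m) = 'X ^+ a * T &
    T.[0] = c * (w *m (vpick (gline A h))^T) 0 0 ^+ a *
      \prod_(y <- rem (gline A h) ys) (v *m (vpick y)^T) 0 0 ^+ a].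
Proof.
move=> gu Uy Py cE hS vh; have [p [pE p0 p1]] := rho_line (u /+/ v) (0 /+/ w).
have hy : gline A h \in ys by apply/Py; exists h.
have p00 : p.[0] = 0.
  rewrite horner_coef0 p0; apply: (rhoO (h := h)); first exact: hS.1.
  apply/(orth_rows (u /+/ v)); rewrite col_mxKu col_mxKd; split; first exact: hS.2.
  have [e e0 ->] := line_vpick (xvGam_neq0 rA hS.1).
  by rewrite linearZ /= -scalemxAr [X in _ *: X]vh scaler0.
have [q qE] : exists q, p = q * 'X.
  have /factor_theorem[q pq] : root p 0 by apply/eqP.
  by exists q; rewrite pq subr0.
pose T := (c * (w *m (vpick (gline A h))^T) 0 0 ^+ a) *:
  \prod_(y <- rem (gline A h) ys) (((v *m (vpick y)^T) 0 0)%:P + 'X * ((w *m (vpick y)^T) 0 0)%:P) ^+ a.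
exists q, T; split.
- by rewrite -p1 qE coefMX.
- rewrite mulrC -exprMn -qE; apply: (poly_eq_nz (k := k)) => s _.
  rewrite hornerZ horner_exp pE -Qrho line_last cE.
  rewrite (perm_big _ (perm_to_rem hy)) big_cons /= hornerM hornerXn hornerZ horner_prod.
  have -> : \prod_(y <- rem (gline A h) ys) ((v + s *: w) *m (vpick y)^T) 0 0 ^+ a =
    \prod_(y <- rem (gline A h) ys) ((((v *m (vpick y)^T) 0 0)%:P + 'X * ((w *m (vpick y)^T) 0 0)%:P) ^+ a).[s].
    by apply: eq_bigr => y _; rewrite mulmxDl -scalemxAl mxE [X in _ + X]mxE horner_exp !hornerE.
  rewrite mulmxDl vh add0r -scalemxAl mxE exprMn.
  by move: (s ^+ a) ((w *m _) 0 0 ^+ a) (\prod_(_ <- _) _) => x y z; ring.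
rewrite /T hornerZ horner_prod; congr (_ * _).
by apply: eq_bigr => y _; rewrite horner_exp !hornerE ?mul0r ?addr0.
Qed.

Lemma avoid_lines n (x0 : 'rV[k]_n) (xs : seq 'rV[k]_n) : x0 != 0 ->
  (forall x, x \in xs -> forall c, x != c *: x0) ->
  exists2 v : 'rV[k]_n, v *m x0^T = 0 & forall x, x \in xs -> (v *m x^T) 0 0 != 0.
Proof.
move=> x00 H; pose f (x : 'rV[k]_n) (O : 'M[k]_(1, n * n)) : k := (skew x0 O *m x^T) 0 0.
have pn x : x \in xs -> pfnz (f x).
  move=> xs'; split.
    apply: pf_entry; apply: pmap_mul; last exact: pmap_const.
    by apply: pmap_skew; pfs.
  have [i xi] := row_nz x00.
  have [j xj] : exists j, x0 0 i * x 0 j - x0 0 j * x 0 i != 0.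
    apply: contrapT => nj; have /eqP := H x xs' (x 0 i / x0 0 i); apply; apply/rowP => j.
    have /eqP : x0 0 i * x 0 j - x0 0 j * x 0 i = 0 by apply: contrapT => /eqP nz; apply: nj; exists j.
    rewrite subr_eq0 => /eqP E; rewrite mxE; apply: (mulfI xi).
    by rewrite E; field; exact: xi.
  pose v : 'rV[k]_n := x0 0 i *: delta_mx 0 j - x0 0 j *: delta_mx 0 i.
  have vE (z : 'rV[k]_n) : (v *m z^T) 0 0 = x0 0 i * z 0 j - x0 0 j * z 0 i.
    by rewrite mulmxBl -!scalemxAl -!rowE !mxE.
  have [|O OE] := skew_onto (x := x0) (u := v) x00.
    by apply/matrixP => s t; rewrite !ord1 vE mulrC subrr mxE.
  by exists O; rewrite /f -OE vE.
have [_ [O ON]] : pfnz (fun O => \prod_(x <- xs | x \in xs) f x O) by apply: pfnz_prod; [exact: 0|].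
exists (skew x0 O); first exact: skew_orth.
by move=> x xs'; move: ON; rewrite prodf_seq_neq0 => /allP/(_ x xs'); rewrite xs'.
Qed.

(** Choose v through exactly one of the orbit points over u. Along a transversal line Q vanishes to
    order exactly a, while rho ^ m vanishes to order at least m. *)
Lemma exponent_le : (m <= a)%N.
Proof.
have [u [_ [gu _]]] := good_nz_exists.
have [ys [Uy Sy Py [c cn cE]]] := form_section gu.
have [y0 y0s] : exists y0, y0 \in ys.
  by case: (ys) Sy => [|y l _]; [have := D_gt0; case: (D)|exists y; rewrite mem_head].
have [h hS y0E] := (Py y0).1 y0s.
have nz y : y \in ys -> vpick y != 0.
  case/Py => h' hS' ->; rewrite vpick0 -dimv_eq0 dim_vline.
  by rewrite (xvGam_neq0 rA hS'.1).
have gen y : y \in ys -> y = <[vpick y]>%VS.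
  case/Py => h' hS' ->; have [e e0] := line_vpick (xvGam_neq0 rA hS'.1).
  by rewrite -/(gline A h') => E; rewrite {1}/gline E line_scale.
have [||v v0 vN] := @avoid_lines N (vpick y0) [seq vpick y | y <- rem y0 ys].
- exact: nz.
- move=> x /mapP[y]; rewrite mem_rem_uniq // inE => /andP[yy ys'] -> e.
  apply: contraNneq yy => E; rewrite (gen _ ys') (gen _ y0s) E line_scale //.
  by apply: contra_neq (nz _ ys') => e0; rewrite E e0 scale0r.
have [j xj] := row_nz (nz _ y0s).
have wx : ((delta_mx 0 j : 'rV[k]_N) *m (vpick y0)^T) 0 0 != 0 by rewrite -rowE !mxE.
rewrite y0E in v0 wx vN.
have [q [T [_ E T0]]] := line_factor (delta_mx 0 j) gu Uy Py cE hS v0.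
rewrite leqNgt; apply/negP => am.
have : T.[0] != 0.
  rewrite T0 !mulf_neq0 ?expf_neq0 // prodf_seq_neq0; apply/allP => y yr.
  by rewrite /= expf_neq0 // vN // map_f.
have -> : T = c0 *: ('X ^+ (m - a) * q ^+ m).
  apply: (mulfI (x := 'X ^+ a)); first by rewrite expf_neq0 // polyX_eq0.
  by rewrite -E -scalerAr mulrA -exprD subnKC // ltnW.
by rewrite hornerZ hornerM hornerXn expr0n subn_eq0 leqNgt am mul0r mulr0 eqxx.
Qed.

Lemma row'_usub (U : 'M[k]_(3 + 1, N)) : row' ord_max U = usubmx U :> 'M_(3, N).
Proof. by apply/matrixP => i j; rewrite !mxE; congr (U _ _); apply: val_inj; rewrite /= /bump leqNgt ltn_ord. Qed.

(** If m < a, the factorization makes the derivatives of rho in the last row vanish on the incidence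
    variety over good u. Then rho divides such a derivative times an equation w in the first three
    rows only; but it divides neither factor, the derivative having smaller degree. *)
Lemma exponent_ge : (a <= m)%N.
Proof.
rewrite leqNgt; apply/negP => ma; have [j dj] := depends_on_last.
have [c [cn cz]] := generic_good char0 hd rA.
have [w wE] : pf (fun U : 'M[k]_(4, N) => c (row' ord_max U)).
  apply: (pf_ext (f := fun U : 'M[k]_(3 + 1, N) => c (usubmx U))); first by move=> U; rewrite row'_usub.
  by apply: (pf_comp cn.1 (f := fun U : 'M[k]_(3 + 1, N) => usubmx U)); apply: pmap_usubmx; exact: pmap_id.
have nw := row_free_ndvd dj cn (fun U => esym (wE U)).
have : rdvd rho (w * rho^`M(cidx ord_max j)).
  apply: rhoD => U h hU; rewrite -[U](@vsubmxK _ 3 1) => /orth_rows.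
  rewrite col_mxKu col_mxKd; set u := usubmx _; set v := dsubmx _ => -[uh vh].
  rewrite mevalM -wE row'_usub col_mxKu.
  have [->|cu] := eqVneq (c u) 0; first by rewrite mul0r.
  have gu : good A u by apply: contrapT => /cz z; rewrite z eqxx in cu.
  have [ys [Uy Sy Py [e en cE]]] := form_section gu.
  have v0 : v *m (vpick (gline A h))^T = 0.
    have [e' e0 E] := line_vpick (xvGam_neq0 rA hU); move: vh; rewrite E linearZ /= -scalemxAr => /eqP.
    by rewrite scaler_eq0 (negPf e0) => /eqP.
  have [q [T [q0 E _]]] := line_factor (delta_mx 0 j) gu Uy Py cE (conj hU uh) v0.
  have dE : 0 /+/ delta_mx 0 j = delta_mx ord_max j :> 'M[k]_(4, N).
    apply/matrixP => i l; rewrite mxE [RHS]mxE; case: splitP => i' ii; rewrite mxE.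
      have -> : (i == ord_max) = false by apply/eqP => i3; have := ltn_ord i'; rewrite -ii i3.
      by [].
    have -> : i = ord_max by apply: ord_inj; rewrite ii [i']ord1.
    by rewrite [i']ord1 !eqxx.
  rewrite dE sum_cf_delta in q0; rewrite -q0 -horner_coef0.
  have : c0 *: q ^+ m = 'X ^+ (a - m) * T.
    apply: (mulfI (x := 'X ^+ m)); first by rewrite expf_neq0 // polyX_eq0.
    by rewrite -scalerAr E mulrA -exprD subnKC // ltnW.
  move/(congr1 (horner^~ 0)); rewrite hornerZ hornerM hornerXn expr0n subn_eq0 leqNgt ma mul0r horner_exp.
  by move/eqP; rewrite mulf_eq0 (negPf c0n) expf_eq0 => /andP[_ /eqP ->]; rewrite mulr0.
have [_ _ pr] := rhoP => /pr[//|[s sE]].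
have := msize_mderiv dj; rewrite sE msizeM; first 1 last.
- by apply: contraNneq dj => s0; rewrite sE s0 mul0r.
- by case: rhoP.
have s0 : s != 0 by apply: contraNneq dj => s0; rewrite sE s0 mul0r.
have -> : msize s = (msize s).-1.+1 by rewrite prednK // lt0n msize_poly_eq0.
by rewrite addSn /= ltnNge leq_addl.
Qed.

Lemma form_exponent : m = a.
Proof. by apply/eqP; rewrite eqn_leq exponent_le exponent_ge. Qed.

Lemma form_last_zero u : Q.@[cf (u /+/ 0)] = 0.
Proof.
have [c [cn cz]] := generic_good char0 hd rA.
have pq : pf (fun u : 'M[k]_(3, N) => Q.@[cf (u /+/ 0)]).
  by apply: (pf_comp pf_Q (f := fun u : 'M[k]_(3, N) => u /+/ 0)); pfs.
have [//|z|z] := pf_mul_eq0 pq cn.1; last by case: cn.2 => u'; rewrite z eqxx.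
  move=> u'; have [->|cu] := eqVneq (c u') 0; first by rewrite mulr0.
  have gu : good A u' by apply: contrapT => /cz z; rewrite z eqxx in cu.
  by rewrite -(scale0r 0) form_row_scale // expr0n; have := D_gt0; case: (D) => // n; rewrite !mul0r.
exact: z.
Qed.

Lemma form_row_scale_all u v s : Q.@[cf (u /+/ (s *: v))] = s ^+ D * Q.@[cf (u /+/ v)].
Proof.
have [c [cn cz]] := generic_good char0 hd rA.
pose f (U : 'M[k]_(3 + 1, N)) : k := Q.@[cf (usubmx U /+/ (s *: dsubmx U))] - s ^+ D * Q.@[cf U].
have pf_f : pf f.
  apply: pf_add; last by apply: pf_opp; apply: pf_mul; [exact: pf_const|exact: pf_Q].
  by apply: (pf_comp pf_Q (f := fun U : 'M[k]_(3 + 1, N) => usubmx U /+/ (s *: dsubmx U)));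
  apply: pmap_col_mx; [apply: pmap_usubmx; exact: pmap_id|apply: pmap_scale; [exact: pf_const|apply: pmap_dsubmx; exact: pmap_id]].
have pc : pf (fun U : 'M[k]_(3 + 1, N) => c (usubmx U)) by apply: (pf_comp cn.1 (f := fun U : 'M[k]_(3 + 1, N) => usubmx U)); apply: pmap_usubmx; exact: pmap_id.
have [//|z|z] := pf_mul_eq0 pf_f pc.
- move=> U; have [->|cu] := eqVneq (c (usubmx U)) 0; first by rewrite mulr0.
  have gu : good A (usubmx U) by apply: contrapT => /cz z; rewrite z eqxx in cu.
  by rewrite /f form_row_scale // vsubmxK subrr mul0r.
- by apply/eqP; rewrite -subr_eq0 -(z (u /+/ v)) /f col_mxKu col_mxKd.
by case: cn.2 => u' /eqP[]; rewrite -(z (u' /+/ 0)) col_mxKu.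
Qed.

(** Combining the hyperplanes by an invertible g does not change their common points, so U |-> rho
    (g U) is a multiple of rho; the same for the inverse makes the cofactor constant. *)
Lemma linear_equivariance (g : 'M[k]_4) : g \in unitmx ->
  exists c, forall U : 'M[k]_(4, N), Q.@[cf (g *m U)] = c * Q.@[cf U].
Proof.
have div (f : 'M[k]_4) : exists s : {mpoly k[4 * N]}, forall U : 'M[k]_(4, N), rho.@[cf (f *m U)] = s.@[cf U] * rho.@[cf U].
  have pr : pf (fun U : 'M[k]_(4, N) => rho.@[cf U]) by exists rho.
  have [p pE] : pf (fun U : 'M[k]_(4, N) => rho.@[cf (f *m U)]).
    by apply: (pf_comp pr (f := fun U : 'M[k]_(4, N) => f *m U)); apply: pmap_mul; [exact: pmap_const|pfs].
  have [U h hU uh|s sE] := rhoD (q := p).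
    by rewrite -pE; apply: (rhoO (h := h)) => //; rewrite -mulmxA uh mulmx0.
  by exists s => U; rewrite pE [p]sE mevalM.
move=> gU; have [s sE] := div g; have [s' sE'] := div (invmx g).
have ps : pf (fun U : 'M[k]_(4, N) => s.@[cf U]) by exists s.
have ps' : pf (fun U : 'M[k]_(4, N) => s'.@[cf (g *m U)]).
  apply: (pf_comp (g := fun U : 'M[k]_(4, N) => s'.@[cf U]) (f := fun U : 'M[k]_(4, N) => g *m U)); first by exists s'.
  by apply: pmap_mul; [exact: pmap_const|pfs].
have pr : pf (fun U : 'M[k]_(4, N) => rho.@[cf U]) by exists rho.
have [//||z|z] := pf_mul_eq0 (f := fun U : 'M[k]_(4, N) => s.@[cf U] * s'.@[cf (g *m U)] - 1) _ pr.
- by apply: pf_add; [exact: pf_mul|exact: pf_const].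
- move=> U; apply/eqP; rewrite mulrBl mul1r subr_eq0 [s.@[_] * _]mulrC -mulrA -sE -sE'.
  by rewrite mulKmx.
- have [|c cn cE] := pf_unit_const ps ps'; first by move=> U; apply/eqP; rewrite -subr_eq0 z.
  by exists (c ^+ m) => U; rewrite !Qrho sE cE exprMn; ring.
case: rhoP => r0 _ _; have [U UN] := @ev_nz k 'M[k]_(4, N) (aff_mx k 4 N) rho r0.
by rewrite z eqxx in UN.
Qed.

Definition scale_row (i : 'I_4) (s : k) : 'M[k]_4 := diag_mx (\row_j (if j == i then s else 1)).

Lemma scale_row_swap i s : scale_row i s = perm_mx (tperm i ord_max) *m scale_row ord_max s *m perm_mx (tperm i ord_max).
Proof.
have E z : (tperm i ord_max z == ord_max) = (z == i) by rewrite -{2}(tpermL i ord_max) (inj_eq perm_inj).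
apply/matrixP => x y; rewrite -row_permE -{2}(tpermV i ord_max) -col_permE !mxE E.
by rewrite (inj_eq perm_inj).
Qed.

Lemma scale_rows s : s%:M = scale_row 0 s *m scale_row 1 s *m scale_row 2%:R s *m scale_row 3%:R s :> 'M[k]_4.
Proof.
rewrite !mulmx_diag -diag_const_mx; congr diag_mx; apply/rowP => j; rewrite !mxE.
by case: j => [[|[|[|[|j]]]] jP] //=; rewrite ?mulr1 ?mul1r.
Qed.

(** Degree D in the last row comes from the product over the conjugates. Exchanging two rows changes
    Q by a constant only, so each of the four rows contributes D. *)
Lemma form_scale (U : 'M[k]_(4, N)) s : Q.@[cf (s *: U)] = s ^+ (4 * D) * Q.@[cf U].
Proof.
have D4 : (4 * D)%N = (D + D + D + D)%N by lia.
have last V t : Q.@[cf (scale_row ord_max t *m V)] = t ^+ D * Q.@[cf V].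
  have -> : scale_row ord_max t *m V = usubmx (V : 'M_(3 + 1, N)) /+/ (t *: dsubmx (V : 'M_(3 + 1, N))).
    apply/matrixP => i j; rewrite mul_diag_mx mxE; case: (splitP (i : 'I_(3 + 1))) => i' ii.
      have -> : i = lshift 1 i' by apply: val_inj.
      by rewrite (col_mxEu _ _ i') !mxE -val_eqE /= ltn_eqF ?mul1r.
    have -> : i = rshift 3 i' by apply: val_inj.
    symmetry; etransitivity; first exact: col_mxEd.
    by rewrite !mxE -val_eqE /= [i']ord1 eqxx.
  by rewrite form_row_scale_all vsubmxK.
have any i V t : Q.@[cf (scale_row i t *m V)] = t ^+ D * Q.@[cf V].
  have [c cE] := linear_equivariance (unitmx_perm k (tperm i ord_max)).
  have pp (W : 'M[k]_(4, N)) : perm_mx (tperm i ord_max) *m (perm_mx (tperm i ord_max) *m W) = W.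
    by rewrite mulmxA -perm_mxM tperm2 perm_mx1 mul1mx.
  rewrite scale_row_swap -!mulmxA cE last mulrCA -cE; congr (_ * _); by rewrite pp.
by rewrite -mul_scalar_mx scale_rows -!mulmxA !any D4 !exprD; ring.
Qed.

End FixedMapForm.

(** * Maps with trivial stabilizer *)

Section TrivialStabilizers.
Variables (k : closedFieldType) (d : nat).
Hypothesis char0 : [pchar k] =i pred0.
Hypothesis hd : (2 <= d)%N.
Implicit Types (A X : 'M[k]_(2, d.+1)) (h g : 'M[k]_2).
Local Notation N := (2 * d.+1)%N.
Local Notation V4 := 'rV[k]_(2 * 2).
Local Notation rigidA := (rigidA k d).

Definition trivial_stab A : Prop := forall g, stab A g -> exists s, g = s%:M.

Lemma proportional A X : A != 0 -> (forall i j i' j', X i j * A i' j' = X i' j' * A i j) ->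
  exists c, X = c *: A.
Proof.
move=> A0 H; have [[i j] Aij] : exists q, A q.1 q.2 != 0.
  apply: contrapT => n; move/eqP: A0; apply; apply/matrixP => i j; rewrite mxE.
  by apply: contrapT => /eqP nz; apply: n; exists (i, j).
exists (X i j / A i j); apply/matrixP => a b; rewrite mxE; apply: (mulIf Aij).
by rewrite H; field; exact: Aij.
Qed.

Lemma rat_scale A c : coprime_map A -> c != 0 -> coprime_map (c *: A).
Proof. by move=> rA c0 x x0; rewrite evZl scaler_eq0 negb_or c0 rA. Qed.

(** Both terms of a limit form vanish at the kernel of w, the second one because d - 1 > 0. *)
Lemma boundary_not_rat A h X : coprime_map A -> h != 0 -> X != 0 -> \det h = 0 -> Xt A h X -> ~ coprime_map X.
Proof.
move=> rA h0 X0 dh XX rX; have [e [v [w [ve w0 hE]]]] := rank1 h0 dh.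
have d0 : (0 < d)%N := ltnW hd.
have [kap [e' [t [m [we _ _ XE _]]]]] := Xt_sing d0 rA X0 ve w0 hE XX.
have cn : chart e' t 0 e' = 1 by rewrite mxE unlift_none.
set c : 'rV[k]_2 := chart e' t in cn XE.
have p0 : perp c != 0.
  apply: contraTneq (oner_neq0 k) => z; rewrite -cn.
  have z0 : c 0 1 = 0 by apply/eqP; rewrite -oppr_eq0 -[- _](vec2_0 _ (c 0 0)) -[vec2 _ _]/(perp c) z mxE.
  have z1 : c 0 0 = 0 by rewrite -[LHS](vec2_1 (- c 0 1)) -[vec2 _ _]/(perp c) z mxE.
  by case: (I2P e') => ->; rewrite ?z0 ?z1 eqxx.
have cp : (c *m perp c) 0 0 = 0 by rewrite mul2E vec2_0 vec2_1; ring.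
have /eqP := rX _ p0; apply; rewrite XE bdry_ev // cp !expr0n.
have -> : (d == 0) = false by case: (d) d0.
have -> : (d.-1 == 0) = false by case: (d) hd => // -[].
by rewrite scale0r mulr0 mul0r scale0r addr0.
Qed.

(** The 2 x 2 minors of the pair (x, a), which test proportionality by polynomial equations. *)
Definition comm_mx (x a : 'rV[k]_N) : 'M[k]_N := x^T *m a - a^T *m x.

Lemma comm_mxE x a i j : comm_mx x a i j = x 0 i * a 0 j - a 0 i * x 0 j.
Proof. by rewrite mxE outer_eq0 mxE outer_eq0. Qed.

Lemma comm_mx_lin x y z a s t : comm_mx (x + s *: y + t *: z) a = comm_mx x a + s *: comm_mx y a + t *: comm_mx z a.
Proof.
apply/matrixP => i j; rewrite comm_mxE [RHS]mxE [X in _ = X + _]mxE [X in _ = _ + X]mxE.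
by rewrite [X in _ = _ + X + _]mxE !comm_mxE !mxE; ring.
Qed.

Lemma mxvecT_lin (X Y Z : 'M[k]_N) s t :
  (mxvec (X + s *: Y + t *: Z))^T = (mxvec X)^T + s *: (mxvec Y)^T + t *: (mxvec Z)^T.
Proof. by rewrite !linearD /= !linearZ. Qed.

Lemma comm_mx_eq0 X A : A != 0 -> comm_mx (xv X) (xv A) = 0 -> exists c, X = c *: A.
Proof.
move=> A0 H; apply: proportional => // i j i' j'.
have := congr1 (fun K : 'M[k]_N => K (mxvec_index i j) (mxvec_index i' j')) H.
by rewrite comm_mxE /xv !mxvecE mxE => /eqP; rewrite subr_eq0 mulrC => /eqP ->; rewrite mulrC.
Qed.

Lemma comm_mx_scale c a : comm_mx (c *: a) a = 0.
Proof. by apply/matrixP => i j; rewrite comm_mxE !mxE; ring. Qed.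

Definition relation (q : 'M[k]_(2, d.+1) * V4) : 'M[k]_(N * N, 1) :=
  (mxvec (comm_mx (xv (Gam q.1 (vec_mx q.2))) (xv q.1)))^T.

Lemma pmap_relation : pmap relation.
Proof.
apply: pmap_tr; apply: pmap_mxvec.
have p1 : pmap (fun q : 'M[k]_(2, d.+1) * V4 => xv (Gam q.1 (vec_mx q.2))).
  by apply: pmap_mxvec; apply: pmap_Gam; pfs.
have p2 : pmap (fun q : 'M[k]_(2, d.+1) * V4 => xv q.1) by apply: pmap_mxvec; pfs.
by apply: pmap_addmx; [|apply: pmap_oppmx]; apply: pmap_mul => //; exact: pmap_tr.
Qed.

Lemma relation_eq0 A h c : Gam A h = c *: A -> relation (A, mxvec h) = 0.
Proof. by move=> E; rewrite /relation /= mxvecK E xvZ comm_mx_scale linear0 trmx0. Qed.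

Lemma dot00 (v : V4) : mxvec (delta_mx 0 0 : 'M[k]_2) *m v^T = ((vec_mx v) 0 0)%:M.
Proof. by rewrite mxvec_delta -rowE; apply/matrixP => i j; rewrite !ord1 !mxE. Qed.

Section Quotient.
Variable M : 'M[k]_(2, d.+1) * V4 * V4 -> 'M[k]_(N * N, 2 * 2).
Hypothesis pM : pmap M.
Hypothesis ME : forall A a b, relation (A, b) - relation (A, a) = M ((A, a), b) *m (b - a)^T.

Definition jacA A (a b : V4) : 'M[k]_(N * N + 1, 2 * 2) := col_mx (M ((A, a), b)) (mxvec (delta_mx 0 0 : 'M_2)).

(** A closed condition satisfied by every coprime A with a nontrivial automorphism h: h and a scalar
    matrix, scaled to the same first entry, are two solutions of [relation], so their difference is
    killed by [jacA] and all maximal minors vanish. When h tends to a scalar matrix, this would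
    become an infinitesimal automorphism. *)
Definition bad A h X : Prop := [/\ Xt A h X, (forall i j i' j', X i j * A i' j' = X i' j' * A i j) &
  forall q : {s : k | s != 0} * 'M[k]_(2 * 2, N * N + 1), h 0 0 * \det h *
    \det (q.2 *m jacA A (sval q.1 *: (h 0 0 *: mxvec 1%:M)) (sval q.1 *: mxvec h)) = 0].

(** On the diagonal the difference quotient is the derivative of [relation]; its kernel consists of
    infinitesimal automorphisms, which are scalar, and the last row removes the scalars. *)
Lemma jac_diag A : coprime_map A -> exists S, S *m jacA A (mxvec 1%:M) (mxvec 1%:M) = 1%:M.
Proof.
move=> rA; apply/row_fullP; rewrite /row_full -mxrank_tr -/(row_free _).
apply/inj_row_free => v vJ; set a : V4 := mxvec 1%:M.
have : jacA A a a *m v^T = 0 by rewrite -[LHS]trmxK trmx_mul trmxK vJ trmx0.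
rewrite mul_col_mx dot00 => E.
have MV : M ((A, a), a) *m v^T = 0 by have := congr1 usubmx E; rewrite col_mxKu linear0.
have v0 : (vec_mx v : 'M_2) 0 0 = 0.
  by have := congr1 (fun K : 'M[k]_(1, 1) => K 0 0) (congr1 dsubmx E); rewrite col_mxKd linear0 !mxE.
have [e eE] := Gam_expand A 1%:M (vec_mx v).
pose pa : 'rV[{poly k}]_N := map_mx polyC (xv A).
have : M ((A, a), a) *m v^T = (mxvec (comm_mx (xv (dGam A 1%:M (vec_mx v))) (xv A)))^T.
  apply: (@quotient_diag k _ _ (fun w => relation (A, w)) (fun w w' => M ((A, w), w')) a v _
    (mxvec ((mxvec e)^T *m pa - pa^T *m mxvec e))^T).
  - by apply: (pmap_comp pM); apply: pmap_pair; [apply: pmap_pair|]; pfs.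
  - by move=> w w'; exact: ME.
  move=> t; rewrite /relation /=.
  have -> : vec_mx (a + t *: v) = 1%:M + t *: vec_mx v :> 'M[k]_2 by rewrite linearD /= linearZ /= mxvecK.
  rewrite /a mxvecK Gam1 eE Gam1 !xvD !xvZ comm_mx_lin mxvecT_lin; congr (_ + _ + _ *: _).
  rewrite -[RHS]/(map_mx (horner_eval t) _) -map_trmx map_mxvec map_mxB !map_mxM -!map_trmx map_mxvec.
  by have -> : map_mx (horner_eval t) pa = xv A by apply/matrixP => i j; rewrite !mxE /= horner_evalE hornerC.
rewrite MV => /esym/(congr1 trmx); rewrite trmxK trmx0 => /eqP; rewrite mxvec_eq0 => /eqP.
case/(comm_mx_eq0 (rat_neq0 rA)) => c /(infinitesimal_stabilizer char0 hd rA)[s sE].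
have s0 : s = 0 by move: v0; rewrite sE mxE mulr1n.
by rewrite -[v]vec_mxK sE s0 -scalemx1 scale0r linear0.
Qed.

Lemma zcl_bad : zcl (fun A => exists h X, [/\ h != 0, X != 0 & bad A h X]).
Proof.
apply: elim2.
  have zE : forall q : 'M[k]_(2, d.+1) * 'M[k]_2 * 'M[k]_(2, d.+1), (Xt q.1.1 q.1.2 q.2 /\
    ((forall z : ('I_2 * 'I_d.+1) * ('I_2 * 'I_d.+1), q.2 z.1.1 z.1.2 * q.1.1 z.2.1 z.2.2 = q.2 z.2.1 z.2.2 * q.1.1 z.1.1 z.1.2) /\
    forall r : {s : k | s != 0} * 'M[k]_(2 * 2, N * N + 1), q.1.2 0 0 * \det q.1.2 *
    \det (r.2 *m jacA q.1.1 (sval r.1 *: (q.1.2 0 0 *: mxvec 1%:M)) (sval r.1 *: mxvec q.1.2)) = 0)) <-> bad q.1.1 q.1.2 q.2.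
    move=> q; split=> [[H1 [H2 H3]]|[H1 H2 H3]]; last by split.
    by split=> // i j i' j'; exact: (H2 ((i, j), (i', j'))).
  apply: (zcl_ext zE); apply: zcl_and; first by apply: zcl_Xt; pfs.
  apply: zcl_and.
    by apply: zcl_forall => z; apply: zcl_eq; apply: pf_mul; apply: pf_entry; pfs.
  apply: zcl_forall => r; apply: zcl_eq; last exact: pf_const.
  have ph : pmap (fun q : 'M[k]_(2, d.+1) * 'M[k]_2 * 'M[k]_(2, d.+1) => q.1.2) by pfs.
  have pA : pmap (fun q : 'M[k]_(2, d.+1) * 'M[k]_2 * 'M[k]_(2, d.+1) => q.1.1) by pfs.
  have p0 : pf (fun q : 'M[k]_(2, d.+1) * 'M[k]_2 * 'M[k]_(2, d.+1) => q.1.2 0 0) by exact: pf_entry.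
  apply: pf_mul; first by apply: pf_mul => //; exact: pf_det.
  apply: pf_det; apply: pmap_mul; first exact: pmap_const.
  apply: pmap_col_mx; last exact: pmap_const.
  apply: (pmap_comp pM); apply: pmap_pair; [apply: pmap_pair => //|].
    by apply: pmap_scale; [exact: pf_const|apply: pmap_scale; [exact: p0|exact: pmap_const]].
  by apply: pmap_scale; [exact: pf_const|exact: pmap_mxvec].
move=> A h X s t s0 t0 [H1 H2 H3]; split.
- exact: XtZ (ltnW hd) H1.
- by move=> i j i' j'; rewrite !mxE -!mulrA H2.
move=> [[r r0] S] /=; have rs0 : r * s != 0 by exact: mulf_neq0.
have := H3 (exist _ (r * s) rs0, S); rewrite /= => E.
have -> : r *: ((s *: h) 0 0 *: mxvec 1%:M) = (r * s) *: (h 0 0 *: mxvec 1%:M) :> V4 by rewrite mxE !scalerA mulrA.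
have -> : r *: mxvec (s *: h) = (r * s) *: mxvec h :> V4 by rewrite [mxvec _]linearZ /= scalerA.
rewrite detZ mxE [X in X * _](_ : _ = s ^+ 3 * (h 0 0 * \det h)); first by rewrite -mulrA E mulr0.
ring.
Qed.

(** Here X is a multiple of the rigid map, which is no limit form, so h is invertible and an
    automorphism, hence scalar; the left inverse S of the diagonal Jacobian then gives determinant
    1. *)
Lemma rigid_not_bad : ~ exists h X, [/\ h != 0, X != 0 & bad rigidA h X].
Proof.
have rA := rat_rigid char0 hd.
move=> [h [X [h0 X0 [XX par jz]]]]; have [c XE] := proportional (rat_neq0 rA) par.
have c0 : c != 0 by apply: contra_neq X0 => c0; rewrite XE c0 scale0r.
have hU : h \in unitmx.
  rewrite unit2; apply/eqP => dh; apply: (boundary_not_rat rA h0 X0 dh XX).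
  by rewrite XE; exact: rat_scale.
have [e XG] := Xt_prop (Gam_neq0 (rat_neq0 rA) hU) XX.
have e0 : e != 0 by apply: contra_neq X0 => e0; rewrite XG e0 scale0r.
have [s hE] : exists s, h = s%:M.
  apply: (rigid_trivial char0 hd (c := e^-1 * c) hU).
  by rewrite -scalerA -XE XG scalerA mulVf // scale1r.
have s0 : s != 0 by apply: contra_neq h0 => s0; rewrite hE s0 -scalemx1 scale0r.
have si0 : s^-1 != 0 by rewrite invr_eq0.
have [S SE] := jac_diag rA.
have := jz (exist _ s^-1 si0, S); rewrite /= hE mxE mulr1n.
have -> : s^-1 *: (s *: mxvec 1%:M) = mxvec 1%:M :> V4 by rewrite scalerA mulVf // scale1r.
have -> : s^-1 *: mxvec s%:M = mxvec 1%:M :> V4 by rewrite -linearZ /= scale_scalar_mx mulVf.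
rewrite SE det1 mulr1 det_scalar => /eqP; rewrite mulf_eq0 expf_eq0 (negPf s0).
by [].
Qed.

Lemma not_bad_trivial A : coprime_map A -> ~ (exists h X, [/\ h != 0, X != 0 & bad A h X]) -> trivial_stab A.
Proof.
move=> rA nb g [gU [c gE]]; apply: contrapT => ns; apply: nb.
have c0 : c != 0 by apply: contraTneq (Gam_neq0 (rat_neq0 rA) gU) => c0; rewrite gE c0 scale0r eqxx.
exists g, A; split; [exact: unit_neq0|exact: rat_neq0|split].
- have := XtZ 1 c^-1 (ltnW hd) (Xt_Gam A g).
  by rewrite gE scale1r scalerA mulVf // scale1r.
- by move=> i j i' j'; rewrite mulrC.
move=> [[s s0] S] /=; have [->|g00] := eqVneq (g 0 0) 0; first by rewrite !mul0r.
set a := s *: _; set b := s *: mxvec g.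
have aE : a = mxvec (s * g 0 0)%:M by rewrite /a -[(s * g 0 0)%:M]scalemx1 [RHS]linearZ /= scalerA.
have bE : b = mxvec (s *: g) by rewrite [RHS]linearZ.
have ra : relation (A, a) = 0.
  rewrite aE; apply: (relation_eq0 (c := (s * g 0 0) ^+ d.+1)).
  by rewrite -scalemx1 GamZ Gam1.
have rb : relation (A, b) = 0.
  by rewrite bE; apply: (relation_eq0 (c := s ^+ d.+1 * c)); rewrite GamZ gE scalerA.
have ba : b - a != 0.
  apply: contra_notN ns; rewrite subr_eq0 aE bE => /eqP/(can_inj mxvecK) E; exists (g 0 0).
  by apply: (scalerI s0); rewrite E -scale_scalar_mx.
have J0 : jacA A a b *m (b - a)^T = 0.
  rewrite mul_col_mx -ME ra rb subrr dot00 linearB aE bE /= !mxvecK !mxE mulr1n subrr.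
  by rewrite -scalemx1 scale0r col_mx0.
suff -> : \det (S *m jacA A a b) = 0 by rewrite mulr0.
apply/eqP; rewrite -det_tr; apply/det0P; exists (b - a) => //.
by rewrite -[b - a]trmxK -trmx_mul -mulmxA J0 mulmx0 trmx0.
Qed.

End Quotient.

Theorem trivial_dense (f : 'M[k]_(2, d.+1) -> k) : pf f ->
  (forall A, coprime_map A -> trivial_stab A -> f A = 0) -> forall A, f A = 0.
Proof.
move=> pff H; have [M [pM ME]] := difference_quotient_mx pmap_relation.
have [g [pg gz gn]] := zcl_bad pM (rigid_not_bad pM ME).
have [|z|z] := pf_mul_eq0 pff pg; [|exact: z|by move: gn; rewrite z eqxx].
refine (rat_dense (pf_mul pff pg) _).
move=> A rA; have [->|gA] := eqVneq (g A) 0; first by rewrite mulr0.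
rewrite H ?mul0r //; apply: (not_bad_trivial ME) => // /gz gA0.
by rewrite gA0 eqxx in gA.
Qed.

End TrivialStabilizers.
From mathcomp Require Import boolp classical_sets functions fsbigop cardinality.
From mathcomp Require Import finmap.
Require Import Defs.

(** * Projective varieties and orbit closures *)

Section Homogeneous.
Variable k : closedFieldType.

Lemma meval_scale n (p : {mpoly k[n]}) (v : 'I_n -> k) s :
  p.@[fun i => s * v i] = \sum_(m <- msupp p) p@_m * (\prod_i v i ^+ m i) * s ^+ mdeg m.
Proof.
rewrite mevalE; apply: eq_bigr => m _; rewrite -mulrA; congr (_ * _).
under eq_bigr do rewrite exprMn; rewrite big_split mulrC; congr (_ * _).
by rewrite mdegE expr_sum.
Qed.

Lemma homog_meval n e (p : {mpoly k[n]}) v s : p \is e.-homog ->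
  p.@[fun i => s * v i] = s ^+ e * p.@[v].
Proof.
move=> /dhomogP H; rewrite meval_scale mevalE mulr_sumr big_seq [RHS]big_seq.
by apply: eq_bigr => m /H ->; rewrite mulrC.
Qed.

Lemma meval_inj n (p q : {mpoly k[n]}) : (forall v, p.@[v] = q.@[v]) -> p = q.
Proof.
move=> H; apply/eqP; rewrite -subr_eq0; apply: contrapT => /negP/mpoly_nz[v].
by rewrite mevalB H subrr eqxx.
Qed.

Lemma scaling_homog n e (p : {mpoly k[n]}) :
  (forall v s, p.@[fun i => s * v i] = s ^+ e * p.@[v]) -> p \is e.-homog.
Proof.
move=> H; apply/dhomogP => m0 m0p; apply: contrapT => /eqP me.
have : p@_m0 != 0 by rewrite -mcoeff_msupp.
pose q : {mpoly k[n]} := \sum_(m <- msupp p) (p@_m * (mdeg m0 == mdeg m)%:R) *: 'X_[m].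
have qz : q = 0.
  apply: meval_inj => v; rewrite meval0 raddf_sum /=.
  pose P : {poly k} := \sum_(m <- msupp p) (p@_m * \prod_i v i ^+ m i) *: 'X^(mdeg m).
  have PE : P = p.@[v] *: 'X^e.
    apply: (poly_eq_nz (k := k)) => s _; rewrite hornerZ hornerXn mulrC -H meval_scale /P horner_sum.
    by apply: eq_bigr => m _; rewrite hornerZ hornerXn.
  have := congr1 (fun P : {poly k} => P`_(mdeg m0)) PE.
  rewrite /= coefZ coefXn (negPf me) mulr0 /P coef_sum => E; rewrite -[RHS]E.
  by apply: eq_bigr => m _; rewrite coefZ coefXn /= mevalZ mevalX mulrAC.
have : q@_m0 = p@_m0.
  rewrite /q raddf_sum /= (bigD1_seq m0) //= mcoeffZ mcoeffX !eqxx !mulr1 big1_seq ?addr0 //.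
  by move=> m /andP[mm _]; rewrite mcoeffZ mcoeffX (negPf mm) mulr0.
by rewrite qz mcoeff0 => <-; rewrite eqxx.
Qed.

Lemma mev_homog n e (p : {mpoly k[n]}) (v : 'rV[k]_n) s : p \is e.-homog -> mev p (s *: v) = s ^+ e * mev p v.
Proof. by move=> H; rewrite /mev -(homog_meval _ _ H); apply: meval_eq => i; rewrite mxE. Qed.

Lemma pf_mev n (p : {mpoly k[n]}) : pf (fun v : 'rV[k]_n => mev p v).
Proof.
apply: (pf_ext (f := fun v : 'rV[k]_n => mev p (row 0 v))); first by move=> v; rewrite row_id.
rewrite /mev; apply: (pf_ext (f := fun v : 'rV[k]_n => \sum_(m <- msupp p) p@_m * \prod_i (v 0 i) ^+ m i)).
  by move=> v; rewrite row_id mevalE.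
by apply: pf_sum => m; apply: pf_mul; [exact: pf_const|apply: pf_prod => i; apply: pf_exp; apply: pf_entry; exact: pmap_id].
Qed.

End Homogeneous.

Section Points.
Local Open Scope classical_set_scope.
Local Open Scope ring_scope.
Variables (k : closedFieldType) (n : nat).
Implicit Types (p q : proj k n) (v w : 'rV[k]_n) (Z : set (proj k n)).

Lemma coords_neq0 p v : coords p v -> v != 0.
Proof.
move=> pv; have := valP p; rewrite /= [val p]pv dim_vline.
by case: (v != 0).
Qed.

Lemma coords_exists p : exists v, coords p v.
Proof.
exists (vpick (val p)); have p0 : (val p != 0)%VS by rewrite -dimv_eq0 (eqP (valP p)).
apply/eqP; rewrite eq_sym eqEdim -memvE memv_pick dim_vline vpick0 p0.
by rewrite (eqP (valP p)).
Qed.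

Lemma coords_scale p v w : coords p v -> coords p w -> exists2 c, c != 0 & v = c *: w.
Proof. by move=> pv pw; apply: line_eq (coords_neq0 pv) _; rewrite -pv -pw. Qed.

Lemma coordsZ p v c : c != 0 -> coords p v -> coords p (c *: v).
Proof. by move=> c0 pv; rewrite /coords /= line_scale. Qed.

Lemma proj_of v : v != 0 -> exists p, coords p v.
Proof.
move=> v0; have H : \dim <[v]>%VS == 1%N by rewrite dim_vline v0.
by exists (exist (fun L : {vspace 'rV[k]_n} => \dim L == 1%N) _ H).
Qed.

Lemma zariski_closureE (A : set (proj k n)) : zariski_closure A =
  [set p | forall f, (exists e, f \is e.-homog) -> (forall q w, A q -> coords q w -> mev f w = 0) ->
    forall v, coords p v -> mev f v = 0].
Proof.
apply/seteqP; split=> p.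
  move=> H; apply: H; split; last by move=> q Aq f fh fA v; exact: fA.
  exists [set f | (exists e, f \is e.-homog) /\ forall q w, A q -> coords q w -> mev f w = 0]; split.
    by move=> f [].
  apply/seteqP; split=> q /= H; first by move=> f v [fh fA]; exact: H.
  by move=> f fh fA v; apply: H.
move=> H Z [[S [Sh ->]] AZ] f v Sf pv; apply: (H f) => //; first exact: Sh.
by move=> q w Aq; apply: AZ.
Qed.

Lemma closed_zariski_closure (A : set (proj k n)) : zariski_closed (zariski_closure A).
Proof.
exists [set f | (exists e, f \is e.-homog) /\ forall q w, A q -> coords q w -> mev f w = 0].
split; first by move=> f [].
rewrite zariski_closureE; apply/seteqP; split=> q /= H; first by move=> f v [fh fA]; exact: H.
by move=> f fh fA v; apply: H.
Qed.

Lemma sub_zariski_closure (A : set (proj k n)) : (A `<=` zariski_closure A).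
Proof. by move=> p Ap Z [_]; apply. Qed.

Lemma zariski_closure_sub (A Z : set (proj k n)) : zariski_closed Z -> (A `<=` Z) ->
  (zariski_closure A `<=` Z).
Proof. by move=> cZ AZ p; apply. Qed.

(** Zero rows impose no condition, so an empty section by few hyperplanes stays empty when the list
    is padded with zeros. *)
Lemma has_dim_inj Z r r' : has_dim Z r -> has_dim Z r' -> r = r'.
Proof.
have H a b : has_dim Z a -> has_dim Z b -> (b <= a)%N.
  move=> [_ [u uE]] [H _]; rewrite leqNgt; apply/negP => ab.
  have eb : b = (a.+1 + (b - a.+1))%N by rewrite subnKC.
  move: H; rewrite eb => /(_ (col_mx u 0))[p [Zp pv]].
  have : linear_section Z u p.
    split=> // v cv; have := pv v cv; rewrite mul_col_mx => E.
    by have := congr1 usubmx E; rewrite col_mxKu linear0.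
  by rewrite uE.
by move=> h h'; apply/eqP; rewrite eqn_leq !H.
Qed.

(** The two open sets of generic linear subspaces have a common member, which computes both
    numbers. *)
Lemma has_degree_inj Z e e' : has_degree Z e -> has_degree Z e' -> e = e'.
Proof.
move=> [r [hr [Q [Q0 QE]]]] [r' [hr' [Q' [Q0' QE']]]].
have E := has_dim_inj hr hr'; rewrite -{r'}E in hr' Q' Q0' QE'.
have [v v0] := mpoly_nz (mulf_neq0 Q0 Q0'); move: v0; rewrite mevalM mulf_eq0 negb_or => /andP[a b].
pose u : 'M[k]_(r, n) := vec_mx (\row_i v i).
have uE (P : {mpoly k[r * n]}) : mev P (mxvec u) = P.@[v].
  by rewrite /mev vec_mxK; apply: meval_eq => i; rewrite mxE.
have := QE u; rewrite uE => /(_ a); have := QE' u; rewrite uE => /(_ b).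
by move=> c1 c2; apply/card_eq_II; apply: card_eq_trans c1; rewrite card_eq_sym.
Qed.

Lemma degreeE Z e : has_degree Z e -> degree Z = e.
Proof. by move=> H; rewrite /degree; case: xgetP => [x -> Hx|/(_ e)//]; exact: has_degree_inj Hx H. Qed.

End Points.

(** * Rational maps as pairs of binary forms *)

Section RationalMaps.
Variables (k : closedFieldType) (d : nat).
Implicit Types (A X : 'M[k]_(2, d.+1)) (h g a : 'M[k]_2).
Local Notation N := (2 * d.+1)%N.

Definition colv (x : 'I_2 -> k) : 'cV[k]_2 := \col_i x i.

Lemma bform_ev A i x : (bform A i).@[x] = ev A (colv x) i 0.
Proof.
rewrite /bform raddf_sum mxE; apply: eq_bigr => j _; rewrite /= mevalZ mevalM !rmorphXn /= !mevalXU.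
by rewrite mxE [colv x 0 0]mxE [colv x 1 0]mxE; do 2 (congr (_ * _)); congr (x _ ^+ _); apply: val_inj.
Qed.

Lemma bform_coef A i (j : 'I_d.+1) : (bform A i)@_(U_(ord0) *+ j + U_(ord_max) *+ (d - j))%MM = A i j.
Proof.
rewrite /bform raddf_sum (bigD1 j) //= big1 ?addr0 => [|l lj].
  by rewrite /= mcoeffZ !mpolyXn -mpolyXD mcoeffX eqxx mulr1.
rewrite /= mcoeffZ !mpolyXn -mpolyXD mcoeffX; case: eqP => [E|_]; last by rewrite mulr0.
case/eqP: lj; apply: val_inj.
by have := congr1 (fun m : 'X_{1..2} => m ord0) E; rewrite !mnmDE !mulmnE !mnm1E /= ?muln1 ?mul1n ?muln0 ?mul0n ?addn0.
Qed.

Lemma conj_mxE a A : a \in unitmx -> conj_mx a A = \det a *: Gam A (invmx a).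
Proof.
move=> aU; set B := _ *: _.
have BE x : ev B x = a *m ev A (invmx a *m x).
  rewrite /B evZl ev_Gam scalemxAl; congr (_ *m _).
  have E : invmx a *m (\det a *: \adj (invmx a)) = 1%:M.
    by rewrite -scalemxAr mul_mx_adj scale_scalar_mx det_inv divff // -unit2.
  by rewrite -[LHS]mul1mx -(mulmxV aU) -mulmxA E mulmx1.
have cE i : conj_form a A i = bform B i.
  apply: meval_inj => x; rewrite bform_ev BE /conj_form raddf_sum [RHS]mxE.
  apply: eq_bigr => l _; rewrite /= mevalZ comp_mpoly_meval bform_ev; congr (_ * ev A _ _ _).
  apply/matrixP => s t; rewrite !mxE tnth_mktuple raddf_sum; apply: eq_bigr => m _.
  by rewrite /= mevalZ mevalXU mxE.
by apply/matrixP => i j; rewrite mxE cE bform_coef.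
Qed.

Lemma pf_meval_fun T {hT : aff k T} n (p : {mpoly k[n]}) (f : T -> 'I_n -> k) :
  (forall i, pf (fun t => f t i)) -> pf (fun t => p.@[f t]).
Proof.
move=> H; apply: (pf_ext (f := fun t => \sum_(m <- msupp p) p@_m * \prod_i (f t i) ^+ m i)).
  by move=> t; rewrite mevalE.
by apply: pf_sum => m; apply: pf_mul; [exact: pf_const|apply: pf_prod => i; exact: pf_exp].
Qed.

Lemma no_zero_constant (f : k -> k) : pf f -> (forall t, f t != 0) -> forall t, f t = f 0.
Proof.
move=> /pf_k[q qE] H t; rewrite !qE.
have s1 : size q = 1%N.
  by apply/eqP; apply: contraT => /closed_rootP[x]; rewrite /root -qE (negPf (H x)).
by rewrite [q]size1_polyC ?s1 // !hornerC.
Qed.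

(** A common factor h has no zero besides the origin. A polynomial without zeros is constant on
    every line parallel to an axis that avoids the origin, and by continuation h is constant. *)
Lemma rat_coprime A : coprime_map A -> coprime_forms (bform A ord0) (bform A ord_max).
Proof.
move=> rA h q r fE gE; pose pt s t : 'I_2 -> k := fun i => if i == 0 then s else t.
have nz s t : (s != 0) || (t != 0) -> h.@[pt s t] != 0.
  move=> st; apply/eqP => h0; have H : colv (pt s t) != 0.
    apply: contraTneq st => z; have := congr1 (fun c : 'cV[k]_2 => c 0 0) z.
    have := congr1 (fun c : 'cV[k]_2 => c 1 0) z.
    by rewrite /= !mxE /pt /= => -> ->; rewrite eqxx.
  have /eqP := rA _ H; apply.
  apply: col2P; rewrite -bform_ev [RHS]mxE.
    by rewrite (_ : 0 = ord0) // fE mevalM h0 mul0r.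
  by rewrite (_ : 1 = ord_max) ?gE ?mevalM ?h0 ?mul0r //; apply: val_inj.
have pl s : pf (fun t => h.@[pt s t]).
  by apply: pf_meval_fun => i; rewrite /pt; case: (i == 0); pfs.
have pr t : pf (fun s => h.@[pt s t]).
  by apply: pf_meval_fun => i; rewrite /pt; case: (i == 0); pfs.
have cl s t : h.@[pt s t] = h.@[pt s 0].
  have [p pE] := pf_k (pr t); have [p' pE'] := pf_k (pr 0).
  rewrite pE pE'; congr (_.[_]); apply: poly_eq_nz => s' s0; rewrite -pE -pE'.
  by apply: (no_zero_constant (pl s')) => t'; rewrite nz // s0.
have cr s t : h.@[pt s t] = h.@[pt 0 t].
  have [p pE] := pf_k (pl s); have [p' pE'] := pf_k (pl 0).
  rewrite pE pE'; congr (_.[_]); apply: poly_eq_nz => s' s0; rewrite -pE -pE'.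
  by apply: (no_zero_constant (pr s')) => t'; rewrite nz // s0 orbT.
apply/mpoly_unitE; exists h.@[pt 1 0]; first by rewrite nz // oner_neq0.
apply: meval_inj => v; rewrite mevalC.
have -> : h.@[v] = h.@[pt (v 0) (v 1)] by apply: meval_eq => i; rewrite /pt; case: (I2P i) => ->.
by rewrite cl cr [RHS]cr.
Qed.

(** A prime factor of the linear form that vanishes at a common zero x divides both forms by
    [nullstellensatz_prime]. *)
Lemma coprime_rat A : coprime_forms (bform A ord0) (bform A ord_max) -> coprime_map A.
Proof.
move=> cop x x0; apply/eqP => ex.
pose l : {mpoly k[2]} := x 1 0 *: 'X_0 - x 0 0 *: 'X_1.
have lE v : l.@[v] = x 1 0 * v 0 - x 0 0 * v 1 by rewrite mevalB !mevalZ !mevalXU.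
have l0 : l != 0.
  apply: contra_neq x0 => lz; apply: col2P; rewrite mxE.
    by have := lE (fun i => if i == 0 then 0 else -1); rewrite lz meval0 /= mulr0 mulrN1 opprK add0r.
  by have := lE (fun i => if i == 0 then 1 else 0); rewrite lz meval0 /= mulr0 mulr1 subr0.
have [w [s [wU sP E]]] := ufd_mpoly l0.
case: s sP E => [|p s] sP E.
  have : l \is a GRing.unit by rewrite E big_nil mulr1.
  case/mpoly_unitE => c c0 lc.
  by have := lE (fun=> 0); rewrite lc mevalC !mulr0 subrr => z; rewrite z eqxx in c0.
have pP := sP p (mem_head _ _).
have dv i : rdvd p (bform A i).
  apply: contrapT => /(nullstellensatz_prime pP)[v [pv]]; rewrite bform_ev => /eqP; apply.
  have lv : wedge x (colv v) = 0.
    have := lE v; rewrite E big_cons mulrCA mevalM pv mul0r => /esym/eqP; rewrite subr_eq0 => /eqP vv.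
    by rewrite /wedge ![colv _ _ _]mxE [v 0 * _]mulrC vv subrr.
  by have [c ->] := wedge0 x0 lv; rewrite evZ ex scaler0 mxE.
have [a aE] := dv ord0; have [b bE] := dv ord_max; have [_ pU _] := pP.
by move/negP: pU; apply; apply: (cop p a b); rewrite mulrC.
Qed.

End RationalMaps.

Section MoreProjective.
Local Open Scope classical_set_scope.
Local Open Scope ring_scope.
Variables (k : closedFieldType) (n : nat).

Lemma card_lines (X : set (proj k n)) (s : seq {vspace 'rV[k]_n}) : uniq s ->
  (forall L, (L \in s) <-> exists2 p, X p & val p = L) -> (X #= `I_(size s))%card.
Proof.
elim: s X => [|L s IH] X /=.
  move=> _ H; rewrite II0 card_eq0; apply/eqP/seteqP; split=> // p Xp.
  by have : val p \in [::] by apply/H; exists p.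
move=> /andP[Ls us] H; have [p Xp pL] := (H L).1 (mem_head _ _).
apply/eq_cardSP; exists p => //; apply: IH => // M; split.
  move=> Ms; have [|q Xq qM] := (H M).1; first by rewrite in_cons Ms orbT.
  by exists q => //; split=> //= qp; rewrite -qM qp pL (negPf Ls) in Ms.
case=> q [Xq qp] qM; have : M \in L :: s by apply/H; exists q.
rewrite in_cons => /orP[/eqP ML|//]; case: qp; apply: val_inj.
by rewrite /= qM ML pL.
Qed.

Lemma pf_mpoly (f : 'rV[k]_n -> k) : pf f -> exists q : {mpoly k[n]}, forall y, f y = mev q y.
Proof.
move: f; apply: pf_ind.
- by move=> f g fg [q qE]; exists q => y; rewrite -fg.
- by move=> c; exists c%:MP => y; rewrite /mev mevalC.
- move=> i; case/mxvec_indexP: i => i j; exists 'X_j => y.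
  by rewrite /mev mevalXU /cof /= mxvecE [i]ord1.
- by move=> f g [q qE] [r rE]; exists (q + r) => y; rewrite qE rE /mev mevalD.
by move=> f g [q qE] [r rE]; exists (q * r) => y; rewrite qE rE /mev mevalM.
Qed.

Lemma pf_homog (f : 'rV[k]_n -> k) e : pf f -> (forall v s, f (s *: v) = s ^+ e * f v) ->
  exists2 q : {mpoly k[n]}, q \is e.-homog & forall y, f y = mev q y.
Proof.
move=> /pf_mpoly[q qE] H; exists q => //; apply: scaling_homog => v s.
have E (w : 'I_n -> k) : q.@[w] = f (\row_i w i).
  by rewrite qE /mev; apply: meval_eq => i; rewrite mxE.
rewrite !E -H; congr (f _); by apply/rowP => i; rewrite !mxE.
Qed.

(** The functions separating points from a conic closed set may be taken homogeneous, by
    [homogeneous_part] with a trivial parameter space. *)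
Lemma closed_cone (C : 'rV[k]_n -> Prop) : zcl C -> (forall v s, s != 0 -> C v -> C (s *: v)) ->
  zariski_closed [set p : proj k n | forall v, coords p v -> C v].
Proof.
move=> zC conic; exists [set f | (exists e, f \is e.-homog) /\ forall v, C v -> mev f v = 0].
split; first by move=> f [].
apply/seteqP; split=> p H.
  by move=> f v [_ fC] pv; apply: fC; exact: H.
move=> v pv; apply: contrapT => nC; have [f [pf_f fC fv]] := zC v nC.
have [|||e [g [pg gC gs gv]]] := @homogeneous_part k 'rV[k]_0 _ n (fun _ => C) _ (fun q => f q.2) 0 v _ _ fv.
- by move=> p' y s s0; exact: conic.
- by apply: (pf_comp pf_f); exact: pmap_snd0.
- by move=> p' y; exact: fC.
have pg' : pf (fun y : 'rV[k]_n => g ((0 : 'rV[k]_0), y)).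
  by apply: (pf_comp pg); apply: pmap_pair; [exact: pmap_const|exact: pmap_id].
have [q qe qE] := pf_homog pg' (gs 0).
move/eqP: gv; apply; rewrite qE; apply: H pv; split; first by exists e.
by move=> y Cy; rewrite -qE; exact: gC.
Qed.

End MoreProjective.

(** * Orbit closures: irreducibility, dimension, degree *)

Section Components.
Local Open Scope classical_set_scope.
Local Open Scope ring_scope.
Variables (k : closedFieldType) (d : nat).
Hypothesis char0 : [pchar k] =i pred0.
Hypothesis hd : (2 <= d)%N.
Implicit Types (A X : 'M[k]_(2, d.+1)) (h g : 'M[k]_2) (F : Ratbar k d).
Local Notation N := (2 * d.+1)%N.
Local Notation "u '_|_' X" := (u *m (xv X)^T = 0) (at level 60).
Local Notation D := (d ^ 3 - d)%N.

Lemma is_ratE F A : coords F (mxvec A) -> is_rat F <-> coprime_map A.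
Proof.
move=> FA; split=> [H|rA B FB]; first exact/coprime_rat/H.
have [c c0] := coords_scale FB FA; rewrite -linearZ => /(can_inj mxvecK) ->.
exact/rat_coprime/rat_scale.
Qed.

Lemma proj_mx m n (p : proj k (m * n)) : exists B : 'M[k]_(m, n), coords p (mxvec B).
Proof. by have [v pv] := coords_exists p; exists (vec_mx v); rewrite vec_mxK. Qed.

Lemma orbitE F A q : coords F (mxvec A) ->
  orbit F q <-> exists2 h, h \in unitmx & coords q (mxvec (Gam A h)).
Proof.
move=> FA; split.
  case=> g [a [B [aU ga FB qB]]]; exists (invmx a); first by rewrite unitmx_inv.
  have [c c0] := coords_scale FA FB; rewrite -linearZ => /(can_inj mxvecK) ->.
  move: qB; rewrite conj_mxE // GamZl => qB.
  have -> : mxvec (c *: Gam B (invmx a)) = (c / \det a) *: mxvec (\det a *: Gam B (invmx a)).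
    by rewrite -[RHS]linearZ /= scalerA divfK // -unit2.
  by apply: coordsZ => //; rewrite mulf_neq0 ?invr_eq0 // -unit2.
case=> h hU qh; have hV : invmx h \in unitmx by rewrite unitmx_inv.
have [g gh] := proj_of (mxvec_neq0 hV).
exists g, (invmx h), A; split=> //; rewrite conj_mxE // invmxK linearZ.
by apply: coordsZ => //; rewrite -unit2.
Qed.

Lemma stab_inv A g : A != 0 -> stab A g -> stab A (invmx g).
Proof.
move=> A0 [gU [c gE]]; split; first by rewrite unitmx_inv.
have c0 : c != 0 by apply: contraTneq (Gam_neq0 A0 gU) => c0; rewrite gE c0 scale0r eqxx.
exists c^-1; rewrite -[in RHS](Gam_inv A gU) gE GamZl scalerA mulVf //.
by rewrite scale1r.
Qed.

Lemma AutE F A (g : proj k (2 * 2)) : coords F (mxvec A) -> Aut F g <-> exists2 a, stab A a & coords g (mxvec a).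
Proof.
move=> FA; have A0 : A != 0 by rewrite -mxvec_eq0; exact: coords_neq0 FA.
split.
  case=> a [B [aU ga FB qB]]; exists a => //.
  rewrite -[a]invmxK; apply: stab_inv => //; split; first by rewrite unitmx_inv.
  have [c c0] := coords_scale FA FB; rewrite -linearZ => /(can_inj mxvecK) AE.
  have [e e0] := coords_scale FB qB; rewrite -linearZ => /(can_inj mxvecK); rewrite conj_mxE // => BE.
  have a0 : \det a != 0 by rewrite -unit2.
  exists (e * \det a)^-1; rewrite AE GamZl {2}BE !scalerA; congr (_ *: _).
  by field; rewrite e0 a0.
case=> a sa ga; have [aU _] := sa; have [_ [c cE]] := stab_inv A0 sa.
exists a, A; split=> //; rewrite conj_mxE // cE scalerA linearZ; apply: coordsZ => //.
have c0 : c != 0.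
  have aV : invmx a \in unitmx by rewrite unitmx_inv.
  by apply: contraTneq (Gam_neq0 A0 aV) => c0; rewrite cE c0 scale0r eqxx.
by rewrite mulf_neq0 // -unit2.
Qed.

Lemma card_AutE F A ls : coords F (mxvec A) -> aut_lines A ls -> card_Aut F = size ls.
Proof.
move=> FA [uls lsE]; apply: card_fset_set; apply: card_lines => // L; split.
  case/lsE => g sg ->; have [p pg] := proj_of (mxvec_neq0 sg.1).
  by exists p => //; apply/(AutE _ FA); exists g.
by case=> p /(AutE _ FA)[a sa pa] <-; apply/lsE; exists a.
Qed.

Lemma orbit_eq F F' : orbit F F' -> orbit F = orbit F'.
Proof.
have [A FA] := proj_mx F; case/(orbitE _ FA) => h hU FA'; apply/seteqP; split=> q.
  case/(orbitE _ FA) => g gU qg; apply/(orbitE _ FA'); exists (invmx h *m g).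
    by rewrite unitmx_mul unitmx_inv hU.
  by rewrite -GamM mulKVmx.
case/(orbitE _ FA') => g gU; rewrite -GamM => qg; apply/(orbitE _ FA); exists (h *m g) => //.
by rewrite unitmx_mul hU.
Qed.

Lemma orbit_refl F : orbit F F.
Proof. by have [A FA] := proj_mx F; apply/(orbitE _ FA); exists 1%:M; rewrite ?unitmx1 // Gam1. Qed.

(** Forms vanishing on Z1 and on Z2 pull back along h |-> [Gam A h] to polynomials whose product
    with det h is zero, so one of them is zero. *)
Lemma irreducible_orbit_closure F : irreducible_closed (orbit_closure F).
Proof.
split; first exact: closed_zariski_closure.
  by exists F; apply: sub_zariski_closure; exact: orbit_refl.
move=> Z1 Z2 c1 c2 H; have [A FA] := proj_mx F.
have A0 : A != 0 by rewrite -mxvec_eq0; exact: coords_neq0 FA.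
have sub Z : zariski_closed Z -> ~ (orbit_closure F `<=` Z) -> exists (f : {mpoly k[N]}) h,
    [/\ h \in unitmx, mev f (mxvec (Gam A h)) != 0 & forall p v, Z p -> coords p v -> mev f v = 0].
  move=> cZ nZ; apply: contrapT => nf; apply: nZ; apply: zariski_closure_sub => // p.
  case/(orbitE _ FA) => h hU ph; move: cZ nf => [S [Sh ->]] nf f v Sf pv.
  apply: contrapT => /eqP fv; apply: nf; exists f, h; split=> //.
    have [c c0 vE] := coords_scale ph pv; have [e fe] := Sh f Sf.
    by rewrite vE (mev_homog _ _ fe) mulf_neq0 // expf_neq0.
  by move=> q w Zq qw; apply: Zq qw.
apply: contrapT => /not_orP[/(sub _ c1)[f1 [h1 [h1U f1h f1Z]]] /(sub _ c2)[f2 [h2 [h2U f2h f2Z]]]].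
have pm (f : {mpoly k[N]}) : pf (fun h => mev f (mxvec (Gam A h))).
  by apply: (pf_comp (pf_mev f)); apply: pmap_mxvec; apply: pmap_Gam; pfs.
have pd : pf (fun h : 'M[k]_2 => \det h) by apply: pf_det; pfs.
have [h|z|z] := pf_mul_eq0 (pf_mul (pm f1) pd) (pm f2).
- have [->|dh] := eqVneq (\det h) 0; first by rewrite mulr0 mul0r.
  have hU : h \in unitmx by rewrite unit2.
  have [q qh] : exists q, coords q (mxvec (Gam A h)) by apply: proj_of; rewrite mxvec_eq0; exact: Gam_neq0.
  have /H[Zq|Zq] : orbit_closure F q.
  + by apply: sub_zariski_closure; apply/(orbitE _ FA); exists h.
  + by rewrite (f1Z q) // !mul0r.
  by rewrite (f2Z q) // mulr0.
- by have /eqP := z h1; rewrite mulf_eq0 (negPf f1h) /= -[_ == 0]negbK -unit2 h1U.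
by have /eqP := z h2; rewrite (negPf f2h).
Qed.

(** The X for which some nonzero h satisfies [Xt] form a closed cone by elimination, and it contains
    the orbit. *)
Lemma orbit_closure_Xt F A q X : coords F (mxvec A) -> orbit_closure F q -> coords q (mxvec X) ->
  exists2 h, h != 0 & Xt A h X.
Proof.
move=> FA; pose C (v : 'rV[k]_N) := exists y : 'rV[k]_(2 * 2), y != 0 /\ Xt A (vec_mx y) (vec_mx v).
have zC : zcl C.
  apply: (@elimination k 'rV[k]_N _ (2 * 2) (fun v y => Xt A (vec_mx y) (vec_mx v))).
    by apply: zcl_Xt; pfs.
  move=> v y s s0; rewrite linearZ /= -{2}[vec_mx v]scale1r.
  exact: XtZ (ltnW hd).
have cC := closed_cone zC _; move=> Zq qX.
have : [set p : proj k N | forall v, coords p v -> C v] q.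
  apply: (zariski_closure_sub (A := orbit F)) Zq.
    apply: cC => v s s0 [y [y0 H]]; exists y; split=> //; rewrite linearZ /= -[vec_mx y]scale1r.
    exact: XtZ (ltnW hd) H.
  move=> p /(orbitE _ FA)[h hU ph] v pv; exists (mxvec h); split; first exact: mxvec_neq0.
  have [c c0 ->] := coords_scale pv ph; rewrite mxvecK linearZ /= mxvecK -[h]scale1r.
  by apply: XtZ (ltnW hd) _; rewrite scale1r; exact: Xt_Gam.
move=> /(_ _ qX)[y [y0]]; rewrite mxvecK => H; exists (vec_mx y) => //.
by rewrite vec_mx_eq0.
Qed.

Lemma orbit_closure_inj F F' : is_rat F -> is_rat F' -> orbit_closure F = orbit_closure F' -> orbit F = orbit F'.
Proof.
have [A FA] := proj_mx F; have [A' FA'] := proj_mx F'.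
move=> /(is_ratE FA) rA /(is_ratE FA') rA' E; apply: orbit_eq.
have A'0 := rat_neq0 rA'.
have ZF' : orbit_closure F F' by rewrite E; apply: sub_zariski_closure; exact: orbit_refl.
have [h h0 XX] := orbit_closure_Xt FA ZF' FA'.
have hU : h \in unitmx.
  by rewrite unit2; apply/eqP => dh; exact: (boundary_not_rat hd rA h0 A'0 dh XX).
have [c cE] := Xt_prop (Gam_neq0 (rat_neq0 rA) hU) XX.
have c0 : c != 0 by apply: contra_neq A'0 => c0; rewrite cE c0 scale0r.
apply/(orbitE _ FA); exists h => //.
have -> : mxvec (Gam A h) = c^-1 *: mxvec A' by rewrite -linearZ /= cE scalerA mulVf // scale1r.
by apply: coordsZ; rewrite ?invr_eq0.
Qed.

Section OneMap.
Variables (F : Ratbar k d) (A : 'M[k]_(2, d.+1)) (Q : {mpoly k[4 * N]}).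
Hypothesis FA : coords F (mxvec A).
Hypothesis rA : coprime_map A.
Local Notation cf := (@cof k 'M[k]_(4, N) (aff_mx k 4 N)).
Hypothesis Qhit : forall (U : 'M[k]_(4, N)) h, h \in unitmx -> U _|_ Gam A h -> Q.@[cf U] = 0.
Hypothesis Qcl : forall U : 'M[k]_(4, N), Q.@[cf U] = 0 -> exists h X, [/\ h != 0, X != 0, Xt A h X & U _|_ X].
Hypothesis Qgood : forall u, good A u -> exists rs : seq 'M[k]_2, [/\ uniq rs, size rs = D,
  forall h, (h \in rs) <-> (solution A u h /\ h 0 0 = 1) &
  exists2 c, c != 0 & forall v : 'rV[k]_N, Q.@[cf (col_mx u v : 'M_(3 + 1, N))] =
    c * \prod_(h <- rs) (v *m (xv (Gam A h))^T) 0 0].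

Lemma cf_mev (q : {mpoly k[4 * N]}) (U : 'M[k]_(4, N)) : q.@[cf U] = mev q (mxvec U).
Proof. by []. Qed.

Lemma aut_exists : exists2 ls, aut_lines A ls & (0 < size ls)%N.
Proof. by apply: (aut_lines_exist char0 hd rA) => u gu; have [rs [U S P _]] := Qgood gu; exists rs. Qed.

Lemma Q_homog : Q \is (4 * D).-homog.
Proof.
have [ls lsP a0] := aut_exists.
have [rho [m [c0 [rP rO c0n QE rD]]]] := form_power char0 hd rA Qhit Qcl.
apply: scaling_homog => v s.
pose U : 'M[k]_(4, N) := vec_mx (\row_i v i).
have vE i : v i = cf U i by rewrite /cof /= vec_mxK mxE.
have : Q.@[cf (s *: U)] = s ^+ (4 * D) * Q.@[cf U] by eapply form_scale; eassumption.
have -> : Q.@[cf U] = Q.@[v] by apply: meval_eq => i; rewrite -vE.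
move=> <-; apply: meval_eq => i; rewrite vE /cof /= linearZ /= [RHS]mxE.
by [].
Qed.

(** Every U orthogonal to a point x is [skew x O] for some O, and y |-> Q (skew y O) is a form
    vanishing on the orbit, hence on its closure. *)
Lemma section_form (U : 'M[k]_(4, N)) : linear_section (orbit_closure F) U !=set0 -> Q.@[cf U] = 0.
Proof.
case=> q [Zq qU]; have [x qx] := coords_exists q.
have [O UE] := skew_onto (coords_neq0 qx) (qU x qx).
have pg : pf (fun y : 'rV[k]_N => Q.@[cf (skew y O)]).
  apply: (@pf_meval_comp k 'M[k]_(4, N) 'rV[k]_N (aff_mx k 4 N) _ Q (fun y => skew y O)).
  by apply: pmap_skew; [exact: pmap_id|exact: pmap_const].
have [y s|f fh fE] := pf_homog (e := 4 * D) pg.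
  have -> : skew (s *: y) O = s *: skew y O.
    by apply/matrixP => i j; rewrite mxE -scalemxAl mxE [RHS]mxE [X in _ = _ * X]mxE.
  rewrite !cf_mev linearZ /=; exact: mev_homog Q_homog.
rewrite UE fE; move: Zq; rewrite /orbit_closure zariski_closureE; apply=> //; first by exists (4 * D)%N.
move=> p w /(orbitE _ FA)[h hU ph] pw; have [c c0 ->] := coords_scale pw ph.
rewrite (mev_homog _ _ fh) -fE (Qhit hU) ?mulr0 //; exact: skew_orth.
Qed.

(** The U that meet the closure form a closed set by elimination; any equation of it vanishes on the
    incidence variety and so is divisible by rho. *)
Lemma form_section_nonempty (U : 'M[k]_(4, N)) : Q.@[cf U] = 0 -> linear_section (orbit_closure F) U !=set0.
Proof.
move=> QU; have [rho [m [c0 [rP rO c0n QE rD]]]] := form_power char0 hd rA Qhit Qcl.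
have rU : rho.@[cf U] = 0.
  move: QU; rewrite QE mevalZ rmorphXn /= => /eqP; rewrite mulf_eq0 (negPf c0n) expf_eq0 => /andP[_ /eqP //].
have [S [Sh SE]] := closed_zariski_closure (orbit F).
pose C (V : 'M[k]_(4, N)) (x : 'rV[k]_N) := (forall f : {f : {mpoly k[N]} | S f}, mev (sval f) x = 0) /\ V *m x^T = 0.
have zC : zcl (fun V => exists x, x != 0 /\ C V x).
  apply: elimination => [|V x s s0 [H1 H2]].
    apply: zcl_and.
      apply: zcl_forall => f; apply: zcl_eq; last exact: pf_const.
      by apply: (pf_comp (pf_mev (sval f))); exact: pmap_snd0.
    apply: zcl_eq0mx; apply: pmap_mul; first exact: pmap_fst0.
    by apply: pmap_tr; exact: pmap_snd0.
  split=> [f|]; last by rewrite linearZ /= -scalemxAr H2 scaler0.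
  by have [e fe] := Sh _ (svalP f); rewrite (mev_homog _ _ fe) H1 mulr0.
have [x [x0 [fx Ux]]] : exists x, x != 0 /\ C U x.
  apply: contrapT => nU; have [f [[q qE] fC fU]] := zC U nU.
  have qO : on_orbit A q.
    move=> V h hU Vh; rewrite -qE; apply: fC; exists (xv (Gam A h)); split; first exact: xvGam_neq0.
    split=> // -[f' Sf'] /=; have [p ph] := proj_of (xvGam_neq0 rA hU).
    have : zariski_closure (orbit F) p by apply: sub_zariski_closure; apply/(orbitE _ FA); exists h.
    by rewrite SE; apply.
  have [s sE] := rD q qO; move/eqP: fU; apply; rewrite qE [q]sE mevalM.
  by rewrite [X in _ * X]rU mulr0.
have [p px] := proj_of x0; exists p; split.
  rewrite /orbit_closure SE => f v Sf pv; have [c cn ->] := coords_scale pv px.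
  by have [e fe] := Sh f Sf; rewrite (mev_homog _ _ fe) (fx (exist _ f Sf)) mulr0.
by move=> v pv; have [c cn ->] := coords_scale pv px; rewrite linearZ /= -scalemxAr Ux scaler0.
Qed.

(** Three hyperplanes always meet the closure because Q vanishes when the fourth row is 0; four do
    not whenever Q is nonzero. *)
Lemma closure_has_dim : has_dim (orbit_closure F) 3.
Proof.
have [ls lsP a0] := aut_exists.
have [rho [m [c0 [rP rO c0n QE rD]]]] := form_power char0 hd rA Qhit Qcl.
split=> [u|].
  have [p [Zp pu]] := form_section_nonempty (form_last_zero char0 hd rA Qgood lsP u).
  exists p; split=> // v pv; have := (orth_rows (col_mx u 0) (vec_mx v)).1.
  by rewrite /xv vec_mxK col_mxKu => /(_ (pu v pv))[].
have [U UN] := @ev_nz k 'M[k]_(4, N) (aff_mx k 4 N) Q (Q_neq0 hd rA Qcl).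
exists U; apply/seteqP; split=> // p pU; move/eqP: UN; apply; apply: section_form.
by exists p.
Qed.

(** The conjugates over u lie on the section. For any further point x of it there is a hyperplane
    through x avoiding all of them; there Q is nonzero by the factorization and zero by
    [section_form]. *)
Lemma closure_section u (ls : seq {vspace 'rV[k]_(2 * 2)}) : aut_lines A ls -> good A u ->
  exists e, (e * size ls)%N = D /\ (linear_section (orbit_closure F) u #= `I_e)%card.
Proof.
move=> lsP gu; have [ys [Uy Sy Py [c cn cE]]] := form_section Qgood lsP gu.
exists (size ys); split=> //; apply: card_lines => // L; split.
  case/Py => h [hU hu] ->; have [p ph] := proj_of (xvGam_neq0 rA hU).
  exists p => //; split; first by apply: sub_zariski_closure; apply/(orbitE _ FA); exists h.
  by move=> v pv; have [e e0 ->] := coords_scale pv ph; rewrite linearZ /= -scalemxAr hu scaler0.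
case=> p [Zp pu] <-; have [x px] := coords_exists p.
have x0 := coords_neq0 px; apply: contrapT => nL.
have nz y : y \in ys -> vpick y != 0.
  by case/Py => h' hS' ->; rewrite vpick0 -dimv_eq0 dim_vline (xvGam_neq0 rA hS'.1).
have gen y : y \in ys -> y = <[vpick y]>%VS.
  case/Py => h' hS' ->; have [e e0] := line_vpick (xvGam_neq0 rA hS'.1).
  by rewrite -/(gline A h') => E; rewrite {1}/gline E line_scale.
have [|v vx vN] := @avoid_lines k N x [seq vpick y | y <- ys] x0.
  move=> z /mapP[y ys' ->] e; apply/eqP => E; apply: nL; rewrite px.
  have e0 : e != 0 by apply: contra_neq (nz _ ys') => e0; rewrite E e0 scale0r.
  by rewrite -(line_scale x e0) -E -gen.
have : Q.@[cf (col_mx u v : 'M_(3 + 1, N))] = 0.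
  apply: section_form; exists p; split=> // w pw; have [e e0 ->] := coords_scale pw px.
  rewrite linearZ /= -scalemxAr; apply/eqP; rewrite scaler_eq0 (negPf e0) /=; apply/eqP.
  have := (orth_rows (col_mx u v) (vec_mx x)).2; rewrite /xv vec_mxK col_mxKu col_mxKd; apply.
  by split; [exact: pu|exact: vx].
apply/eqP; rewrite cE mulf_neq0 // prodf_seq_neq0; apply/allP => y ys'.
by rewrite /= expf_neq0 // vN // map_f.
Qed.

Theorem closure_has_degree ls : aut_lines A ls -> (0 < size ls)%N ->
  exists e, (e * size ls)%N = D /\ has_degree (orbit_closure F) e.
Proof.
move=> lsP a0; have [c [[[w wE] [u cu]] cz]] := generic_good char0 hd rA.
have gu v : c v != 0 -> good A v by move=> cv; apply: contrapT => /cz z; rewrite z eqxx in cv.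
have [e [eD _]] := closure_section lsP (gu u cu).
exists e; split=> //; exists 3; split; first exact: closure_has_dim.
exists w; split=> [|v]; first by apply: contraNneq cu => w0; rewrite wE w0 meval0.
rewrite -[mev w _]/(w.@[cof v]) -wE => /gu gv; have [e' [e'D E]] := closure_section lsP gv.
have -> // : e = e' by apply/eqP; rewrite -(eqn_pmul2r a0) eD e'D.
Qed.

End OneMap.
End Components.

(** * The orbit cycle map *)

Section ChowForms.
Local Open Scope classical_set_scope.
Local Open Scope ring_scope.
Variables (k : closedFieldType) (d : nat).
Hypothesis char0 : [pchar k] =i pred0.
Hypothesis hd : (2 <= d)%N.
Implicit Types (A X : 'M[k]_(2, d.+1)) (h g : 'M[k]_2) (F : Ratbar k d).
Local Notation N := (2 * d.+1)%N.
Local Notation "u '_|_' X" := (u *m (xv X)^T = 0) (at level 60).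
Local Notation D := (d ^ 3 - d)%N.
Local Notation cf := (@cof k 'M[k]_(4, N) (aff_mx k 4 N)).
Local Notation CN := (coef_dim (4 * N) (4 * D)).

Lemma pf_family T {hT : aff k T} T' {hT' : aff k T'} (f : T * T' -> k) : pf f ->
  exists q : T -> {mpoly k[@adim k T' hT']}, (forall t t', f (t, t') = (q t).@[cof t']) /\
    forall m, pf (fun t => (q t)@_m).
Proof.
move: f; apply: pf_ind.
- by move=> f g fg [q [qE pq]]; exists q; split=> // t t'; rewrite -fg.
- move=> c; exists (fun=> c%:MP); split=> [t t'|m]; [by rewrite mevalC|exact: pf_const].
- move=> i; have [[j jE]|[j jE]] := cof_pair i.
    exists (fun t => (cof t j)%:MP); split=> [t t'|m]; first by rewrite mevalC.
    apply: (pf_ext (f := fun t => cof t j * (m == 0%MM)%:R)); first by move=> t; rewrite mcoeffC.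
    by apply: pf_mul; [exact: pf_cof|exact: pf_const].
  by exists (fun=> 'X_j); split=> [t t'|m]; [rewrite mevalXU|exact: pf_const].
- move=> f g [q [qE pq]] [r [rE pr]]; exists (fun t => q t + r t); split=> [t t'|m].
    by rewrite mevalD qE rE.
  by apply: (pf_ext (f := fun t => (q t)@_m + (r t)@_m)) => [t|]; [rewrite mcoeffD|exact: pf_add].
move=> f g [q [qE pq]] [r [rE pr]]; exists (fun t => q t * r t); split=> [t t'|m].
  by rewrite mevalM qE rE.
pose n := @adim k T' hT'.
apply: (pf_ext (f := fun t => \sum_(x : 'X_{1.. n < (mdeg m).+1, (mdeg m).+1} | m == (x.1 + x.2)%MM)
    (q t)@_x.1 * (r t)@_x.2)) => [t|]; first by rewrite mcoeffM.
by apply: pf_sum => x; exact: pf_mul.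
Qed.

Lemma coef_vecZ n e c (R : {mpoly k[n]}) : coef_vec e (c *: R) = c *: coef_vec e R.
Proof. by apply/rowP => i; rewrite !mxE mcoeffZ. Qed.

Lemma coef_vec_neq0 n e (R : {mpoly k[n]}) : R \is e.-homog -> R != 0 -> coef_vec e R != 0.
Proof.
move=> /dhomogP H R0; apply: contra_neq R0 => z; apply/mpolyP => m; rewrite mcoeff0.
apply/eqP; apply: contraT; rewrite -mcoeff_msupp => mR; have me : (mdeg m < e.+1)%N by rewrite (H m mR).
have := congr1 (fun v : 'rV[k]__ => v 0 (enum_rank (BMultinom me))) z.
by rewrite !mxE enum_rankK /= => Rm; rewrite mcoeff_msupp Rm eqxx in mR.
Qed.

Definition section_product A (Q : {mpoly k[4 * N]}) : Prop :=
  [/\ (forall (U : 'M[k]_(4, N)) h, h \in unitmx -> U _|_ Gam A h -> Q.@[cf U] = 0),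
   (forall U : 'M[k]_(4, N), Q.@[cf U] = 0 -> exists h X, [/\ h != 0, X != 0, Xt A h X & U _|_ X]) &
   forall u, good A u -> exists rs : seq 'M[k]_2, [/\ uniq rs, size rs = D,
     forall h, (h \in rs) <-> (solution A u h /\ h 0 0 = 1) &
     exists2 c, c != 0 & forall v : 'rV[k]_N, Q.@[cf (col_mx u v : 'M_(3 + 1, N))] =
       c * \prod_(h <- rs) (v *m (xv (Gam A h))^T) 0 0]].

Lemma components_orbit_cycle F : card_Aut F != 0%N -> components (orbit_cycle F) = [set orbit_closure F].
Proof.
move=> c0; apply/seteqP; split=> Z; rewrite /components /orbit_cycle /=.
  by case: asboolP.
by move=> ->; case: asboolP.
Qed.

Lemma orbit_cycleE F : orbit_cycle F (orbit_closure F) = card_Aut F.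
Proof. by rewrite /orbit_cycle; case: asboolP. Qed.

(** The irreducible rho is the Chow form of the orbit closure, and Q is up to a constant its power
    with exponent [card_Aut F], the Chow form of the cycle. The total degree 4 D is D for each of
    the four hyperplanes. *)
Lemma orbit_chow F A Q : coords F (mxvec A) -> coprime_map A -> section_product A Q ->
  [/\ effective 3 (orbit_cycle F), coef_vec (4 * D) Q != 0,
      (forall p : proj k CN, coords p (coef_vec (4 * D) Q) -> @chow_point k N 3 (4 * D) (orbit_cycle F) p),
      (0 < card_Aut F)%N &
      exists e, [/\ (e * card_Aut F)%N = D, degree (orbit_closure F) = e & cycle_degree (orbit_cycle F) = D]].
Proof.
move=> FA rA [Qhit Qcl Qgood]; have [ls lsP a0] := aut_exists char0 hd rA Qgood.
have caE := card_AutE FA lsP; have c0 : card_Aut F != 0%N by rewrite caE -lt0n.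
have [rho [m [c [rP rO cn QE rD]]]] := form_power char0 hd rA Qhit Qcl.
have mE : m = size ls by eapply form_exponent; eassumption.
have compE := components_orbit_cycle c0; have Qh := Q_homog char0 hd rA Qhit Qcl Qgood.
have dim3 := closure_has_dim char0 hd FA rA Qhit Qcl Qgood.
have eff : effective 3 (orbit_cycle F).
  split; rewrite compE; first exact: finite_set1.
    by exists (orbit_closure F).
  by move=> Z ->; split; [exact: irreducible_orbit_closure|exact: dim3].
have Q0 : Q != 0 := Q_neq0 hd rA Qcl.
split=> //.
- exact: coef_vec_neq0.
- move=> p pQ; split=> //; exists (rho ^+ m); split.
  + exists (fun=> rho); split=> [Z|]; last by rewrite compE fsbig_set1 orbit_cycleE caE mE.
    rewrite compE => ->; split; first exact: rprime_irr rP.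
    move=> U; rewrite -cf_mev; split=> [rU|H].
      apply: (form_section_nonempty char0 hd FA rA Qhit Qcl).
      by rewrite QE mevalZ rmorphXn /= [rho.@[_]]rU expr0n mE caE in c0 *; rewrite (negPf c0) mulr0.
    have := section_form char0 hd FA rA Qhit Qcl Qgood H.
    rewrite QE mevalZ rmorphXn /= => /eqP; rewrite mulf_eq0 (negPf cn) expf_eq0 => /andP[_ /eqP //].
  + have -> : rho ^+ m = c^-1 *: Q by rewrite QE scalerA mulVf // scale1r.
    exact: rpredZ.
  have -> : rho ^+ m = c^-1 *: Q by rewrite QE scalerA mulVf // scale1r.
  by rewrite coef_vecZ; apply: coordsZ; rewrite ?invr_eq0.
- by rewrite caE.
have [e [eD he]] := closure_has_degree char0 hd FA rA Qhit Qcl Qgood lsP a0.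
exists e; rewrite caE; split=> //; first exact: degreeE.
by rewrite /cycle_degree compE fsbig_set1 orbit_cycleE caE (degreeE he) mulnC.
Qed.

Lemma section_family : exists (q : 'M[k]_(2, d.+1) -> {mpoly k[4 * N]}) (m : nat),
  [/\ forall A, coprime_map A -> section_product A (q A), forall A s, q (s *: A) = s ^+ m *: q A &
      forall i, pf (fun A => coef_vec (4 * D) (q A) 0 i)].
Proof.
have [G [pG [m Gm] Ghit Gcl Ggood]] := universal_form char0 hd.
have [q [qE pq]] := pf_family pG; exists q, m; split.
- move=> A rA; split=> [U h hU uh|U|u gu].
  + by rewrite -[LHS]qE; apply: Ghit uh; [exact: rat_neq0|].
  + by rewrite -[X in X = 0 -> _]qE; exact: Gcl.
  have [rs [Us Ss Ps [c c0 cE]]] := Ggood A u gu; exists rs; split=> //; exists c => // v.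
  by rewrite -[LHS]qE; exact: cE.
- move=> A s; apply: (@ev_inj k 'M[k]_(4, N) (aff_mx k 4 N)) => U.
  by rewrite mevalZ -!qE.
by move=> i; apply: pf_ext (pq _) => A; rewrite mxE.
Qed.

Section Pullback.
Variables (q : 'M[k]_(2, d.+1) -> {mpoly k[4 * N]}) (m : nat).
Hypothesis qP : forall A, coprime_map A -> section_product A (q A).
Hypothesis qm : forall A s, q (s *: A) = s ^+ m *: q A.
Hypothesis pq : forall i, pf (fun A => coef_vec (4 * D) (q A) 0 i).
Local Notation V A := (coef_vec (4 * D) (q A) : 'rV[k]_CN).

(** The coefficients of q A are polynomials in A that scale with weight m. Substituting them carries
    closed sets and regular functions from the Chow side to the space of maps. *)
Lemma pullback (f : {mpoly k[CN]}) e : f \is e.-homog ->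
  exists2 f' : {mpoly k[N]}, f' \is (m * e).-homog & forall A, mev f' (mxvec A) = mev f (V A).
Proof.
move=> fe; have pg : pf (fun x : 'rV[k]_N => mev f (V (vec_mx x))).
  apply: (pf_comp (g := fun A => mev f (V A)) (f := fun x : 'rV[k]_N => vec_mx x)); last by pfs.
  by apply: (pf_comp (pf_mev f) (f := fun A => V A)); apply: pmap_mx => i j; rewrite [i]ord1; exact: pq.
have [x s|f' fe' fE] := pf_homog (e := m * e) pg.
  by rewrite linearZ /= qm coef_vecZ (mev_homog _ _ fe) exprM.
by exists f' => // A; rewrite -fE mxvecK.
Qed.

Lemma coordsV F A A' (p : proj k CN) : coords F (mxvec A) -> coords F (mxvec A') ->
  coords p (V A) -> coords p (V A').
Proof.
move=> FA FA' pA; have [c c0] := coords_scale FA' FA; rewrite -linearZ => /(can_inj mxvecK) ->.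
by rewrite qm coef_vecZ; apply: coordsZ; rewrite ?expf_neq0.
Qed.

Lemma pullback_closed (Z : set (proj k CN)) : zariski_closed Z ->
  exists S : set {mpoly k[N]}, (forall f, S f -> exists e, f \is e.-homog) /\
    forall F A p, coords F (mxvec A) -> coords p (V A) ->
      (Z p <-> forall f, S f -> forall v, coords F v -> mev f v = 0).
Proof.
move=> [S [Sh ->]]; exists [set f' | exists e, f' \is e.-homog /\ exists2 f, S f & forall A, mev f' (mxvec A) = mev f (V A)].
split=> [f [e [fe _]]|F A p FA pA]; first by exists e.
split=> [H f' [e [fe [f Sf E]]] v Fv|H f v Sf pv].
  have Fv' : coords F (mxvec (vec_mx v : 'M_(2, d.+1))) by rewrite vec_mxK.
  by rewrite -[v]vec_mxK E; apply: H Sf _; exact: coordsV FA Fv' pA.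
have [e fe] := Sh f Sf; have [f' fe' fE] := pullback fe.
have [c c0 ->] := coords_scale pv pA; rewrite (mev_homog _ _ fe) -fE H ?mulr0 //.
by exists (m * e)%N; split=> //; exists f.
Qed.

Lemma is_rat_data (F : Ratd k d) : exists A (p : proj k CN),
  [/\ coords (sval F) (mxvec A), coprime_map A, coords p (V A) & @chow_point k N 3 (4 * D) (orbit_cycle (sval F)) p].
Proof.
have [A FA] := proj_mx (sval F); have rA := (is_ratE FA).1 (svalP F).
have [_ V0 H _ _] := orbit_chow FA rA (qP rA).
by have [p pA] := proj_of V0; exists A, p; split=> //; exact: H.
Qed.

Lemma orbit_cycle_effective (F : Ratd k d) : exists r, effective r (orbit_cycle (sval F)).
Proof.
have [A FA] := proj_mx (sval F); have rA := (is_ratE FA).1 (svalP F).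
by exists 3; have [] := orbit_chow FA rA (qP rA).
Qed.

Definition chow_of (F : Ratd k d) : Chow k N := exist _ (orbit_cycle (sval F)) (orbit_cycle_effective F).

Definition trivial_image : set (Chow k N) :=
  [set c | exists2 p, @trivial_Aut k d p & sval c = orbit_cycle p].

Lemma trivial_stab_Aut F A : coords F (mxvec A) -> coprime_map A -> trivial_stab A -> @trivial_Aut k d F.
Proof.
move=> FA rA tA; split; first exact/(is_ratE FA).
apply/seteqP; split=> g.
  case/(AutE _ FA) => a sa ga; have [s sE] := tA a sa; rewrite /= in ga *.
  have s0 : s != 0 by apply: contraTneq sa.1 => s0; rewrite sE s0 unit2 det_scalar expr0n eqxx.
  have -> : mxvec 1%:M = s^-1 *: mxvec a by rewrite sE -linearZ /= scale_scalar_mx mulVf.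
  by apply: coordsZ; rewrite ?invr_eq0.
move=> ga; apply/(AutE _ FA); exists 1%:M => //; split; first exact: unitmx1.
by exists 1; rewrite Gam1 scale1r.
Qed.

(** A form vanishing at the Chow points of the maps with trivial stabilizer pulls back to a
    polynomial in A that vanishes on a dense set, by [trivial_dense]. *)
Lemma chow_of_closure (F : Ratd k d) : space_closure trivial_image (chow_of F).
Proof.
move=> C [oC sub]; have [Z [cZ ZE]] := oC (3, 4 * D)%N.
have [S [Sh SE]] := pullback_closed cZ.
have [A [p [FA rA pA cp]]] := is_rat_data F.
have := (ZE (chow_of F) p cp); rewrite (SE _ _ _ FA pA) => ZC.
apply: contrapT => nC; have {ZC nC} := ZC.1 nC; apply=> f Sf v Fv.
have pf_f : pf (fun B : 'M[k]_(2, d.+1) => mev f (mxvec B)).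
  by apply: (pf_comp (pf_mev f)); apply: pmap_mxvec; exact: pmap_id.
rewrite -[v]vec_mxK; apply: (trivial_dense char0 hd pf_f) => B rB tB.
have B0 : mxvec B != 0 by rewrite mxvec_eq0; exact: rat_neq0.
have [F1 F1B] := proj_of B0; have rF1 := (is_ratE F1B).2 rB.
pose F1' : Ratd k d := exist _ F1 rF1.
have [A1 [p1 [FA1 rA1 pA1 cp1]]] := is_rat_data F1'.
have CF1 : C (chow_of F1') by apply: sub; exists F1 => //; exact: trivial_stab_Aut F1B rB tB.
have Zp1 : Z p1 by apply: contrapT => nZ; exact: ((ZE (chow_of F1') p1 cp1).2 nZ CF1).
by apply: ((SE _ _ _ FA1 pA1).1 Zp1) Sf _ F1B.
Qed.

(** The multiplicity is determined by the closure, being D divided by its degree, which is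
    positive. *)
Lemma orbit_cycle_eq (F F' : Ratd k d) : orbit (sval F) = orbit (sval F') ->
  orbit_cycle (sval F) = orbit_cycle (sval F').
Proof.
move=> E; have EZ : orbit_closure (sval F) = orbit_closure (sval F') by rewrite /orbit_closure E.
have [A FA] := proj_mx (sval F); have rA := (is_ratE FA).1 (svalP F).
have [A' FA'] := proj_mx (sval F'); have rA' := (is_ratE FA').1 (svalP F').
have [_ _ _ c0 [e [eD eE _]]] := orbit_chow FA rA (qP rA).
have [_ _ _ c0' [e' [eD' eE' _]]] := orbit_chow FA' rA' (qP rA').
have ee : e = e' by rewrite -eE -eE' EZ.
have e0 : (0 < e)%N.
  by rewrite lt0n; apply: contraTneq (D_gt0 hd) => e0; rewrite -eD e0.
have cE : card_Aut (sval F) = card_Aut (sval F') by apply/eqP; rewrite -(eqn_pmul2l e0) eD ee eD'.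
by rewrite /orbit_cycle EZ cE.
Qed.

Lemma orbit_cycle_inj (F F' : Ratd k d) : orbit_cycle (sval F) = orbit_cycle (sval F') ->
  orbit (sval F) = orbit (sval F').
Proof.
move=> E; apply: (orbit_closure_inj hd) (svalP F) (svalP F') _.
have [A FA] := proj_mx (sval F); have rA := (is_ratE FA).1 (svalP F).
have [_ _ _ c0 _] := orbit_chow FA rA (qP rA).
have := orbit_cycleE (sval F); rewrite E /orbit_cycle.
by case: asboolP => // _ z; rewrite -z in c0.
Qed.

(** A class is represented by a chosen map; by [orbit_cycle_eq] its cycle does not depend on the
    choice. *)
Definition repr_map (C : ratd k d) : Ratd k d := projT1 (cid (svalP C)).

Lemma repr_mapE C : sval C = @same_orbit k d (repr_map C).
Proof. exact: (projT2 (cid (svalP C))). Qed.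

Lemma repr_map_orbit (C : ratd k d) (F : Ratd k d) : sval C F -> orbit (sval (repr_map C)) = orbit (sval F).
Proof. by rewrite repr_mapE; exact: orbit_eq. Qed.

Definition orbit_map (C : ratd k d) : Yd k d := exist _ (chow_of (repr_map C)) (chow_of_closure (repr_map C)).

Lemma orbit_mapE (F : Ratd k d) : cycle_of (orbit_map (rat_class F)) = orbit_cycle (sval F).
Proof. by apply: orbit_cycle_eq; apply: repr_map_orbit; exact: orbit_refl. Qed.

Lemma orbit_map_inj : injective orbit_map.
Proof.
move=> C C' E; have EO : sval C = sval C'.
  rewrite !repr_mapE; apply/funext => F; rewrite /same_orbit.
  rewrite (@orbit_cycle_inj (repr_map C) (repr_map C')) //.
  by have := congr1 (fun y : Yd k d => cycle_of y) E.
by case: C C' EO {E} => [c cP] [c' cP'] /= EO; subst c'; congr exist; exact: Prop_irrelevance.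
Qed.

(** All orbit cycles lie in the piece of the Chow variety with dimension 3 and total degree 4 D of
    the Chow form, and there local quotients of forms of degree e pull back to quotients of forms of
    degree m e. *)
Lemma orbit_map_morphism : morphism orbit_map.
Proof.
move=> O oO; split.
  move=> i; have [Z [cZ ZE]] := oO (3, 4 * D)%N; have [S [Sh SE]] := pullback_closed cZ.
  exists [set p | forall f v, S f -> coords p v -> mev f v = 0]; split; first by exists S.
  move=> F _ <-; have [A [p [FA rA pA cp]]] := is_rat_data F.
  have := ZE (orbit_map (rat_class F)) p; rewrite -[sval (sval _)]/(cycle_of _) orbit_mapE => /(_ cp).
  rewrite (SE _ _ _ FA pA) => H; split=> [/H nZ H'|nZ]; first by apply: nZ => f Sf v; exact: H'.
  by apply/H => H'; apply: nZ => f v Sf; exact: H'.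
move=> f fO i F _ OF <-; have [A [p [FA rA pA cp]]] := is_rat_data F.
have cp' (G : Ratd k d) p' : chow_point (orbit_cycle (sval G)) p' ->
  @chow_point k N 3 (4 * D) (sval (sval (orbit_map (rat_class G)))) p'.
  by rewrite -[sval (sval _)]/(cycle_of _) orbit_mapE.
have [e [g [h [ge he hp ghE]]]] := fO (3, 4 * D)%N _ p OF (cp' _ _ cp).
have [g' ge' gE] := pullback ge; have [h' he' hE] := pullback he.
exists (m * e)%N, g', h'; split=> // [v Fv|G _ v OG <- Gv].
  rewrite -[v]vec_mxK hE; apply: hp; apply: coordsV FA _ pA.
  by rewrite vec_mxK.
have [B [p' [GB rB pB cpB]]] := is_rat_data G.
rewrite -[v]vec_mxK hE gE; apply: ghE OG (cp' _ _ cpB) _.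
by apply: coordsV GB _ pB; rewrite vec_mxK.
Qed.

End Pullback.
End ChowForms.

Local Close Scope ring_scope.

Theorem corollary6p9 (k : closedFieldType) (char0 : [pchar k]%R =i pred0)
    (d : nat) (hd : 2 <= d) :
  (exists iota : ratd k d -> Yd k d,
     [/\ morphism iota, injective iota &
         forall F : Ratd k d,
           cycle_of (iota (rat_class F)) = orbit_cycle (sval F)]) /\
  (forall F : Ratd k d,
     [/\ cycle_degree (orbit_cycle (sval F)) = d ^ 3 - d,
         card_Aut (sval F) %| d ^ 3 - d &
         degree (orbit_closure (sval F)) = (d ^ 3 - d) %/ card_Aut (sval F)]).
Proof.
have [q [m [qP qm pq]]] := section_family char0 hd; split.
  exists (orbit_map char0 hd qP qm pq); split.
  - exact: orbit_map_morphism.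
  - exact: orbit_map_inj.
  - exact: orbit_mapE.
move=> F; have [A FA] := proj_mx (sval F); have rA := (is_ratE FA).1 (svalP F).
have [_ _ _ c0 [e [eD eE cD]]] := orbit_chow char0 hd FA rA (qP A rA).
by split; [exact: cD|rewrite -eD dvdn_mull|rewrite eE -eD mulnK].
Qed.
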